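(* Let $F=F(\phi,I)$ be a real analytic and exact symplectic map of the annulus $\mathbb{T}\times\mathbb{R}$ of the form $$F(\phi,I)=(\phi+\alpha(I)+f_{\phi}(\phi,I),\; I+f_I(\phi,I)),$$ with $f_\phi,f_I$ $2\pi$-periodic in $\phi$. Take a particular action $I_0^{*}\in\mathbb{R}$ and denote $\omega=\alpha(I_0^{*})$. Suppose: (H1) $F$ can be analytically extended to $\mathcal{U}:=\Delta(\rho_0)\times D(I_0^{*},R_0)$, for some $\rho_0,R_0\in(0,1)$. (H2) $\omega/2\pi$ is a Diophantine number of type $(\gamma,\nu)$, for some $0<\gamma\le 1$ and $\nu\ge 2$, i.e. $$\left|\frac{\omega}{2\pi}-\frac{p}{q}\right|\ge\frac{\gamma}{q^{\nu}},\qquad \forall p\in\mathbb{Z},\ \forall q\in\mathbb{N},\ q\geq 1.$$ (H3) There are positive constants $c_1,c_2,c_3$ and $c$, with $c\le 1$, such that $$c_1\le|\alpha'(I)|\le c_2,\quad |\alpha''(I)|\le c_3,\quad |\partial_\phi^{i}\partial_I^{j}f_\phi(\phi,I)|\le c,\quad |\partial_\phi^{i}\partial_I^{j}f_I(\phi,I)|\le c,$$ for every $(\phi,I)\in\mathcal{U}$ and $0\le i+j\le 2$. Then there is a constant $c^{*}\ge 1$, depending only on $1/c_1,c_2,c_3,\nu$ and increasing in each of them, for which the following holds. Assume that $c$ is small enough so that $$c^{*}c\le\gamma^{2}\delta_0^{2\nu}\min\{c_1\delta_0/8,\ \delta_0/12,\ R_0/3\},\qquad c^{*}c\le 2^{-4\nu-2}\gamma^{4}\delta_0^{4\nu+1},$$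 where $\delta_0=\rho_0/12$. Then there exists a real analytic function $\varphi^{*}:\mathbb{T}\to\mathbb{T}\times\mathbb{R}$ of the form $\varphi^{*}(\theta)=(\theta+\varphi^{*}_{\phi}(\theta),\varphi^{*}_I(\theta))$, with $\varphi^{*}_\phi,\varphi^{*}_I$ $2\pi$-periodic in $\theta$ and $(\varphi^{*})'(\theta)\ne 0$ for all $\theta$, which is a solution of the invariance equation $$F(\varphi^{*}(\theta))=\varphi^{*}(\theta+\omega).$$ Consequently, $\varphi^{*}$ is the parametrization of an invariant curve $\mathcal{T}=\varphi^{*}(\mathbb{T})$ of $F$ with frequency $\omega$. Moreover, $\varphi^{*}$ is defined for $\theta\in\Delta(\rho_0/2)$ and satisfies $$\|\varphi^{*}_\phi\|_{\rho_0/2}\le\frac{2c^{*}c}{\gamma^{2}\delta_0^{2\nu}},\qquad \|\varphi^{*}_I-I_0^{*}\|_{\rho_0/2}\le\frac{2c^{*}c}{\gamma^{2}\delta_0^{2\nu}},\qquad \|(\varphi^{*}_s)'\|_{\rho_0/2}\le\frac{2c^{*}c}{\gamma^{2}\delta_0^{2\nu+1}},$$ for $s\in\{\phi,I\}$.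
   Context: $\mathbb{T}=\mathbb{R}/2\pi\mathbb{Z}$. For $\rho>0$, $\Delta(\rho)=\{\theta\in\mathbb{C}:|\mathrm{Im}(\theta)|<\rho\}$, and for a $2\pi$-periodic function $f$ (scalar or vector valued) that extends analytically to $\Delta(\rho)$ and is bounded up to the boundary, $\|f\|_\rho=\sup_{\theta\in\Delta(\rho)}|f(\theta)|$, where $|\cdot|$ is the modulus of complex numbers and the sup-norm for vectors and matrices. $D(I_0^{*},R_0)=\{I\in\mathbb{C}:|I-I_0^{*}|<R_0\}$. The map $F$ is exact symplectic (with respect to the 1-form $I\,d\phi$) if $F^{*}(I\,d\phi)=I\,d\phi+dV(\phi,I)$ for some function $V$ that is $2\pi$-periodic in $\phi$. In (H1), analytic extension of $F$ means that $\alpha$, $f_\phi$, $f_I$ extend analytically (with $f_\phi,f_I$ $2\pi$-periodic in $\phi$). *)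

(* Defs.v *)
(* Stdlib reals with Coquelicot. *)
From Stdlib Require Import Reals ZArith.
From Coquelicot Require Import Coquelicot.
Open Scope R_scope.

Definition strip (rho : R) (theta : C) : Prop := Rabs (Im theta) < rho.

Definition cdisc (I0 R0 : R) (I : C) : Prop := Cmod (I - RtoC I0)%C < R0.

(** The supremum is taken in [Rbar], so a finite upper bound on the norm
    asserts in particular that [f] is bounded on the strip. *)
Definition strip_norm (rho : R) (f : C -> C) : Rbar :=
  Lub_Rbar (fun x => exists theta, strip rho theta /\ x = Cmod (f theta)).

Definition analytic_at {K : AbsRing} {V : NormedModule K} (f : K -> V) (x : K)
  : Prop :=
  exists (a : nat -> V) (r : R), 0 < r /\
    forall h : K, abs h < r -> is_pseries a h (f (plus x h)).

(** Analyticity in two variables: near [(x, y)], [f] is the sum of a double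
    power series [sum a i j h^i k^j] that converges absolutely on a
    polydisc. The first clause is the absolute convergence at [h = k = r];
    it makes the order of summation irrelevant, so that summing over squares
    is no restriction. *)
Definition analytic2_at {K : AbsRing} {V : NormedModule K} (f : K -> K -> V)
  (x y : K) : Prop :=
  exists (a : nat -> nat -> V) (r M : R), 0 < r /\
    (forall n : nat,
       sum_n (fun i => sum_n (fun j => norm (a i j) * r ^ i * r ^ j) n) n <= M) /\
    forall h k : K, abs h < r -> abs k < r ->
      filterlim
        (fun n : nat =>
           sum_n (fun i =>
             sum_n (fun j => scal (mult (pow_n h i) (pow_n k j)) (a i j)) n) n)
        eventually (locally (f (plus x h) (plus y k))).

Definition real_analytic (f : R -> R) : Prop :=
  forall x : R, @analytic_at R_AbsRing R_NormedModule f x.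

Definition real_analytic2 (f : R -> R -> R) : Prop :=
  forall x y : R, @analytic2_at R_AbsRing R_NormedModule f x y.

Definition complex_analytic_on (D : C -> Prop) (f : C -> C) : Prop :=
  forall z : C, D z -> @analytic_at C_AbsRing C_NormedModule f z.

Definition complex_analytic2_on (D1 D2 : C -> Prop) (f : C -> C -> C) : Prop :=
  forall z w : C, D1 z -> D2 w -> @analytic2_at C_AbsRing C_NormedModule f z w.

Definition periodic (f : R -> R) : Prop :=
  forall theta : R, f (theta + 2 * PI) = f theta.

Definition analytic_extension_disc (I0 R0 : R) (f : R -> R) (g : C -> C)
  : Prop :=
  complex_analytic_on (cdisc I0 R0) g /\
  (forall I : R, Rabs (I - I0) < R0 -> g (RtoC I) = RtoC (f I)).

Definition analytic_extension_strip (rho : R) (f : R -> R) (g : C -> C)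
  : Prop :=
  complex_analytic_on (strip rho) g /\
  (forall theta : C, strip rho theta ->
     g (theta + RtoC (2 * PI))%C = g theta) /\
  (forall theta : R, g (RtoC theta) = RtoC (f theta)).

Definition analytic_extension_strip_disc (rho I0 R0 : R) (f : R -> R -> R)
  (g : C -> C -> C) : Prop :=
  complex_analytic2_on (strip rho) (cdisc I0 R0) g /\
  (forall phi I : C, strip rho phi -> cdisc I0 R0 I ->
     g (phi + RtoC (2 * PI))%C I = g phi I) /\
  (forall phi I : R, Rabs (I - I0) < R0 ->
     g (RtoC phi) (RtoC I) = RtoC (f phi I)).

(** [partials i j f] is d_phi^i d_I^j f. *)
Definition partials (i j : nat) (f : C -> C -> C) : C -> C -> C :=
  Nat.iter i (fun (g : C -> C -> C) (phi I : C) => C_derive (fun z => g z I) phi)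
    (Nat.iter j (fun (g : C -> C -> C) (phi I : C) => C_derive (g phi) I) f).

(** Points of the annulus (R / 2 PI Z) x R are represented by points of
    [R * R], and equality in the annulus is [annulus_eq]. *)
Definition annulus_eq (p q : R * R) : Prop :=
  (exists k : Z, fst p = fst q + 2 * PI * IZR k) /\ snd p = snd q.

Definition annulus_map (alpha : R -> R) (fphi fI : R -> R -> R) (p : R * R)
  : R * R :=
  (fst p + alpha (snd p) + fphi (fst p) (snd p), snd p + fI (fst p) (snd p)).

(** [F^* (I dphi) = I dphi + dV], both sides being evaluated at [p] on the
    tangent vector [h]; [dF] and [dV] are the differentials at [p]. *)
Definition exact_symplectic (F : R * R -> R * R) : Prop :=
  exists V : R * R -> R,
    (forall phi I : R, V (phi + 2 * PI, I) = V (phi, I)) /\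
    forall p : R * R,
      exists (dF : R * R -> R * R) (dV : R * R -> R),
        filterdiff (K := R_AbsRing) F (locally p) dF /\
        filterdiff (K := R_AbsRing) V (locally p) dV /\
        forall h : R * R, snd (F p) * fst (dF h) = snd p * fst h + dV h.

Definition diophantine (gamma nu x : R) : Prop :=
  forall (p : Z) (q : nat), (1 <= q)%nat ->
    Rabs (x - IZR p / INR q) >= gamma / Rpower (INR q) nu.

(** The curve [theta |-> (theta + gphi theta, gI theta)]. *)
Definition param (gphi gI : R -> R) (theta : R) : R * R :=
  (theta + gphi theta, gI theta).

Definition on_curve (P : R -> R * R) (p : R * R) : Prop :=
  exists theta : R, annulus_eq p (P theta).

(** The last clause is the equality [F (T) = T] for the curve [T = P (R / 2 PI Z)]. *)
Definition parametrizes_invariant_curve (F : R * R -> R * R) (P : R -> R * R)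
  (omega : R) : Prop :=
  (forall theta : R, annulus_eq (F (P theta)) (P (theta + omega))) /\
  (forall p : R * R,
     on_curve P p <-> exists q : R * R, on_curve P q /\ annulus_eq p (F q)).

(** [cst x c2 c3 nu], with [x] standing for [1 / c1]. *)
Definition increasing_in_each (cst : R -> R -> R -> R -> R) : Prop :=
  forall x c2 c3 nu : R, 0 < x -> 0 < c2 -> 0 < c3 -> 2 <= nu ->
    (forall x', x < x' -> cst x c2 c3 nu < cst x' c2 c3 nu) /\
    (forall c2', c2 < c2' -> cst x c2 c3 nu < cst x c2' c3 nu) /\
    (forall c3', c3 < c3' -> cst x c2 c3 nu < cst x c2 c3' nu) /\
    (forall nu', nu < nu' -> cst x c2 c3 nu < cst x c2 c3 nu').

(* Main.v *)
Require Import Defs.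
From Stdlib Require Import Reals ZArith Lra Lia Psatz ClassicalEpsilon.
From Coquelicot Require Import Coquelicot.
Open Scope R_scope.

(** Newton's method for the invariance equation [F o K = K(. + omega)] of a curve
    [K theta = (theta + u theta, v theta)], without changes of coordinates. Since
    [F] is exact symplectic, it preserves area, and in the frame
    [(K', (0, 1 / K_phi'))] along an approximately invariant curve [DF] is
    unipotent, up to derivatives of the error. Linearizing in this frame leaves
    two cohomological equations [e(z + omega) - e(z) = f(z)], solved by Fourier
    series and the Diophantine condition with loss of a strip of width [d]. The
    mean of the first right-hand side is quadratic in the error by exactness; the
    mean of the second one is removed by the free constant of the first, which is
    possible because of the twist [alpha' <> 0]. A step turns an error [eps] into
    [O(eps^2 / (gamma d^nu)^4)], and the widths [d] are halved at every step. *)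

(** Only means over horizontal lines are ever integrated. Such a mean does not depend on the height
    of the line, and this replaces contour integration: moving the line makes Fourier coefficients
    decay, and the substitution [z + Cexpi w], which wraps a half-plane around a punctured disc,
    turns the same series into Cauchy estimates and Taylor expansions. The potential [V] is only
    differentiable once, so the determinant of DF is read off from integrals of I dphi over small
    circles, then carried from real to complex points by Fourier series. The iteration starts at the
    circle I = I0, whose error is at most c. Two equations are solved in sequence, each at the price
    X of order 1 / (gamma d^nu), so a correction has size X^2 eps: this is the factor gamma^2
    delta0^(2 nu) of the first smallness condition and of the conclusion. Squaring it produces
    gamma^4 delta0^(4 nu) in the second condition. Errors falling like 2^(-(4 nu + 1) n) outrun the
    growth of X^4 under halving, and the corrections stay summable after division by d. *)

(** * Elementary bounds for the complex modulus *)

Lemma Cmod_plus_le (a b : C) (A B : R) :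
  Cmod a <= A -> Cmod b <= B -> Cmod (a + b)%C <= A + B.
Proof.
  intros Ha Hb. eapply Rle_trans. apply Cmod_triangle. lra.
Qed.

Lemma Cmod_minus_le (a b : C) (A B : R) :
  Cmod a <= A -> Cmod b <= B -> Cmod (a - b)%C <= A + B.
Proof.
  intros Ha Hb. apply Cmod_plus_le; [ exact Ha | ]. now rewrite Cmod_opp.
Qed.

Lemma Cmod_mult_le (a b : C) (A B : R) :
  Cmod a <= A -> Cmod b <= B -> Cmod (a * b)%C <= A * B.
Proof.
  intros Ha Hb. rewrite Cmod_mult.
  apply Rmult_le_compat; auto using Cmod_ge_0.
Qed.

Lemma Cmod_sub_sym (a b : C) : Cmod (a - b)%C = Cmod (b - a)%C.
Proof. rewrite <- Cmod_opp. f_equal. ring. Qed.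

Lemma Im_le_Cmod (z : C) : Rabs (Im z) <= Cmod z.
Proof.
  eapply Rle_trans; [ | apply Rmax_Cmod ]. apply Rmax_r.
Qed.

Lemma Cmod_le_Re_Im (z : C) : Cmod z <= Rabs (Re z) + Rabs (Im z).
Proof.
  destruct z as [x y]. unfold Cmod; simpl.
  rewrite <- (sqrt_Rsqr (Rabs x + Rabs y)).
  - apply sqrt_le_1_alt. unfold Rsqr.
    generalize (Rabs_pos x) (Rabs_pos y).
    rewrite <- (Rabs_pos_eq (x * (x * 1))), <- (Rabs_pos_eq (y * (y * 1))) by nra.
    rewrite !Rabs_mult, Rabs_R1. nra.
  - generalize (Rabs_pos x) (Rabs_pos y). lra.
Qed.

Lemma Cmod_sqr_Re_Im (z : C) : Cmod z * Cmod z = Re z * Re z + Im z * Im z.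
Proof. generalize (Cmod2_alt z). simpl. intros H. lra. Qed.

(** * Uniformly differentiable functions *)

(** Bounds [f], [f1] and the Taylor remainder of order one uniformly on [D].
    Unlike pointwise differentiability this is inherited by limits, and it makes
    integrals over curves in [D] differentiable without a compactness argument. *)
Definition holo_bound (B : R) (D : C -> Prop) (f f1 : C -> C) : Prop :=
  (forall z, D z -> Cmod (f z) <= B) /\
  (forall z, D z -> Cmod (f1 z) <= B) /\
  (forall z w, D z -> D w ->
     Cmod (f w - f z - (w - z) * f1 z)%C <= B * Cmod (w - z)%C ^ 2).

Definition holo (D : C -> Prop) (f f1 : C -> C) : Prop :=
  exists B, 0 <= B /\ holo_bound B D f f1.

Lemma holo_bound_weaken (A B : R) D f f1 :
  A <= B -> holo_bound A D f f1 -> holo_bound B D f f1.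
Proof.
  intros HAB [H1 [H2 H3]]. split; [ | split ].
  - intros z Hz. generalize (H1 z Hz). lra.
  - intros z Hz. generalize (H2 z Hz). lra.
  - intros z w Hz Hw. eapply Rle_trans. apply H3; auto.
    apply Rmult_le_compat_r; [ apply pow2_ge_0 | exact HAB ].
Qed.

Lemma holo_bound2 D f f1 g g1 :
  holo D f f1 -> holo D g g1 ->
  exists B, 1 <= B /\ holo_bound B D f f1 /\ holo_bound B D g g1.
Proof.
  intros [A [HA Hf]] [B [HB Hg]]. exists (1 + A + B). split; [ lra | split ].
  - apply holo_bound_weaken with A; [ lra | exact Hf ].
  - apply holo_bound_weaken with B; [ lra | exact Hg ].
Qed.

Lemma holo_sub (D D' : C -> Prop) f f1 :
  (forall z, D' z -> D z) -> holo D f f1 -> holo D' f f1.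
Proof.
  intros H [B [HB [H1 [H2 H3]]]]. exists B. repeat split; auto.
Qed.

Lemma holo_ext (D : C -> Prop) f f1 g g1 :
  (forall z, D z -> f z = g z) -> (forall z, D z -> f1 z = g1 z) ->
  holo D f f1 -> holo D g g1.
Proof.
  intros E E1 [B [HB [H1 [H2 H3]]]]. exists B. split; [ exact HB | ].
  split; [ | split ].
  - intros z Hz. rewrite <- E; auto.
  - intros z Hz. rewrite <- E1; auto.
  - intros z w Hz Hw. rewrite <- !E, <- E1; auto.
Qed.

(** Up to distance 1 the quadratic remainder is dominated by a linear term; beyond it the sup bound
    [2 * B] is enough. No path inside [D] has to be followed. *)
Lemma holo_bound_lipschitz B D f f1 z w :
  holo_bound B D f f1 -> D z -> D w ->
  Cmod (f w - f z)%C <= 2 * B * Cmod (w - z)%C.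
Proof.
  intros [H1 [H2 H3]] Hz Hw.
  assert (HB : 0 <= B) by (generalize (H1 z Hz) (Cmod_ge_0 (f z)); lra).
  set (h := Cmod (w - z)%C). assert (Hh : 0 <= h) by apply Cmod_ge_0.
  destruct (Rle_dec h 1) as [L | L].
  - replace (f w - f z)%C with ((f w - f z - (w - z) * f1 z) + (w - z) * f1 z)%C by ring.
    eapply Rle_trans.
    { apply Cmod_plus_le. apply H3; auto. apply Cmod_mult_le. apply Rle_refl. apply H2; auto. }
    fold h. assert (0 <= B * h * (1 - h)) by (apply Rmult_le_pos; nra). nra.
  - eapply Rle_trans. { apply Cmod_minus_le; apply H1; auto. } nra.
Qed.

(** Adding the Taylor remainders based at [z] and at [w] cancels the values of [f] and leaves
    [(w - z) * (f1 w - f1 z)]. Continuity of the derivative thus comes without a second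
    derivative. *)
Lemma holo_bound_derive_lipschitz B D f f1 z w :
  holo_bound B D f f1 -> D z -> D w ->
  Cmod (f1 w - f1 z)%C <= 2 * B * Cmod (w - z)%C.
Proof.
  intros [H1 [H2 H3]] Hz Hw.
  destruct (Ceq_dec w z) as [-> | N].
  - replace (f1 z - f1 z)%C with (RtoC 0) by ring.
    replace (z - z)%C with (RtoC 0) by ring. rewrite Cmod_0. lra.
  - assert (P : 0 < Cmod (w - z)%C).
    { apply Cmod_gt_0. intros E. apply N. now apply Ceq_minus. }
    apply Rmult_le_reg_l with (Cmod (w - z)%C); [ exact P | ].
    rewrite <- Cmod_mult.
    replace ((w - z) * (f1 w - f1 z))%C with
      ((f w - f z - (w - z) * f1 z) + (f z - f w - (z - w) * f1 w))%C by ring.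
    eapply Rle_trans.
    { apply Cmod_plus_le; apply H3; auto. }
    rewrite (Cmod_sub_sym z w). simpl. lra.
Qed.

Lemma holo_const D (c : C) : holo D (fun _ => c) (fun _ => RtoC 0).
Proof.
  exists (Cmod c). split; [ apply Cmod_ge_0 | split; [ | split ] ].
  - intros; lra.
  - intros. rewrite Cmod_0. apply Cmod_ge_0.
  - intros z w _ _. replace (c - c - (w - z) * 0)%C with (RtoC 0) by ring.
    rewrite Cmod_0. apply Rmult_le_pos; [ apply Cmod_ge_0 | apply pow2_ge_0 ].
Qed.

Lemma holo_plus D f f1 g g1 :
  holo D f f1 -> holo D g g1 ->
  holo D (fun z => f z + g z)%C (fun z => f1 z + g1 z)%C.
Proof.
  intros Hf Hg. destruct (holo_bound2 _ _ _ _ _ Hf Hg) as [B [HB [[F1 [F2 F3]] [G1 [G2 G3]]]]].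
  exists (B + B). split; [ lra | split; [ | split ] ].
  - intros; apply Cmod_plus_le; auto.
  - intros; apply Cmod_plus_le; auto.
  - intros z w Hz Hw.
    replace (f w + g w - (f z + g z) - (w - z) * (f1 z + g1 z))%C with
      ((f w - f z - (w - z) * f1 z) + (g w - g z - (w - z) * g1 z))%C by ring.
    rewrite Rmult_plus_distr_r. apply Cmod_plus_le; auto.
Qed.

Lemma holo_mult D f f1 g g1 :
  holo D f f1 -> holo D g g1 ->
  holo D (fun z => f z * g z)%C (fun z => f1 z * g z + f z * g1 z)%C.
Proof.
  intros Hf Hg. destruct (holo_bound2 _ _ _ _ _ Hf Hg) as [B [HB [Bf Bg]]].
  pose proof Bf as [F1 [F2 F3]]. pose proof Bg as [G1 [G2 G3]].
  exists (2 * B * B + B * B + B * B). split; [ nra | split; [ | split ] ].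
  - intros z Hz. eapply Rle_trans. apply Cmod_mult_le; auto. nra.
  - intros z Hz. eapply Rle_trans.
    { apply Cmod_plus_le; apply Cmod_mult_le; auto. } nra.
  - intros z w Hz Hw.
    replace (f w * g w - f z * g z - (w - z) * (f1 z * g z + f z * g1 z))%C with
      ((f w - f z) * ((w - z) * g1 z) + f w * (g w - g z - (w - z) * g1 z)
       + (f w - f z - (w - z) * f1 z) * g z)%C by ring.
    eapply Rle_trans.
    { apply Cmod_plus_le; [ apply Cmod_plus_le | ].
      - apply Cmod_mult_le; [ apply (holo_bound_lipschitz B D f f1); auto | ].
        apply Cmod_mult_le; [ apply Rle_refl | auto ].
      - apply Cmod_mult_le; auto.
      - apply Cmod_mult_le; auto. }
    right. ring.
Qed.

Lemma holo_scal D (c : C) f f1 :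
  holo D f f1 -> holo D (fun z => c * f z)%C (fun z => c * f1 z)%C.
Proof.
  intros H. eapply holo_ext; [ | | apply (holo_mult D _ _ f f1 (holo_const D c) H) ].
  - reflexivity.
  - intros; simpl; ring.
Qed.

Lemma holo_minus D f f1 g g1 :
  holo D f f1 -> holo D g g1 ->
  holo D (fun z => f z - g z)%C (fun z => f1 z - g1 z)%C.
Proof.
  intros Hf Hg.
  eapply holo_ext; [ | | apply (holo_plus D f f1 _ _ Hf (holo_scal D (-(1))%C _ _ Hg)) ];
    intros; simpl; ring.
Qed.

Lemma holo_inv D f f1 (m : R) :
  0 < m -> (forall z, D z -> m <= Cmod (f z)) -> holo D f f1 ->
  holo D (fun z => / f z)%C (fun z => - f1 z / (f z * f z))%C.
Proof.
  intros Hm L [B [HB Hf]]. pose proof Hf as [F1 [F2 F3]].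
  assert (NZ : forall z, D z -> f z <> RtoC 0).
  { intros z Hz E. generalize (L z Hz). rewrite E, Cmod_0. lra. }
  assert (I : forall z, D z -> Cmod (/ f z)%C <= / m).
  { intros z Hz. rewrite Cmod_inv by auto. apply Rinv_le_contravar; auto. }
  assert (Pm : 0 < / m) by now apply Rinv_0_lt_compat.
  set (k := / m) in *.
  exists (k + B * (k * k) + (B * k * k + 2 * B * B * (k * k * k))).
  assert (0 <= B * (k * k)) by (apply Rmult_le_pos; nra).
  assert (0 <= 2 * B * B * (k * k * k)).
  { apply Rmult_le_pos; [ nra | ]. apply Rmult_le_pos; nra. }
  split; [ nra | split; [ | split ] ].
  - intros z Hz. generalize (I z Hz). nra.
  - intros z Hz. unfold Cdiv.
    replace (/ (f z * f z))%C with (/ f z * / f z)%C by (field; auto).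
    eapply Rle_trans.
    { apply Cmod_mult_le; [ rewrite Cmod_opp; auto | apply Cmod_mult_le; auto ]. }
    nra.
  - intros z w Hz Hw.
    replace (/ f w - / f z - (w - z) * (- f1 z / (f z * f z)))%C with
      (- (f w - f z - (w - z) * f1 z) * / f z * / f w +
       (f w - f z) * ((w - z) * f1 z) * (/ f z * / f z * / f w))%C
      by (field; auto).
    eapply Rle_trans.
    { apply Cmod_plus_le.
      - apply Cmod_mult_le; [ apply Cmod_mult_le | ]; [ rewrite Cmod_opp; auto | auto | auto ].
      - apply Cmod_mult_le.
        + apply Cmod_mult_le; [ apply (holo_bound_lipschitz B D f f1); auto | ].
          apply Cmod_mult_le; [ apply Rle_refl | auto ].
        + apply Cmod_mult_le; [ apply Cmod_mult_le | ]; auto. }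
    assert (0 <= Cmod (w - z)%C ^ 2) by apply pow2_ge_0.
    set (h := Cmod (w - z)%C) in *. simpl in *.
    match goal with |- ?l <= _ =>
      replace l with ((B * k * k + 2 * B * B * (k * k * k)) * (h * (h * 1))) by ring end.
    apply Rmult_le_compat_r; nra.
Qed.

(** The inner map carries Lipschitz and Taylor bounds instead of [holo], because an affine map is
    unbounded on a strip. *)
Lemma holo_comp D D' f f1 g g1 :
  (forall z, D z -> D' (g z)) -> holo D' f f1 ->
  (exists B, 0 <= B /\ (forall z, D z -> Cmod (g1 z) <= B) /\
    (forall z w, D z -> D w -> Cmod (g w - g z)%C <= B * Cmod (w - z)%C) /\
    (forall z w, D z -> D w ->
     Cmod (g w - g z - (w - z) * g1 z)%C <= B * Cmod (w - z)%C ^ 2)) ->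
  holo D (fun z => f (g z)) (fun z => f1 (g z) * g1 z)%C.
Proof.
  intros HD [A [HA [F1 [F2 F3]]]] [B [HB [G1 [GL G3]]]].
  exists (A + A * B + (A * (B * B) + A * B)). split; [ nra | split; [ | split ] ].
  - intros z Hz. generalize (F1 (g z) (HD z Hz)). nra.
  - intros z Hz. eapply Rle_trans. { apply Cmod_mult_le; auto. } nra.
  - intros z w Hz Hw.
    replace (f (g w) - f (g z) - (w - z) * (f1 (g z) * g1 z))%C with
      ((f (g w) - f (g z) - (g w - g z) * f1 (g z)) +
       f1 (g z) * (g w - g z - (w - z) * g1 z))%C by ring.
    eapply Rle_trans.
    { apply Cmod_plus_le; [ apply F3; auto | apply Cmod_mult_le; auto ]. }
    generalize (GL z w Hz Hw) (Cmod_ge_0 (g w - g z)%C) (Cmod_ge_0 (w - z)%C).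
    set (h := Cmod (w - z)%C). set (k := Cmod (g w - g z)%C). intros K1 K2 K3.
    assert (k ^ 2 <= (B * B) * h ^ 2).
    { replace (B * B * h ^ 2) with ((B * h) ^ 2) by ring. apply pow_incr; lra. }
    assert (0 <= h ^ 2) by apply pow2_ge_0.
    assert (A * k ^ 2 <= A * (B * B * h ^ 2)) by (apply Rmult_le_compat_l; auto).
    assert (0 <= A * h ^ 2) by now apply Rmult_le_pos.
    assert (0 <= A * B * h ^ 2) by (apply Rmult_le_pos; [ apply Rmult_le_pos | ]; auto).
    lra.
Qed.

Lemma holo_comp_affine D D' f f1 (a b : C) :
  (forall z, D z -> D' (a * z + b)%C) -> holo D' f f1 ->
  holo D (fun z => f (a * z + b)%C) (fun z => f1 (a * z + b) * a)%C.
Proof.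
  intros HD Hf. apply (holo_comp D D' f f1 (fun z => a * z + b)%C (fun _ => a)); auto.
  exists (Cmod a). split; [ apply Cmod_ge_0 | ]. split; [ intros; lra | split ].
  - intros z w _ _. right. rewrite <- Cmod_mult. f_equal. ring.
  - intros z w _ _.
    replace (a * w + b - (a * z + b) - (w - z) * a)%C with (RtoC 0) by ring.
    rewrite Cmod_0. apply Rmult_le_pos; [ apply Cmod_ge_0 | apply pow2_ge_0 ].
Qed.

Lemma holo_shift D f f1 (b : C) (D' : C -> Prop) :
  (forall z, D z -> D' (z + b)%C) -> holo D' f f1 ->
  holo D (fun z => f (z + b)%C) (fun z => f1 (z + b)%C).
Proof.
  intros HD Hf. eapply holo_ext; [ | | apply (holo_comp_affine D D' f f1 1 b); auto ];
    intros; simpl.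
  - f_equal; ring.
  - rewrite Cmult_1_r. f_equal; ring.
  - replace (1 * z + b)%C with (z + b)%C by ring. auto.
Qed.

(** The entire function [exp (i z)]. *)
Definition Cexpi (z : C) : C :=
  (exp (- Im z) * cos (Re z), exp (- Im z) * sin (Re z)).

Lemma Cexpi_plus (z w : C) : Cexpi (z + w)%C = (Cexpi z * Cexpi w)%C.
Proof.
  destruct z as [a b], w as [c d]. unfold Cexpi, Cmult, Cplus; simpl.
  rewrite Ropp_plus_distr, exp_plus, cos_plus, sin_plus.
  apply injective_projections; simpl; ring.
Qed.

Lemma Cmod_Cexpi (z : C) : Cmod (Cexpi z) = exp (- Im z).
Proof.
  unfold Cmod, Cexpi; simpl.
  assert (P := exp_pos (- Im z)). set (e := exp (- Im z)) in *.
  replace (_ + _) with (e * e).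
  - apply sqrt_square. lra.
  - generalize (sin2_cos2 (Re z)). unfold Rsqr. intros H.
    transitivity (e * e * (sin (Re z) * sin (Re z) + cos (Re z) * cos (Re z))).
    rewrite H; ring. ring.
Qed.

Lemma Cexpi_0 : Cexpi 0 = RtoC 1.
Proof.
  unfold Cexpi; simpl. rewrite Ropp_0, exp_0, cos_0, sin_0.
  apply injective_projections; simpl; ring.
Qed.

Lemma Cexpi_nz (z : C) : Cexpi z <> RtoC 0.
Proof.
  intros E. assert (H := Cmod_Cexpi z). rewrite E, Cmod_0 in H.
  generalize (exp_pos (- Im z)); lra.
Qed.

Lemma Cexpi_2PI (z : C) : Cexpi (z + RtoC (2 * PI))%C = Cexpi z.
Proof.
  unfold Cexpi. destruct z as [a b]; simpl.
  rewrite cos_plus, sin_plus, cos_2PI, sin_2PI, Rplus_0_r.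
  apply injective_projections; simpl; ring.
Qed.

Lemma Cexpi_INR (n : nat) (z : C) : Cexpi (INR n * z)%C = (Cexpi z ^ n)%C.
Proof.
  induction n.
  - simpl. rewrite Cmult_0_l. apply Cexpi_0.
  - rewrite S_INR, RtoC_plus.
    replace ((INR n + 1) * z)%C with (z + INR n * z)%C by ring.
    now rewrite Cexpi_plus, IHn, Cpow_S.
Qed.

Lemma exp_remainder (b : R) : Rabs b <= 1 -> 0 <= exp b - 1 - b <= 8 * b ^ 2.
Proof.
  intros H. apply Rabs_le_between in H. split. { generalize (exp_ineq1_le b). lra. }
  assert (P := exp_ineq1_le (- b)).
  destruct (Req_dec b 1) as [-> | N].
  - generalize exp_le_3. lra.
  - assert (Q : 0 < 1 - b) by lra.
    assert (E : exp b * (1 - b) <= 1).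
    { apply Rle_trans with (exp b * exp (- b)).
      apply Rmult_le_compat_l. left; apply exp_pos. lra.
      rewrite <- exp_plus, Rplus_opp_r, exp_0. lra. }
    destruct (Rle_dec b (1 / 2)) as [L | L].
    + apply Rmult_le_reg_r with (1 - b); [ exact Q | ].
      assert (0 <= b ^ 2 * (1 - 2 * b)) by (apply Rmult_le_pos; nra). nra.
    + generalize exp_le_3 (exp_increasing b 1). intros E3 M. assert (exp b < 3) by lra. nra.
Qed.

Lemma sin_cos_remainder (a : R) :
  Rabs a <= 1 -> Rabs (cos a - 1) <= a ^ 2 /\ Rabs (sin a - a) <= a ^ 2.
Proof.
  assert (W : forall a, 0 <= a <= 1 -> Rabs (cos a - 1) <= a ^ 2 /\ Rabs (sin a - a) <= a ^ 2).
  { clear a. intros a H. generalize PI2_3_2; intros HPI.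
    destruct (cos_bound a 0) as [c1 c2]; [ lra | lra | ].
    destruct (sin_bound a 0) as [s1 s2]; [ lra | lra | ].
    unfold cos_approx, sin_approx, cos_term, sin_term in *. simpl in *.
    assert (P2 : 0 <= a * a <= 1) by nra.
    assert (P3 : 0 <= a * a * a <= a * a) by nra.
    assert (P4 : 0 <= a * a * a * a <= a * a * a) by nra.
    assert (P5 : 0 <= a * a * a * a * a <= a * a * a * a) by nra.
    split; apply Rabs_le; simpl; split; lra. }
  intros H. destruct (Rle_dec 0 a) as [P | P].
  - apply W. apply Rabs_le_between in H. lra.
  - destruct (W (- a)) as [W1 W2]. { apply Rabs_le_between in H. lra. }
    rewrite cos_neg in W1. rewrite sin_neg in W2.
    replace ((- a) ^ 2) with (a ^ 2) in * by ring. split; [ exact W1 | ].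
    replace (sin a - a) with (- (- sin a - - a)) by ring. now rewrite Rabs_Ropp.
Qed.

Lemma Cexpi_remainder (h : C) :
  Cmod h <= 1 -> Cmod (Cexpi h - 1 - h * Ci)%C <= 30 * Cmod h ^ 2.
Proof.
  intros H. destruct h as [a b].
  assert (Ha := re_le_Cmod (a, b)). assert (Hb := Im_le_Cmod (a, b)). simpl in Ha, Hb.
  destruct (sin_cos_remainder a) as [c s]; [ lra | ].
  destruct (exp_remainder (- b)) as [e1 e2]; [ rewrite Rabs_Ropp; lra | ].
  assert (Q := Cmod_sqr_Re_Im (a, b)). simpl in Q.
  eapply Rle_trans; [ apply Cmod_le_Re_Im | ].
  unfold Cexpi; simpl.
  set (M := Cmod (a, b)) in *. set (e := exp (- b)) in *.
  assert (A2 : a ^ 2 = Rabs a * Rabs a) by (rewrite <- Rabs_mult, Rabs_pos_eq; [ ring | nra ]).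
  assert (B2 : (- b) ^ 2 = Rabs b * Rabs b) by (rewrite <- Rabs_mult, Rabs_pos_eq; [ ring | nra ]).
  rewrite B2 in e2. assert (Pa := Rabs_pos a). assert (Pb := Rabs_pos b).
  assert (Eb : Rabs (e - 1) <= 9 * Rabs b).
  { replace (e - 1) with ((e - 1 - - b) + - b) by ring.
    eapply Rle_trans; [ apply Rabs_triang | ].
    rewrite (Rabs_pos_eq (e - 1 - - b)), Rabs_Ropp by lra. nra. }
  assert (E3 : Rabs e <= 10).
  { replace e with ((e - 1) + 1) by ring. eapply Rle_trans; [ apply Rabs_triang | ].
    rewrite Rabs_R1. lra. }
  match goal with |- Rabs ?x + Rabs ?y <= _ =>
    replace x with (e * (cos a - 1) + (e - 1 - - b)) by ring;
    replace y with (e * (sin a - a) + (e - 1) * a) by ring end.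
  eapply Rle_trans.
  { apply Rplus_le_compat; apply Rabs_triang. }
  rewrite !Rabs_mult, (Rabs_pos_eq (e - 1 - - b)) by lra.
  assert (Rabs e * Rabs (cos a - 1) <= 10 * a ^ 2) by (apply Rmult_le_compat; auto using Rabs_pos).
  assert (Rabs e * Rabs (sin a - a) <= 10 * a ^ 2) by (apply Rmult_le_compat; auto using Rabs_pos).
  assert (Rabs (e - 1) * Rabs a <= 9 * Rabs b * Rabs a) by (apply Rmult_le_compat_r; auto using Rabs_pos).
  assert (a * a = Rabs a * Rabs a) by (rewrite <- A2; ring).
  assert (b * b = Rabs b * Rabs b) by (rewrite <- B2; ring).
  rewrite A2 in *.
  replace (M ^ 2) with (Rabs a * Rabs a + Rabs b * Rabs b) by (simpl; lra).
  nra.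
Qed.

(** * Averages over a period *)

Definition Ccont (p : R -> C) : Prop :=
  forall x, continuous (fun t => Re (p t)) x /\ continuous (fun t => Im (p t)) x.

Definition cavg (p : R -> C) : C :=
  (RtoC (/ (2 * PI)) *
   (RInt (fun t => Re (p t)) 0 (2 * PI), RInt (fun t => Im (p t)) 0 (2 * PI)))%C.

Definition periodic_C (p : R -> C) : Prop := forall t, p (t + 2 * PI) = p t.

Lemma lipschitz_continuous (f : R -> R) (L : R) :
  (forall s t, Rabs (f t - f s) <= L * Rabs (t - s)) -> forall x, continuous f x.
Proof.
  intros H x. apply continuity_pt_filterlim. intros eps Heps.
  assert (HL : 0 < Rabs L + 1) by (generalize (Rabs_pos L); lra).
  exists (eps / (Rabs L + 1)). split.
  - apply Rdiv_lt_0_compat; lra.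
  - intros t [_ Ht]. unfold dist in *; simpl in *. unfold R_dist in *.
    apply Rle_lt_trans with ((Rabs L + 1) * Rabs (t - x)).
    + eapply Rle_trans; [ apply H | ]. apply Rmult_le_compat_r. apply Rabs_pos.
      generalize (Rle_abs L). lra.
    + apply Rmult_lt_reg_r with (/ (Rabs L + 1)); [ now apply Rinv_0_lt_compat | ].
      replace ((Rabs L + 1) * Rabs (t - x) * / (Rabs L + 1)) with (Rabs (t - x))
        by (field; lra). exact Ht.
Qed.

Lemma Ccont_lipschitz (p : R -> C) (L : R) :
  (forall s t, Cmod (p t - p s)%C <= L * Rabs (t - s)) -> Ccont p.
Proof.
  intros H x. split; apply (lipschitz_continuous _ L); intros s t.
  - eapply Rle_trans; [ | apply H ]. eapply Rle_trans; [ | apply re_le_Cmod ].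
    right. reflexivity.
  - eapply Rle_trans; [ | apply H ]. eapply Rle_trans; [ | apply Im_le_Cmod ].
    right. reflexivity.
Qed.

Lemma Ccont_const (c : C) : Ccont (fun _ => c).
Proof. intros x. split; apply continuous_const. Qed.

Lemma Ccont_plus p q : Ccont p -> Ccont q -> Ccont (fun t => p t + q t)%C.
Proof.
  intros Hp Hq x. destruct (Hp x), (Hq x). split; simpl.
  - apply (continuous_plus (fun t => Re (p t)) (fun t => Re (q t))); auto.
  - apply (continuous_plus (fun t => Im (p t)) (fun t => Im (q t))); auto.
Qed.

Lemma Ccont_mult p q : Ccont p -> Ccont q -> Ccont (fun t => p t * q t)%C.
Proof.
  intros Hp Hq x. destruct (Hp x) as [p1 p2], (Hq x) as [q1 q2]. split; simpl.
  - apply (continuous_minus (fun t => Re (p t) * Re (q t)) (fun t => Im (p t) * Im (q t)));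
      [ apply (continuous_mult (fun t => Re (p t)) (fun t => Re (q t)))
      | apply (continuous_mult (fun t => Im (p t)) (fun t => Im (q t))) ]; auto.
  - apply (continuous_plus (fun t => Re (p t) * Im (q t)) (fun t => Im (p t) * Re (q t)));
      [ apply (continuous_mult (fun t => Re (p t)) (fun t => Im (q t)))
      | apply (continuous_mult (fun t => Im (p t)) (fun t => Re (q t))) ]; auto.
Qed.

Lemma Ccont_scal c p : Ccont p -> Ccont (fun t => c * p t)%C.
Proof. intros Hp. apply (Ccont_mult (fun _ => c)); [ apply Ccont_const | exact Hp ]. Qed.

Lemma Ccont_minus p q : Ccont p -> Ccont q -> Ccont (fun t => p t - q t)%C.
Proof.
  intros Hp Hq x. destruct (Hp x), (Hq x). split; simpl.
  - apply (continuous_minus (fun t => Re (p t)) (fun t => Re (q t))); auto.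
  - apply (continuous_minus (fun t => Im (p t)) (fun t => Im (q t))); auto.
Qed.

Lemma Ccont_ext p q : (forall t, p t = q t) -> Ccont p -> Ccont q.
Proof.
  intros E Hp x. destruct (Hp x). split.
  - apply (continuous_ext (fun t => Re (p t))); [ intros; now rewrite E | auto ].
  - apply (continuous_ext (fun t => Im (p t))); [ intros; now rewrite E | auto ].
Qed.

Lemma Ccont_shift p (s : R) : Ccont p -> Ccont (fun t => p (t + s)).
Proof.
  intros Hp x. destruct (Hp (x + s)) as [H1 H2].
  assert (A : continuous (fun t : R => t + s) x).
  { apply (continuous_plus (fun t : R => t) (fun _ => s));
      [ apply continuous_id | apply continuous_const ]. }
  split.
  - apply (continuous_comp (fun t => t + s) (fun t => Re (p t))); auto.
  - apply (continuous_comp (fun t => t + s) (fun t => Im (p t))); auto.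
Qed.

Lemma ex_RInt_cont (f : R -> R) a b : (forall x, continuous f x) -> ex_RInt f a b.
Proof. intros H. apply (ex_RInt_continuous (V := R_CompleteNormedModule)). auto. Qed.

Lemma two_PI_pos : 0 < 2 * PI.
Proof. generalize PI_RGT_0; lra. Qed.

Lemma cavg_ext p q : (forall t, p t = q t) -> cavg p = cavg q.
Proof.
  intros E. unfold cavg. do 2 f_equal; apply RInt_ext; intros; now rewrite E.
Qed.

Lemma cavg_plus p q :
  Ccont p -> Ccont q -> cavg (fun t => p t + q t)%C = (cavg p + cavg q)%C.
Proof.
  intros Hp Hq. unfold cavg. rewrite <- Cmult_plus_distr_l. f_equal.
  apply injective_projections; simpl;
  apply (RInt_plus (V := R_CompleteNormedModule));
    apply ex_RInt_cont; intros x; destruct (Hp x), (Hq x); auto.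
Qed.

Lemma RInt_lin (f g : R -> R) (a b : R) :
  (forall x, continuous f x) -> (forall x, continuous g x) ->
  RInt (fun t => a * f t + b * g t) 0 (2 * PI)
  = a * RInt f 0 (2 * PI) + b * RInt g 0 (2 * PI).
Proof.
  intros Hf Hg.
  rewrite (RInt_plus (V := R_CompleteNormedModule) (fun t => a * f t) (fun t => b * g t)).
  - rewrite (RInt_scal (V := R_CompleteNormedModule) f), (RInt_scal (V := R_CompleteNormedModule) g);
      [ reflexivity | apply ex_RInt_cont; auto | apply ex_RInt_cont; auto ].
  - apply (ex_RInt_scal (V := R_NormedModule)). apply ex_RInt_cont; auto.
  - apply (ex_RInt_scal (V := R_NormedModule)). apply ex_RInt_cont; auto.
Qed.

Lemma cavg_scal c p : Ccont p -> cavg (fun t => c * p t)%C = (c * cavg p)%C.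
Proof.
  intros Hp. unfold cavg.
  assert (H1 : forall x, continuous (fun t => Re (p t)) x) by (intros; apply Hp).
  assert (H2 : forall x, continuous (fun t => Im (p t)) x) by (intros; apply Hp).
  transitivity (RtoC (/ (2 * PI)) * (c * (RInt (fun t => Re (p t)) 0 (2 * PI), RInt (fun t => Im (p t)) 0 (2 * PI))))%C; [ | ring ].
  f_equal. destruct c as [a b]. apply injective_projections; simpl.
  - rewrite (RInt_ext _ (fun t => a * Re (p t) + (- b) * Im (p t))).
    + rewrite RInt_lin; auto. ring.
    + intros; unfold Re, Im; simpl; ring.
  - rewrite (RInt_ext _ (fun t => a * Im (p t) + b * Re (p t))).
    + rewrite RInt_lin; auto.
    + intros; unfold Re, Im; simpl; ring.
Qed.

Lemma cavg_minus p q :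
  Ccont p -> Ccont q -> cavg (fun t => p t - q t)%C = (cavg p - cavg q)%C.
Proof.
  intros Hp Hq.
  rewrite (cavg_ext _ (fun t => p t + (-(1)) * q t)%C) by (intros; ring).
  rewrite cavg_plus, cavg_scal; auto. ring. now apply Ccont_scal.
Qed.

Lemma cavg_const c : cavg (fun _ => c) = c.
Proof.
  unfold cavg. rewrite !(RInt_const (V := R_CompleteNormedModule)).
  generalize two_PI_pos; intros P. destruct c as [a b].
  apply injective_projections; simpl; unfold scal; simpl; unfold mult; simpl; field; lra.
Qed.

Lemma cavg_Re p : Re (cavg p) = / (2 * PI) * RInt (fun t => Re (p t)) 0 (2 * PI).
Proof. unfold cavg; simpl. ring. Qed.

Lemma cavg_Im p : Im (cavg p) = / (2 * PI) * RInt (fun t => Im (p t)) 0 (2 * PI).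
Proof. unfold cavg; simpl. ring. Qed.

(** The average is paired with its own conjugate, which reduces the claim to the integral of a real
    part; bounding real and imaginary parts separately would cost a factor. *)
Lemma cavg_bound p (M : R) :
  Ccont p -> (forall t, Cmod (p t) <= M) -> Cmod (cavg p) <= M.
Proof.
  intros Hp HM. set (I := cavg p).
  destruct (Req_dec (Cmod I) 0) as [E | N].
  { rewrite E. generalize (HM 0) (Cmod_ge_0 (p 0)). lra. }
  assert (P : 0 < Cmod I) by (generalize (Cmod_ge_0 I); lra).
  apply Rmult_le_reg_l with (Cmod I); [ exact P | ].
  assert (E : Cmod I * Cmod I = Re (cavg (fun t => Cconj I * p t)%C)).
  { rewrite cavg_scal by auto. fold I. rewrite Cmod_sqr_Re_Im. simpl. ring. }
  rewrite E, cavg_Re.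
  assert (P2 := two_PI_pos).
  apply Rle_trans with (/ (2 * PI) * ((2 * PI - 0) * (Cmod I * M))).
  2: { right. field. lra. }
  apply Rmult_le_compat_l. left; now apply Rinv_0_lt_compat.
  eapply Rle_trans; [ apply Rle_abs | ].
  apply abs_RInt_le_const; [ lra | | ].
  - apply ex_RInt_cont. intros x. apply (Ccont_scal (Cconj I) p Hp x).
  - intros t _. eapply Rle_trans; [ apply re_le_Cmod | ].
    apply Cmod_mult_le; [ rewrite Cmod_conj; lra | auto ].
Qed.

Lemma RInt_periodic_shift (f : R -> R) (s : R) :
  (forall x, continuous f x) -> (forall x, f (x + 2 * PI) = f x) ->
  RInt (fun t => f (t + s)) 0 (2 * PI) = RInt f 0 (2 * PI).
Proof.
  intros Hc Hp.
  assert (X : forall a b, ex_RInt f a b) by (intros; now apply ex_RInt_cont).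
  assert (S : forall u a b, RInt (fun t => f (t + u)) a b = RInt f (a + u) (b + u)).
  { intros u a b. generalize (RInt_comp_lin (V := R_CompleteNormedModule) f 1 u a b).
    rewrite !Rmult_1_l. intros <-; auto. apply RInt_ext. intros x _.
    unfold scal; simpl; unfold mult; simpl. rewrite Rmult_1_l. f_equal. ring. }
  rewrite S, Rplus_0_l.
  assert (E1 := RInt_Chasles (V := R_CompleteNormedModule) f s (2 * PI) (2 * PI + s) (X _ _) (X _ _)).
  assert (E2 := RInt_Chasles (V := R_CompleteNormedModule) f 0 s (2 * PI) (X _ _) (X _ _)).
  assert (E3 : RInt f (2 * PI) (2 * PI + s) = RInt f 0 s).
  { rewrite <- (RInt_ext (fun t => f (t + 2 * PI)) f 0 s) by (intros; auto).
    rewrite S, Rplus_0_l. f_equal. ring. }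
  unfold plus in *; simpl in *. change zero with 0 in *. lra.
Qed.

Lemma cavg_shift p (s : R) :
  Ccont p -> periodic_C p -> cavg (fun t => p (t + s)) = cavg p.
Proof.
  intros Hc Hp. unfold cavg. do 2 f_equal.
  - apply (RInt_periodic_shift (fun t => Re (p t))). intros; apply Hc. intros; now rewrite Hp.
  - apply (RInt_periodic_shift (fun t => Im (p t))). intros; apply Hc. intros; now rewrite Hp.
Qed.

(** Stands for the limit [s -> 0] in the arguments below that compare increments with
    derivatives. *)
Lemma Rabs_zero_of_linear_bound (x B : R) :
  (forall s, 0 < s -> x <= B * s) -> x <= 0.
Proof.
  intros H. destruct (Rle_dec x 0) as [L | L]; [ exact L | exfalso ].
  assert (HB : 0 < Rabs B + 1) by (generalize (Rabs_pos B); lra).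
  assert (Q : 0 < x / (2 * (Rabs B + 1))) by (apply Rdiv_lt_0_compat; lra).
  specialize (H _ Q).
  assert (B * (x / (2 * (Rabs B + 1))) <= (Rabs B + 1) * (x / (2 * (Rabs B + 1)))).
  { apply Rmult_le_compat_r. lra. generalize (Rle_abs B); lra. }
  replace ((Rabs B + 1) * (x / (2 * (Rabs B + 1)))) with (x / 2) in H0 by (field; lra). lra.
Qed.

(** By periodicity the increment [p (t + s) - p t] has mean zero, so [s] times the mean of [p1] is,
    up to sign, the mean of a remainder of order [s^2]. *)
Lemma cavg_derive_zero (p p1 : R -> C) (B : R) :
  Ccont p -> Ccont p1 -> periodic_C p ->
  (forall s t, Cmod (p t - p s - RtoC (t - s) * p1 s)%C <= B * (t - s) ^ 2) ->
  cavg p1 = RtoC 0.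
Proof.
  intros Hp Hp1 Per HB. apply Cmod_eq_0. apply Rle_antisym; [ | apply Cmod_ge_0 ].
  apply Rabs_zero_of_linear_bound with B. intros s Hs.
  apply Rmult_le_reg_l with s; [ exact Hs | ].
  rewrite <- (Rabs_pos_eq s) at 1 by lra. rewrite <- Cmod_R, <- Cmod_mult, <- cavg_scal by auto.
  replace (cavg (fun t => s * p1 t)%C) with
    (- cavg (fun t => p (t + s)%R - p t - RtoC s * p1 t))%C.
  - rewrite Cmod_opp. apply cavg_bound.
    + apply Ccont_minus; [ apply Ccont_minus | apply Ccont_scal ]; auto. now apply Ccont_shift.
    + intros t. generalize (HB t (t + s)). replace (t + s - t) with s by ring. simpl. lra.
  - rewrite !cavg_minus; auto.
    + rewrite cavg_shift by auto. ring.
    + now apply Ccont_shift.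
    + apply Ccont_minus; auto. now apply Ccont_shift.
    + now apply Ccont_scal.
Qed.

Lemma constant_of_quadratic_bound (phi : R -> C) (a b B : R) :
  (forall s t, a < s < b -> a < t < b -> Cmod (phi t - phi s)%C <= B * (t - s) ^ 2) ->
  forall s t, a < s < b -> a < t < b -> phi s = phi t.
Proof.
  intros H.
  (* [n] equal pieces of [[s, t]] give the bound [B (t - s)^2 / n]. *)
  assert (Sub : forall n s h, 0 < h -> a < s -> s + INR n * h < b ->
             Cmod (phi (s + INR n * h)%R - phi s)%C <= INR n * (B * h ^ 2)).
  { induction n as [ | n IH]; intros s h Hh Ha Hb.
    - simpl. rewrite !Rmult_0_l, Rplus_0_r.
      replace (phi s - phi s)%C with (RtoC 0) by ring. rewrite Cmod_0. lra.
    - rewrite S_INR in *. assert (Hn := pos_INR n).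
      assert (0 <= INR n * h) by nra.
      replace (phi (s + (INR n + 1) * h)%R - phi s)%C with
        ((phi (s + INR n * h)%R - phi s) + (phi (s + (INR n + 1) * h)%R - phi (s + INR n * h)%R))%C by ring.
      replace ((INR n + 1) * (B * h ^ 2)) with (INR n * (B * h ^ 2) + B * h ^ 2) by ring.
      apply Cmod_plus_le.
      + apply IH; lra.
      + eapply Rle_trans; [ apply H; lra | ]. right. f_equal. f_equal. ring. }
  assert (W : forall s t, a < s -> s < t -> t < b -> phi s = phi t).
  { intros s t Ha Hst Hb. symmetry. apply Ceq_minus, Cmod_eq_0.
    apply Rle_antisym; [ | apply Cmod_ge_0 ].
    destruct (Rle_dec (Cmod (phi t - phi s)%C) 0) as [L | L]; [ exact L | exfalso ].
    set (x := Cmod (phi t - phi s)%C) in *.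
    assert (Q : forall n, x * INR (S n) <= B * (t - s) ^ 2).
    { intros n. assert (0 < INR (S n)) by (apply lt_0_INR; lia).
      specialize (Sub (S n) s ((t - s) / INR (S n))).
      replace (s + INR (S n) * ((t - s) / INR (S n))) with t in Sub by (field; lra).
      apply Rle_trans with (INR (S n) * (B * ((t - s) / INR (S n)) ^ 2) * INR (S n)).
      + apply Rmult_le_compat_r. lra. apply Sub; try lra. apply Rdiv_lt_0_compat; lra.
      + right. field. lra. }
    destruct (INR_unbounded (B * (t - s) ^ 2 / x)) as [n Hn].
    specialize (Q n). rewrite S_INR in Q.
    apply (Rmult_lt_compat_l x) in Hn; [ | lra ].
    replace (x * (B * (t - s) ^ 2 / x)) with (B * (t - s) ^ 2) in Hn by (field; lra). lra. }
  intros s t Hs Ht. destruct (Rtotal_order s t) as [L | [-> | L]].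
  - apply W; lra.
  - reflexivity.
  - symmetry. apply W; lra.
Qed.

Definition band (a b : R) (z : C) : Prop := a < Im z < b.

Definition periodic_on (D : C -> Prop) (f : C -> C) : Prop :=
  forall z, D z -> f (z + RtoC (2 * PI))%C = f z.

Definition line (y : R) (f : C -> C) (t : R) : C := f (t, y).

Lemma band_line a b y t : a < y < b -> band a b (t, y).
Proof. intros H; exact H. Qed.

Lemma line_minus (t s y : R) : ((t, y) - (s, y))%C = RtoC (t - s).
Proof. apply injective_projections; simpl; ring. Qed.

Lemma holo_line_Ccont D f f1 y :
  holo D f f1 -> (forall t, D (t, y)) -> Ccont (line y f).
Proof.
  intros [B [HB H]] HD. apply (Ccont_lipschitz _ (2 * B)). intros s t. unfold line.
  eapply Rle_trans; [ apply (holo_bound_lipschitz B D f f1); auto | ].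
  rewrite line_minus, Cmod_R. lra.
Qed.

Lemma holo_line_Ccont1 D f f1 y :
  holo D f f1 -> (forall t, D (t, y)) -> Ccont (line y f1).
Proof.
  intros [B [HB H]] HD. apply (Ccont_lipschitz _ (2 * B)). intros s t. unfold line.
  eapply Rle_trans; [ apply (holo_bound_derive_lipschitz B D f f1); auto | ].
  rewrite line_minus, Cmod_R. lra.
Qed.

Lemma line_periodic D f y :
  periodic_on D f -> (forall t, D (t, y)) -> periodic_C (line y f).
Proof.
  intros H HD t. unfold line. rewrite <- (H (t, y)); auto. f_equal.
  apply injective_projections; simpl; ring.
Qed.

Lemma cavg_line_derive D f f1 y :
  holo D f f1 -> periodic_on D f -> (forall t, D (t, y)) -> cavg (line y f1) = RtoC 0.
Proof.
  intros Hf Hp HD. pose proof Hf as [B [HB [_ [_ Q]]]].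
  apply (cavg_derive_zero (line y f) _ B).
  - eapply holo_line_Ccont; eauto.
  - eapply holo_line_Ccont1; eauto.
  - eapply line_periodic; eauto.
  - intros s t. unfold line. rewrite <- (line_minus t s y).
    eapply Rle_trans; [ apply Q; auto | ]. rewrite line_minus, Cmod_R, RPow_abs.
    rewrite Rabs_pos_eq by apply pow2_ge_0. lra.
Qed.

(** Cauchy's theorem for a rectangle one period wide. Moving the line by [t - s] changes the mean by
    [i (t - s)] times the mean of [f1], which vanishes, up to a quadratic error; a function with
    quadratic increments is constant. *)
Lemma cavg_line_constant a b f f1 :
  holo (band a b) f f1 -> periodic_on (band a b) f ->
  forall y1 y2, a < y1 < b -> a < y2 < b -> cavg (line y1 f) = cavg (line y2 f).
Proof.
  intros Hf Hp. pose proof Hf as [B [HB [_ [_ Q]]]].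
  apply (constant_of_quadratic_bound (fun y => cavg (line y f)) a b B).
  intros s t Hs Ht.
  assert (Cs := holo_line_Ccont _ _ _ s Hf (fun x => band_line a b s x Hs)).
  assert (Ct := holo_line_Ccont _ _ _ t Hf (fun x => band_line a b t x Ht)).
  assert (C1 := holo_line_Ccont1 _ _ _ s Hf (fun x => band_line a b s x Hs)).
  replace (cavg (line t f) - cavg (line s f))%C with
    (cavg (fun x => line t f x - line s f x - (RtoC (t - s) * Ci) * line s f1 x)%C).
  - apply cavg_bound.
    + apply Ccont_minus; [ now apply Ccont_minus | now apply Ccont_scal ].
    + intros x. unfold line.
      replace (RtoC (t - s) * Ci)%C with ((x, t) - (x, s))%C
        by (apply injective_projections; simpl; ring).
      eapply Rle_trans; [ apply Q; apply band_line; auto | ].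
      replace ((x, t) - (x, s))%C with (RtoC (t - s) * Ci)%C
        by (apply injective_projections; simpl; ring).
      rewrite Cmod_mult, Cmod_R, Cmod_Ci, Rmult_1_r, RPow_abs.
      rewrite Rabs_pos_eq by apply pow2_ge_0. lra.
  - rewrite !cavg_minus, cavg_scal; auto.
    + rewrite (cavg_line_derive (band a b) f f1 s Hf Hp (fun x => band_line a b s x Hs)). ring.
    + now apply Ccont_minus.
    + now apply Ccont_scal.
Qed.

(** * Fourier series *)

Fixpoint csum (a : nat -> C) (n : nat) : C :=
  match n with 0%nat => RtoC 0 | S m => (csum a m + a m)%C end.

Lemma csum_ext a b n : (forall k, (k < n)%nat -> a k = b k) -> csum a n = csum b n.
Proof.
  induction n; intros H; simpl; [ reflexivity | ].
  rewrite IHn, H; auto.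
Qed.

Lemma csum_bound a b n :
  (forall k, (k < n)%nat -> Cmod (a k) <= b k) ->
  Cmod (csum a n) <= match n with 0%nat => 0 | S m => sum_f_R0 b m end.
Proof.
  induction n as [ | n IH]; intros H; simpl. { rewrite Cmod_0; lra. }
  destruct n.
  - simpl. rewrite Cplus_0_l. apply H. lia.
  - simpl. apply Cmod_plus_le; [ apply IH; intros; apply H; lia | apply H; lia ].
Qed.

(** * Absolutely convergent complex series *)

Definition summable (a : nat -> C) : Prop := ex_series (fun n => Cmod (a n)).

Definition CSeries (a : nat -> C) : C :=
  (Series (fun n => Re (a n)), Series (fun n => Im (a n))).

Lemma summable_le a (b : nat -> R) :
  (forall n, Cmod (a n) <= b n) -> ex_series b -> summable a.
Proof.
  intros H Hb. apply (ex_series_le (V := R_CompleteNormedModule)) with b; [ | exact Hb ].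
  intros n. simpl. unfold norm; simpl. unfold abs; simpl.
  rewrite Rabs_pos_eq by apply Cmod_ge_0. apply H.
Qed.

Lemma summable_Re a : summable a -> ex_series (fun n => Re (a n)).
Proof.
  intros H. apply (ex_series_le (V := R_CompleteNormedModule)) with (2 := H).
  intros n. apply re_le_Cmod.
Qed.

Lemma summable_Im a : summable a -> ex_series (fun n => Im (a n)).
Proof.
  intros H. apply (ex_series_le (V := R_CompleteNormedModule)) with (2 := H).
  intros n. apply Im_le_Cmod.
Qed.

Lemma summable_scal c a : summable a -> summable (fun n => c * a n)%C.
Proof.
  intros H. apply summable_le with (fun n => Cmod c * Cmod (a n)).
  - intros n. rewrite Cmod_mult. lra.
  - apply (ex_series_scal (V := R_NormedModule) (Cmod c)). exact H.
Qed.

Lemma summable_plus a b : summable a -> summable b -> summable (fun n => a n + b n)%C.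
Proof.
  intros H K. apply summable_le with (fun n => Cmod (a n) + Cmod (b n)).
  - intros n. apply Cmod_triangle.
  - apply (ex_series_plus (V := R_NormedModule)); auto.
Qed.

Lemma CSeries_ext a b : (forall n, a n = b n) -> CSeries a = CSeries b.
Proof. intros E. unfold CSeries. f_equal; apply Series_ext; intros; now rewrite E. Qed.

Lemma CSeries_plus a b :
  summable a -> summable b -> CSeries (fun n => a n + b n)%C = (CSeries a + CSeries b)%C.
Proof.
  intros H K. apply injective_projections; simpl; apply Series_plus;
    auto using summable_Re, summable_Im.
Qed.

Lemma CSeries_scal c a : summable a -> CSeries (fun n => c * a n)%C = (c * CSeries a)%C.
Proof.
  intros H. destruct c as [x y].
  assert (HR := summable_Re a H). assert (HI := summable_Im a H).
  apply injective_projections; simpl.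
  - rewrite <- !Series_scal_l, <- Series_minus; [ reflexivity | | ].
    + now apply (ex_series_scal (V := R_NormedModule) x).
    + now apply (ex_series_scal (V := R_NormedModule) y).
  - rewrite <- !Series_scal_l, <- Series_plus; [ reflexivity | | ].
    + now apply (ex_series_scal (V := R_NormedModule) x).
    + now apply (ex_series_scal (V := R_NormedModule) y).
Qed.

Lemma CSeries_minus a b :
  summable a -> summable b -> CSeries (fun n => a n - b n)%C = (CSeries a - CSeries b)%C.
Proof.
  intros H K. rewrite (CSeries_ext _ (fun n => a n + (-(1)) * b n)%C) by (intros; ring).
  rewrite CSeries_plus, CSeries_scal; auto. ring. now apply summable_scal.
Qed.

Lemma CSeries_bound a (b : nat -> R) :
  (forall n, Cmod (a n) <= b n) -> ex_series b -> Cmod (CSeries a) <= Series b.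
Proof.
  intros H Hb. assert (Sa := summable_le a b H Hb).
  set (s := CSeries a).
  assert (P0 : 0 <= Series b).
  { rewrite <- (Rmult_0_l (Series b)), <- Series_scal_l.
    apply Series_le; [ | exact Hb ]. intros n. generalize (H n) (Cmod_ge_0 (a n)). lra. }
  destruct (Req_dec (Cmod s) 0) as [E | N]; [ rewrite E; exact P0 | ].
  assert (P : 0 < Cmod s) by (generalize (Cmod_ge_0 s); lra).
  apply Rmult_le_reg_l with (Cmod s); [ exact P | ].
  replace (Cmod s * Cmod s) with (Re (CSeries (fun n => Cconj s * a n)%C)).
  2: { rewrite CSeries_scal by auto. fold s. rewrite Cmod_sqr_Re_Im. simpl. ring. }
  simpl Re. rewrite <- Series_scal_l.
  assert (K : forall n, Cmod (Cconj s * a n)%C <= Cmod s * b n).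
  { intros n. apply Cmod_mult_le; auto. rewrite Cmod_conj; lra. }
  eapply Rle_trans; [ apply Rle_abs | ].
  assert (Eb : ex_series (fun n => Cmod s * b n)).
  { apply (ex_series_scal (V := R_NormedModule) (Cmod s)). exact Hb. }
  assert (W : ex_series (fun n => Rabs (Re (Cconj s * a n)%C))).
  { apply (ex_series_le (V := R_CompleteNormedModule)) with (2 := Eb).
    intros n. change (Rabs (Rabs (Re (Cconj s * a n)%C)) <= Cmod s * b n). rewrite Rabs_Rabsolu.
    eapply Rle_trans; [ apply re_le_Cmod | apply K ]. }
  eapply Rle_trans; [ apply (Series_Rabs (fun n => Re (Cconj s * a n)%C)); exact W | ].
  apply Series_le; [ | exact Eb ].
  intros n. split; [ apply Rabs_pos | ]. eapply Rle_trans; [ apply re_le_Cmod | apply K ].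
Qed.

Lemma summable_incr_1 a : summable a -> summable (fun n => a (S n)).
Proof. intros H. apply (ex_series_incr_1 (V := R_NormedModule) (fun n => Cmod (a n))). exact H. Qed.

Lemma CSeries_incr_n a n :
  summable a -> CSeries a = (csum a n + CSeries (fun k => a (n + k)%nat))%C.
Proof.
  revert a; induction n as [ | n IH]; intros a H.
  - simpl. rewrite Cplus_0_l. apply CSeries_ext. reflexivity.
  - assert (E : CSeries a = (a 0%nat + CSeries (fun k => a (S k)))%C).
    { apply injective_projections; simpl; apply Series_incr_1; auto using summable_Re, summable_Im. }
    rewrite E, IH by now apply summable_incr_1. simpl.
    assert (F : forall m, (a 0%nat + csum (fun k => a (S k)) m = csum a m + a m)%C).
    { induction m; simpl; [ ring | ]. rewrite Cplus_assoc, IHm. reflexivity. }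
    rewrite Cplus_assoc, F. reflexivity.
Qed.

Lemma ex_series_geom_scal (M q : R) : 0 <= q < 1 -> ex_series (fun n => M * q ^ n).
Proof.
  intros H. apply (ex_series_scal (V := R_NormedModule) M).
  apply ex_series_geom. rewrite Rabs_pos_eq; lra.
Qed.

Lemma CSeries_geom_tail a (M q : R) (m : nat) :
  0 <= q < 1 -> (forall n, Cmod (a n) <= M * q ^ n) ->
  Cmod (CSeries a - csum a m)%C <= M / (1 - q) * q ^ m.
Proof.
  intros Hq H.
  rewrite (CSeries_incr_n a m) by (eapply summable_le; [ apply H | now apply ex_series_geom_scal ]).
  replace (csum a m + CSeries (fun k => a (m + k)%nat) - csum a m)%C
    with (CSeries (fun k => a (m + k)%nat)) by ring.
  eapply Rle_trans.
  { apply (CSeries_bound _ (fun k => M * q ^ m * q ^ k)).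
    - intros n. generalize (H (m + n)%nat). rewrite pow_add. lra.
    - now apply ex_series_geom_scal. }
  rewrite Series_scal_l, Series_geom by (rewrite Rabs_pos_eq; lra).
  right. field. lra.
Qed.

(** * Exponential modes and the characters of the circle *)

Lemma Cexpi_taylor (e : R) (z w : C) :
  Cmod (Cexpi z) <= e -> Cmod (Cexpi w) <= e ->
  Cmod (Cexpi w - Cexpi z - (w - z) * (Cexpi z * Ci))%C <= 30 * e * Cmod (w - z)%C ^ 2.
Proof.
  intros Lz Lw.
  assert (P : 0 <= e) by (generalize (Cmod_ge_0 (Cexpi z)); lra).
  destruct (Rle_dec (Cmod (w - z)%C) 1) as [S | S].
  - replace w with (z + (w - z))%C at 1 by ring. rewrite Cexpi_plus.
    replace (Cexpi z * Cexpi (w - z) - Cexpi z - (w - z) * (Cexpi z * Ci))%C with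
      (Cexpi z * (Cexpi (w - z) - 1 - (w - z) * Ci))%C by ring.
    replace (30 * e * Cmod (w - z)%C ^ 2) with (e * (30 * Cmod (w - z)%C ^ 2)) by ring.
    apply Cmod_mult_le; [ exact Lz | ]. now apply Cexpi_remainder.
  - eapply Rle_trans.
    { apply Cmod_minus_le; [ apply Cmod_minus_le; [ exact Lw | exact Lz ] | ].
      apply Cmod_mult_le; [ apply Rle_refl | ].
      rewrite Cmod_mult, Cmod_Ci, Rmult_1_r. exact Lz. }
    set (h := Cmod (w - z)%C) in *. simpl.
    assert (0 <= e * (30 * (h * h) - 2 - h)) by (apply Rmult_le_pos; nra). lra.
Qed.

Lemma holo_Cexpi a b : holo (band a b) Cexpi (fun z => Cexpi z * Ci)%C.
Proof.
  assert (L : forall z, band a b z -> Cmod (Cexpi z) <= exp (- a)).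
  { intros z [H1 H2]. rewrite Cmod_Cexpi.
    destruct (Req_dec (Im z) a) as [-> | N]; [ lra | ]. left. apply exp_increasing. lra. }
  assert (P := exp_pos (- a)).
  exists (30 * exp (- a)). split; [ lra | split; [ | split ] ].
  - intros z Hz. generalize (L z Hz). lra.
  - intros z Hz. rewrite Cmod_mult, Cmod_Ci. generalize (L z Hz). lra.
  - intros z w Hz Hw. apply Cexpi_taylor; auto.
Qed.

Lemma holo_Cexpi_scal (s a b : R) :
  holo (band a b) (fun z => Cexpi (RtoC s * z)) (fun z => Cexpi (RtoC s * z) * (RtoC s * Ci))%C.
Proof.
  (* [K] bounds [Rabs (s * Im z)] on the band, whatever the sign of [s]. *)
  set (K := Rabs s * (Rabs a + Rabs b) + 1).
  eapply holo_ext; [ | | apply (holo_comp_affine (band a b) (band (- K) K) Cexpi (fun z => Cexpi z * Ci)%C (RtoC s) 0) ].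
  - intros z _. cbv beta. f_equal. ring.
  - intros z _. cbv beta. rewrite Cplus_0_r. ring.
  - intros z [H1 H2]. rewrite Cplus_0_r.
    assert (E : Im (RtoC s * z)%C = s * Im z) by apply im_scal_l.
    unfold band. rewrite E.
    assert (Rabs (Im z) <= Rabs a + Rabs b).
    { apply Rabs_le. generalize (Rle_abs a) (Rle_abs b) (Rabs_pos a) (Rabs_pos b)
        (Rle_abs (- a)) (Rle_abs (- b)). rewrite !Rabs_Ropp. lra. }
    assert (Q : Rabs (s * Im z) < K).
    { unfold K. rewrite Rabs_mult. generalize (Rabs_pos s). nra. }
    apply Rabs_def2 in Q. lra.
  - apply holo_Cexpi.
Qed.

Lemma Cexpi_INR_2PI (n : nat) (z : C) :
  Cexpi (RtoC (INR n) * (z + RtoC (2 * PI)))%C = Cexpi (RtoC (INR n) * z)%C.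
Proof. now rewrite !Cexpi_INR, Cexpi_2PI. Qed.

Lemma Cexpi_opp (z : C) : (Cexpi z * Cexpi (- z) = 1)%C.
Proof. rewrite <- Cexpi_plus, Cplus_opp_r. apply Cexpi_0. Qed.

Lemma Cexpi_opp_inv (z : C) : Cexpi (- z)%C = (/ Cexpi z)%C.
Proof.
  assert (N := Cexpi_nz z). transitivity (/ Cexpi z * (Cexpi z * Cexpi (- z)))%C.
  - field. exact N.
  - rewrite Cexpi_opp. ring.
Qed.

Lemma Cexpi_opp_INR_2PI (n : nat) (z : C) :
  Cexpi (RtoC (- INR n) * (z + RtoC (2 * PI)))%C = Cexpi (RtoC (- INR n) * z)%C.
Proof.
  rewrite RtoC_opp.
  replace (- RtoC (INR n) * (z + RtoC (2 * PI)))%C with (- (RtoC (INR n) * (z + RtoC (2 * PI))))%C by ring.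
  replace (- RtoC (INR n) * z)%C with (- (RtoC (INR n) * z))%C by ring.
  now rewrite !Cexpi_opp_inv, Cexpi_INR_2PI.
Qed.

Lemma Ccont_csum (p : nat -> R -> C) n :
  (forall k, Ccont (p k)) -> Ccont (fun x => csum (fun k => p k x) n).
Proof.
  intros H. induction n; simpl. apply Ccont_const. now apply Ccont_plus.
Qed.

Lemma cavg_csum (p : nat -> R -> C) n :
  (forall k, Ccont (p k)) ->
  cavg (fun x => csum (fun k => p k x) n) = csum (fun k => cavg (p k)) n.
Proof.
  intros H. induction n; simpl. apply cavg_const.
  rewrite cavg_plus, IHn; auto. now apply Ccont_csum.
Qed.

Lemma csum_scal c a n : (c * csum a n = csum (fun k => c * a k) n)%C.
Proof. induction n; simpl; [ ring | ]. rewrite <- IHn. ring. Qed.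

(** Negative frequencies get a name of their own so that all indices remain natural numbers. *)
Definition ex (n : nat) (x : R) : C := Cexpi (RtoC (INR n) * RtoC x).
Definition exm (n : nat) (x : R) : C := Cexpi (RtoC (- INR n) * RtoC x).

Lemma Ccont_Cexpi_scal (s : R) : Ccont (fun x : R => Cexpi (RtoC s * RtoC x)).
Proof.
  eapply (holo_line_Ccont _ _ _ 0 (holo_Cexpi_scal s (-1) 1)).
  intros t. apply band_line. lra.
Qed.

Lemma Ccont_ex n : Ccont (ex n).
Proof. apply Ccont_Cexpi_scal. Qed.

Lemma Ccont_exm n : Ccont (exm n).
Proof. apply Ccont_Cexpi_scal. Qed.

Lemma ex_0 x : ex 0 x = RtoC 1.
Proof. unfold ex. simpl. rewrite Cmult_0_l. apply Cexpi_0. Qed.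

Lemma exm_0 x : exm 0 x = RtoC 1.
Proof. unfold exm. simpl. rewrite Ropp_0, Cmult_0_l. apply Cexpi_0. Qed.

Lemma ex_S n x : ex (S n) x = (ex 1 x * ex n x)%C.
Proof.
  unfold ex. rewrite <- Cexpi_plus. f_equal. rewrite S_INR, RtoC_plus. simpl. ring.
Qed.

Lemma exm_S n x : exm (S n) x = (exm 1 x * exm n x)%C.
Proof.
  unfold exm. rewrite <- Cexpi_plus. f_equal. rewrite S_INR, !RtoC_opp, RtoC_plus.
  simpl. ring.
Qed.

Lemma ex_exm n x : (ex n x * exm n x = 1)%C.
Proof.
  unfold ex, exm. rewrite <- Cexpi_plus, RtoC_opp.
  replace (INR n * x + - INR n * x)%C with (RtoC 0) by ring. apply Cexpi_0.
Qed.

Lemma Cmod_ex n x : Cmod (ex n x) = 1.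
Proof.
  unfold ex. rewrite Cmod_Cexpi, im_scal_l. simpl. rewrite Rmult_0_r, Ropp_0. apply exp_0.
Qed.

Lemma Cmod_exm n x : Cmod (exm n x) = 1.
Proof.
  unfold exm. rewrite Cmod_Cexpi, im_scal_l. simpl. rewrite Rmult_0_r, Ropp_0. apply exp_0.
Qed.

Lemma cavg_Cexpi_scal (s : R) :
  s <> 0 -> periodic_C (fun x : R => Cexpi (RtoC s * RtoC x)) ->
  cavg (fun x : R => Cexpi (RtoC s * RtoC x)) = RtoC 0.
Proof.
  intros Hs Hp.
  (* The domain is the real line itself, because periodicity is only assumed for real arguments. *)
  assert (E := cavg_line_derive (fun z => Im z = 0) (fun z => Cexpi (RtoC s * z))
         (fun z => Cexpi (RtoC s * z) * (RtoC s * Ci))%C 0).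
  assert (E0 : cavg (line 0 (fun z => Cexpi (RtoC s * z) * (RtoC s * Ci))%C) = RtoC 0).
  { apply E.
    - eapply holo_sub; [ | apply (holo_Cexpi_scal s (-1) 1) ].
      intros z Hz. split; rewrite Hz; lra.
    - intros [x y] Hz. simpl in Hz. subst y.
      replace ((x, 0) + RtoC (2 * PI))%C with (RtoC (x + 2 * PI))
        by (apply injective_projections; simpl; ring).
      apply Hp.
    - reflexivity. }
  rewrite (cavg_ext _ (fun x : R => (RtoC s * Ci) * Cexpi (RtoC s * RtoC x))%C) in E0.
  - rewrite cavg_scal in E0 by apply Ccont_Cexpi_scal.
    replace (cavg _) with (/ (RtoC s * Ci) * (RtoC s * Ci * cavg (fun x : R => Cexpi (RtoC s * RtoC x))))%C.
    + rewrite E0. ring.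
    + field. split. apply Ci_nz. intros F. apply Hs. now apply RtoC_inj.
  - intros t. unfold line. ring_simplify. unfold RtoC. ring.
Qed.

Lemma ex_periodic n : periodic_C (ex n).
Proof. intros x. unfold ex. rewrite RtoC_plus. apply Cexpi_INR_2PI. Qed.

Lemma exm_periodic n : periodic_C (exm n).
Proof. intros x. unfold exm. rewrite RtoC_plus. apply Cexpi_opp_INR_2PI. Qed.

Lemma cavg_ex n : cavg (ex (S n)) = RtoC 0.
Proof.
  apply cavg_Cexpi_scal. apply not_0_INR; lia. apply (ex_periodic (S n)).
Qed.

Lemma cavg_exm n : cavg (exm (S n)) = RtoC 0.
Proof.
  apply cavg_Cexpi_scal. apply Ropp_neq_0_compat, not_0_INR; lia. apply (exm_periodic (S n)).
Qed.

Lemma ex_E n x : ex n x = Cexpi (RtoC (INR n) * RtoC x).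
Proof. reflexivity. Qed.

Lemma exm_E n x : exm n x = Cexpi (RtoC (- INR n) * RtoC x).
Proof. reflexivity. Qed.

(* Without this, unification of [ex] with [exm] unfolds the real numbers. *)
#[global] Opaque ex exm.

Ltac ccont :=
  match goal with
  | |- Ccont (ex ?n) => exact (Ccont_ex n)
  | |- Ccont (fun x => ex ?n x) => exact (Ccont_ex n)
  | |- Ccont (exm ?n) => exact (Ccont_exm n)
  | |- Ccont (fun x => exm ?n x) => exact (Ccont_exm n)
  | H : Ccont ?p |- Ccont ?p => exact H
  | |- Ccont (fun x => ?c) => exact (Ccont_const c)
  | |- Ccont (fun x => (@?p x + @?q x)%C) => apply (Ccont_plus p q); ccont
  | |- Ccont (fun x => (@?p x - @?q x)%C) => apply (Ccont_minus p q); ccont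
  | |- Ccont (fun x => (@?p x * @?q x)%C) => apply (Ccont_mult p q); ccont
  end.

(** * Dirichlet and Fejer kernels *)

Definition dirichlet (m : nat) (x : R) : C :=
  (1 + csum (fun n => ex (S n) x + exm (S n) x) m)%C.

(** This is [N] times the usual Fejer kernel: the division by [N] is left to the end of the
    convergence argument. *)
Definition fejer (N : nat) (x : R) : C := csum (fun m => dirichlet m x) N.

Lemma Ccont_dirichlet m : Ccont (dirichlet m).
Proof.
  apply Ccont_plus; [ apply Ccont_const | ].
  apply (Ccont_csum (fun n x => ex (S n) x + exm (S n) x)%C).
  intros k. apply Ccont_plus; [ apply Ccont_ex | apply Ccont_exm ].
Qed.

Lemma Ccont_fejer N : Ccont (fejer N).
Proof. apply (Ccont_csum dirichlet). apply Ccont_dirichlet. Qed.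

Lemma dirichlet_closed m x :
  ((1 - ex 1 x) * dirichlet m x = exm m x - ex (S m) x)%C.
Proof.
  induction m.
  - unfold dirichlet. simpl. rewrite exm_0. ring.
  - unfold dirichlet in *. simpl csum. rewrite Cplus_assoc, Cmult_plus_distr_l, IHm.
    rewrite (exm_S m), (ex_S (S m)).
    replace (exm m x) with ((ex 1 x * exm 1 x) * exm m x)%C at 1 by (rewrite ex_exm; ring).
    ring.
Qed.

Lemma fejer_closed N x :
  ((1 - ex 1 x) * (1 - exm 1 x) * fejer N x = 2 - ex N x - exm N x)%C.
Proof.
  unfold fejer. induction N.
  - simpl. rewrite ex_0, exm_0. ring.
  - simpl csum. rewrite Cmult_plus_distr_l, IHN.
    replace ((1 - ex 1 x) * (1 - exm 1 x) * dirichlet N x)%C with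
      ((1 - exm 1 x) * ((1 - ex 1 x) * dirichlet N x))%C by ring.
    rewrite dirichlet_closed, (exm_S N), (ex_S N).
    replace (ex N x) with ((ex 1 x * exm 1 x) * ex N x)%C at 1 by (rewrite ex_exm; ring).
    ring.
Qed.

Lemma fejer_bound N x : Cmod (1 - ex 1 x)%C ^ 2 * Cmod (fejer N x) <= 4.
Proof.
  replace (Cmod (1 - ex 1 x)%C ^ 2 * Cmod (fejer N x)) with
    (Cmod ((1 - ex 1 x) * (1 - exm 1 x) * fejer N x)%C).
  - rewrite fejer_closed. replace 4 with (2 + 1 + 1) by ring.
    apply Cmod_minus_le; [ apply Cmod_minus_le | ].
    + rewrite Cmod_R, Rabs_pos_eq; lra.
    + rewrite Cmod_ex; lra.
    + rewrite Cmod_exm; lra.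
  - rewrite !Cmod_mult. simpl. rewrite Rmult_1_r. f_equal. f_equal.
    replace (1 - exm 1 x)%C with (- (exm 1 x * (1 - ex 1 x)))%C.
    + rewrite Cmod_opp, Cmod_mult, Cmod_exm. ring.
    + replace (exm 1 x * (1 - ex 1 x))%C with (exm 1 x - ex 1 x * exm 1 x)%C by ring.
      rewrite ex_exm. ring.
Qed.

Lemma cavg_dirichlet m : cavg (dirichlet m) = RtoC 1.
Proof.
  unfold dirichlet.
  rewrite cavg_plus; [ | apply Ccont_const
    | apply (Ccont_csum (fun n x => ex (S n) x + exm (S n) x)%C); intros k;
      apply Ccont_plus; [ apply Ccont_ex | apply Ccont_exm ] ].
  rewrite cavg_const, (cavg_csum (fun n x => ex (S n) x + exm (S n) x)%C)
    by (intros; apply Ccont_plus; [ apply Ccont_ex | apply Ccont_exm ]).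
  rewrite (csum_ext _ (fun _ => RtoC 0)).
  - induction m; simpl; [ ring | ]. now rewrite Cplus_0_r.
  - intros k _. transitivity (cavg (ex (S k)) + cavg (exm (S k)))%C.
    + apply cavg_plus; [ apply Ccont_ex | apply Ccont_exm ].
    + rewrite cavg_ex, cavg_exm. ring.
Qed.

Lemma cavg_fejer N : cavg (fejer N) = RtoC (INR N).
Proof.
  unfold fejer. rewrite (cavg_csum dirichlet) by apply Ccont_dirichlet.
  induction N; [ reflexivity | ].
  rewrite S_INR, RtoC_plus. simpl csum. now rewrite IHN, cavg_dirichlet.
Qed.

(** [ex 1 - 1] times the [m]-th Dirichlet kernel telescopes to [ex (S m) - exm m], whose mean is
    nonzero for [m = 0] only. Hence the linear Taylor term contributes a bounded amount, however
    many kernels are added. *)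
Lemma cavg_ex1_fejer N :
  cavg (fun x => (ex 1 x - 1) * fejer N x)%C = match N with 0%nat => RtoC 0 | S _ => (- (1))%C end.
Proof.
  rewrite (cavg_ext _ (fun x => csum (fun m => (ex (S m) x - exm m x)%C) N)).
  - rewrite (cavg_csum (fun m x => ex (S m) x - exm m x)%C)
      by (intros; ccont).
    destruct N; [ reflexivity | ].
    induction N.
    + simpl csum. rewrite (cavg_minus (ex 1) (exm 0)), cavg_ex by ccont.
      rewrite (cavg_ext (exm 0) (fun _ => RtoC 1)) by apply exm_0.
      rewrite cavg_const. ring.
    + change (csum (fun k => cavg (fun x => (ex (S k) x - exm k x)%C)) (S N) +
              cavg (fun x => (ex (S (S N)) x - exm (S N) x)%C) = - (1))%C.
      rewrite IHN, (cavg_minus (ex (S (S N))) (exm (S N))), cavg_ex, cavg_exm by ccont. ring.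
  - intros x. unfold fejer. rewrite csum_scal. apply csum_ext. intros k _.
    replace ((ex 1 x - 1) * dirichlet k x)%C with (- ((1 - ex 1 x) * dirichlet k x))%C by ring.
    rewrite dirichlet_closed. ring.
Qed.

(** The linear term is integrated exactly, and by [fejer_bound] the quadratic remainder compensates
    the growth of the kernel at [0]. The integral need not be split into a neighbourhood of [0] and
    its complement. *)
Lemma fejer_mean (p : R -> C) (b : C) (K : R) (N : nat) :
  Ccont p ->
  (forall x, Cmod (p x - p 0 - b * (ex 1 x - 1))%C <= K * Cmod (1 - ex 1 x)%C ^ 2) ->
  Cmod (cavg (fun x => p x * fejer N x) - INR N * p 0)%C <= 4 * K + Cmod b.
Proof.
  intros Hp HK.
  assert (K0 : 0 <= K).
  (* At [x = PI] the weight [Cmod (1 - ex 1 x)] equals [2], which forces the sign of [K]. *)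
  { generalize (HK PI) (Cmod_ge_0 (p PI - p 0 - b * (ex 1 PI - 1))%C).
    replace (1 - ex 1 PI)%C with (RtoC 2).
    - rewrite Cmod_R, Rabs_pos_eq by lra. lra.
    - rewrite ex_E. unfold Cexpi. rewrite im_scal_l, re_scal_l. simpl.
      rewrite Rmult_0_r, Ropp_0, exp_0, !Rmult_1_l, cos_PI, sin_PI.
      apply injective_projections; simpl; ring. }
  set (r := fun x => (p x - p 0 - b * (ex 1 x - 1))%C).
  assert (Cr : Ccont r).
  { apply Ccont_minus; [ apply Ccont_minus; [ exact Hp | apply Ccont_const ] | ].
    apply Ccont_scal, Ccont_minus; [ apply Ccont_ex | apply Ccont_const ]. }
  assert (C1 : Ccont (fun x => (ex 1 x - 1) * fejer N x)%C).
  { apply Ccont_mult; [ apply Ccont_minus; [ apply Ccont_ex | apply Ccont_const ] | apply Ccont_fejer ]. }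
  assert (Cr' : Ccont (fun x => r x * fejer N x)%C) by (apply Ccont_mult; [ exact Cr | apply Ccont_fejer ]).
  rewrite (cavg_ext _ (fun x => r x * fejer N x + (p 0 * fejer N x + b * ((ex 1 x - 1) * fejer N x)))%C).
  2: { intros x. unfold r. ring. }
  assert (Cf := Ccont_fejer N).
  rewrite (cavg_plus (fun x => r x * fejer N x)%C
    (fun x => p 0 * fejer N x + b * ((ex 1 x - 1) * fejer N x))%C) by
    (auto; apply Ccont_plus; now apply Ccont_scal).
  rewrite (cavg_plus (fun x => p 0 * fejer N x)%C (fun x => b * ((ex 1 x - 1) * fejer N x))%C)
    by now apply Ccont_scal.
  rewrite (cavg_scal (p 0) (fejer N)), (cavg_scal b (fun x => (ex 1 x - 1) * fejer N x)%C) by auto.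
  rewrite cavg_fejer, cavg_ex1_fejer.
  replace (cavg (fun x => r x * fejer N x) + (p 0 * INR N + b * match N with 0%nat => 0 | S _ => - (1) end) - INR N * p 0)%C
   with (cavg (fun x => r x * fejer N x) + match N with 0%nat => 0 | S _ => - (1) end * b)%C
   by (destruct N; ring).
  apply Cmod_plus_le.
  - apply cavg_bound; auto. intros x. rewrite Cmod_mult.
    apply Rle_trans with (K * (Cmod (1 - ex 1 x)%C ^ 2 * Cmod (fejer N x))).
    + rewrite <- Rmult_assoc. apply Rmult_le_compat_r; [ apply Cmod_ge_0 | apply HK ].
    + generalize (fejer_bound N x). nra.
  - rewrite Cmod_mult. destruct N.
    + rewrite Cmod_0, Rmult_0_l. apply Cmod_ge_0.
    + rewrite Cmod_m1. lra.
Qed.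

(** Geometric convergence of the Dirichlet means to [S] keeps their sum within a bounded distance of
    [INR N * S], while [fejer_mean] keeps it within a bounded distance of [INR N * p 0]. Dividing by
    [N] identifies the two limits. *)
Lemma dirichlet_limit_unique (p : R -> C) (b S : C) (K A q : R) :
  Ccont p ->
  (forall x, Cmod (p x - p 0 - b * (ex 1 x - 1))%C <= K * Cmod (1 - ex 1 x)%C ^ 2) ->
  0 <= q < 1 ->
  (forall m, Cmod (S - cavg (fun x => p x * dirichlet m x))%C <= A * q ^ m) ->
  p 0 = S.
Proof.
  intros Hp HK Hq HA.
  set (s := fun m => cavg (fun x => p x * dirichlet m x)%C).
  change (forall m, Cmod (S - s m)%C <= A * q ^ m) in HA.
  assert (Ces : forall N, Cmod (INR N * S - csum s N)%C <= A / (1 - q)).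
  { assert (A0 : 0 <= A). { generalize (HA 0%nat) (Cmod_ge_0 (S - s 0%nat)%C). rewrite pow_O. lra. }
    assert (W : forall N, Cmod (INR N * S - csum s N)%C <= A / (1 - q) * (1 - q ^ N)).
    { induction N.
      - simpl. rewrite Cmult_0_l. replace (0 - 0)%C with (RtoC 0) by ring. rewrite Cmod_0. lra.
      - rewrite S_INR, RtoC_plus. simpl csum.
        replace ((INR N + 1) * S - (csum s N + s N))%C with ((INR N * S - csum s N) + (S - s N))%C by ring.
        eapply Rle_trans; [ apply Cmod_plus_le; [ exact IHN | apply HA ] | ].
        right. simpl. field. lra. }
    intros N. eapply Rle_trans; [ apply W | ].
    rewrite <- (Rmult_1_r (A / (1 - q))) at 2. apply Rmult_le_compat_l.
    - apply Rle_div_r; lra.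
    - generalize (pow_le q N). lra. }
  assert (E : forall N, csum s N = cavg (fun x => p x * fejer N x)%C).
  { intros N. rewrite (cavg_ext _ (fun x => csum (fun m => p x * dirichlet m x) N)%C).
    - rewrite (cavg_csum (fun m x => p x * dirichlet m x)%C); [ reflexivity | ].
      intros; apply Ccont_mult; [ exact Hp | apply Ccont_dirichlet ].
    - intros x. apply csum_scal. }
  apply Ceq_minus, Cmod_eq_0. apply Rle_antisym; [ | apply Cmod_ge_0 ].
  apply Rabs_zero_of_linear_bound with (2 * (A / (1 - q) + (4 * K + Cmod b))).
  intros e He.
  destruct (INR_unbounded (/ e)) as [N HN].
  assert (P : 0 < / e) by now apply Rinv_0_lt_compat.
  assert (Q : INR N * Cmod (p 0 - S)%C <= A / (1 - q) + (4 * K + Cmod b)).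
  { rewrite <- (Rabs_pos_eq (INR N)) at 1 by apply pos_INR. rewrite <- Cmod_R, <- Cmod_mult.
    replace (INR N * (p 0 - S))%C with
      (- (INR N * S - csum s N) - (csum s N - INR N * p 0))%C by ring.
    apply Cmod_minus_le.
    - rewrite Cmod_opp. apply Ces.
    - rewrite E. now apply fejer_mean. }
  assert (Z := Cmod_ge_0 (p 0 - S)%C). set (d := Cmod (p 0 - S)%C) in *.
  assert (d <= e * (INR N * d)).
  { assert (1 <= e * INR N). { apply Rmult_le_reg_l with (/ e); auto. rewrite <- Rmult_assoc, Rinv_l; lra. }
    rewrite <- Rmult_assoc. rewrite <- (Rmult_1_l d) at 1. now apply Rmult_le_compat_r. }
  assert (0 <= A / (1 - q) + (4 * K + Cmod b)). { generalize (pos_INR N). nra. }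
  nra.
Qed.

Lemma sin_half_lower (y : R) : 0 <= y <= PI / 2 -> y / 4 <= sin y.
Proof.
  intros H. assert (P4 := PI_4).
  destruct (sin_bound y 0) as [s _]; [ lra | lra | ].
  unfold sin_approx, sin_term in s. simpl in s.
  assert (y * (1 - y * y / 6 - 1 / 4) >= 0). { assert (y <= 2) by lra. nra. }
  lra.
Qed.

(** The modulus on the right is [2 * Rabs (sin (x / 2))]. The bound serves twice: to compare Taylor
    remainders in [x] with remainders in [ex 1 x - 1], and for the small divisors. *)
Lemma ex1_lower (x : R) : - PI <= x <= PI -> Rabs x <= 4 * Cmod (1 - ex 1 x)%C.
Proof.
  intros H.
  assert (E : Cmod (1 - ex 1 x)%C = 2 * Rabs (sin (x / 2))).
  { rewrite ex_E. unfold Cmod, Cexpi. rewrite im_scal_l, re_scal_l. simpl.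
    rewrite Rmult_0_r, Ropp_0, exp_0, !Rmult_1_l.
    transitivity (sqrt (Rsqr (2 * sin (x / 2)))).
    2: { rewrite sqrt_Rsqr_abs, Rabs_mult, (Rabs_pos_eq 2) by lra. reflexivity. }
    f_equal.
    unfold Rsqr. replace x with (2 * (x / 2)) at 1 2 3 4 by field.
    rewrite cos_2a_sin, sin_2a. generalize (sin2_cos2 (x / 2)). unfold Rsqr.
    set (s := sin (x / 2)); set (c := cos (x / 2)). intros E.
    replace (c * c) with (1 - s * s) by lra.
    transitivity (4 * s * s * (s * s + c * c)); [ ring | rewrite E; ring ]. }
  rewrite E.
  assert (W : forall y, 0 <= y <= PI -> y <= 8 * Rabs (sin (y / 2))).
  { intros y Hy. generalize (sin_half_lower (y / 2)) (Rle_abs (sin (y / 2))). lra. }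
  destruct (Rle_dec 0 x).
  - rewrite Rabs_pos_eq by auto. generalize (W x). lra.
  - rewrite Rabs_left by lra. generalize (W (- x)).
    replace (- x / 2) with (- (x / 2)) by field. rewrite sin_neg, Rabs_Ropp. lra.
Qed.

Lemma reduce_mod_2PI (x : R) : exists k : Z, - PI <= x - 2 * PI * IZR k <= PI.
Proof.
  assert (P := PI_RGT_0). set (t := x / (2 * PI) + 1 / 2).
  exists (Int_part t). destruct (base_Int_part t) as [H1 H2].
  assert (E : x = 2 * PI * (t - 1 / 2)) by (unfold t; field; lra).
  rewrite E at 1 2. split; nra.
Qed.

Lemma periodic_C_nat p : periodic_C p -> forall (n : nat) x, p (x + 2 * PI * INR n) = p x.
Proof.
  intros H. induction n; intros x.
  - simpl. f_equal. ring.
  - rewrite S_INR. replace (x + 2 * PI * (INR n + 1)) with (x + 2 * PI * INR n + 2 * PI) by ring.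
    rewrite H. apply IHn.
Qed.

Lemma periodic_C_Z p : periodic_C p -> forall (k : Z) x, p (x + 2 * PI * IZR k) = p x.
Proof.
  intros H k x. destruct (Z_le_dec 0 k) as [L | L].
  - rewrite <- (Z2Nat.id k) by auto. rewrite <- INR_IZR_INZ. now apply periodic_C_nat.
  - rewrite <- (periodic_C_nat p H (Z.to_nat (- k)) (x + 2 * PI * IZR k)).
    rewrite INR_IZR_INZ, Z2Nat.id, opp_IZR by lia. f_equal. ring.
Qed.

(** * Fourier coefficients and expansions on a strip *)

(** The frequency [s] is real so that positive and negative modes share one definition;
    [integer_freq] below singles out the frequencies whose exponential has period [2 * PI]. *)
Definition fcoef (y : R) (f : C -> C) (s : R) : C :=
  cavg (line y (fun z => f z * Cexpi (RtoC (- s) * z))%C).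

Definition posc (y : R) (f : C -> C) (n : nat) : C := fcoef y f (INR n).

(** The mode [n = 0] is stored in [posc] only. *)
Definition negc (y : R) (f : C -> C) (n : nat) : C :=
  match n with 0%nat => RtoC 0 | S _ => fcoef y f (- INR n) end.

Definition tterm (A B : nat -> C) (n : nat) (z : C) : C :=
  (A n * Cexpi (RtoC (INR n) * z) + B n * Cexpi (RtoC (- INR n) * z))%C.

Definition tseries (A B : nat -> C) (z : C) : C := CSeries (fun n => tterm A B n z).

Definition integer_freq (s : R) : Prop :=
  forall z, Cexpi (RtoC s * (z + RtoC (2 * PI)))%C = Cexpi (RtoC s * z)%C.

Lemma integer_freq_INR n : integer_freq (INR n).
Proof. intros z. apply Cexpi_INR_2PI. Qed.

Lemma integer_freq_opp_INR n : integer_freq (- INR n).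
Proof. intros z. apply Cexpi_opp_INR_2PI. Qed.

Lemma holo_mode a b f f1 s :
  holo (band a b) f f1 ->
  holo (band a b) (fun z => f z * Cexpi (RtoC s * z))%C
    (fun z => f1 z * Cexpi (RtoC s * z) + f z * (Cexpi (RtoC s * z) * (RtoC s * Ci)))%C.
Proof.
  intros H. apply (holo_mult _ f f1 (fun z => Cexpi (RtoC s * z))); auto.
  apply holo_Cexpi_scal.
Qed.

Lemma periodic_on_mode D f s :
  integer_freq s -> periodic_on D f -> periodic_on D (fun z => f z * Cexpi (RtoC s * z))%C.
Proof. intros Hs Hf z Hz. now rewrite Hs, Hf. Qed.

Lemma integer_freq_opp s : integer_freq s -> integer_freq (- s).
Proof.
  intros H z.
  replace (RtoC (- s) * (z + RtoC (2 * PI)))%C with (- (RtoC s * (z + RtoC (2 * PI))))%C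
    by (rewrite RtoC_opp; ring).
  replace (RtoC (- s) * z)%C with (- (RtoC s * z))%C by (rewrite RtoC_opp; ring).
  now rewrite !Cexpi_opp_inv, H.
Qed.

Lemma fcoef_line a b f f1 s y1 y2 :
  holo (band a b) f f1 -> periodic_on (band a b) f -> integer_freq s ->
  a < y1 < b -> a < y2 < b -> fcoef y1 f s = fcoef y2 f s.
Proof.
  intros Hf Hp Hs. unfold fcoef.
  eapply cavg_line_constant.
  - apply holo_mode, Hf.
  - apply periodic_on_mode; [ now apply integer_freq_opp | exact Hp ].
Qed.

(** The line of integration is moved from [y1] to [y2]; taking [y2] close to an edge of the band
    gives the exponential decay. *)
Lemma fcoef_bound a b f f1 s y1 y2 M :
  holo (band a b) f f1 -> periodic_on (band a b) f -> integer_freq s ->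
  a < y1 < b -> a < y2 < b -> (forall z, Im z = y2 -> Cmod (f z) <= M) ->
  Cmod (fcoef y1 f s) <= M * exp (s * y2).
Proof.
  intros Hf Hp Hs H1 H2 HM. rewrite (fcoef_line a b f f1 s y1 y2); auto.
  apply cavg_bound.
  - eapply holo_line_Ccont; [ apply holo_mode, Hf | intros; now apply band_line ].
  - intros t. unfold line. apply Cmod_mult_le; [ now apply HM | ].
    rewrite Cmod_Cexpi, im_scal_l. simpl. right. f_equal. ring.
Qed.

(** Integrating along the line through [z] itself turns the translation of [f] by [z] into the
    factor [Cexpi (s * z)]. *)
Lemma fcoef_translate a b f f1 s (z : C) :
  holo (band a b) f f1 -> periodic_on (band a b) f -> integer_freq s -> band a b z ->
  cavg (fun x : R => f (z + RtoC x) * Cexpi (RtoC (- s) * RtoC x))%C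
  = (fcoef (Im z) f s * Cexpi (RtoC s * z))%C.
Proof.
  intros Hf Hp Hs Hz. unfold fcoef. rewrite Cmult_comm.
  assert (Cl : Ccont (line (Im z) (fun w => f w * Cexpi (RtoC (- s) * w))%C)).
  { eapply holo_line_Ccont; [ apply holo_mode, Hf | intros; now apply band_line ]. }
  rewrite <- cavg_scal by exact Cl.
  rewrite <- (cavg_shift (fun t => Cexpi (RtoC s * z) * line (Im z) (fun w => f w * Cexpi (RtoC (- s) * w)) t)%C (Re z)).
  - apply cavg_ext. intros x. unfold line.
    replace ((x + Re z)%R, Im z) with (z + RtoC x)%C
      by (destruct z; apply injective_projections; simpl; ring).
    replace (RtoC (- s) * (z + RtoC x))%C with (- (RtoC s * z) + RtoC (- s) * RtoC x)%C
      by (rewrite RtoC_opp; ring).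
    rewrite Cexpi_plus.
    transitivity ((Cexpi (RtoC s * z) * Cexpi (- (RtoC s * z))) * (f (z + RtoC x) * Cexpi (RtoC (- s) * RtoC x)))%C.
    + rewrite Cexpi_opp. ring.
    + ring.
  - now apply Ccont_scal.
  - intros t. f_equal.
    apply (line_periodic (band a b)); [ | intros; now apply band_line ].
    apply periodic_on_mode; [ now apply integer_freq_opp | exact Hp ].
Qed.

(** Convolution with the Dirichlet kernel is a partial sum of the Fourier series; the modes [0] to
    [m] are [S m] terms of [csum]. *)
Lemma cavg_mult_dirichlet a b f f1 (z : C) m :
  holo (band a b) f f1 -> periodic_on (band a b) f -> band a b z ->
  cavg (fun x => f (z + RtoC x) * dirichlet m x)%C =
  csum (fun n => tterm (posc (Im z) f) (negc (Im z) f) n z) (S m).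
Proof.
  intros Hf Hp Hz.
  assert (Cf : Ccont (fun x => f (z + RtoC x)%C)).
  { apply (Ccont_ext (fun x => line (Im z) f (x + Re z))).
    - intros x. unfold line. f_equal. destruct z; apply injective_projections; simpl; ring.
    - apply Ccont_shift. eapply holo_line_Ccont; [ apply Hf | intros; now apply band_line ]. }
  assert (E1 : forall n, cavg (fun x => f (z + RtoC x) * exm n x)%C
              = (fcoef (Im z) f (INR n) * Cexpi (RtoC (INR n) * z))%C).
  { intros n. eapply fcoef_translate; eauto using integer_freq_INR. }
  assert (E2 : forall n, cavg (fun x => f (z + RtoC x) * ex n x)%C
              = (fcoef (Im z) f (- INR n) * Cexpi (RtoC (- INR n) * z))%C).
  { intros n. rewrite <- (fcoef_translate a b f f1); eauto using integer_freq_opp_INR.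
    rewrite Ropp_involutive. reflexivity. }
  induction m.
  - simpl csum. unfold tterm, negc. rewrite Cplus_0_l.
    rewrite (cavg_ext _ (fun x => f (z + RtoC x) * exm 0 x)%C), E1.
    + unfold posc. ring.
    + intros x. unfold dirichlet. simpl. rewrite exm_0. ring.
  - rewrite (cavg_ext _ (fun x => f (z + RtoC x) * dirichlet m x +
       (f (z + RtoC x) * exm (S m) x + f (z + RtoC x) * ex (S m) x))%C).
    + rewrite (cavg_plus (fun x => f (z + RtoC x) * dirichlet m x)%C
        (fun x => f (z + RtoC x) * exm (S m) x + f (z + RtoC x) * ex (S m) x)%C),
        (cavg_plus (fun x => f (z + RtoC x) * exm (S m) x)%C (fun x => f (z + RtoC x) * ex (S m) x)%C),
        IHm, E1, E2; try ccont.
      * reflexivity.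
      * apply Ccont_mult; [ exact Cf | apply Ccont_dirichlet ].
    + intros x. unfold dirichlet. simpl csum. ring.
Qed.

Lemma ex1_remainder x : Rabs x <= PI -> Cmod (ex 1 x - 1 - RtoC x * Ci)%C <= 30 * Rabs x ^ 2.
Proof.
  intros _. rewrite ex_E. simpl INR. rewrite Cmult_1_l.
  destruct (Rle_dec (Rabs x) 1) as [L | L].
  - generalize (Cexpi_remainder (RtoC x)). rewrite Cmod_R. auto.
  - eapply Rle_trans.
    { apply Cmod_minus_le; [ apply Cmod_minus_le | ].
      - rewrite Cmod_Cexpi. simpl. rewrite Ropp_0, exp_0. apply Rle_refl.
      - rewrite Cmod_1. apply Rle_refl.
      - rewrite Cmod_mult, Cmod_R, Cmod_Ci. apply Rle_refl. }
    nra.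
Qed.

Lemma tterm_geometric (A B : nat -> C) (M y d : R) (z : C) :
  Im z = y ->
  (forall n, Cmod (A n) <= M * exp (INR n * (y - d))) ->
  (forall n, Cmod (B n) <= M * exp (- INR n * (y + d))) ->
  forall n, Cmod (tterm A B n z) <= 2 * M * exp (- d) ^ n.
Proof.
  intros Hz HA HB n.
  assert (E : exp (- d) ^ n = exp (INR n * - d)).
  { induction n; [ simpl; now rewrite Rmult_0_l, exp_0 | ].
    rewrite S_INR, Rmult_plus_distr_r, exp_plus, <- IHn, Rmult_1_l. simpl; ring. }
  rewrite E. unfold tterm. replace (2 * M) with (M + M) by ring. rewrite Rmult_plus_distr_r.
  apply Cmod_plus_le; rewrite Cmod_mult, Cmod_Cexpi, im_scal_l, Hz.
  - replace (INR n * - d) with (INR n * (y - d) + - (INR n * y)) by ring.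
    rewrite exp_plus, <- Rmult_assoc. apply Rmult_le_compat_r; [ left; apply exp_pos | auto ].
  - replace (INR n * - d) with (- INR n * (y + d) + - (- INR n * y)) by ring.
    rewrite exp_plus, <- Rmult_assoc. apply Rmult_le_compat_r; [ left; apply exp_pos | auto ].
Qed.

(** On the line through [z] the terms decay geometrically, so the Dirichlet means converge at a
    geometric rate, and [dirichlet_limit_unique] identifies their limit with the value at [0] of the
    translate. *)
Lemma fourier_expansion a b f f1 y z :
  holo (band a b) f f1 -> periodic_on (band a b) f -> a < y < b -> band a b z ->
  f z = tseries (posc y f) (negc y f) z.
Proof.
  intros Hf Hp Hy Hz.
  assert (EA : forall n, posc y f n = posc (Im z) f n).
  { intros n. eapply fcoef_line; eauto using integer_freq_INR. }
  assert (EB : forall n, negc y f n = negc (Im z) f n).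
  { intros [ | n]; [ reflexivity | ]. eapply fcoef_line; eauto using integer_freq_opp_INR. }
  unfold tseries. rewrite (CSeries_ext _ (fun n => tterm (posc (Im z) f) (negc (Im z) f) n z))
    by (intros; unfold tterm; now rewrite EA, EB).
  clear EA EB y Hy.
  pose proof Hf as [B0 [HB0 [Q1 [Q2 Q3]]]].
  set (p := fun x : R => f (z + RtoC x)%C).
  replace (f z) with (p 0) by (unfold p; now rewrite Cplus_0_r).
  destruct Hz as [Hz1 Hz2].
  (* Half the distance from [z] to the edges; moving the line by [d] both ways gives the ratio
     [exp (- d)]. *)
  set (d := Rmin (Im z - a) (b - Im z) / 2).
  assert (Hd : 0 < d /\ a < Im z - d /\ Im z + d < b).
  { unfold d. unfold Rmin; destruct (Rle_dec _ _); lra. }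
  assert (Hq : 0 <= exp (- d) < 1).
  { split; [ left; apply exp_pos | ]. rewrite <- exp_0. apply exp_increasing. lra. }
  assert (Hline : forall x : R, band a b (z + RtoC x)%C).
  { intros x. split; simpl; rewrite Rplus_0_r; unfold Im in *; lra. }
  assert (T : forall n, Cmod (tterm (posc (Im z) f) (negc (Im z) f) n z) <= 2 * B0 * exp (- d) ^ n).
  { apply (tterm_geometric _ _ B0 (Im z) d z); [ reflexivity | | ].
    - intros n. eapply fcoef_bound; eauto using integer_freq_INR; try lra.
      intros w Hw. apply Q1. split; lra.
    - intros [ | n].
      + simpl negc. rewrite Cmod_0. apply Rmult_le_pos; [ lra | left; apply exp_pos ].
      + eapply fcoef_bound; eauto using integer_freq_opp_INR; try lra.
        intros w Hw. apply Q1. split; lra. }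
  (* Since [ex 1 x - 1] is [i x] to first order, the slope is [- Ci * f1 z]. In the constant, 31 = 1
     + 30 adds the Taylor remainders of [f] and of the exponential, and 16 is the square of the 4 in
     [ex1_lower]. The extra [exp (- d)] reflects the [S m] terms of a partial sum. *)
  apply (dirichlet_limit_unique p (- Ci * f1 z)%C _ (31 * B0 * 16) (2 * B0 / (1 - exp (- d)) * exp (- d)) (exp (- d))).
  - apply (Ccont_lipschitz _ (2 * B0)). intros s t. unfold p.
    eapply Rle_trans; [ apply (holo_bound_lipschitz B0 (band a b) f f1); auto; repeat split; auto | ].
    replace (z + RtoC t - (z + RtoC s))%C with (RtoC (t - s)) by (rewrite RtoC_minus; ring).
    rewrite Cmod_R. lra.
  - assert (W : forall x, - PI <= x <= PI ->
       Cmod (p x - p 0 - - Ci * f1 z * (ex 1 x - 1))%C <= 31 * B0 * 16 * Cmod (1 - ex 1 x)%C ^ 2).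
    { intros x Hx. assert (L := ex1_lower x Hx).
      replace (p x - p 0 - - Ci * f1 z * (ex 1 x - 1))%C with
        ((f (z + RtoC x) - f z - ((z + RtoC x) - z) * f1 z) + Ci * f1 z * (ex 1 x - 1 - RtoC x * Ci))%C.
      2: { unfold p. rewrite Cplus_0_r.
           assert (Ci * Ci = -(1))%C by (apply injective_projections; simpl; ring).
           transitivity (f (z + RtoC x) - f z - RtoC x * f1 z * (1 + Ci * Ci) + Ci * f1 z * (ex 1 x - 1))%C; [ ring | ].
           rewrite H. ring. }
      assert (S2 : Rabs x ^ 2 <= 16 * Cmod (1 - ex 1 x)%C ^ 2).
      { replace (16 * Cmod (1 - ex 1 x)%C ^ 2) with ((4 * Cmod (1 - ex 1 x)%C) ^ 2) by ring.
        apply pow_incr. split; [ apply Rabs_pos | exact L ]. }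
      eapply Rle_trans.
      { apply Cmod_plus_le.
        - apply Q3; [ split; auto | apply Hline ].
        - apply Cmod_mult_le; [ rewrite Cmod_mult, Cmod_Ci, Rmult_1_l; apply Q2; split; auto | ].
          apply ex1_remainder. apply Rabs_le; lra. }
      replace (z + RtoC x - z)%C with (RtoC x) by ring. rewrite Cmod_R.
      assert (0 <= Rabs x ^ 2) by apply pow2_ge_0. nra. }
    (* The estimate holds on one period; reduction modulo [2 * PI] extends it. *)
    intros x. destruct (reduce_mod_2PI x) as [k Hk].
    assert (Per : periodic_C p).
    { intros t. unfold p. rewrite <- (Hp (z + RtoC t)%C (Hline t)), RtoC_plus. f_equal. ring. }
    replace x with (x - 2 * PI * IZR k + 2 * PI * IZR k) by ring.
    rewrite (periodic_C_Z _ Per), (periodic_C_Z _ (ex_periodic 1)). now apply W.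
  - exact Hq.
  - intros m. unfold p. rewrite (cavg_mult_dirichlet a b f f1); auto; [ | split; auto ].
    eapply Rle_trans; [ apply (CSeries_geom_tail _ (2 * B0) (exp (- d))); auto | ].
    simpl. lra.
Qed.

Lemma holo_derive_unique a b f f1 g1 z :
  holo (band a b) f f1 -> holo (band a b) f g1 -> band a b z -> f1 z = g1 z.
Proof.
  intros Hf Hg Hz. destruct Hf as [A [HA [_ [_ F]]]], Hg as [B [HB [_ [_ G]]]].
  apply Ceq_minus, Cmod_eq_0. apply Rle_antisym; [ | apply Cmod_ge_0 ].
  apply Rabs_zero_of_linear_bound with (A + B). intros s Hs.
  apply Rmult_le_reg_l with s; [ exact Hs | ].
  rewrite <- (Rabs_pos_eq s) at 1 by lra. rewrite <- Cmod_R, <- Cmod_mult.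
  assert (Hw : band a b (z + RtoC s)%C).
  { destruct Hz. split; simpl; rewrite Rplus_0_r; auto. }
  replace (RtoC s * (f1 z - g1 z))%C with
   ((f (z + RtoC s) - f z - (z + RtoC s - z) * g1 z) - (f (z + RtoC s) - f z - (z + RtoC s - z) * f1 z))%C by ring.
  eapply Rle_trans; [ apply Cmod_minus_le; [ apply G | apply F ]; auto | ].
  replace (z + RtoC s - z)%C with (RtoC s) by ring. rewrite Cmod_R, (Rabs_pos_eq s) by lra.
  right; ring.
Qed.

(** The Taylor bound is an inequality between values, so termwise differentiation amounts to summing
    inequalities. *)
Lemma holo_bound_series D (g g1 : nat -> C -> C) (b : nat -> R) :
  (forall n, holo_bound (b n) D (g n) (g1 n)) -> ex_series b ->
  holo_bound (Series b) D (fun z => CSeries (fun n => g n z)) (fun z => CSeries (fun n => g1 n z)).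
Proof.
  intros H Hb.
  assert (S0 : forall z, D z -> summable (fun n => g n z)).
  { intros z Hz. apply summable_le with b; [ | exact Hb ]. intros n. now apply (H n). }
  assert (S1 : forall z, D z -> summable (fun n => g1 n z)).
  { intros z Hz. apply summable_le with b; [ | exact Hb ]. intros n. now apply (H n). }
  split; [ | split ].
  - intros z Hz. apply CSeries_bound; [ | exact Hb ]. intros n. now apply (H n).
  - intros z Hz. apply CSeries_bound; [ | exact Hb ]. intros n. now apply (H n).
  - intros z w Hz Hw.
    replace (CSeries (fun n => g n w) - CSeries (fun n => g n z) - (w - z) * CSeries (fun n => g1 n z))%C
      with (CSeries (fun n => g n w - g n z - (w - z) * g1 n z)%C).
    + rewrite <- Series_scal_r. apply CSeries_bound.
      * intros n. now apply (H n).
      * apply (ex_series_scal_r (Cmod (w - z)%C ^ 2) b). exact Hb.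
    + rewrite <- CSeries_scal, <- !CSeries_minus; auto using summable_scal.
      apply (summable_plus (fun n => g n w) (fun n => - g n z)%C); auto.
      eapply summable_le; [ | apply (S0 z Hz) ]. intros n. rewrite Cmod_opp. lra.
Qed.

(** * Interior estimates *)

Definition decays (M s : R) (A : nat -> C) : Prop :=
  forall n, Cmod (A n) <= M * exp (- INR n * s).

(** Coefficients of the derivative: each mode is multiplied by [i] times its frequency. *)
Definition dpos (A : nat -> C) (n : nat) : C := (A n * (RtoC (INR n) * Ci))%C.
Definition dneg (B : nat -> C) (n : nat) : C := (B n * (RtoC (- INR n) * Ci))%C.

Lemma decays_nonneg M s A : decays M s A -> 0 <= M.
Proof.
  intros H. generalize (H 0%nat) (Cmod_ge_0 (A 0%nat)). simpl.
  rewrite Ropp_0, Rmult_0_l, exp_0. lra.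
Qed.

Lemma decays_mult M s A (g : nat -> C) K t :
  decays M s A -> (forall n, Cmod (g n) <= K * exp (INR n * t)) ->
  decays (M * K) (s - t) (fun n => A n * g n)%C.
Proof.
  intros H Hg n. eapply Rle_trans; [ apply Cmod_mult_le; [ apply H | apply Hg ] | ].
  right. replace (- INR n * (s - t)) with (- INR n * s + INR n * t) by ring. rewrite exp_plus. ring.
Qed.

Lemma INR_le_exp (n : nat) (t : R) : 0 < t -> INR n <= / t * exp (INR n * t).
Proof.
  intros Ht. generalize (exp_ineq1_le (INR n * t)). intros.
  apply Rmult_le_reg_l with t; [ exact Ht | ]. rewrite <- Rmult_assoc, Rinv_r by lra. lra.
Qed.

(** The factor [n] is paid for by giving up a width [t] of the decay. *)
Lemma decays_dpos M s A t : 0 < t -> decays M s A -> decays (M * / t) (s - t) (dpos A).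
Proof.
  intros Ht H. apply decays_mult; auto. intros n.
  rewrite Cmod_mult, Cmod_Ci, Rmult_1_r, Cmod_R, Rabs_pos_eq by apply pos_INR.
  now apply INR_le_exp.
Qed.

Lemma decays_dneg M s A t : 0 < t -> decays M s A -> decays (M * / t) (s - t) (dneg A).
Proof.
  intros Ht H. apply decays_mult; auto. intros n.
  rewrite Cmod_mult, Cmod_Ci, Rmult_1_r, Cmod_R, Rabs_Ropp, Rabs_pos_eq by apply pos_INR.
  now apply INR_le_exp.
Qed.

Lemma mode_bound (A : C) (G r s : R) (n : nat) :
  Rabs s = INR n -> Cmod A <= G ->
  holo_bound (G * (30 * (1 + INR n) ^ 2 * exp (INR n * r))) (band (- r) r)
    (fun z => A * Cexpi (RtoC s * z))%C (fun z => A * (RtoC s * Ci) * Cexpi (RtoC s * z))%C.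
Proof.
  intros Hs HA.
  assert (G0 : 0 <= G) by (generalize (Cmod_ge_0 A); lra).
  assert (Hn := pos_INR n). assert (P := exp_pos (INR n * r)).
  set (e := exp (INR n * r)) in *.
  assert (E : forall z, band (- r) r z -> Cmod (Cexpi (RtoC s * z)) <= e).
  { intros z [H1 H2]. rewrite Cmod_Cexpi, im_scal_l. unfold e.
    assert (K : - (s * Im z) <= INR n * r).
    { rewrite <- Hs. eapply Rle_trans; [ apply Rle_abs | ]. rewrite Rabs_Ropp, Rabs_mult.
      apply Rmult_le_compat_l; [ apply Rabs_pos | ]. apply Rabs_le; lra. }
    destruct K as [K | ->]; [ left; now apply exp_increasing | lra ]. }
  assert (Q : 1 <= (1 + INR n) ^ 2 /\ INR n <= (1 + INR n) ^ 2 /\ INR n ^ 2 <= (1 + INR n) ^ 2) by (simpl; nra).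
  set (q := (1 + INR n) ^ 2) in *.
  split; [ | split ].
  - intros z Hz. apply Cmod_mult_le; [ exact HA | ]. eapply Rle_trans; [ now apply E | ]. nra.
  - intros z Hz. rewrite <- Cmult_assoc. apply Cmod_mult_le; [ exact HA | ].
    rewrite !Cmod_mult, Cmod_Ci, Cmod_R, Hs. generalize (E z Hz) (Cmod_ge_0 (Cexpi (RtoC s * z))). nra.
  - intros z w Hz Hw.
    replace (A * Cexpi (RtoC s * w) - A * Cexpi (RtoC s * z) - (w - z) * (A * (RtoC s * Ci) * Cexpi (RtoC s * z)))%C
     with (A * (Cexpi (RtoC s * w) - Cexpi (RtoC s * z) - (RtoC s * w - RtoC s * z) * (Cexpi (RtoC s * z) * Ci)))%C by ring.
    rewrite Rmult_assoc. apply Cmod_mult_le; [ exact HA | ].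
    eapply Rle_trans; [ apply (Cexpi_taylor e); now apply E | ].
    replace (RtoC s * w - RtoC s * z)%C with (RtoC s * (w - z))%C by ring.
    rewrite Cmod_mult, Cmod_R, Hs, Rpow_mult_distr.
    assert (0 <= Cmod (w - z)%C ^ 2) by apply pow2_ge_0. set (h := Cmod (w - z)%C ^ 2) in *.
    assert (0 <= e * h) by nra.
    replace (30 * e * (INR n ^ 2 * h)) with (30 * (e * h) * INR n ^ 2) by ring.
    replace (30 * q * e * h) with (30 * (e * h) * q) by ring. apply Rmult_le_compat_l; lra.
Qed.

Lemma holo_bound_plus A B D f f1 g g1 :
  holo_bound A D f f1 -> holo_bound B D g g1 ->
  holo_bound (A + B) D (fun z => f z + g z)%C (fun z => f1 z + g1 z)%C.
Proof.
  intros [F1 [F2 F3]] [G1 [G2 G3]]. split; [ | split ].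
  - intros; apply Cmod_plus_le; auto.
  - intros; apply Cmod_plus_le; auto.
  - intros z w Hz Hw.
    replace (f w + g w - (f z + g z) - (w - z) * (f1 z + g1 z))%C with
      ((f w - f z - (w - z) * f1 z) + (g w - g z - (w - z) * g1 z))%C by ring.
    rewrite Rmult_plus_distr_r. apply Cmod_plus_le; auto.
Qed.

Lemma one_plus_INR_sqr (n : nat) (t : R) : 0 < t <= 1 -> (1 + INR n) ^ 2 <= / t ^ 2 * exp (INR n * (2 * t)).
Proof.
  intros Ht. assert (Hn := pos_INR n).
  assert (E : exp (INR n * (2 * t)) = exp (INR n * t) ^ 2).
  { simpl. rewrite Rmult_1_r, <- exp_plus. f_equal. ring. }
  rewrite E, <- pow_inv, <- Rpow_mult_distr. apply pow_incr. split; [ lra | ].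
  apply Rmult_le_reg_l with t; [ lra | ]. rewrite <- Rmult_assoc, Rinv_r by lra.
  generalize (exp_ineq1_le (INR n * t)). nra.
Qed.

(** The width [s - r] is split: a part [2 t <= (s - r) / 2] pays for the factor [(1 + n)^2] of
    [mode_bound], and the remaining half gives the ratio of the geometric series. The 60 counts 30
    for each of the two modes of index [n]. *)
Definition tseries_const (r s : R) : R :=
  Series (fun n => 60 * / (Rmin 1 ((s - r) / 4)) ^ 2 * exp (- ((s - r) / 2)) ^ n).

Lemma exp_INR_mult (n : nat) (x : R) : exp (INR n * x) = exp x ^ n.
Proof.
  induction n; [ simpl; now rewrite Rmult_0_l, exp_0 | ].
  rewrite S_INR, Rmult_plus_distr_r, exp_plus, IHn, Rmult_1_l. simpl; ring.
Qed.

Lemma holo_bound_tseries (A B : nat -> C) (M r s : R) :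
  r < s -> decays M s A -> decays M s B ->
  holo_bound (M * tseries_const r s) (band (- r) r) (tseries A B) (tseries (dpos A) (dneg B)).
Proof.
  intros Hrs HA HB. assert (M0 := decays_nonneg _ _ _ HA).
  unfold tseries_const. rewrite <- Series_scal_l.
  set (t := Rmin 1 ((s - r) / 4)).
  assert (Ht : 0 < t <= 1 /\ t <= (s - r) / 4).
  { unfold t. split; [ split; [ apply Rmin_glb_lt; lra | apply Rmin_l ] | apply Rmin_r ]. }
  assert (Pt : 0 < / t ^ 2) by (apply Rinv_0_lt_compat, pow_lt; lra).
  assert (Hq : 0 <= exp (- ((s - r) / 2)) < 1).
  { split; [ left; apply exp_pos | ]. rewrite <- exp_0. apply exp_increasing. lra. }
  unfold tseries. apply holo_bound_series.
  2: { apply (ex_series_scal (V := R_NormedModule) M). now apply ex_series_geom_scal. }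
  intros n.
  assert (W : forall G : R, G = M * exp (- INR n * s) ->
     G * (30 * (1 + INR n) ^ 2 * exp (INR n * r)) <= M * (30 * / t ^ 2 * exp (- ((s - r) / 2)) ^ n)).
  { intros G ->. rewrite Rmult_assoc. apply Rmult_le_compat_l; [ exact M0 | ].
    rewrite <- exp_INR_mult.
    replace (exp (- INR n * s) * (30 * (1 + INR n) ^ 2 * exp (INR n * r))) with
      (30 * ((1 + INR n) ^ 2 * (exp (- INR n * s) * exp (INR n * r)))) by ring.
    rewrite <- exp_plus, Rmult_assoc. apply Rmult_le_compat_l; [ lra | ].
    eapply Rle_trans.
    { apply Rmult_le_compat_r; [ left; apply exp_pos | apply (one_plus_INR_sqr n t); lra ]. }
    rewrite Rmult_assoc, <- exp_plus. apply Rmult_le_compat_l; [ lra | ].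
    assert (K : INR n * (2 * t) + (- INR n * s + INR n * r) <= INR n * - ((s - r) / 2)).
    { generalize (pos_INR n). nra. }
    destruct K as [K | ->]; [ left; now apply exp_increasing | lra ]. }
  apply (holo_bound_weaken (M * (30 * / t ^ 2 * exp (- ((s - r) / 2)) ^ n)
             + M * (30 * / t ^ 2 * exp (- ((s - r) / 2)) ^ n))); [ lra | ].
  apply (holo_bound_plus _ _ _ (fun z => A n * Cexpi (RtoC (INR n) * z))%C
     (fun z => A n * (RtoC (INR n) * Ci) * Cexpi (RtoC (INR n) * z))%C
     (fun z => B n * Cexpi (RtoC (- INR n) * z))%C
     (fun z => B n * (RtoC (- INR n) * Ci) * Cexpi (RtoC (- INR n) * z))%C).
  - eapply holo_bound_weaken; [ apply (W _ eq_refl) | ].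
    apply mode_bound; [ apply Rabs_pos_eq, pos_INR | apply HA ].
  - eapply holo_bound_weaken; [ apply (W _ eq_refl) | ].
    apply mode_bound; [ rewrite Rabs_Ropp; apply Rabs_pos_eq, pos_INR | apply HB ].
Qed.

Lemma tseries_periodic A B z : tseries A B (z + RtoC (2 * PI))%C = tseries A B z.
Proof.
  unfold tseries. apply CSeries_ext. intros n. unfold tterm.
  now rewrite Cexpi_INR_2PI, Cexpi_opp_INR_2PI.
Qed.

Lemma coef_decays R f f1 M s :
  holo (band (- R) R) f f1 -> periodic_on (band (- R) R) f ->
  (forall z, band (- R) R z -> Cmod (f z) <= M) -> 0 <= s < R ->
  decays M s (posc 0 f) /\ decays M s (negc 0 f).
Proof.
  intros Hf Hp HM Hs.
  assert (M0 : 0 <= M).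
  { assert (B0 : band (- R) R 0) by (split; simpl; lra). generalize (HM 0 B0) (Cmod_ge_0 (f 0)). lra. }
  split; intros n.
  - replace (- INR n * s) with (INR n * - s) by ring.
    apply (fcoef_bound (- R) R f f1); auto using integer_freq_INR; try lra.
    intros z Hz. apply HM. split; lra.
  - destruct n as [ | n]; [ simpl negc; rewrite Cmod_0; apply Rmult_le_pos; [ lra | left; apply exp_pos ] | ].
    apply (fcoef_bound (- R) R f f1); auto using integer_freq_opp_INR; try lra.
    intros z Hz. apply HM. split; lra.
Qed.

Lemma symmetric_band_mono r R z : r <= R -> band (- r) r z -> band (- R) R z.
Proof. unfold band; lra. Qed.

(** On the smaller strip [f] is its Fourier series, which can be differentiated term by term. [K]
    depends on the two widths only; this uniformity lets the bounds pass to limits in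
    [holo_limit]. *)
Lemma holo_bound_interior (r R : R) :
  0 <= r < R -> exists K, 0 < K /\ forall f f1 M,
    holo (band (- R) R) f f1 -> periodic_on (band (- R) R) f ->
    (forall z, band (- R) R z -> Cmod (f z) <= M) ->
    holo_bound (K * M) (band (- r) r) f f1 /\
    (forall z, band (- r) r z -> f1 (z + RtoC (2 * PI))%C = f1 z) /\
    exists f2, holo (band (- r) r) f1 f2.
Proof.
  intros Hr. set (s := (r + R) / 2).
  exists (Rabs (tseries_const r s) + 1). split; [ generalize (Rabs_pos (tseries_const r s)); lra | ].
  intros f f1 M Hf Hp HM.
  destruct (coef_decays R f f1 M s Hf Hp HM) as [DA DB]; [ unfold s; lra | ].
  assert (M0 := decays_nonneg _ _ _ DA).
  set (A := posc 0 f) in *. set (B := negc 0 f) in *.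
  assert (Ef : forall z, band (- R) R z -> f z = tseries A B z).
  { intros z Hz. apply (fourier_expansion (- R) R f f1); auto. lra. }
  assert (HT := holo_bound_tseries A B M r s ltac:(unfold s; lra) DA DB).
  assert (HK : M * tseries_const r s <= (Rabs (tseries_const r s) + 1) * M).
  { generalize (Rle_abs (tseries_const r s)). nra. }
  assert (K0 : 0 <= (Rabs (tseries_const r s) + 1) * M).
  { apply Rmult_le_pos; auto. generalize (Rabs_pos (tseries_const r s)); lra. }
  assert (Eg : forall z, band (- r) r z -> f1 z = tseries (dpos A) (dneg B) z).
  { intros z Hz. apply (holo_derive_unique (- r) r f); auto.
    - eapply holo_sub; [ | exact Hf ]. intros w. apply symmetric_band_mono; lra.
    - apply holo_ext with (tseries A B) (tseries (dpos A) (dneg B)); auto.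
      + intros w Hw. symmetry. apply Ef. revert Hw. apply symmetric_band_mono; lra.
      + eexists. split; [ exact K0 | eapply holo_bound_weaken; [ exact HK | exact HT ] ]. }
  split; [ | split ].
  - apply (holo_bound_weaken _ _ _ _ _ HK). destruct HT as [T1 [T2 T3]].
    assert (I : forall z, band (- r) r z -> band (- R) R z) by (intros z; apply symmetric_band_mono; lra).
    split; [ | split ].
    + intros z Hz. rewrite Ef by auto. auto.
    + intros z Hz. rewrite Eg by auto. auto.
    + intros z w Hz Hw. rewrite !Ef, Eg by auto. auto.
  - intros z Hz. rewrite !Eg; auto.
    + apply tseries_periodic.
    + destruct Hz. split; simpl; rewrite Rplus_0_r; auto.
  - set (t := (s - r) / 2).
    assert (Pt : 0 < t) by (unfold t, s; lra).
    exists (tseries (dpos (dpos A)) (dneg (dneg B))).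
    apply holo_ext with (tseries (dpos A) (dneg B)) (tseries (dpos (dpos A)) (dneg (dneg B))); auto.
    + intros z Hz. symmetry; auto.
    + assert (HB := holo_bound_tseries (dpos A) (dneg B) (M * / t) r (s - t)
        ltac:(unfold t, s; lra) (decays_dpos _ _ _ _ Pt DA) (decays_dneg _ _ _ _ Pt DB)).
      eexists. split; [ apply Rabs_pos | ]. eapply holo_bound_weaken; [ apply Rle_abs | exact HB ].
Qed.

(** All Fourier coefficients can be computed on the real axis, where the function vanishes. *)
Lemma zero_on_reals_zero rho f f1 :
  holo (band (- rho) rho) f f1 -> periodic_on (band (- rho) rho) f ->
  (forall x : R, f (RtoC x) = RtoC 0) -> forall z, band (- rho) rho z -> f z = RtoC 0.
Proof.
  intros Hf Hp H0 z Hz.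
  assert (PR : 0 < rho) by (destruct Hz; lra).
  rewrite (fourier_expansion (- rho) rho f f1 0 z); auto; [ | lra ].
  assert (F0 : forall s, fcoef 0 f s = RtoC 0).
  { intros s. unfold fcoef. rewrite (cavg_ext _ (fun _ => RtoC 0)); [ apply cavg_const | ].
    intros t. unfold line. change (t, 0) with (RtoC t). rewrite H0. ring. }
  unfold tseries. rewrite (CSeries_ext _ (fun n => 0 * 0)%C).
  - rewrite CSeries_scal; [ ring | ]. apply summable_le with (fun n => 0 * 0 ^ n).
    + intros n. rewrite Cmod_0. lra.
    + apply ex_series_geom_scal. lra.
  - intros n. unfold tterm, posc. rewrite F0.
    replace (negc 0 f n) with (RtoC 0) by (destruct n; [ reflexivity | symmetry; apply F0 ]). ring.
Qed.

(** * Discs as images of half-planes: Cauchy estimates and Taylor series *)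

(** For [Im w > a] the point [z + Cexpi w] runs through the punctured disc of radius [exp (- a)]
    around [z]. Pulled back in this way, [f] is periodic in [w] and the Fourier tools apply. *)
Lemma holo_circle rho f f1 a b (z : C) :
  holo (band (- rho) rho) f f1 -> exp (- a) <= rho - Rabs (Im z) ->
  holo (band a b) (fun w => f (z + Cexpi w)%C) (fun w => f1 (z + Cexpi w) * (Cexpi w * Ci))%C.
Proof.
  intros Hf Ha.
  apply (holo_comp (band a b) (band (- rho) rho) f f1 (fun w => z + Cexpi w)%C (fun w => Cexpi w * Ci)%C); auto.
  - intros w [H1 H2].
    assert (E : Rabs (Im (z + Cexpi w)%C) < rho).
    { rewrite im_plus. eapply Rle_lt_trans; [ apply Rabs_triang | ].
      assert (K := Im_le_Cmod (Cexpi w)). rewrite Cmod_Cexpi in K.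
      assert (exp (- Im w) < exp (- a)) by (apply exp_increasing; lra). lra. }
    apply Rabs_def2 in E. split; lra.
  - destruct (holo_Cexpi a b) as [B [HB HE]]. exists (2 * B). split; [ lra | ].
    split; [ | split ].
    + intros w Hw. destruct HE as [_ [H _]]. generalize (H w Hw). lra.
    + intros w v Hw Hv. replace (z + Cexpi v - (z + Cexpi w))%C with (Cexpi v - Cexpi w)%C by ring.
      apply (holo_bound_lipschitz B (band a b) Cexpi (fun z => Cexpi z * Ci)%C); auto.
    + intros w v Hw Hv.
      replace (z + Cexpi v - (z + Cexpi w) - (v - w) * (Cexpi w * Ci))%C
        with (Cexpi v - Cexpi w - (v - w) * (Cexpi w * Ci))%C by ring.
      destruct HE as [_ [_ H]]. eapply Rle_trans; [ now apply H | ].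
      apply Rmult_le_compat_r; [ apply pow2_ge_0 | lra ].
Qed.

Lemma circle_periodic D f (z : C) : periodic_on D (fun w => f (z + Cexpi w)%C).
Proof. intros w _. now rewrite Cexpi_2PI. Qed.

Lemma Rle_of_le_plus_small (x y B e0 : R) :
  0 < e0 -> (forall s, 0 < s <= e0 -> x <= y + B * s) -> x <= y.
Proof.
  intros He H. cut (x - y <= 0); [ lra | ].
  apply Rabs_zero_of_linear_bound with (Rabs B). intros s Hs.
  specialize (H (Rmin s e0)).
  assert (Q : 0 < Rmin s e0 <= e0) by (split; [ now apply Rmin_glb_lt | apply Rmin_r ]).
  specialize (H Q). assert (L := Rmin_l s e0).
  assert (B * Rmin s e0 <= Rabs B * Rmin s e0) by (apply Rmult_le_compat_r; [ lra | apply Rle_abs ]).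
  assert (Rabs B * Rmin s e0 <= Rabs B * s) by (apply Rmult_le_compat_l; [ apply Rabs_pos | lra ]).
  lra.
Qed.

(** The derivative is the first Fourier coefficient of [f (z + Cexpi w)]: computed on a circle of
    radius [s], this coefficient differs from [f1 z] by at most [B * s]. On the circle of radius
    [(rho - r) / 2] it is seen to be at most [2 * M / (rho - r)], and [s] can be taken arbitrarily
    small. *)
Lemma cauchy_estimate r rho f f1 M z :
  0 <= r < rho -> holo (band (- rho) rho) f f1 ->
  (forall w, band (- rho) rho w -> Cmod (f w) <= M) ->
  band (- r) r z -> Cmod (f1 z) <= 2 * M / (rho - r).
Proof.
  intros Hr Hf HM Hz. pose proof Hf as [B [HB [Q1 [Q2 Q3]]]].
  (* [a], [y1] and, below, [y2] are the heights at which the circles have radii [rho - r],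
     [(rho - r) / 2] and [s]. *)
  set (a := - ln (rho - r)). set (y1 := - ln ((rho - r) / 2)).
  assert (Ea : exp (- a) = rho - r) by (unfold a; rewrite Ropp_involutive; apply exp_ln; lra).
  assert (Ey : exp (- y1) = (rho - r) / 2) by (unfold y1; rewrite Ropp_involutive; apply exp_ln; lra).
  assert (Hay : a < y1). { apply Ropp_lt_cancel, exp_lt_inv. rewrite Ea, Ey. lra. }
  assert (Iz : Rabs (Im z) < r) by (destruct Hz; apply Rabs_def1; lra).
  apply (Rle_of_le_plus_small _ _ B ((rho - r) / 2)); [ lra | ]. intros s Hs.
  set (y2 := - ln s).
  assert (Es : exp (- y2) = s) by (unfold y2; rewrite Ropp_involutive; apply exp_ln; lra).
  assert (H12 : y1 <= y2).
  { destruct (Rle_dec y1 y2) as [L | L]; [ exact L | exfalso ].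
    assert (exp (- y1) < exp (- y2)) by (apply exp_increasing; lra). lra. }
  assert (HC : holo (band a (y2 + 1)) (fun w => f (z + Cexpi w)%C) (fun w => f1 (z + Cexpi w) * (Cexpi w * Ci))%C).
  { apply (holo_circle rho); auto. rewrite Ea. lra. }
  assert (HP := circle_periodic (band a (y2 + 1)) f z).
  assert (I1 : integer_freq 1) by apply (integer_freq_INR 1).
  assert (In : forall y (t : R), a < y -> band (- rho) rho (z + Cexpi (t, y))%C /\ Cmod (Cexpi (t, y)) = exp (- y)).
  { intros y t Hy. assert (E := Cmod_Cexpi (t, y)). simpl in E. split; [ | exact E ].
    assert (K := Im_le_Cmod (Cexpi (t, y))). rewrite E in K.
    assert (exp (- y) < exp (- a)) by (apply exp_increasing; lra).
    assert (Q : Rabs (Im (z + Cexpi (t, y))%C) < rho).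
    { rewrite im_plus. eapply Rle_lt_trans; [ apply Rabs_triang | ]. lra. }
    apply Rabs_def2 in Q. split; lra. }
  assert (B1 : Cmod (fcoef y2 (fun w => f (z + Cexpi w)%C) 1) <= 2 * M / (rho - r)).
  { eapply Rle_trans.
    - apply (fcoef_bound a (y2 + 1) _ _ 1 y2 y1 M HC HP I1); try lra.
      intros [t y] Hw. simpl in Hw. subst y. apply HM. now apply In.
    - right. rewrite Rmult_1_l. rewrite <- (Ropp_involutive y1), exp_Ropp, Ey. field. lra. }
  assert (Cg : Ccont (line y2 (fun w => f (z + Cexpi w) * Cexpi (RtoC (- 1) * w))%C)).
  { eapply holo_line_Ccont; [ apply holo_mode, HC | intros; apply band_line; lra ]. }
  assert (Ce : Ccont (line y2 (fun w => Cexpi (RtoC (- 1) * w))%C)).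
  { eapply holo_line_Ccont; [ apply (holo_Cexpi_scal (-1) a (y2 + 1)) | intros; apply band_line; lra ]. }
  assert (Z : cavg (line y2 (fun w => Cexpi (RtoC (- 1) * w))%C) = RtoC 0).
  { rewrite (cavg_ext _ (fun t => Cexpi (RtoC (-1) * (0, y2)) * exm 1 t)%C).
    - rewrite cavg_scal by apply Ccont_exm. rewrite cavg_exm. ring.
    - intros t. rewrite exm_E, <- Cexpi_plus. unfold line. f_equal.
      apply injective_projections; simpl; ring. }
  assert (D : Cmod (fcoef y2 (fun w => f (z + Cexpi w)%C) 1 - f1 z)%C <= B * s).
  { unfold fcoef. change (RtoC (Ropp 1)) with (RtoC (- 1)). rewrite <- (cavg_const (f1 z)).
    replace (cavg (line y2 (fun w => f (z + Cexpi w) * Cexpi (RtoC (- 1) * w)))%C - cavg (fun _ => f1 z))%C with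
     (cavg (fun t => line y2 (fun w => f (z + Cexpi w) * Cexpi (RtoC (- 1) * w))%C t - f1 z -
              f z * line y2 (fun w => Cexpi (RtoC (- 1) * w))%C t)%C).
    - apply cavg_bound.
      + apply Ccont_minus; [ apply Ccont_minus; [ exact Cg | apply Ccont_const ] | now apply Ccont_scal ].
      + intros t. unfold line. destruct (In y2 t) as [I2 E2]; [ lra | ].
        replace (RtoC (- 1) * (t, y2))%C with (- (t, y2))%C by (apply injective_projections; simpl; ring).
        rewrite Cexpi_opp_inv.
        replace (f (z + Cexpi (t, y2)) * / Cexpi (t, y2) - f1 z - f z * / Cexpi (t, y2))%C
          with ((f (z + Cexpi (t, y2)) - f z - (z + Cexpi (t, y2) - z) * f1 z) * / Cexpi (t, y2))%C
          by (field; apply Cexpi_nz).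
        rewrite Cmod_mult, Cmod_inv by apply Cexpi_nz. rewrite E2, Es.
        apply Rmult_le_reg_r with s; [ lra | ]. rewrite Rmult_assoc, Rinv_l, Rmult_1_r by lra.
        eapply Rle_trans; [ apply Q3; [ revert Hz; apply symmetric_band_mono; lra | exact I2 ] | ].
        replace (z + Cexpi (t, y2) - z)%C with (Cexpi (t, y2)) by ring. rewrite E2, Es. right; ring.
    - set (G := line y2 (fun w => f (z + Cexpi w) * Cexpi (RtoC (- 1) * w))%C) in *.
      set (E := line y2 (fun w => Cexpi (RtoC (- 1) * w))%C) in *.
      rewrite (cavg_minus (fun t => G t - f1 z)%C (fun t => f z * E t)%C),
        (cavg_minus G (fun _ => f1 z)), (cavg_scal (f z) E), Z;
        auto using Ccont_const, Ccont_scal, Ccont_minus. ring. }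
  replace (f1 z) with (fcoef y2 (fun w => f (z + Cexpi w)%C) 1 - (fcoef y2 (fun w => f (z + Cexpi w)%C) 1 - f1 z))%C by ring.
  apply Cmod_minus_le; auto.
Qed.

Lemma polar_form (h : C) : h <> RtoC 0 -> exists w, Cexpi w = h /\ Im w = - ln (Cmod h).
Proof.
  intros Hh. assert (P := proj1 (Cmod_gt_0 h) Hh). set (m := Cmod h) in *.
  assert (Q := Cmod_sqr_Re_Im h). fold m in Q. destruct h as [x y]. simpl in Q.
  set (c := x / m). set (s := y / m).
  assert (U : c * c + s * s = 1). { unfold c, s. apply Rmult_eq_reg_r with (m * m); [ | nra ]. field_simplify; lra. }
  assert (A : exists t, cos t = c /\ sin t = s).
  { assert (Hc : -1 <= c <= 1) by nra.
    assert (S : sin (acos c) = Rabs s).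
    { rewrite sin_acos by auto. rewrite <- sqrt_Rsqr_abs. f_equal. unfold Rsqr. lra. }
    destruct (Rle_dec 0 s).
    - exists (acos c). rewrite cos_acos, S by auto. split; [ reflexivity | now apply Rabs_pos_eq ].
    - exists (- acos c). rewrite cos_neg, sin_neg, cos_acos, S by auto.
      split; [ reflexivity | rewrite Rabs_left; lra ]. }
  destruct A as [t [A1 A2]]. exists (t, - ln m). split; [ | reflexivity ].
  unfold Cexpi. simpl. rewrite Ropp_involutive, exp_ln, A1, A2 by auto.
  unfold c, s. apply injective_projections; simpl; field; lra.
Qed.

Lemma csum_sum_n (a : nat -> C) (n : nat) : sum_n a n = csum a (S n).
Proof.
  induction n.
  - rewrite sum_O. simpl. now rewrite Cplus_0_l.
  - rewrite sum_Sn, IHn. reflexivity.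
Qed.

Lemma is_series_of_geometric (a : nat -> C) (l : C) (K q : R) :
  0 <= q < 1 -> (forall n, Cmod (l - csum a n)%C <= K * q ^ n) ->
  is_series (V := C_NormedModule) a l.
Proof.
  intros Hq H. apply filterlim_locally. intros eps.
  assert (L : is_lim_seq (fun n => K * q ^ n) 0).
  { replace (Finite 0) with (Rbar_mult K 0) by (simpl; f_equal; ring).
    apply is_lim_seq_scal_l. apply is_lim_seq_geom. rewrite Rabs_pos_eq; lra. }
  apply is_lim_seq_spec in L. destruct (L eps) as [N HN].
  exists N. intros n Hn. apply C_NormedModule_mixin_compat1.
  rewrite csum_sum_n. change (minus (csum a (S n)) l) with (csum a (S n) - l)%C.
  rewrite Cmod_sub_sym. eapply Rle_lt_trans; [ apply H | ].
  assert (Q : (N <= S n)%nat) by lia. specialize (HN (S n) Q). rewrite Rminus_0_r in HN.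
  generalize (Rle_abs (K * q ^ S n)). lra.
Qed.

Lemma pow_n_Cpow (h : C) (n : nat) : pow_n (K := C_AbsRing) h n = (h ^ n)%C.
Proof. induction n; simpl; [ reflexivity | ]. rewrite IHn. reflexivity. Qed.

(** In the variable [h = Cexpi w] the Fourier series of [f (z + Cexpi w)] is a Laurent series, and
    boundedness near the centre removes its negative part. *)
Lemma taylor_expansion rho f f1 z :
  holo (band (- rho) rho) f f1 -> band (- rho) rho z ->
  exists (a : nat -> C) (r : R), 0 < r /\ forall h, Cmod h < r ->
    is_series (V := C_NormedModule) (fun n => a n * h ^ n)%C (f (z + h)%C).
Proof.
  intros Hf Hz. pose proof Hf as [M [HM [Q1 [Q2 Q3]]]].
  assert (Iz : Rabs (Im z) < rho) by (destruct Hz; apply Rabs_def1; lra).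
  set (r := rho - Rabs (Im z)). assert (Hr : 0 < r) by (unfold r; lra).
  set (a := - ln r). assert (Ea : exp (- a) = r) by (unfold a; rewrite Ropp_involutive; apply exp_ln; lra).
  set (g := fun w => f (z + Cexpi w)%C).
  assert (HC : forall b, holo (band a b) g (fun w => f1 (z + Cexpi w) * (Cexpi w * Ci))%C).
  { intros b. apply (holo_circle rho); auto. rewrite Ea. unfold r. lra. }
  assert (HP : forall b, periodic_on (band a b) g) by (intros b; apply circle_periodic).
  assert (In : forall w, a < Im w -> Cmod (g w) <= M).
  { intros w Hw. apply Q1. assert (K := Im_le_Cmod (Cexpi w)). rewrite Cmod_Cexpi in K.
    assert (exp (- Im w) < exp (- a)) by (apply exp_increasing; lra).
    assert (Q : Rabs (Im (z + Cexpi w)%C) < rho).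
    { rewrite im_plus. eapply Rle_lt_trans; [ apply Rabs_triang | ]. unfold r in Ea. lra. }
    apply Rabs_def2 in Q. split; lra. }
  (* Shrinking the circle to radius [s] bounds the coefficient of index [- S n] by [M * s ^ S n],
     hence by [M * s] when [s <= 1]. For larger [s] a circle of radius at most 1 gives the bound
     [M], which is then below [M * s]. *)
  assert (Neg : forall y n, a < y -> negc y g n = RtoC 0).
  { intros y [ | n] Hy; [ reflexivity | ]. apply Cmod_eq_0. apply Rle_antisym; [ | apply Cmod_ge_0 ].
    apply Rle_of_le_plus_small with M (exp (- (y + 1))); [ apply exp_pos | ].
    intros s [Hs0 Hs].
    set (y2 := - ln s).
    assert (Es : exp (- y2) = s) by (unfold y2; rewrite Ropp_involutive; apply exp_ln; lra).
    assert (Hy2 : y + 1 <= y2).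
    { destruct (Rle_dec (y + 1) y2) as [L | L]; [ exact L | exfalso ].
      assert (exp (- (y + 1)) < exp (- y2)) by (apply exp_increasing; lra). lra. }
    assert (Hs1 : (0 <= s -> s <= 1 -> s ^ S n <= s)).
    { intros. simpl. rewrite <- (Rmult_1_r s) at 3. apply Rmult_le_compat_l; auto.
      rewrite <- (pow1 n). apply pow_incr; auto. }
    destruct (Rle_dec s 1) as [L1 | L1].
    - eapply Rle_trans; [ apply (fcoef_bound a (y2 + 1) g _ (- INR (S n)) y y2 M (HC _) (HP _)) | ];
        auto using integer_freq_opp_INR; try lra.
      + intros w Hw. apply In. lra.
      + replace (- INR (S n) * y2) with (INR (S n) * - y2) by ring.
        rewrite exp_INR_mult, Es. rewrite Rplus_0_l. apply Rmult_le_compat_l; auto. apply Hs1; lra.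
    - eapply Rle_trans; [ apply (fcoef_bound a (Rmax y 0 + 2) g _ (- INR (S n)) y (Rmax y 0 + 1) M (HC _) (HP _)) | ];
        auto using integer_freq_opp_INR; try (generalize (Rmax_l y 0); lra).
      + intros w Hw. apply In. generalize (Rmax_l y 0); lra.
      + rewrite Rplus_0_l. apply Rmult_le_compat_l; auto.
        apply Rle_trans with (exp 0); [ left; apply exp_increasing | rewrite exp_0; lra ].
        assert (0 < INR (S n)) by (apply lt_0_INR; lia). generalize (Rmax_r y 0). nra. }
  exists (posc (a + 1) g), (r / 2). split; [ lra | ]. intros h Hh.
  (* The circle of radius [3 / 4 * r] gives this bound; with [Cmod h < r / 2] it leaves the ratio
     2/3. *)
  assert (Pb : forall n, Cmod (posc (a + 1) g n) <= M * (/ r * (4 / 3)) ^ n).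
  { intros n. set (y3 := - ln (3 / 4 * r)).
    assert (E3 : exp (- y3) = 3 / 4 * r) by (unfold y3; rewrite Ropp_involutive; apply exp_ln; lra).
    assert (H3 : a < y3). { apply Ropp_lt_cancel, exp_lt_inv. rewrite Ea, E3. lra. }
    replace (/ r * (4 / 3)) with (exp y3).
    - rewrite <- exp_INR_mult. apply (fcoef_bound a (Rmax (a + 1) y3 + 1) g _ (INR n) (a + 1) y3 M (HC _) (HP _));
      auto using integer_freq_INR; try (generalize (Rmax_l (a + 1) y3) (Rmax_r (a + 1) y3); lra).
      intros w Hw. apply In. lra.
    - rewrite <- (Ropp_involutive y3), exp_Ropp, E3. field. lra. }
  assert (T : forall n, Cmod (posc (a + 1) g n * h ^ n)%C <= M * (2 / 3) ^ n).
  { intros n. rewrite Cmod_mult, Cmod_pow.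
    replace (M * (2 / 3) ^ n) with (M * (/ r * (4 / 3)) ^ n * (r / 2) ^ n).
    - apply Rmult_le_compat; auto using Cmod_ge_0. apply pow_le, Cmod_ge_0.
      apply pow_incr. split; [ apply Cmod_ge_0 | lra ].
    - rewrite Rmult_assoc, <- Rpow_mult_distr. do 2 f_equal. field. lra. }
  apply (is_series_of_geometric _ _ (M / (1 - 2 / 3)) (2 / 3)); [ lra | ].
  intros n. replace (f (z + h)%C) with (CSeries (fun n => posc (a + 1) g n * h ^ n)%C).
  { apply CSeries_geom_tail; auto. lra. }
  assert (Gen : forall w, a < Im w -> g w = CSeries (fun n => posc (a + 1) g n * Cexpi w ^ n)%C).
  { intros w Hw.
    set (b := Rmax (a + 1) (Im w) + 1).
    rewrite (fourier_expansion a b g _ (a + 1) w (HC _) (HP _));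
     [ | unfold b; generalize (Rmax_l (a + 1) (Im w)); lra | split; unfold b; generalize (Rmax_r (a + 1) (Im w)); lra ].
    apply CSeries_ext. intros k. unfold tterm. rewrite Neg, Cexpi_INR by lra. ring. }
  destruct (Ceq_dec h 0) as [-> | Nh].
  - (* By continuity: evaluate along [h = exp (i w)], [Im w -> infinity]. *)
    symmetry. apply Ceq_minus, Cmod_eq_0. apply Rle_antisym; [ | apply Cmod_ge_0 ].
    apply Rle_of_le_plus_small with (2 * M + M * (4 / r) * 3) (Rmin (r / 2) 1).
    { apply Rmin_glb_lt; lra. }
    intros s [Hs0 Hs]. rewrite Rplus_0_l.
    assert (Hs' : s <= r / 2) by (generalize (Rmin_l (r / 2) 1); lra).
    set (ws := (0, - ln s) : C).
    assert (Es : g ws = f (z + RtoC s)%C).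
    { unfold g. do 2 f_equal. unfold Cexpi, ws. simpl. rewrite Ropp_involutive, exp_ln, cos_0, sin_0 by lra.
      apply injective_projections; simpl; ring. }
    assert (E0 : CSeries (fun k => posc (a + 1) g k * 0 ^ k)%C = posc (a + 1) g 0%nat).
    { rewrite (CSeries_incr_n _ 1).
      - simpl csum. rewrite (CSeries_ext _ (fun _ => 0 * 0)%C) by (intros; simpl; ring).
        rewrite CSeries_scal; [ simpl; ring | ]. apply summable_le with (fun k => 0 * 0 ^ k).
        intros k. rewrite Cmod_0; lra. apply ex_series_geom_scal; lra.
      - apply summable_le with (fun k => M * (2 / 3) ^ k); [ exact T | apply ex_series_geom_scal; lra ]. }
    rewrite E0, Cplus_0_r.
    assert (Gs := Gen ws). rewrite Es in Gs.
    assert (Ls : a < Im ws).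
    { unfold ws, a. simpl. apply Ropp_lt_contravar. apply ln_increasing; lra. }
    specialize (Gs Ls).
    assert (Ts : Cmod (CSeries (fun k => posc (a + 1) g k * Cexpi ws ^ k) - csum (fun k => posc (a + 1) g k * Cexpi ws ^ k) 1)%C
       <= M / (1 - s / r * (4 / 3)) * (s / r * (4 / 3)) ^ 1).
    { apply CSeries_geom_tail.
      - split; [ apply Rmult_le_pos; [ | lra ]; apply Rdiv_le_0_compat; lra | ].
        apply Rmult_lt_reg_r with r; [ lra | ]. replace (s / r * (4 / 3) * r) with (s * (4 / 3)) by (field; lra). lra.
      - intros k. rewrite Cmod_mult, Cmod_pow, Cmod_Cexpi. change (Im ws) with (- ln s). rewrite Ropp_involutive, exp_ln by lra.
        replace (s / r * (4 / 3)) with (/ r * (4 / 3) * s) by (field; lra).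
        rewrite Rpow_mult_distr, <- Rmult_assoc. apply Rmult_le_compat_r; [ apply pow_le; lra | auto ]. }
    rewrite <- Gs in Ts. simpl csum in Ts.
    replace (f z - posc (a + 1) g 0%nat)%C with ((f (z + RtoC s) - (0 + posc (a + 1) g 0%nat * 1)) - (f (z + RtoC s) - f z))%C by ring.
    eapply Rle_trans.
    { apply Cmod_minus_le; [ exact Ts | ].
      apply (holo_bound_lipschitz M (band (- rho) rho) f f1); [ repeat split; auto | auto | ].
      destruct Hz. split; simpl; rewrite Rplus_0_r; auto. }
    replace (z + RtoC s - z)%C with (RtoC s) by ring. rewrite Cmod_R, Rabs_pos_eq, pow_1 by lra.
    assert (U : s / r * (4 / 3) <= 2 / 3).
    { apply Rmult_le_reg_r with r; [ lra | ]. replace (s / r * (4 / 3) * r) with (s * (4 / 3)) by (field; lra). lra. }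
    assert (V : / (1 - s / r * (4 / 3)) <= 3).
    { replace 3 with (/ (/ 3)) by field. apply Rinv_le_contravar; lra. }
    assert (W : M / (1 - s / r * (4 / 3)) * (s / r * (4 / 3)) <= M * 3 * (s / r * (4 / 3))).
    { apply Rmult_le_compat_r. apply Rmult_le_pos; [ | lra ]; apply Rdiv_le_0_compat; lra.
      unfold Rdiv at 1. apply Rmult_le_compat_l; auto. }
    assert (0 <= M * (s / r)). { apply Rmult_le_pos; auto. apply Rdiv_le_0_compat; lra. }
    replace ((2 * M + M * (4 / r) * 3) * s) with (2 * M * s + 12 * (M * (s / r))) by (field; lra). lra.
  - destruct (polar_form h Nh) as [w [Ew Iw]]. rewrite <- Ew. symmetry. apply Gen.
    rewrite Iw. unfold a. apply Ropp_lt_contravar. apply ln_increasing; [ now apply Cmod_gt_0 | lra ].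
Qed.

Lemma analytic_of_holo rho f f1 z :
  holo (band (- rho) rho) f f1 -> band (- rho) rho z ->
  @analytic_at C_AbsRing C_NormedModule f z.
Proof.
  intros Hf Hz. destruct (taylor_expansion rho f f1 z Hf Hz) as [a [r [Hr H]]].
  exists a, r. split; [ exact Hr | ]. intros h Hh. unfold is_pseries.
  apply (is_series_ext (fun n => a n * h ^ n)%C).
  - intros n. rewrite Cmult_comm. change (h ^ n * a n = pow_n (K := C_AbsRing) h n * a n)%C. now rewrite <- pow_n_Cpow.
  - apply (H h Hh).
Qed.

Lemma is_series_Re (a : nat -> C) (l : C) :
  is_series (V := C_NormedModule) a l -> is_series (V := R_NormedModule) (fun n => Re (a n)) (Re l).
Proof.
  intros H. unfold is_series in *. apply filterlim_locally. intros eps.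
  assert (K := proj1 (filterlim_locally _ _) H eps).
  revert K. apply filter_imp. intros n [K _].
  assert (E : forall n, sum_n (fun k => Re (a k)) n = Re (sum_n a n)).
  { induction n0. now rewrite !sum_O. rewrite !sum_Sn, IHn0. reflexivity. }
  rewrite E. exact K.
Qed.

Lemma real_analytic_of_holo rho f f1 (g : R -> R) :
  0 < rho -> holo (band (- rho) rho) f f1 -> (forall x, f (RtoC x) = RtoC (g x)) -> real_analytic g.
Proof.
  intros HR Hf Hg x.
  destruct (taylor_expansion rho f f1 (RtoC x) Hf) as [a [r [Hr H]]]; [ split; simpl; lra | ].
  exists (fun n => Re (a n)), r. split; [ exact Hr | ]. intros h Hh. unfold is_pseries.
  assert (K := H (RtoC h)). rewrite Cmod_R in K. specialize (K Hh).
  apply is_series_Re in K. rewrite <- RtoC_plus, Hg in K. change (Re (RtoC (g (x + h)))) with (g (x + h)) in K.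
  eapply is_series_ext; [ | exact K ].
  intros n. cbv beta. rewrite <- RtoC_pow, re_scal_r. rewrite Rmult_comm. unfold scal; simpl; unfold mult; simpl.
  f_equal.
Qed.

(** * Limits *)

Definition Ccv (u : nat -> C) (l : C) : Prop :=
  forall eps, 0 < eps -> exists N, forall n, (N <= n)%nat -> Cmod (u n - l)%C < eps.

Lemma Ccv_plus u v k l : Ccv u k -> Ccv v l -> Ccv (fun n => u n + v n)%C (k + l)%C.
Proof.
  intros Hu Hv eps He. destruct (Hu (eps / 2)) as [N1 H1]; [ lra | ].
  destruct (Hv (eps / 2)) as [N2 H2]; [ lra | ]. exists (N1 + N2)%nat. intros n Hn.
  replace (u n + v n - (k + l))%C with ((u n - k) + (v n - l))%C by ring.
  eapply Rle_lt_trans; [ apply Cmod_triangle | ].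
  generalize (H1 n ltac:(lia)) (H2 n ltac:(lia)). lra.
Qed.

Lemma Ccv_scal c u l : Ccv u l -> Ccv (fun n => c * u n)%C (c * l)%C.
Proof.
  intros Hu eps He. assert (P := Cmod_ge_0 c).
  destruct (Hu (eps / (Cmod c + 1))) as [N HN]; [ apply Rdiv_lt_0_compat; lra | ].
  exists N. intros n Hn. replace (c * u n - c * l)%C with (c * (u n - l))%C by ring.
  rewrite Cmod_mult. specialize (HN n Hn).
  apply (Rmult_lt_compat_l (Cmod c + 1)) in HN; [ | lra ].
  replace ((Cmod c + 1) * (eps / (Cmod c + 1))) with eps in HN by (field; lra).
  generalize (Cmod_ge_0 (u n - l)%C). nra.
Qed.

Lemma Ccv_minus u v k l : Ccv u k -> Ccv v l -> Ccv (fun n => u n - v n)%C (k - l)%C.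
Proof.
  intros Hu Hv. assert (H := Ccv_plus _ _ _ _ Hu (Ccv_scal (-(1))%C _ _ Hv)).
  intros eps He. destruct (H eps He) as [N HN]. exists N. intros n Hn.
  replace (u n - v n - (k - l))%C with (u n + - (1) * v n - (k + - (1) * l))%C by ring. auto.
Qed.

Lemma Ccv_bound u l M : Ccv u l -> (forall n, Cmod (u n) <= M) -> Cmod l <= M.
Proof.
  intros Hu HM. apply le_epsilon. intros eps He. destruct (Hu eps He) as [N HN].
  replace l with (u N - (u N - l))%C by ring.
  apply Cmod_minus_le; [ apply HM | left; apply HN; lia ].
Qed.

Lemma Ccv_unique u k l : Ccv u k -> Ccv u l -> k = l.
Proof.
  intros Hk Hl. apply Ceq_minus, Cmod_eq_0, Rle_antisym; [ | apply Cmod_ge_0 ].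
  apply le_epsilon. intros eps He.
  destruct (Hk (eps / 2)) as [N1 H1]; [ lra | ]. destruct (Hl (eps / 2)) as [N2 H2]; [ lra | ].
  replace (k - l)%C with ((u (N1 + N2)%nat - l) - (u (N1 + N2)%nat - k))%C by ring.
  rewrite Rplus_0_l. replace eps with (eps / 2 + eps / 2) by field.
  apply Cmod_minus_le; left; [ apply H2 | apply H1 ]; lia.
Qed.

Lemma Ccv_ext u v l : (forall n, u n = v n) -> Ccv u l -> Ccv v l.
Proof. intros E H eps He. destruct (H eps He) as [N HN]. exists N. intros n Hn. rewrite <- E. auto. Qed.

Lemma Ccv_const c : Ccv (fun _ => c) c.
Proof.
  intros eps He. exists 0%nat. intros n _. replace (c - c)%C with (RtoC 0) by ring. now rewrite Cmod_0.
Qed.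

(** [Lim_seq] is total; the value is meaningful once [Ccv_cauchy] applies. *)
Definition Clim (u : nat -> C) : C :=
  (real (Lim_seq (fun n => Re (u n))), real (Lim_seq (fun n => Im (u n)))).

Lemma Ccv_cauchy u :
  (forall eps, 0 < eps -> exists N, forall n m, (N <= n)%nat -> (N <= m)%nat -> Cmod (u n - u m)%C < eps) ->
  Ccv u (Clim u).
Proof.
  intros H.
  assert (W : forall (p : C -> R), (forall z w, Rabs (p z - p w) <= Cmod (z - w)%C) ->
     is_lim_seq (fun n => p (u n)) (real (Lim_seq (fun n => p (u n))))).
  { intros p Hp. apply Lim_seq_correct', ex_lim_seq_cauchy_corr. intros eps.
    destruct (H eps (cond_pos eps)) as [N HN]. exists N. intros n m Hn Hm.
    eapply Rle_lt_trans; [ apply Hp | auto ]. }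
  assert (H1 := W Re (fun z w => re_le_Cmod (z - w)%C)).
  assert (H2 := W Im (fun z w => Im_le_Cmod (z - w)%C)).
  apply is_lim_seq_spec in H1. apply is_lim_seq_spec in H2. intros eps He.
  assert (P : 0 < eps / 2) by lra.
  destruct (H1 (mkposreal _ P)) as [N1 L1]. destruct (H2 (mkposreal _ P)) as [N2 L2]. simpl in L1, L2.
  exists (N1 + N2)%nat. intros n Hn. eapply Rle_lt_trans; [ apply Cmod_le_Re_Im | ].
  specialize (L1 n ltac:(lia)). specialize (L2 n ltac:(lia)).
  change (Re (u n - Clim u)%C) with (Re (u n) - real (Lim_seq (fun n => Re (u n)))).
  change (Im (u n - Clim u)%C) with (Im (u n) - real (Lim_seq (fun n => Im (u n)))). lra.
Qed.

(** The derivatives converge because the difference quotients with a fixed step [s] converge and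
    approximate [u1 n] within [K * M * s], uniformly in [n]. The Taylor bound itself is preserved by
    pointwise limits. *)
Lemma holo_limit (r rho M : R) (u u1 : nat -> C -> C) (f : C -> C) :
  0 <= r < rho ->
  (forall n, holo (band (- rho) rho) (u n) (u1 n)) ->
  (forall n, periodic_on (band (- rho) rho) (u n)) ->
  (forall n z, band (- rho) rho z -> Cmod (u n z) <= M) ->
  (forall z, band (- rho) rho z -> Ccv (fun n => u n z) (f z)) ->
  holo (band (- r) r) f (fun z => Clim (fun n => u1 n z)) /\
  (forall z, band (- r) r z -> Ccv (fun n => u1 n z) (Clim (fun n => u1 n z))).
Proof.
  intros Hr Hu Hp HM Hf.
  destruct (holo_bound_interior r rho Hr) as [K [K0 HK]].
  assert (HB : forall n, holo_bound (K * M) (band (- r) r) (u n) (u1 n)).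
  { intros n. destruct (HK (u n) (u1 n) M); auto. }
  assert (M0 : 0 <= M).
  { assert (B0 : band (- rho) rho 0) by (split; simpl; lra). generalize (HM 0%nat _ B0) (Cmod_ge_0 (u 0%nat 0)). lra. }
  assert (KM : 0 <= K * M) by (apply Rmult_le_pos; lra).
  assert (I : forall z, band (- r) r z -> band (- rho) rho z) by (intros z; apply symmetric_band_mono; lra).
  assert (L : forall z, band (- r) r z -> Ccv (fun n => u1 n z) (Clim (fun n => u1 n z))).
  { intros z Hz. apply Ccv_cauchy. intros eps He.
    (* With this step the two Taylor remainders amount to less than [s * eps / 4]; the four values
       within [s * eps / 16] of their limits add another [s * eps / 4]. *)
    set (s := eps / (8 * (K * M + 1))).
    assert (Hs : 0 < s) by (apply Rdiv_lt_0_compat; lra).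
    assert (Hs2 : 8 * (K * M + 1) * s = eps) by (unfold s; field; lra).
    assert (Hw : band (- r) r (z + RtoC s)%C).
    { destruct Hz. split; simpl; rewrite Rplus_0_r; auto. }
    destruct (Hf z (I z Hz) (s * eps / 16)) as [N1 H1]; [ nra | ].
    destruct (Hf _ (I _ Hw) (s * eps / 16)) as [N2 H2]; [ nra | ].
    exists (N1 + N2)%nat. intros n m Hn Hm.
    apply Rmult_lt_reg_l with s; [ exact Hs | ].
    rewrite <- (Rabs_pos_eq s) at 1 by lra. rewrite <- Cmod_R, <- Cmod_mult.
    replace (RtoC s * (u1 n z - u1 m z))%C with
      ((u m (z + RtoC s) - u m z - (z + RtoC s - z) * u1 m z) - (u n (z + RtoC s) - u n z - (z + RtoC s - z) * u1 n z)
       + (((u n (z + RtoC s) - f (z + RtoC s)) - (u m (z + RtoC s) - f (z + RtoC s)))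
          - ((u n z - f z) - (u m z - f z))))%C by ring.
    eapply Rle_lt_trans.
    { apply Cmod_plus_le; [ apply Cmod_minus_le; apply HB; auto | ].
      apply Cmod_minus_le; apply Cmod_minus_le; left.
      - apply H2; lia.
      - apply H2; lia.
      - apply H1; lia.
      - apply H1; lia. }
    replace (z + RtoC s - z)%C with (RtoC s) by ring. rewrite Cmod_R, Rabs_pos_eq by lra. nra. }
  split; [ | exact L ].
  exists (K * M). split; [ exact KM | split; [ | split ] ].
  - intros z Hz. apply (Ccv_bound _ _ _ (Hf z (I z Hz))). intros n. now apply (HB n).
  - intros z Hz. apply (Ccv_bound _ _ _ (L z Hz)). intros n. now apply (HB n).
  - intros z w Hz Hw.
    apply (Ccv_bound (fun n => u n w - u n z - (w - z) * u1 n z)%C).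
    + apply Ccv_minus; [ apply Ccv_minus; auto | apply Ccv_scal; auto ].
    + intros n. now apply (HB n).
Qed.

Definition real_on_reals (f : C -> C) : Prop := forall x : R, Im (f (RtoC x)) = 0.

(** * Small divisors *)

Lemma Cexpi_1_lower (x : R) : - PI <= x <= PI -> Rabs x <= 4 * Cmod (Cexpi (RtoC x) - 1)%C.
Proof.
  intros H. rewrite Cmod_sub_sym. generalize (ex1_lower x H). rewrite ex_E.
  simpl INR. now rewrite Cmult_1_l.
Qed.

Lemma Rpower_pos a b : 0 < Rpower a b.
Proof. apply exp_pos. Qed.

(** With [x] the residue of [n * omega] modulo [2 * PI], [Rabs x] is [2 * PI * n] times the distance
    of [omega / (2 * PI)] to a fraction with denominator [n]. The factor [2 * PI] absorbs the 4 of
    [Cexpi_1_lower]. *)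
Lemma small_divisor gamma nu omega (n : nat) :
  diophantine gamma nu (omega / (2 * PI)) -> (1 <= n)%nat ->
  gamma * INR n / Rpower (INR n) nu <= Cmod (Cexpi (RtoC (INR n * omega)) - 1)%C.
Proof.
  intros HD Hn.
  assert (Pn : 0 < INR n) by (apply lt_0_INR; lia).
  assert (P := PI2_3_2).
  destruct (reduce_mod_2PI (INR n * omega)) as [k Hk].
  set (x := INR n * omega - 2 * PI * IZR k) in *.
  assert (E : Cexpi (RtoC (INR n * omega)) = Cexpi (RtoC x)).
  { generalize (periodic_C_Z _ (ex_periodic 1) k x). rewrite !ex_E. simpl INR. rewrite !Cmult_1_l.
    intros <-. do 2 f_equal. unfold x. ring. }
  rewrite E. assert (L := Cexpi_1_lower x Hk).
  specialize (HD k n Hn). apply Rge_le in HD.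
  assert (Ex : Rabs x = 2 * PI * INR n * Rabs (omega / (2 * PI) - IZR k / INR n)).
  { rewrite <- (Rabs_pos_eq (2 * PI * INR n)) by (apply Rmult_le_pos; lra). rewrite <- Rabs_mult.
    f_equal. unfold x. field. lra. }
  rewrite Ex in L.
  set (d := Rabs (omega / (2 * PI) - IZR k / INR n)) in *.
  assert (0 <= d) by apply Rabs_pos.
  assert (INR n * d <= Cmod (Cexpi (RtoC x) - 1)%C). {
    assert (Q : 0 <= INR n * d) by (apply Rmult_le_pos; lra).
    assert (4 * (INR n * d) <= 2 * PI * (INR n * d)) by (apply Rmult_le_compat_r; lra). lra. }
  apply Rle_trans with (INR n * d); [ | assumption ].
  replace (gamma * INR n / Rpower (INR n) nu) with (INR n * (gamma / Rpower (INR n) nu)).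
  - apply Rmult_le_compat_l; lra.
  - field. apply Rgt_not_eq, Rpower_pos.
Qed.

(** The constant comes from [a ln x <= x + a ln a - a]. *)
Lemma Rpower_le_exp (a x : R) : 0 < a -> 0 < x -> Rpower x a <= exp (a * ln a) * exp x.
Proof.
  intros Ha Hx. unfold Rpower. rewrite <- exp_plus.
  assert (K : a * ln x <= a * ln a + x).
  { replace x with (a * (x / a)) at 1 by (field; lra).
    assert (Q : 0 < x / a) by (apply Rdiv_lt_0_compat; lra).
    rewrite ln_mult by lra.
    assert (ln (x / a) <= x / a).
    { assert (E := exp_ineq1_le (ln (x / a))). rewrite exp_ln in E by lra. lra. }
    apply (Rmult_le_compat_l a) in H; [ | lra ].
    replace (a * (x / a)) with x in H by (field; lra). lra. }
  destruct K as [K | ->]; [ left; now apply exp_increasing | lra ].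
Qed.

(** [exp (nu * nu)] dominates the constant of [Rpower_le_exp] at the exponent [nu - 1]; the power of
    2 comes from replacing [n] by [n * (d / 2)]. In this form monotonicity in [nu] is immediate. *)
Definition div_const (nu : R) : R := exp (nu * nu) * Rpower 2 nu.

(** The polynomial growth [n^(nu - 1)] of the inverse divisors is exchanged for [exp (n * d / 2)],
    that is, for half of the width [d] about to be lost. *)
Lemma small_divisor_inv gamma nu omega d (n : nat) :
  0 < gamma -> 2 <= nu -> 0 < d -> diophantine gamma nu (omega / (2 * PI)) -> (1 <= n)%nat ->
  Cexpi (RtoC (INR n * omega)) <> RtoC 1 /\
  / Cmod (Cexpi (RtoC (INR n * omega)) - 1)%C
   <= div_const nu * d / (2 * gamma * Rpower d nu) * exp (INR n * (d / 2)).
Proof.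
  intros Hg Hnu Hd HD Hn. assert (S := small_divisor _ _ _ n HD Hn).
  assert (Pn : 0 < INR n) by (apply lt_0_INR; lia).
  set (x := Cmod (Cexpi (RtoC (INR n * omega)) - 1)%C) in *.
  assert (Pp := Rpower_pos (INR n) nu). assert (Pd := Rpower_pos d nu).
  assert (PL : 0 < gamma * INR n / Rpower (INR n) nu).
  { apply Rdiv_lt_0_compat; [ | lra ]. now apply Rmult_lt_0_compat. }
  split.
  { intros E. assert (x = 0); [ | lra ]. unfold x. rewrite E.
    replace (1 - 1)%C with (RtoC 0) by ring. apply Cmod_0. }
  eapply Rle_trans; [ apply Rinv_le_contravar; [ exact PL | exact S ] | ].
  assert (E1 : Rpower (INR n) nu = Rpower (INR n * (d / 2)) nu * Rpower 2 nu / Rpower d nu).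
  { apply Rmult_eq_reg_r with (Rpower d nu); [ | lra ]. unfold Rdiv at 1.
    replace (Rpower (INR n * (d / 2)) nu * Rpower 2 nu * / Rpower d nu * Rpower d nu) with
       (Rpower (INR n * (d / 2)) nu * Rpower 2 nu) by (field; lra).
    rewrite !Rpower_mult_distr; try lra. f_equal. field. apply Rmult_lt_0_compat; lra. }
  set (y := INR n * (d / 2)) in *.
  assert (Hy : 0 < y) by (unfold y; apply Rmult_lt_0_compat; lra).
  assert (E2 : Rpower y nu = y * Rpower y (nu - 1)).
  { replace nu with (1 + (nu - 1)) at 1 by ring. rewrite Rpower_plus, Rpower_1; auto. }
  assert (B : Rpower y (nu - 1) <= exp (nu * nu) * exp y).
  { eapply Rle_trans; [ apply Rpower_le_exp; lra | ]. apply Rmult_le_compat_r; [ left; apply exp_pos | ].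
    assert (K : (nu - 1) * ln (nu - 1) < nu * nu).
    { assert (ln (nu - 1) <= nu - 1).
      { assert (E := exp_ineq1_le (ln (nu - 1))). rewrite exp_ln in E by lra. lra. } nra. }
    left. now apply exp_increasing. }
  assert (P2 := Rpower_pos 2 nu).
  replace (/ (gamma * INR n / Rpower (INR n) nu)) with
    (Rpower 2 nu * d / (2 * gamma * Rpower d nu) * Rpower y (nu - 1)).
  2: { rewrite E1, E2. assert (Pq := Rpower_pos y (nu - 1)). set (q := Rpower y (nu - 1)) in *.
       unfold y. field. repeat split; lra. }
  unfold div_const.
  replace (exp (nu * nu) * Rpower 2 nu * d / (2 * gamma * Rpower d nu) * exp y) with
    (Rpower 2 nu * d / (2 * gamma * Rpower d nu) * (exp (nu * nu) * exp y)) by (field; lra).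
  apply Rmult_le_compat_l; [ | exact B ].
  apply Rdiv_le_0_compat; [ apply Rmult_le_pos; lra | ]. apply Rmult_lt_0_compat; lra.
Qed.

Lemma cavg_conj p : Ccont p -> cavg (fun t => Cconj (p t)) = Cconj (cavg p).
Proof.
  intros Hp. unfold cavg. rewrite Cmult_conj.
  replace (Cconj (RtoC (/ (2 * PI)))) with (RtoC (/ (2 * PI)))
    by (apply injective_projections; simpl; ring).
  f_equal. apply injective_projections; simpl; [ reflexivity | ].
  apply (RInt_opp (V := R_CompleteNormedModule) (fun t => snd (p t))).
  apply ex_RInt_cont. intros x. apply Hp.
Qed.

Lemma Cexpi_conj_real (x : R) : Cexpi (- RtoC x)%C = Cconj (Cexpi (RtoC x)).
Proof.
  unfold Cexpi. simpl. rewrite !Ropp_0, exp_0, cos_neg, sin_neg.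
  apply injective_projections; simpl; ring.
Qed.

Lemma Im_zero_conj (z : C) : Im z = 0 -> Cconj z = z.
Proof. destruct z as [x y]; simpl. intros ->. unfold Cconj; simpl. now rewrite Ropp_0. Qed.

(** Conjugacy of opposite coefficients is what keeps the solutions of the cohomological equation
    real. *)
Lemma fcoef_conj f s :
  real_on_reals f -> Ccont (line 0 (fun z => f z * Cexpi (RtoC (- s) * z))%C) ->
  fcoef 0 f (- s) = Cconj (fcoef 0 f s).
Proof.
  intros Hr Hc. unfold fcoef. rewrite <- cavg_conj by exact Hc.
  apply cavg_ext. intros t. unfold line. change (t, 0) with (RtoC t).
  rewrite Cmult_conj, (Im_zero_conj (f (RtoC t)) (Hr t)). f_equal.
  rewrite <- !RtoC_mult, <- Cexpi_conj_real. f_equal. rewrite <- RtoC_opp. f_equal. ring.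
Qed.

(** The 8 is what remains of the two modes per index, the 2 in the denominator of [den], and the
    bound [1 / (1 - exp (- d / 4)) <= 8 / d]. *)
Definition sol_const (nu : R) : R := 8 * div_const nu.

Lemma one_minus_exp_lower (x : R) : 0 < x <= 1 -> x / 2 <= 1 - exp (- x).
Proof.
  intros H. assert (E := exp_ineq1_le x). rewrite exp_Ropp.
  assert (/ exp x <= / (1 + x)) by (apply Rinv_le_contravar; lra).
  assert (/ (1 + x) <= 1 - x / 2).
  { apply Rmult_le_reg_r with (1 + x); [ lra | ]. rewrite Rinv_l by lra. nra. }
  lra.
Qed.

Lemma geometric_CSeries_bound a (M q : R) :
  0 <= q < 1 -> (forall n, Cmod (a n) <= M * q ^ n) -> Cmod (CSeries a) <= M / (1 - q).
Proof.
  intros Hq H. generalize (CSeries_geom_tail a M q 0 Hq H). simpl csum.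
  replace (CSeries a - 0)%C with (CSeries a) by ring. simpl. lra.
Qed.

Section Cohomology.

Variables (gamma nu omega : R).
Hypotheses (Hgamma : 0 < gamma) (Hnu : 2 <= nu)
  (HD : diophantine gamma nu (omega / (2 * PI))).

(** The divisor vanishes at mode [0]; the value chosen there selects the solution of zero mean. *)
Definition sol_pos (A : nat -> C) (n : nat) : C :=
  match n with 0%nat => RtoC 0 | S _ => (A n * / (Cexpi (RtoC (INR n * omega)) - 1))%C end.

Definition sol_neg (B : nat -> C) (n : nat) : C :=
  match n with 0%nat => RtoC 0 | S _ => (B n * / (Cexpi (- RtoC (INR n * omega)) - 1))%C end.

Lemma div_opp_eq (x : R) :
  (Cexpi (- RtoC x) - 1)%C = (- (Cexpi (- RtoC x) * (Cexpi (RtoC x) - 1)))%C.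
Proof.
  replace (Cexpi (- RtoC x) * (Cexpi (RtoC x) - 1))%C with (Cexpi (RtoC x) * Cexpi (- RtoC x) - Cexpi (- RtoC x))%C by ring.
  rewrite Cexpi_opp. ring.
Qed.

Lemma Cmod_div_opp (x : R) : Cmod (Cexpi (- RtoC x) - 1)%C = Cmod (Cexpi (RtoC x) - 1)%C.
Proof.
  rewrite div_opp_eq, Cmod_opp, Cmod_mult, Cmod_Cexpi, im_opp. simpl.
  rewrite !Ropp_0, exp_0. ring.
Qed.

Let den (d : R) : R := div_const nu * d / (2 * gamma * Rpower d nu).

Lemma div_const_pos : 0 < div_const nu.
Proof. apply Rmult_lt_0_compat; apply exp_pos. Qed.

Lemma den_pos d : 0 < d -> 0 < den d.
Proof.
  intros Hd. assert (P := div_const_pos). assert (Q := Rpower_pos d nu).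
  apply Rdiv_lt_0_compat; [ nra | ]. apply Rmult_lt_0_compat; lra.
Qed.

Lemma sol_decays M s d A B :
  0 < d -> decays M s A -> decays M s B ->
  decays (M * den d) (s - d / 2) (sol_pos A) /\ decays (M * den d) (s - d / 2) (sol_neg B).
Proof.
  intros Hd HA HB. assert (M0 := decays_nonneg _ _ _ HA). assert (P := den_pos d Hd).
  assert (Z : forall n, 0 <= M * den d * exp (- INR n * (s - d / 2))).
  { intros n. apply Rmult_le_pos; [ nra | left; apply exp_pos ]. }
  split; intros [ | n]; try (simpl sol_pos; simpl sol_neg; rewrite Cmod_0; apply Z).
  - assert (W := small_divisor_inv gamma nu omega d (S n) Hgamma Hnu Hd HD ltac:(lia)).
    destruct W as [N W].
    unfold sol_pos. eapply Rle_trans.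
    { apply Cmod_mult_le; [ apply HA | ]. rewrite Cmod_inv; [ exact W | ].
      intros E. apply N. now apply Ceq_minus. }
    right. unfold den.
    replace (- INR (S n) * (s - d / 2)) with (- INR (S n) * s + INR (S n) * (d / 2)) by ring.
    rewrite exp_plus. ring.
  - assert (W := small_divisor_inv gamma nu omega d (S n) Hgamma Hnu Hd HD ltac:(lia)).
    destruct W as [N W].
    unfold sol_neg. eapply Rle_trans.
    { apply Cmod_mult_le; [ apply HB | ]. rewrite Cmod_inv; [ rewrite Cmod_div_opp; exact W | ].
      apply Cmod_gt_0. rewrite Cmod_div_opp. apply Cmod_gt_0. intros E. apply N. now apply Ceq_minus. }
    right. unfold den.
    replace (- INR (S n) * (s - d / 2)) with (- INR (S n) * s + INR (S n) * (d / 2)) by ring.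
    rewrite exp_plus. ring.
Qed.

Lemma tterm_summable A B M s rho z :
  decays M s A -> decays M s B -> rho < s -> band (- rho) rho z ->
  forall n, Cmod (tterm A B n z) <= 2 * M * exp (- (s - rho)) ^ n.
Proof.
  intros HA HB Hr Hz n. assert (M0 := decays_nonneg _ _ _ HA).
  replace (2 * M) with (M + M) by ring. rewrite Rmult_plus_distr_r, <- exp_INR_mult.
  assert (W : forall y, - INR n * s + y <= INR n * - (s - rho) ->
      M * exp (- INR n * s) * exp y <= M * exp (INR n * - (s - rho))).
  { intros y Hy. rewrite Rmult_assoc, <- exp_plus. apply Rmult_le_compat_l; [ exact M0 | ].
    destruct Hy as [Hy | ->]; [ left; now apply exp_increasing | lra ]. }
  assert (Pn := pos_INR n). destruct Hz as [Hz1 Hz2].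
  unfold tterm. apply Cmod_plus_le; rewrite Cmod_mult, Cmod_Cexpi, im_scal_l.
  - eapply Rle_trans; [ apply Rmult_le_compat_r; [ left; apply exp_pos | apply HA ] | ].
    apply W. nra.
  - eapply Rle_trans; [ apply Rmult_le_compat_r; [ left; apply exp_pos | apply HB ] | ].
    apply W. nra.
Qed.

Lemma cohomological_equation rho d f f1 M :
  0 < d < rho -> d <= 1 ->
  holo (band (- rho) rho) f f1 -> periodic_on (band (- rho) rho) f -> real_on_reals f ->
  (forall z, band (- rho) rho z -> Cmod (f z) <= M) -> cavg (line 0 f) = RtoC 0 ->
  exists e e1, holo (band (- (rho - d)) (rho - d)) e e1 /\
    periodic_on (band (- (rho - d)) (rho - d)) e /\ real_on_reals e /\
    (forall z, band (- (rho - d)) (rho - d) z -> (e (z + RtoC omega) - e z = f z)%C) /\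
    (forall z, band (- (rho - d)) (rho - d) z ->
       Cmod (e z) <= sol_const nu * M / (gamma * Rpower d nu)).
Proof.
  intros Hd Hd1 Hf Hp Hr HM Havg.
  (* The width [d] is spent in three portions: [d / 4] to bound the coefficients inside the strip,
     [d / 2] on the divisors and [d / 4] on the convergence of the sum. *)
  destruct (coef_decays rho f f1 M (rho - d / 4) Hf Hp HM) as [DA DB]; [ lra | ].
  set (A := posc 0 f) in *. set (B := negc 0 f) in *.
  destruct (sol_decays M (rho - d / 4) d A B ltac:(lra) DA DB) as [SA SB].
  replace (rho - d / 4 - d / 2) with (rho - 3 / 4 * d) in * by field.
  exists (tseries (sol_pos A) (sol_neg B)), (tseries (dpos (sol_pos A)) (dneg (sol_neg B))).
  set (r := rho - d).
  assert (P := den_pos d ltac:(lra)). assert (M0 := decays_nonneg _ _ _ DA).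
  assert (T : forall z, band (- r) r z -> forall n,
     Cmod (tterm (sol_pos A) (sol_neg B) n z) <= 2 * (M * den d) * exp (- (d / 4)) ^ n).
  { intros z Hz n. replace (d / 4) with (rho - 3 / 4 * d - r) by (unfold r; field).
    apply tterm_summable; auto. unfold r; lra. }
  assert (Hq : 0 <= exp (- (d / 4)) < 1).
  { split; [ left; apply exp_pos | ]. rewrite <- exp_0. apply exp_increasing. lra. }
  split; [ | split; [ | split; [ | split ] ] ].
  - eexists. split; [ apply Rabs_pos | ]. eapply holo_bound_weaken; [ apply Rle_abs | ].
    eapply holo_bound_tseries; [ | exact SA | exact SB ]. unfold r; lra.
  - intros z _. apply tseries_periodic.
  - intros x. change (Series (fun n => Im (tterm (sol_pos A) (sol_neg B) n (RtoC x))) = 0).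
    rewrite (Series_ext _ (fun _ => 0 * 0)); [ rewrite Series_scal_l; ring | ].
    intros n. rewrite Rmult_0_l.
    (* Opposite modes are conjugate, so each term is real on the real axis. *)
    assert (E : sol_neg B n = Cconj (sol_pos A n)).
    { destruct n as [ | n]; [ simpl; apply injective_projections; simpl; ring | ].
      unfold sol_neg, sol_pos. rewrite Cmult_conj, Cinv_conj.
      2: { destruct (small_divisor_inv gamma nu omega d (S n) Hgamma Hnu ltac:(lra) HD ltac:(lia)) as [N _].
           intros E. apply N. now apply Ceq_minus. }
      rewrite Cminus_conj, <- Cexpi_conj_real.
      replace (Cconj 1) with (RtoC 1) by (apply injective_projections; simpl; ring).
      f_equal. unfold B, A, negc, posc. apply fcoef_conj; auto.
      eapply holo_line_Ccont; [ apply holo_mode, Hf | intros; apply band_line; lra ]. }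
    unfold tterm. rewrite E.  rewrite <- !RtoC_mult.
    replace (RtoC (- INR n * x)) with (- RtoC (INR n * x))%C by (rewrite <- RtoC_opp; f_equal; ring).
    rewrite Cexpi_conj_real, <- Cmult_conj, im_plus, im_conj. ring.
  - intros z Hz.
    assert (Hzw : band (- r) r (z + RtoC omega)%C).
    { destruct Hz. split; simpl; rewrite Rplus_0_r; auto. }
    rewrite (fourier_expansion (- rho) rho f f1 0 z); auto; try lra.
    2: { revert Hz. apply symmetric_band_mono; unfold r; lra. }
    unfold tseries. rewrite <- CSeries_minus.
    2: { eapply summable_le; [ apply (T _ Hzw) | now apply ex_series_geom_scal ]. }
    2: { eapply summable_le; [ apply (T _ Hz) | now apply ex_series_geom_scal ]. }
    apply CSeries_ext. intros n. fold A B. unfold tterm.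
    destruct n as [ | n].
    (* Mode [0] drops out of the left side, and it is absent from the right side because [f] has
       zero mean. *)
    + simpl sol_pos. simpl sol_neg. replace (A 0%nat) with (RtoC 0).
      * unfold B, negc. ring.
      * unfold A, posc, fcoef. rewrite <- Havg. apply cavg_ext. intros t. unfold line.
        replace (RtoC (- INR 0) * (t, 0))%C with (RtoC 0) by (apply injective_projections; simpl; ring).
        rewrite Cexpi_0. ring.
    + unfold sol_pos, sol_neg.
      destruct (small_divisor_inv gamma nu omega d (S n) Hgamma Hnu ltac:(lra) HD ltac:(lia)) as [N _].
      set (k := INR (S n)) in *.
      replace (RtoC k * (z + RtoC omega))%C with (RtoC k * z + RtoC (k * omega))%C by (rewrite RtoC_mult; ring).
      replace (RtoC (- k) * (z + RtoC omega))%C with (RtoC (- k) * z + - RtoC (k * omega))%C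
        by (rewrite RtoC_opp, RtoC_mult; ring).
      rewrite !Cexpi_plus.
      assert (N1 : (Cexpi (RtoC (k * omega)) - 1)%C <> RtoC 0) by (intros E; apply N; now apply Ceq_minus).
      assert (N2 : (Cexpi (- RtoC (k * omega)) - 1)%C <> RtoC 0).
      { apply Cmod_gt_0. rewrite Cmod_div_opp. now apply Cmod_gt_0. }
      field. split; auto.
  - intros z Hz. unfold tseries.
    eapply Rle_trans; [ apply (geometric_CSeries_bound _ _ _ Hq (T z Hz)) | ].
    assert (L := one_minus_exp_lower (d / 4) ltac:(lra)).
    apply Rle_trans with (2 * (M * den d) * (8 / d)).
    + unfold Rdiv at 1. apply Rmult_le_compat_l; [ nra | ].
      replace (8 / d) with (/ (d / 4 / 2)) by (field; lra). apply Rinv_le_contravar; lra.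
    + right. unfold den, sol_const. field. split; [ apply Rgt_not_eq, Rpower_pos | lra ].
Qed.

End Cohomology.

(** * Analytic functions of one and two variables *)

(** Pointwise counterpart of [holo], the form in which [C_derive] is computed. *)
Definition cderiv (f : C -> C) (z l : C) : Prop :=
  forall eps, 0 < eps -> exists d, 0 < d /\ forall h, Cmod h < d ->
    Cmod (f (z + h) - f z - h * l)%C <= eps * Cmod h.

Lemma cderiv_is_derive f z l : cderiv f z l -> @is_derive C_AbsRing C_NormedModule f z l.
Proof.
  intros H. split.
  - apply (is_linear_scal_l (K := C_AbsRing) (V := C_NormedModule)).
  - intros x Hx. apply (is_filter_lim_locally_unique (K := C_AbsRing) (V := AbsRing_NormedModule C_AbsRing)) in Hx. subst x.
    intros eps. destruct (H eps (cond_pos eps)) as [d [Hd HH]].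
    exists (mkposreal d Hd). intros w Hw.
    change (Cmod (w - z)%C < d) in Hw.
    change (Cmod ((f w - f z) - (w - z) * l)%C <= eps * Cmod (w - z)%C).
    replace w with (z + (w - z))%C at 1 by ring. now apply HH.
Qed.

Lemma cderiv_C_derive f z l : cderiv f z l -> C_derive f z = l.
Proof. intros H. now apply is_C_derive_unique, cderiv_is_derive. Qed.

Lemma cderiv_of_quadratic f z l (r K : R) :
  0 < r -> (forall h, Cmod h < r -> Cmod (f (z + h) - f z - h * l)%C <= K * Cmod h ^ 2) ->
  cderiv f z l.
Proof.
  intros Hr H eps He. assert (PK : 0 < Rabs K + 1) by (generalize (Rabs_pos K); lra).
  exists (Rmin r (eps / (Rabs K + 1))). split.
  - apply Rmin_glb_lt; [ exact Hr | ]. now apply Rdiv_lt_0_compat.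
  - intros h Hh. assert (H1 := Rmin_l r (eps / (Rabs K + 1))). assert (H2 := Rmin_r r (eps / (Rabs K + 1))).
    eapply Rle_trans; [ apply H; lra | ].
    assert (P := Cmod_ge_0 h). simpl. rewrite Rmult_1_r, <- Rmult_assoc. apply Rmult_le_compat_r; [ exact P | ].
    apply Rle_trans with ((Rabs K + 1) * Cmod h).
    + apply Rmult_le_compat_r; [ exact P | ]. generalize (Rle_abs K); lra.
    + apply Rle_trans with ((Rabs K + 1) * (eps / (Rabs K + 1))); [ | right; field; lra ].
      apply Rmult_le_compat_l; lra.
Qed.

Lemma cderiv_plus f g z k l : cderiv f z k -> cderiv g z l -> cderiv (fun w => f w + g w)%C z (k + l)%C.
Proof.
  intros Hf Hg eps He. destruct (Hf (eps / 2)) as [d1 [P1 H1]]; [ lra | ].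
  destruct (Hg (eps / 2)) as [d2 [P2 H2]]; [ lra | ].
  exists (Rmin d1 d2). split; [ now apply Rmin_glb_lt | ]. intros h Hh.
  assert (L1 := Rmin_l d1 d2). assert (L2 := Rmin_r d1 d2).
  replace (f (z + h) + g (z + h) - (f z + g z) - h * (k + l))%C with
    ((f (z + h) - f z - h * k) + (g (z + h) - g z - h * l))%C by ring.
  replace (eps * Cmod h) with (eps / 2 * Cmod h + eps / 2 * Cmod h) by field.
  apply Cmod_plus_le; [ apply H1 | apply H2 ]; lra.
Qed.

Lemma cderiv_lin c d z : cderiv (fun w => c * w + d)%C z c.
Proof.
  intros eps He. exists 1. split; [ lra | ]. intros h _.
  replace (c * (z + h) + d - (c * z + d) - h * c)%C with (RtoC 0) by ring.
  rewrite Cmod_0. apply Rmult_le_pos; [ lra | apply Cmod_ge_0 ].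
Qed.

Definition dmono (n : nat) (h : C) : C :=
  match n with 0%nat => RtoC 0 | S m => (RtoC (INR (S m)) * h ^ m)%C end.

(** Both bounds are multiplied by powers of [s], which keeps the induction free of divisions. The
    step writes the remainder of degree [n + 1] as [k] times that of degree [n] plus
    [dmono n h * (k - h)^2]. *)
Lemma monomial_taylor (n : nat) (s : R) (h k : C) :
  0 <= s -> Cmod h <= s -> Cmod k <= s ->
  s * Cmod (dmono n h) <= INR n * s ^ n /\
  s ^ 2 * Cmod (k ^ n - h ^ n - (k - h) * dmono n h)%C <= INR n ^ 2 * s ^ n * Cmod (k - h)%C ^ 2.
Proof.
  intros Hs Hh Hk.
  assert (D : forall n, s * Cmod (dmono n h) <= INR n * s ^ n).
  { intros [ | m].
    - unfold dmono. rewrite Cmod_0. simpl. lra.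
    - unfold dmono. rewrite Cmod_mult, Cmod_R, Cmod_pow, Rabs_pos_eq by apply pos_INR.
      simpl (s ^ S m). assert (P := pos_INR (S m)).
      assert (Cmod h ^ m <= s ^ m) by (apply pow_incr; split; [ apply Cmod_ge_0 | exact Hh ]).
      replace (INR (S m) * (s * s ^ m)) with (s * (INR (S m) * s ^ m)) by ring.
      apply Rmult_le_compat_l; [ exact Hs | ]. apply Rmult_le_compat_l; auto. }
  split; [ apply D | ].
  induction n.
  - simpl. replace (1 - 1 - (k - h) * 0)%C with (RtoC 0) by ring. rewrite Cmod_0. lra.
  - replace (k ^ S n - h ^ S n - (k - h) * dmono (S n) h)%C with
      (k * (k ^ n - h ^ n - (k - h) * dmono n h) + dmono n h * ((k - h) * (k - h)))%C.
    + set (w := Cmod (k - h)%C ^ 2) in *.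
      assert (W : 0 <= w) by apply pow2_ge_0.
      apply Rle_trans with (s * (INR n ^ 2 * s ^ n * w) + s * (INR n * s ^ n * w)).
      * eapply Rle_trans; [ apply Rmult_le_compat_l; [ apply pow2_ge_0 | apply Cmod_triangle ] | ].
        rewrite Rmult_plus_distr_l. apply Rplus_le_compat.
        -- rewrite Cmod_mult.
           apply Rle_trans with (s * (s ^ 2 * Cmod (k ^ n - h ^ n - (k - h) * dmono n h)%C)).
           ++ set (x := Cmod (k ^ n - h ^ n - (k - h) * dmono n h)%C).
              assert (0 <= x) by apply Cmod_ge_0.
              replace (s ^ 2 * (Cmod k * x)) with (Cmod k * (s ^ 2 * x)) by ring.
              apply Rmult_le_compat_r; [ apply Rmult_le_pos; auto; apply pow2_ge_0 | exact Hk ].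
           ++ apply Rmult_le_compat_l; auto.
        -- rewrite !Cmod_mult. specialize (D n).
           replace (s ^ 2 * (Cmod (dmono n h) * (Cmod (k - h)%C * Cmod (k - h)%C))) with
             (s * (s * Cmod (dmono n h) * w)) by (unfold w; ring).
           apply Rmult_le_compat_l; auto. apply Rmult_le_compat_r; auto.
      * rewrite S_INR. simpl (s ^ S n).
        assert (0 <= s * s ^ n * w). { apply Rmult_le_pos; auto. apply Rmult_le_pos; auto. now apply pow_le. }
        assert (P := pos_INR n).
        replace (s * (INR n ^ 2 * s ^ n * w) + s * (INR n * s ^ n * w)) with ((INR n ^ 2 + INR n) * (s * s ^ n * w)) by ring.
        replace ((INR n + 1) ^ 2 * (s * s ^ n) * w) with ((INR n + 1) ^ 2 * (s * s ^ n * w)) by ring.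
        apply Rmult_le_compat_r; auto. nra.
    + destruct n as [ | m]; unfold dmono; [ simpl; ring | ].
      rewrite (S_INR (S m)), RtoC_plus, !Cpow_S. ring.
Qed.

Lemma sqr_le_two_pow (n : nat) : INR n ^ 2 <= 4 * 2 ^ n.
Proof.
  assert (W : INR n <= 2 * 2 ^ n / 1 /\ INR n ^ 2 <= 4 * 2 ^ n /\ 2 * INR n + 1 <= 4 * 2 ^ n).
  { induction n. { simpl. lra. }
    rewrite S_INR. simpl (2 ^ S n). destruct IHn as [A [B D]].
    assert (1 <= 2 ^ n) by (apply pow_R1_Rle; lra). simpl in *. repeat split; nra. }
  apply W.
Qed.

(** The coefficients of the derived series satisfy a bound of the same kind, on the radius [r / 2],
    so the argument can be repeated on them and yields second derivatives. *)
Lemma power_series_holo (a : nat -> C) (r M : R) :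
  0 < r -> (forall n, Cmod (a n) * r ^ n <= M) ->
  holo (fun h => Cmod h < r / 4) (fun h => CSeries (fun n => a n * h ^ n)%C)
    (fun h => CSeries (fun n => (a (S n) * RtoC (INR (S n))) * h ^ n)%C) /\
  forall n, Cmod (a (S n) * RtoC (INR (S n)))%C * (r / 2) ^ n <= 4 / r * M.
Proof.
  intros Hr Ha.
  assert (M0 : 0 <= M). { generalize (Ha 0%nat) (Cmod_ge_0 (a 0%nat)). simpl. lra. }
  assert (N2 : forall n, INR n <= 2 * 2 ^ n).
  { induction n; [ simpl; lra | ]. rewrite S_INR. simpl.
    assert (1 <= 2 ^ n) by (apply pow_R1_Rle; lra). lra. }
  split.
  (* The three summands of [K] serve the value, the derivative and the Taylor remainder, in this
     order. *)
  - set (s := r / 4). set (K := 1 + 4 / s + 4 / s ^ 2).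
    assert (Ps : 0 < s) by (unfold s; lra). assert (P2 : 0 < s ^ 2) by (apply pow_lt; lra).
    assert (I1 : 0 < 4 / s) by (apply Rdiv_lt_0_compat; lra).
    assert (I2 : 0 < 4 / s ^ 2) by (apply Rdiv_lt_0_compat; lra).
    assert (HB : holo_bound (Series (fun n => M * K * (1 / 2) ^ n)) (fun h => Cmod h < s)
       (fun h => CSeries (fun n => a n * h ^ n)%C) (fun h => CSeries (fun n => a n * dmono n h)%C)).
    { apply holo_bound_series; [ | apply ex_series_geom_scal; lra ].
      intros n.
      (* On the radius [r / 4] the terms carry [(1 / 4)^n]: one factor [(1 / 2)^n] cancels the [2^n]
         that bounds [n] and [n^2], the other remains for the sum. *)
      assert (As : Cmod (a n) * s ^ n <= M * (1 / 4) ^ n).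
      { replace s with (r * (1 / 4)) by (unfold s; field). rewrite Rpow_mult_distr, <- Rmult_assoc.
        apply Rmult_le_compat_r; [ apply pow_le; lra | auto ]. }
      assert (Q : (1 / 4) ^ n = (1 / 2) ^ n * (1 / 2) ^ n).
      { rewrite <- Rpow_mult_distr. f_equal. field. }
      assert (Q2 : 2 ^ n * (1 / 2) ^ n = 1).
      { rewrite <- Rpow_mult_distr. replace (2 * (1 / 2)) with 1 by field. apply pow1. }
      assert (Hp : 0 < (1 / 2) ^ n) by (apply pow_lt; lra).
      set (p := (1 / 2) ^ n) in *. assert (p <= 1).
      { generalize (pow_incr (1 / 2) 1 n ltac:(lra)). rewrite pow1. auto. }
      assert (A0 := Cmod_ge_0 (a n)). assert (Nn := pos_INR n).
      assert (B1 : INR n * (Cmod (a n) * s ^ n) <= 2 * (M * p)).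
      { specialize (N2 n). apply Rle_trans with (2 * 2 ^ n * (M * (p * p))).
        - apply Rmult_le_compat; auto. apply Rmult_le_pos; auto. apply pow_le; lra. now rewrite <- Q.
        - right. replace (2 * 2 ^ n * (M * (p * p))) with (2 * (2 ^ n * p) * (M * p)) by ring. rewrite Q2; ring. }
      assert (B2 : INR n ^ 2 * (Cmod (a n) * s ^ n) <= 4 * (M * p)).
      { generalize (sqr_le_two_pow n); intros S2. apply Rle_trans with (4 * 2 ^ n * (M * (p * p))).
        - apply Rmult_le_compat; auto. apply pow2_ge_0. apply Rmult_le_pos; auto. apply pow_le; lra. now rewrite <- Q.
        - right. replace (4 * 2 ^ n * (M * (p * p))) with (4 * (2 ^ n * p) * (M * p)) by ring. rewrite Q2; ring. }
      assert (Mp : 0 <= M * p) by (apply Rmult_le_pos; lra).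
      split; [ | split ].
      - intros h Hh. rewrite Cmod_mult, Cmod_pow.
        apply Rle_trans with (Cmod (a n) * s ^ n).
        + apply Rmult_le_compat_l; auto. apply pow_incr; split; [ apply Cmod_ge_0 | lra ].
        + eapply Rle_trans; [ apply As | ]. rewrite Q.
          assert (0 <= M * p * (K - p)) by (apply Rmult_le_pos; [ exact Mp | unfold K; lra ]). lra.
      - intros h Hh. rewrite Cmod_mult.
        destruct (monomial_taylor n s h h) as [D _]; try lra.
        apply Rmult_le_reg_l with s; [ lra | ].
        replace (s * (M * K * p)) with (s * (1 + 4 / s ^ 2) * (M * p) + 4 * (M * p)) by (unfold K; field; lra).
        assert (0 <= s * (1 + 4 / s ^ 2) * (M * p)) by (apply Rmult_le_pos; [ nra | auto ]).
        apply (Rmult_le_compat_l (Cmod (a n))) in D; auto. lra.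
      - intros h k Hh Hk.
        replace (a n * k ^ n - a n * h ^ n - (k - h) * (a n * dmono n h))%C with
          (a n * (k ^ n - h ^ n - (k - h) * dmono n h))%C by ring.
        rewrite Cmod_mult.
        destruct (monomial_taylor n s h k) as [_ D]; try lra.
        apply (Rmult_le_compat_l (Cmod (a n))) in D; auto.
        apply Rmult_le_reg_l with (s ^ 2); [ auto | ].
        assert (W : 0 <= Cmod (k - h)%C ^ 2) by apply pow2_ge_0. set (w := Cmod (k - h)%C ^ 2) in *.
        assert (B3 : INR n ^ 2 * (Cmod (a n) * s ^ n) * w <= 4 * (M * p) * w) by (apply Rmult_le_compat_r; auto).
        replace (s ^ 2 * (M * K * p * w)) with (s ^ 2 * (1 + 4 / s) * (M * p * w) + 4 * (M * p) * w) by (unfold K; field; lra).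
        assert (0 <= s ^ 2 * (1 + 4 / s) * (M * p * w)) by (apply Rmult_le_pos; [ nra | nra ]). lra. }
    exists (Rabs (Series (fun n => M * K * (1 / 2) ^ n))). split; [ apply Rabs_pos | ].
    assert (HB' : holo_bound (Rabs (Series (fun n => M * K * (1 / 2) ^ n))) (fun h => Cmod h < s)
       (fun h => CSeries (fun n => a n * h ^ n)%C) (fun h => CSeries (fun n => a n * dmono n h)%C)).
    { eapply holo_bound_weaken; [ apply Rle_abs | exact HB ]. }
    assert (E : forall h, Cmod h < s -> CSeries (fun n => a n * dmono n h)%C =
       CSeries (fun n => (a (S n) * RtoC (INR (S n))) * h ^ n)%C).
    { intros h Hh. unfold CSeries.
      rewrite (Series_incr_1_aux (fun n => Re (a n * dmono n h)%C)) by (unfold dmono; now rewrite Cmult_0_r).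
      rewrite (Series_incr_1_aux (fun n => Im (a n * dmono n h)%C)) by (unfold dmono; now rewrite Cmult_0_r).
      f_equal; apply Series_ext; intros n; unfold dmono; now rewrite Cmult_assoc. }
    destruct HB' as [H1 [H2 H3]]. split; [ exact H1 | split ].
    + intros h Hh. rewrite <- E; auto.
    + intros h k Hh Hk. rewrite <- E; auto.
  - intros n. rewrite Cmod_mult, Cmod_R, Rabs_pos_eq by apply pos_INR.
    specialize (Ha (S n)). specialize (N2 (S n)). simpl in Ha, N2.
    assert (Hp : 0 < (1 / 2) ^ n) by (apply pow_lt; lra).
    assert (Q2 : 2 ^ n * (1 / 2) ^ n = 1).
    { rewrite <- Rpow_mult_distr. replace (2 * (1 / 2)) with 1 by field. apply pow1. }
    replace (r / 2) with (r * (1 / 2)) by field. rewrite Rpow_mult_distr.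
    set (p := (1 / 2) ^ n) in *.
    apply Rmult_le_reg_l with r; [ exact Hr | ].
    replace (r * (4 / r * M)) with (4 * (2 ^ n * p) * M) by (rewrite Q2; field; lra).
    replace (r * (Cmod (a (S n)) * INR (S n) * (r ^ n * p))) with (INR (S n) * p * (Cmod (a (S n)) * (r * r ^ n))) by ring.
    replace (4 * (2 ^ n * p) * M) with (2 * (2 * 2 ^ n) * p * M) by ring.
    assert (0 <= Cmod (a (S n)) * (r * r ^ n)).
    { apply Rmult_le_pos; [ apply Cmod_ge_0 | ]. apply Rmult_le_pos; [ lra | apply pow_le; lra ]. }
    assert (Nn := pos_INR (S n)).
    apply Rmult_le_compat; auto; [ nra | ]. apply Rmult_le_compat_r; [ lra | exact N2 ].
Qed.

Lemma Ccv_of_filterlim (u : nat -> C) (l : C) :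
  filterlim (T := nat) (U := C_NormedModule) u eventually (locally l) -> Ccv u l.
Proof.
  intros H eps He.
  (* Balls of the uniform structure on the complex numbers are squares; [sqrt 2] compares them with
     discs. *)
  assert (P : 0 < eps / sqrt 2) by (apply Rdiv_lt_0_compat; [ exact He | apply sqrt_lt_R0; lra ]).
  destruct (proj1 (filterlim_locally _ _) H (mkposreal _ P)) as [N HN].
  exists N. intros n Hn. specialize (HN n Hn).
  apply (C_NormedModule_mixin_compat2 l (u n)) in HN. simpl in HN.
  replace (sqrt 2 * (eps / sqrt 2)) with eps in HN; [ exact HN | ].
  field. apply Rgt_not_eq, sqrt_lt_R0; lra.
Qed.

Lemma Ccv_incr_1 u l : Ccv (fun n => u (S n)) l -> Ccv u l.
Proof.
  intros H eps He. destruct (H eps He) as [N HN]. exists (S N). intros [ | n] Hn; [ lia | ].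
  apply HN. lia.
Qed.

Lemma Ccv_csum_of_is_series (a : nat -> C) (l : C) :
  is_series (V := C_NormedModule) a l -> Ccv (csum a) l.
Proof.
  intros H. apply Ccv_incr_1. apply Ccv_ext with (sum_n (G := C_AbelianMonoid) a).
  - intros n. apply csum_sum_n.
  - apply Ccv_of_filterlim. exact H.
Qed.

Lemma eventually_bounded (u : nat -> R) (N : nat) :
  (forall n, (N <= n)%nat -> u n <= 1) -> exists M, forall n, u n <= M.
Proof.
  revert u. induction N; intros u H.
  - exists 1. intros n. apply H. lia.
  - destruct (IHN (fun n => u (S n))) as [M HM]. { intros n Hn. apply H. lia. }
    exists (Rmax M (u 0%nat)). intros [ | n]; [ apply Rmax_r | ].
    eapply Rle_trans; [ apply HM | apply Rmax_l ].
Qed.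

(** Convergence at the single point [r / 2] bounds the terms there, hence gives geometric
    convergence on smaller discs. *)
Lemma analytic_at_coefficients f z :
  @analytic_at C_AbsRing C_NormedModule f z ->
  exists (a : nat -> C) (r M : R), 0 < r /\ (forall n, Cmod (a n) * r ^ n <= M) /\
    forall h, Cmod h < r / 2 -> f (z + h)%C = CSeries (fun n => a n * h ^ n)%C.
Proof.
  intros [a [r [Hr H]]].
  assert (Sr : forall h, Cmod h < r -> Ccv (csum (fun n => a n * h ^ n)%C) (f (z + h)%C)).
  { intros h Hh. apply Ccv_csum_of_is_series.
    eapply is_series_ext; [ | apply (H h Hh) ].
    intros n. rewrite (Cmult_comm (a n)). apply (f_equal (fun w => w * a n)%C (pow_n_Cpow h n)). }
  assert (HB : exists M, forall n, Cmod (a n) * (r / 2) ^ n <= M).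
  { assert (Hh : Cmod (RtoC (r / 2)) < r) by (rewrite Cmod_R, Rabs_pos_eq; lra).
    destruct (Sr _ Hh (1 / 2)) as [N HN]; [ lra | ].
    apply (eventually_bounded _ N). intros n Hn.
    replace (Cmod (a n) * (r / 2) ^ n) with (Cmod (a n * RtoC (r / 2) ^ n)%C).
    - replace (a n * RtoC (r / 2) ^ n)%C with
        ((csum (fun n => a n * RtoC (r / 2) ^ n) (S n) - f (z + RtoC (r / 2)))
          - (csum (fun n => a n * RtoC (r / 2) ^ n) n - f (z + RtoC (r / 2))))%C by (simpl; ring).
      replace 1 with (1 / 2 + 1 / 2) by field.
      apply Cmod_minus_le; left; apply HN; lia.
    - rewrite Cmod_mult, Cmod_pow, Cmod_R, Rabs_pos_eq by lra. reflexivity. }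
  destruct HB as [M HM]. exists a, (r / 2), M. split; [ lra | split; [ exact HM | ] ].
  intros h Hh. apply (Ccv_unique (csum (fun n => a n * h ^ n)%C)); [ apply Sr; lra | ].
  set (q := Cmod h / (r / 2)).
  assert (Hq : 0 <= q <= 1 / 2).
  { unfold q. split; [ apply Rdiv_le_0_compat; [ apply Cmod_ge_0 | lra ] | ].
    apply Rmult_le_reg_r with (r / 2); [ lra | ]. unfold Rdiv at 1. rewrite Rmult_assoc, Rinv_l by lra. lra. }
  assert (T : forall n, Cmod (a n * h ^ n)%C <= M * q ^ n).
  { intros n. rewrite Cmod_mult, Cmod_pow. replace (Cmod h) with (r / 2 * q) by (unfold q; field; lra).
    rewrite Rpow_mult_distr, <- Rmult_assoc. apply Rmult_le_compat_r; [ apply pow_le; lra | auto ]. }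
  apply Ccv_csum_of_is_series.
  apply (is_series_of_geometric _ _ (M / (1 - q)) q); [ lra | ].
  intros n. apply CSeries_geom_tail; auto. lra.
Qed.

Lemma power_series_cderiv (f : C -> C) (z : C) (a : nat -> C) (r M : R) :
  0 < r -> (forall n, Cmod (a n) * r ^ n <= M) ->
  (forall h, Cmod h < r / 2 -> f (z + h)%C = CSeries (fun n => a n * h ^ n)%C) ->
  forall h, Cmod h < r / 8 ->
    cderiv f (z + h)%C (CSeries (fun n => (a (S n) * RtoC (INR (S n))) * h ^ n)%C).
Proof.
  intros Hr Ha Hf h Hh.
  destruct (power_series_holo a r M Hr Ha) as [[B [HB [_ [_ Q]]]] _].
  apply cderiv_of_quadratic with (r / 8) B; [ lra | ]. intros k Hk.
  assert (Hhk : Cmod (h + k)%C < r / 4) by (eapply Rle_lt_trans; [ apply Cmod_triangle | lra ]).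
  rewrite <- Cplus_assoc, !Hf by lra.
  specialize (Q h (h + k)%C ltac:(lra) Hhk). replace (h + k - h)%C with k in Q by ring. exact Q.
Qed.

Lemma analytic_at_cderiv f z :
  @analytic_at C_AbsRing C_NormedModule f z ->
  cderiv f z (C_derive f z) /\ cderiv (C_derive f) z (C_derive (C_derive f) z).
Proof.
  intros H. destruct (analytic_at_coefficients f z H) as [a [r [M [Hr [Ha Hf]]]]].
  assert (D := power_series_cderiv f z a r M Hr Ha Hf).
  set (f1 := fun h => CSeries (fun n => (a (S n) * RtoC (INR (S n))) * h ^ n)%C) in D.
  destruct (power_series_holo a r M Hr Ha) as [_ Ha1].
  assert (E : forall h, Cmod h < r / 8 -> C_derive f (z + h)%C = f1 h).
  { intros h Hh. apply cderiv_C_derive. now apply D. }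
  split.
  - assert (D0 := D 0). rewrite Cmod_0, Cplus_0_r in D0. specialize (D0 ltac:(lra)).
    now rewrite (cderiv_C_derive _ _ _ D0).
  - assert (D1 := power_series_cderiv f1 0 (fun n => a (S n) * RtoC (INR (S n)))%C (r / 2) (4 / r * M)
       ltac:(lra) Ha1).
    specialize (D1 ltac:(intros h _; unfold f1; now rewrite Cplus_0_l) 0).
    rewrite Cmod_0, Cplus_0_r in D1. specialize (D1 ltac:(lra)).
    assert (D2 : cderiv (C_derive f) z (CSeries (fun n => a (S (S n)) * RtoC (INR (S (S n))) * RtoC (INR (S n)) * 0 ^ n)%C)).
    { intros eps He. destruct (D1 eps He) as [d [Hd HH]].
      exists (Rmin d (r / 8)). split; [ apply Rmin_glb_lt; lra | ]. intros h Hh.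
      assert (L1 := Rmin_l d (r / 8)). assert (L2 := Rmin_r d (r / 8)).
      assert (E0 := E 0). rewrite Cmod_0, Cplus_0_r in E0.
      rewrite E, E0 by lra. specialize (HH h ltac:(lra)). rewrite Cplus_0_l in HH. exact HH. }
    now rewrite (cderiv_C_derive _ _ _ D2).
Qed.

Lemma sum_f_R0_term_le (u : nat -> R) (n i : nat) :
  (forall k, 0 <= u k) -> (i <= n)%nat -> u i <= sum_f_R0 u n.
Proof.
  intros Hu. induction n; intros Hi.
  - replace i with 0%nat by lia. simpl; lra.
  - simpl. assert (0 <= sum_f_R0 u n) by (apply cond_pos_sum; auto).
    destruct (Nat.eq_dec i (S n)) as [-> | N]; [ lra | ].
    specialize (IHn ltac:(lia)). generalize (Hu (S n)). lra.
Qed.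

(** Compared with [r^j], every power [k^j] with [j >= 2] carries the factor [(Cmod k / r)^2]; the
    estimate does not depend on the length of the row otherwise than through the sum on the
    right. *)
Lemma row_remainder (u : nat -> C) (k : C) (r : R) (n : nat) :
  0 < r -> Cmod k <= r ->
  Cmod (csum (fun j => u j * k ^ j)%C (S (S n)) - u 0%nat - u 1%nat * k)%C
  <= (Cmod k / r) ^ 2 * sum_f_R0 (fun j => Cmod (u j) * r ^ j) (S n).
Proof.
  intros Hr Hk. set (q := Cmod k / r).
  assert (Hq : 0 <= q <= 1).
  { unfold q. split; [ apply Rdiv_le_0_compat; [ apply Cmod_ge_0 | lra ] | ].
    apply Rmult_le_reg_r with r; [ lra | ]. unfold Rdiv. rewrite Rmult_assoc, Rinv_l by lra. lra. }
  induction n.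
  - simpl csum. replace (0 + u 0%nat * 1 + u 1%nat * (k * 1) - u 0%nat - u 1%nat * k)%C with (RtoC 0) by ring.
    rewrite Cmod_0. apply Rmult_le_pos; [ apply pow2_ge_0 | ].
    apply cond_pos_sum. intros j. apply Rmult_le_pos; [ apply Cmod_ge_0 | apply pow_le; lra ].
  - replace (csum (fun j => u j * k ^ j) (S (S (S n))) - u 0%nat - u 1%nat * k)%C with
      ((csum (fun j => u j * k ^ j) (S (S n)) - u 0%nat - u 1%nat * k) + u (S (S n)) * k ^ (S (S n)))%C
      by (cbn [csum]; ring).
    change (sum_f_R0 (fun j => Cmod (u j) * r ^ j) (S (S n))) with
      (sum_f_R0 (fun j => Cmod (u j) * r ^ j) (S n) + Cmod (u (S (S n))) * r ^ (S (S n))).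
    rewrite Rmult_plus_distr_l. apply Cmod_plus_le; [ exact IHn | ].
    rewrite Cmod_mult, Cmod_pow. replace (Cmod k) with (q * r) by (unfold q; field; lra).
    rewrite Rpow_mult_distr.
    replace (q ^ 2 * (Cmod (u (S (S n))) * r ^ S (S n))) with (Cmod (u (S (S n))) * (q ^ 2 * r ^ S (S n))) by ring.
    apply Rmult_le_compat_l; [ apply Cmod_ge_0 | ]. apply Rmult_le_compat_r; [ apply pow_le; lra | ].
    assert (0 <= q ^ n <= 1).
    { split; [ apply pow_le; lra | ]. generalize (pow_incr q 1 n ltac:(lra)). now rewrite pow1. }
    simpl. rewrite <- Rmult_assoc. assert (0 <= q * q) by nra. nra.
Qed.

Lemma analytic2_at_expansion (f : C -> C -> C) x y :
  @analytic2_at C_AbsRing C_NormedModule f x y ->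
  exists (a : nat -> nat -> C) (r M : R), 0 < r /\
    (forall n, sum_f_R0 (fun i => sum_f_R0 (fun j => Cmod (a i j) * r ^ j) n * r ^ i) n <= M) /\
    forall h k, Cmod h < r -> Cmod k < r ->
      Ccv (fun n => csum (fun i => csum (fun j => a i j * k ^ j) (S n) * h ^ i) (S n))%C (f (x + h)%C (y + k)%C).
Proof.
  intros [a [r [M [Hr [HM H]]]]]. exists a, r, M. split; [ exact Hr | split ].
  - intros n. eapply Rle_trans; [ | apply (HM n) ]. right.
    rewrite sum_n_Reals. apply sum_eq. intros i _. rewrite sum_n_Reals, Rmult_comm, scal_sum.
    apply sum_eq. intros j _. change (norm (a i j)) with (Cmod (a i j)). ring.
  - intros h k Hh Hk. apply Ccv_of_filterlim.
    eapply filterlim_ext; [ | apply (H h k Hh Hk) ].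
    intros n. cbv beta.
    transitivity (csum (fun i => sum_n (G := C_AbelianMonoid) (fun j => (h ^ i * k ^ j) * a i j)%C n) (S n)).
    + rewrite <- csum_sum_n. reflexivity.
    + apply csum_ext. intros i _. rewrite csum_sum_n, Cmult_comm, csum_scal.
      apply csum_ext. intros j _. ring.
Qed.

(** The slices supply the derivatives that [two_variable_taylor] asks for. The third claim is the
    delicate one: the derivative in the second variable is the power series with coefficients
    [a i 1], because the rows minus their linear parts sum to [O(k^2)] uniformly in the number of
    terms. *)
Lemma analytic2_at_slices (f : C -> C -> C) x y :
  @analytic2_at C_AbsRing C_NormedModule f x y ->
  @analytic_at C_AbsRing C_NormedModule (fun z => f z y) x /\
  @analytic_at C_AbsRing C_NormedModule (f x) y /\
  @analytic_at C_AbsRing C_NormedModule (fun z => C_derive (f z) y) x.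
Proof.
  intros H. destruct (analytic2_at_expansion f x y H) as [a [r [M [Hr [HM Hf]]]]].
  assert (Pr : forall j, 0 < r ^ j) by (intros; apply pow_lt; lra).
  assert (Pt : forall i j, 0 <= Cmod (a i j) * r ^ j).
  { intros. apply Rmult_le_pos; [ apply Cmod_ge_0 | left; apply Pr ]. }
  assert (Row : forall n i, 0 <= sum_f_R0 (fun j => Cmod (a i j) * r ^ j) n * r ^ i).
  { intros n i. apply Rmult_le_pos; [ apply cond_pos_sum; auto | left; apply Pr ]. }
  assert (Coef : forall i j, Cmod (a i j) * r ^ j * r ^ i <= M).
  { intros i j. set (n := (i + j)%nat). eapply Rle_trans; [ | apply (HM n) ].
    eapply Rle_trans; [ | apply (sum_f_R0_term_le _ n i); [ apply Row | unfold n; lia ] ].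
    apply Rmult_le_compat_r; [ left; apply Pr | ].
    apply (sum_f_R0_term_le (fun j => Cmod (a i j) * r ^ j)); [ auto | unfold n; lia ]. }
  assert (M0 : 0 <= M).
  { generalize (Coef 0%nat 0%nat) (Pt 0%nat 0%nat). simpl. lra. }
  (* At the argument [0] only the term of index [0] survives, with [0 ^ 0 = 1]. *)
  assert (Row0 : forall u : nat -> C, forall n, csum (fun j => u j * 0 ^ j)%C (S n) = u 0%nat).
  { intros u n. induction n; [ simpl; ring | ].
    change (csum (fun j => u j * 0 ^ j)%C (S n) + u (S n) * 0 ^ S n = u 0%nat)%C. rewrite IHn. simpl. ring. }
  assert (Gen : forall (b : nat -> C) (K : R) (g : C -> C) (w : C), 0 <= K -> (forall n, Cmod (b n) * r ^ n <= K) ->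
     (forall h, Cmod h < r / 2 -> Ccv (csum (fun n => b n * h ^ n)%C) (g (w + h)%C)) ->
     @analytic_at C_AbsRing C_NormedModule g w).
  { intros b K g w K0 Hb Hg. exists b, (r / 2). split; [ lra | ]. intros h Hh.
    change (Cmod h < r / 2) in Hh.
    assert (T : forall n, Cmod (b n * h ^ n)%C <= K * (1 / 2) ^ n).
    { intros n. rewrite Cmod_mult, Cmod_pow. apply Rle_trans with (Cmod (b n) * (r * (1 / 2)) ^ n).
      - apply Rmult_le_compat_l; [ apply Cmod_ge_0 | ]. apply pow_incr; split; [ apply Cmod_ge_0 | lra ].
      - rewrite Rpow_mult_distr, <- Rmult_assoc. apply Rmult_le_compat_r; [ apply pow_le; lra | auto ]. }
    assert (S1 : is_series (V := C_NormedModule) (fun n => b n * h ^ n)%C (CSeries (fun n => b n * h ^ n)%C)).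
    { apply (is_series_of_geometric _ _ (K / (1 - 1 / 2)) (1 / 2)); [ lra | ].
      intros n. apply CSeries_geom_tail; auto. lra. }
    assert (E : CSeries (fun n => b n * h ^ n)%C = g (w + h)%C).
    { apply (Ccv_unique (csum (fun n => b n * h ^ n)%C)); [ now apply Ccv_csum_of_is_series | now apply Hg ]. }
    unfold is_pseries. change (is_series (V := C_NormedModule) (fun k => scal (pow_n h k) (b k)) (g (w + h)%C)).
    rewrite <- E. apply (is_series_ext (V := C_NormedModule) (fun n => b n * h ^ n)%C); [ | exact S1 ].
    intros n. rewrite (Cmult_comm (b n)). symmetry.
    apply (f_equal (fun w => w * b n)%C (pow_n_Cpow h n)). }
  split; [ | split ].
  - apply (Gen (fun i => a i 0%nat) M); auto.
    + intros n. generalize (Coef n 0%nat). simpl. now rewrite Rmult_1_r.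
    + intros h Hh. apply Ccv_incr_1. rewrite <- (Cplus_0_r y).
      eapply Ccv_ext; [ | apply (Hf h 0); [ lra | rewrite Cmod_0; lra ] ].
      intros n. apply csum_ext. intros i _. now rewrite (Row0 (a i)).
  - apply (Gen (fun j => a 0%nat j) M); auto.
    + intros n. generalize (Coef 0%nat n). simpl. now rewrite Rmult_1_r.
    + intros k Hk. apply Ccv_incr_1. rewrite <- (Cplus_0_r x).
      eapply Ccv_ext; [ | apply (Hf 0 k); [ rewrite Cmod_0; lra | lra ] ].
      intros n. apply (Row0 (fun i => csum (fun j => a i j * k ^ j)%C (S n))).
  - set (b := fun i => a i 1%nat).
    assert (Hb : forall n, Cmod (b n) * r ^ n <= M / r).
    { intros n. generalize (Coef n 1%nat). simpl. rewrite Rmult_1_r. intros. unfold b.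
      apply Rmult_le_reg_r with r; [ lra | ]. unfold Rdiv. rewrite (Rmult_assoc M), Rinv_l by lra. lra. }
    assert (Mr : 0 <= M / r) by (apply Rdiv_le_0_compat; lra).
    apply (Gen b (M / r)); auto.
    intros h Hh.
    assert (T : forall n, Cmod (b n * h ^ n)%C <= M / r * (1 / 2) ^ n).
    { intros n. rewrite Cmod_mult, Cmod_pow. apply Rle_trans with (Cmod (b n) * (r * (1 / 2)) ^ n).
      - apply Rmult_le_compat_l; [ apply Cmod_ge_0 | ]. apply pow_incr; split; [ apply Cmod_ge_0 | lra ].
      - rewrite Rpow_mult_distr, <- Rmult_assoc. apply Rmult_le_compat_r; [ apply pow_le; lra | auto ]. }
    assert (S1 : Ccv (csum (fun n => b n * h ^ n)%C) (CSeries (fun n => b n * h ^ n)%C)).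
    { apply Ccv_csum_of_is_series.
      apply (is_series_of_geometric _ _ (M / r / (1 - 1 / 2)) (1 / 2)); [ lra | ].
      intros n. apply CSeries_geom_tail; auto. lra. }
    replace (C_derive (f (x + h)%C) y) with (CSeries (fun n => b n * h ^ n)%C); [ exact S1 | symmetry ].
    apply cderiv_C_derive. apply cderiv_of_quadratic with r (M / r ^ 2); [ exact Hr | ].
    intros k Hk.
    assert (Z0 : Cmod 0 < r) by (rewrite Cmod_0; exact Hr).
    assert (F0 := Hf h 0 ltac:(lra) Z0). rewrite Cplus_0_r in F0.
    assert (Fk := Hf h k ltac:(lra) Hk).
    assert (S2 : Ccv (fun n => csum (fun n => b n * h ^ n)%C (S n)) (CSeries (fun n => b n * h ^ n)%C)).
    { intros eps He. destruct (S1 eps He) as [N HN]. exists N. intros n Hn. apply HN. lia. }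
    assert (L := Ccv_minus _ _ _ _ (Ccv_minus _ _ _ _ Fk F0) (Ccv_scal k _ _ S2)).
    assert (L' : Ccv (fun n => csum (fun i => (csum (fun j => a i j * k ^ j) (S (S n)) - a i 0%nat - a i 1%nat * k) * h ^ i) (S (S n)))%C
       (f (x + h) (y + k) - f (x + h) y - k * CSeries (fun n => b n * h ^ n))%C).
    { intros eps He. destruct (L eps He) as [N HN]. exists N. intros n Hn.
      specialize (HN (S n) ltac:(lia)). cbv beta in HN.
      replace (csum (fun i => (csum (fun j => a i j * k ^ j) (S (S n)) - a i 0%nat - a i 1%nat * k) * h ^ i) (S (S n)))%C with
       (csum (fun i => csum (fun j => a i j * k ^ j) (S (S n)) * h ^ i) (S (S n)) -
         csum (fun i => csum (fun j => a i j * 0 ^ j) (S (S n)) * h ^ i) (S (S n)) -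
         k * csum (fun n => b n * h ^ n) (S (S n)))%C; [ exact HN | ].
      assert (E : forall N m, (csum (fun i => csum (fun j => a i j * k ^ j) (S N) * h ^ i) m -
         csum (fun i => csum (fun j => a i j * 0 ^ j) (S N) * h ^ i) m - k * csum (fun n => b n * h ^ n) m)%C =
         csum (fun i => (csum (fun j => a i j * k ^ j) (S N) - a i 0%nat - a i 1%nat * k) * h ^ i)%C m).
      { intros N' m. induction m as [ | m IH]; [ simpl; ring | ].
        set (p := fun i => csum (fun j => a i j * k ^ j)%C (S N')) in *.
        assert (R0 := Row0 (a m) N').
        set (q := fun i => csum (fun j => a i j * 0 ^ j)%C (S N')) in *. change (q m = a m 0%nat) in R0.
        change ((csum (fun i => p i * h ^ i)%C m + p m * h ^ m) - (csum (fun i => q i * h ^ i)%C m + q m * h ^ m)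
          - k * (csum (fun n => b n * h ^ n)%C m + b m * h ^ m) =
          csum (fun i => (p i - a i 0%nat - a i 1%nat * k) * h ^ i)%C m + (p m - a m 0%nat - a m 1%nat * k) * h ^ m)%C.
        change (csum (fun i => p i * h ^ i)%C m - csum (fun i => q i * h ^ i)%C m - k * csum (fun n => b n * h ^ n)%C m =
          csum (fun i => (p i - a i 0%nat - a i 1%nat * k) * h ^ i)%C m)%C in IH.
        rewrite <- IH, R0. unfold b. ring. }
      apply E. }
    apply (Ccv_bound _ _ _ L'). intros n.
    eapply Rle_trans; [ apply (csum_bound _ (fun i => (Cmod k / r) ^ 2 * (sum_f_R0 (fun j => Cmod (a i j) * r ^ j) (S n) * r ^ i))) | ].
    + intros i _. rewrite <- Rmult_assoc. apply Cmod_mult_le; [ apply row_remainder; lra | ].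
      rewrite Cmod_pow. apply pow_incr. split; [ apply Cmod_ge_0 | lra ].
    + rewrite (sum_eq _ (fun i => (sum_f_R0 (fun j => Cmod (a i j) * r ^ j) (S n) * r ^ i) * (Cmod k / r) ^ 2))
        by (intros; ring).
      rewrite <- scal_sum.
      replace (M / r ^ 2 * Cmod k ^ 2) with ((Cmod k / r) ^ 2 * M) by (field; lra).
      apply Rmult_le_compat_l; [ apply pow2_ge_0 | apply HM ].
Qed.

(** * Taylor estimates *)

Definition convexC (D : C -> Prop) : Prop :=
  forall z w t, D z -> D w -> 0 <= t <= 1 -> D (z + RtoC t * (w - z))%C.

Lemma is_derive_of_taylor (f : R -> R) (t l : R) :
  (forall eps, 0 < eps -> exists d, 0 < d /\ forall s, Rabs s < d ->
     Rabs (f (t + s) - f t - s * l) <= eps * Rabs s) -> is_derive f t l.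
Proof.
  intros H. apply is_derive_Reals. intros eps He.
  destruct (H (eps / 2)) as [d [Hd HH]]; [ lra | ].
  exists (mkposreal d Hd). intros s Hs Hsd. simpl in Hsd. specialize (HH s Hsd).
  assert (P : 0 < Rabs s) by now apply Rabs_pos_lt.
  replace ((f (t + s) - f t) / s - l) with ((f (t + s) - f t - s * l) / s) by (field; auto).
  unfold Rdiv. rewrite Rabs_mult, Rabs_inv.
  apply Rle_lt_trans with (eps / 2); [ | lra ].
  apply Rmult_le_reg_r with (Rabs s); [ exact P | ].
  rewrite Rmult_assoc, Rinv_l by lra. lra.
Qed.

(** Projection onto the direction of [g w - g z], by the factor [u], reduces the complex statement
    to the real mean value theorem. *)
Lemma segment_mvt (g g1 : C -> C) (z w : C) (B : R) :
  (forall t, 0 <= t <= 1 -> cderiv g (z + RtoC t * (w - z))%C (g1 (z + RtoC t * (w - z))%C)) ->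
  (forall t, 0 <= t <= 1 -> Cmod (g1 (z + RtoC t * (w - z))%C) <= B) ->
  Cmod (g w - g z)%C <= B * Cmod (w - z)%C.
Proof.
  intros Hd HB. set (u := Cconj (g w - g z)%C). set (h := (w - z)%C) in *.
  set (phi := fun t : R => Re (u * g (z + RtoC t * h))%C).
  assert (Dphi : forall t, 0 <= t <= 1 -> is_derive phi t (Re (u * (h * g1 (z + RtoC t * h)))%C)).
  { intros t Ht. apply is_derive_of_taylor. intros eps He.
    assert (P1 := Cmod_ge_0 u). assert (P2 := Cmod_ge_0 h).
    set (K := (Cmod u + 1) * (Cmod h + 1)).
    assert (PK : 0 < K) by (unfold K; nra).
    destruct (Hd t Ht (eps / K)) as [d [Pd HH]]; [ now apply Rdiv_lt_0_compat | ].
    exists (d / (Cmod h + 1)). split; [ apply Rdiv_lt_0_compat; lra | ].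
    intros s Hs. unfold phi.
    assert (Hsh : Cmod (RtoC s * h)%C < d).
    { rewrite Cmod_mult, Cmod_R. apply Rle_lt_trans with (Rabs s * (Cmod h + 1)).
      - apply Rmult_le_compat_l; [ apply Rabs_pos | lra ].
      - apply (Rmult_lt_compat_r (Cmod h + 1)) in Hs; [ | lra ].
        replace (d / (Cmod h + 1) * (Cmod h + 1)) with d in Hs by (field; lra). exact Hs. }
    specialize (HH _ Hsh).
    replace (Re (u * g (z + RtoC (t + s) * h))%C - Re (u * g (z + RtoC t * h))%C - s * Re (u * (h * g1 (z + RtoC t * h)))%C)
      with (Re (u * (g ((z + RtoC t * h) + RtoC s * h) - g (z + RtoC t * h) - RtoC s * h * g1 (z + RtoC t * h)))%C).
    - eapply Rle_trans; [ apply re_le_Cmod | ]. rewrite Cmod_mult.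
      apply Rle_trans with (Cmod u * (eps / K * (Rabs s * Cmod h))).
      + apply Rmult_le_compat_l; auto. rewrite Cmod_mult, Cmod_R in HH. exact HH.
      + replace (Cmod u * (eps / K * (Rabs s * Cmod h))) with ((Cmod u * Cmod h) / K * (eps * Rabs s)) by (field; lra).
        rewrite <- (Rmult_1_l (eps * Rabs s)) at 2. apply Rmult_le_compat_r.
        * apply Rmult_le_pos; [ lra | apply Rabs_pos ].
        * apply Rmult_le_reg_r with K; auto. unfold Rdiv. rewrite Rmult_assoc, Rinv_l by lra. unfold K. nra.
    - rewrite RtoC_plus. replace (z + (RtoC t + RtoC s) * h)%C with (z + RtoC t * h + RtoC s * h)%C by ring.
      set (A := g (z + RtoC t * h + RtoC s * h)%C). set (B' := g (z + RtoC t * h)%C). set (G := g1 (z + RtoC t * h)%C).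
      rewrite <- re_scal_l.
      replace (u * (A - B' - RtoC s * h * G))%C with ((u * A + - (u * B')) + - (RtoC s * (u * (h * G))))%C by ring.
      rewrite !re_plus, !re_opp. ring. }
  destruct (MVT_gen phi 0 1 (fun t => Re (u * (h * g1 (z + RtoC t * h)))%C)) as [t [Ht E]].
  - intros t Ht. rewrite Rmin_left, Rmax_right in Ht by lra. apply Dphi. lra.
  - intros t Ht. rewrite Rmin_left, Rmax_right in Ht by lra.
    apply derivable_continuous_pt. exists (Re (u * (h * g1 (z + RtoC t * h)))%C).
    apply is_derive_Reals, Dphi. exact Ht.
  - rewrite Rmin_left, Rmax_right in Ht by lra.
    assert (E1 : phi 1 - phi 0 = Cmod (g w - g z)%C * Cmod (g w - g z)%C).
    { unfold phi. replace (z + RtoC 1 * h)%C with w by (unfold h; ring).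
      replace (z + RtoC 0 * h)%C with z by ring.
      rewrite Cmod_sqr_Re_Im. unfold u.
      replace (Re (Cconj (g w - g z) * g w)%C - Re (Cconj (g w - g z) * g z)%C) with (Re (Cconj (g w - g z) * (g w - g z))%C).
      - rewrite re_mult, re_conj, im_conj. ring.
      - unfold Cminus at 2. rewrite Cmult_plus_distr_l, re_plus.
        replace (Cconj (g w - g z) * - g z)%C with (- (Cconj (g w - g z) * g z))%C by ring.
        rewrite re_opp. ring. }
    destruct (Req_dec (Cmod (g w - g z)%C) 0) as [Z | N].
    { rewrite Z. apply Rmult_le_pos; [ | apply Cmod_ge_0 ].
      generalize (HB 0 ltac:(lra)) (Cmod_ge_0 (g1 (z + RtoC 0 * h)%C)). lra. }
    assert (P : 0 < Cmod (g w - g z)%C) by (generalize (Cmod_ge_0 (g w - g z)%C); lra).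
    apply Rmult_le_reg_l with (Cmod (g w - g z)%C); [ exact P | ].
    rewrite <- E1, E. replace (1 - 0) with 1 by ring. rewrite Rmult_1_r.
    eapply Rle_trans; [ apply Rle_abs | ]. eapply Rle_trans; [ apply re_le_Cmod | ].
    unfold u. rewrite !Cmod_mult, Cmod_conj. specialize (HB t Ht).
    apply Rmult_le_compat_l; [ apply Cmod_ge_0 | ]. rewrite Rmult_comm.
    apply Rmult_le_compat_r; [ apply Cmod_ge_0 | exact HB ].
Qed.

Lemma segment_taylor D (g g1 g2 : C -> C) (z w : C) (B : R) :
  convexC D -> (forall x, D x -> cderiv g x (g1 x)) -> (forall x, D x -> cderiv g1 x (g2 x)) ->
  (forall x, D x -> Cmod (g2 x) <= B) -> D z -> D w ->
  Cmod (g w - g z - (w - z) * g1 z)%C <= B * Cmod (w - z)%C ^ 2.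
Proof.
  intros Cv H1 H2 HB Hz Hw.
  assert (L : forall t, 0 <= t <= 1 -> Cmod (g1 (z + RtoC t * (w - z)) - g1 z)%C <= B * Cmod (w - z)%C).
  { intros t Ht. assert (Dt := Cv z w t Hz Hw Ht).
    eapply Rle_trans; [ apply (segment_mvt g1 g2 z (z + RtoC t * (w - z))%C B) | ].
    - intros s Hs. apply H2. now apply Cv.
    - intros s Hs. apply HB. now apply Cv.
    - replace (z + RtoC t * (w - z) - z)%C with (RtoC t * (w - z))%C by ring.
      rewrite Cmod_mult, Cmod_R, Rabs_pos_eq by lra.
      assert (0 <= B) by (generalize (HB z Hz) (Cmod_ge_0 (g2 z)); lra).
      assert (0 <= B * Cmod (w - z)%C) by (apply Rmult_le_pos; [ auto | apply Cmod_ge_0 ]). nra. }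
  replace (g w - g z - (w - z) * g1 z)%C with ((g w + (- g1 z * w + 0)) - (g z + (- g1 z * z + 0)))%C by ring.
  replace (B * Cmod (w - z)%C ^ 2) with (B * Cmod (w - z)%C * Cmod (w - z)%C) by ring.
  apply (segment_mvt (fun x => g x + (- g1 z * x + 0))%C (fun x => g1 x + - g1 z)%C).
  - intros t Ht. apply cderiv_plus; [ apply H1; now apply Cv | apply cderiv_lin ].
  - intros t Ht. apply L. exact Ht.
Qed.

(** The increment is decomposed along the corner [(z', w)]; this path involves the mixed derivative
    in one order of differentiation only. *)
Lemma two_variable_taylor D1 D2 (f fp fi fpp fii fip : C -> C -> C) (c : R) :
  convexC D1 -> convexC D2 ->
  (forall z w, D1 z -> D2 w -> cderiv (fun x => f x w) z (fp z w)) ->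
  (forall z w, D1 z -> D2 w -> cderiv (fun x => fp x w) z (fpp z w)) ->
  (forall z w, D1 z -> D2 w -> cderiv (f z) w (fi z w)) ->
  (forall z w, D1 z -> D2 w -> cderiv (fi z) w (fii z w)) ->
  (forall z w, D1 z -> D2 w -> cderiv (fun x => fi x w) z (fip z w)) ->
  (forall z w, D1 z -> D2 w -> Cmod (fpp z w) <= c /\ Cmod (fii z w) <= c /\ Cmod (fip z w) <= c) ->
  forall z z' w w', D1 z -> D1 z' -> D2 w -> D2 w' ->
    Cmod (f z' w' - f z w - (z' - z) * fp z w - (w' - w) * fi z w)%C
    <= 2 * c * (Cmod (z' - z)%C ^ 2 + Cmod (w' - w)%C ^ 2).
Proof.
  intros C1 C2 Hp Hpp Hi Hii Hip HB z z' w w' Hz Hz' Hw Hw'.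
  assert (A1 : Cmod (f z' w' - f z' w - (w' - w) * fi z' w)%C <= c * Cmod (w' - w)%C ^ 2).
  { apply (segment_taylor D2 (f z') (fi z') (fii z')); auto. intros; now apply HB. }
  assert (A2 : Cmod (fi z' w - fi z w)%C <= c * Cmod (z' - z)%C).
  { apply (segment_mvt (fun x => fi x w) (fun x => fip x w)); intros t Ht.
    - apply (Hip (z + RtoC t * (z' - z))%C w); auto.
    - apply HB; auto. }
  assert (A3 : Cmod (f z' w - f z w - (z' - z) * fp z w)%C <= c * Cmod (z' - z)%C ^ 2).
  { apply (segment_taylor D1 (fun x => f x w) (fun x => fp x w) (fun x => fpp x w)); auto. intros; now apply HB. }
  replace (f z' w' - f z w - (z' - z) * fp z w - (w' - w) * fi z w)%C with
   ((f z' w' - f z' w - (w' - w) * fi z' w) + (w' - w) * (fi z' w - fi z w) + (f z' w - f z w - (z' - z) * fp z w))%C by ring.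
  eapply Rle_trans.
  { apply Cmod_plus_le; [ apply Cmod_plus_le; [ exact A1 | apply Cmod_mult_le; [ apply Rle_refl | exact A2 ] ] | exact A3 ]. }
  assert (c0 : 0 <= c). { destruct (HB z w Hz Hw) as [Q _]. generalize (Cmod_ge_0 (fpp z w)); lra. }
  set (a := Cmod (z' - z)%C). set (b := Cmod (w' - w)%C).
  assert (0 <= c * (a - b) ^ 2) by (apply Rmult_le_pos; [ auto | apply pow2_ge_0 ]).
  assert (0 <= c * (a ^ 2 + b ^ 2)) by (apply Rmult_le_pos; [ auto | generalize (pow2_ge_0 a) (pow2_ge_0 b); lra ]).
  nra.
Qed.

Lemma convex_lt (a b r t : R) : a < r -> b < r -> 0 <= t <= 1 -> (1 - t) * a + t * b < r.
Proof.
  intros Ha Hb Ht. destruct (Rlt_dec t 1) as [L | L].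
  - assert (0 < (1 - t) * (r - a)) by (apply Rmult_lt_0_compat; lra).
    assert (0 <= t * (r - b)) by (apply Rmult_le_pos; lra). lra.
  - replace t with 1 by lra. lra.
Qed.

Lemma convex_strip rho : convexC (strip rho).
Proof.
  intros z w t Hz Hw Ht. unfold strip in *.
  replace (Im (z + RtoC t * (w - z))%C) with ((1 - t) * Im z + t * Im w).
  - apply Rabs_def2 in Hz. apply Rabs_def2 in Hw. apply Rabs_def1; [ apply convex_lt; lra | ].
    assert (K := convex_lt (- Im z) (- Im w) rho t). lra.
  - rewrite im_plus, im_scal_l. unfold Cminus. rewrite im_plus, im_opp. ring.
Qed.

Lemma convex_cdisc I0 R0 : convexC (cdisc I0 R0).
Proof.
  intros z w t Hz Hw Ht. unfold cdisc in *.
  replace (z + RtoC t * (w - z) - RtoC I0)%C with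
    (RtoC (1 - t) * (z - RtoC I0) + RtoC t * (w - RtoC I0))%C by (rewrite RtoC_minus; ring).
  eapply Rle_lt_trans; [ apply Cmod_triangle | ].
  rewrite !Cmod_mult, !Cmod_R, (Rabs_pos_eq (1 - t)), (Rabs_pos_eq t) by lra. now apply convex_lt.
Qed.

(** * Exactness along loops *)

(** By the chain rule the integrand is the derivative of [V] along the loop, and [V] takes the same
    value at both ends, whether the loop closes up in the plane or after one turn in the angle. *)
Lemma exactness_on_loop (F : R * R -> R * R) (x y x' y' d1 : R -> R) :
  exact_symplectic F ->
  (forall t, is_derive x t (x' t)) -> (forall t, is_derive y t (y' t)) ->
  (forall t, continuous x' t) ->
  (forall t, is_derive (fun s => fst (F (x s, y s))) t (d1 t)) -> (forall t, continuous d1 t) ->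
  (forall t, continuous (fun s => snd (F (x s, y s))) t) ->
  (x (2 * PI) = x 0 \/ x (2 * PI) = x 0 + 2 * PI) -> y (2 * PI) = y 0 ->
  RInt (fun t => snd (F (x t, y t)) * d1 t - y t * x' t) 0 (2 * PI) = 0.
Proof.
  intros [V [HV HF]] Hx Hy Cx Hd Cd CF Ex Ey.
  assert (Cy : forall t, continuous y t).
  { intros t. apply (ex_derive_continuous (V := R_NormedModule)). eexists; apply Hy. }
  assert (HW : forall t, is_derive (fun s => V (x s, y s)) t (snd (F (x t, y t)) * d1 t - y t * x' t)).
  { intros t. destruct (HF (x t, y t)) as [dF [dV [DF [DV E]]]].
    assert (Comp : forall (W : R * R -> R) (dW : R * R -> R),
       filterdiff (K := R_AbsRing) (U := prod_NormedModule R_AbsRing R_NormedModule R_NormedModule) (V := R_NormedModule)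
         W (locally (x t, y t)) dW ->
       is_derive (fun s => W (x s, y s)) t (dW (x' t, y' t))).
    { intros W dW HW.
      assert (A := filterdiff_comp'_2 (K := R_AbsRing) (T := R_NormedModule) (U := R_NormedModule) (V := R_NormedModule) (W := R_NormedModule)
        x y (fun a b => W (a, b)) t _ _ (fun a b => dW (a, b)) (Hx t) (Hy t)).
      assert (B : filterdiff (K := R_AbsRing) (fun p : prod_NormedModule R_AbsRing R_NormedModule R_NormedModule => W (fst p, snd p))
         (locally (x t, y t)) (fun p : prod_NormedModule R_AbsRing R_NormedModule R_NormedModule => dW (fst p, snd p))).
      { apply (filterdiff_ext_lin _ dW); [ apply (filterdiff_ext W); [ | exact HW ] | ]; intros [a b]; reflexivity. }
      specialize (A B). unfold is_derive.
      apply (filterdiff_ext_lin _ _ _ A). intros h. destruct HW as [[_ HL _] _].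
      rewrite <- (HL h (x' t, y' t)). reflexivity. }
    assert (E1 : is_derive (fun s => fst (F (x s, y s))) t (fst (dF (x' t, y' t)))).
    { apply (Comp (fun p => fst (F p)) (fun p => fst (dF p))).
      apply (filterdiff_comp' F (fun q => fst q)); [ exact DF | ].
      apply (filterdiff_linear (fun q : R * R => fst q)). apply is_linear_fst. }
    assert (E2 := Comp V dV DV).
    replace (snd (F (x t, y t)) * d1 t - y t * x' t) with (dV (x' t, y' t)); [ exact E2 | ].
    specialize (E (x' t, y' t)). simpl in E.
    (* [d1] is given as a derivative only; uniqueness of derivatives identifies it with the value of
       the differential. *)
    assert (E3 : fst (dF (x' t, y' t)) = d1 t).
    { rewrite <- (is_derive_unique _ _ _ E1). apply is_derive_unique, Hd. }
    rewrite E3 in E. lra. }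
  apply is_RInt_unique.
  replace 0 with (minus (V (x (2 * PI), y (2 * PI))) (V (x 0, y 0))) at 2.
  - apply (is_RInt_derive (V := R_CompleteNormedModule) (fun s => V (x s, y s))).
    + intros t _. apply HW.
    + intros t _. apply (continuous_minus (fun t => snd (F (x t, y t)) * d1 t) (fun t => y t * x' t)).
      * apply (continuous_mult (fun t => snd (F (x t, y t))) d1); auto.
      * apply (continuous_mult y x'); auto.
  - rewrite Ey. destruct Ex as [-> | ->]; [ | rewrite HV ]; unfold minus, plus, opp; simpl; ring.
Qed.

Lemma holo_is_derive D f f1 (t : R) :
  holo D f f1 -> (forall x : R, D (RtoC x)) ->
  is_derive (fun s : R => Re (f (RtoC s))) t (Re (f1 (RtoC t))).
Proof.
  intros [B [HB [_ [_ Q]]]] HD. apply is_derive_of_taylor. intros eps He.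
  exists (eps / (B + 1)). split; [ apply Rdiv_lt_0_compat; lra | ]. intros s Hs.
  assert (K := Q (RtoC t) (RtoC (t + s)) (HD _) (HD _)).
  replace (RtoC (t + s) - RtoC t)%C with (RtoC s) in K by (rewrite RtoC_plus; ring).
  rewrite Cmod_R in K.
  replace (Re (f (RtoC (t + s))) - Re (f (RtoC t)) - s * Re (f1 (RtoC t))) with
    (Re (f (RtoC (t + s)) - f (RtoC t) - RtoC s * f1 (RtoC t))%C).
  - eapply Rle_trans; [ apply re_le_Cmod | ]. eapply Rle_trans; [ apply K | ].
    assert (P := Rabs_pos s). simpl. rewrite Rmult_1_r, <- Rmult_assoc. apply Rmult_le_compat_r; auto.
    apply Rle_trans with ((B + 1) * Rabs s); [ nra | ].
    apply Rle_trans with ((B + 1) * (eps / (B + 1))); [ | right; field; lra ].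
    apply Rmult_le_compat_l; lra.
  - unfold Cminus. rewrite !re_plus, !re_opp, re_scal_l. ring.
Qed.

Lemma holo_derive_real D f f1 :
  holo D f f1 -> (forall x : R, D (RtoC x)) -> real_on_reals f -> real_on_reals f1.
Proof.
  intros [B [HB [_ [_ Q]]]] HD Hf x.
  apply Rabs_eq_0. apply Rle_antisym; [ | apply Rabs_pos ].
  apply Rabs_zero_of_linear_bound with B. intros s Hs.
  assert (K := Q (RtoC x) (RtoC (x + s)) (HD _) (HD _)).
  replace (RtoC (x + s) - RtoC x)%C with (RtoC s) in K by (rewrite RtoC_plus; ring).
  rewrite Cmod_R, Rabs_pos_eq in K by lra.
  apply Rmult_le_reg_l with s; [ lra | ].
  replace (s * (B * s)) with (B * s ^ 2) by ring.
  eapply Rle_trans; [ | apply K ]. eapply Rle_trans; [ | apply Im_le_Cmod ].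
  unfold Cminus. rewrite !im_plus, !im_opp, im_scal_l, !Hf.
  replace (0 + - 0 + - (s * Im (f1 (RtoC x)))) with (- (s * Im (f1 (RtoC x)))) by ring.
  rewrite Rabs_Ropp, Rabs_mult, (Rabs_pos_eq s) by lra. lra.
Qed.

Lemma cavg_by_parts D f f1 g g1 y :
  holo D f f1 -> holo D g g1 -> periodic_on D f -> periodic_on D g -> (forall t, D (t, y)) ->
  cavg (line y (fun z => f1 z * g z)%C) = (- cavg (line y (fun z => f z * g1 z)%C))%C.
Proof.
  intros Hf Hg Pf Pg HD.
  assert (H := cavg_line_derive D _ _ y (holo_mult _ _ _ _ _ Hf Hg)).
  assert (P : periodic_on D (fun z => f z * g z)%C) by (intros z Hz; now rewrite Pf, Pg).
  specialize (H P HD).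
  assert (Cf := holo_line_Ccont D f f1 y Hf HD). assert (Cf1 := holo_line_Ccont1 D f f1 y Hf HD).
  assert (Cg := holo_line_Ccont D g g1 y Hg HD). assert (Cg1 := holo_line_Ccont1 D g g1 y Hg HD).
  assert (E := cavg_plus (line y (fun z => f1 z * g z)%C) (line y (fun z => f z * g1 z)%C)
    (Ccont_mult (line y f1) (line y g) Cf1 Cg) (Ccont_mult (line y f) (line y g1) Cf Cg1)).
  change (cavg (line y (fun z => f1 z * g z + f z * g1 z)%C) =
    (cavg (line y (fun z => f1 z * g z)%C) + cavg (line y (fun z => f z * g1 z)%C))%C) in E.
  rewrite H in E.
  replace (cavg (line y (fun z => f1 z * g z)%C)) with
    ((cavg (line y (fun z => f1 z * g z)%C) + cavg (line y (fun z => f z * g1 z)%C)) - cavg (line y (fun z => f z * g1 z)%C))%C by ring.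
  rewrite <- E. ring.
Qed.

(** * Complex cosine and sine *)

Definition Ccos (z : C) : C := ((Cexpi (RtoC 1 * z) + Cexpi (RtoC (- 1) * z)) * RtoC (/ 2))%C.
Definition Csin (z : C) : C := ((Cexpi (RtoC 1 * z) - Cexpi (RtoC (- 1) * z)) * (- Ci * RtoC (/ 2)))%C.

Lemma Ci_sqr : (Ci * Ci = - (1))%C.
Proof. apply injective_projections; simpl; ring. Qed.

Lemma holo_Ccos a b : holo (band a b) Ccos (fun z => - Csin z)%C.
Proof.
  eapply holo_ext; [ | | apply (holo_scal _ (RtoC (/ 2)) _ _
    (holo_plus _ _ _ _ _ (holo_Cexpi_scal 1 a b) (holo_Cexpi_scal (-1) a b))) ].
  - intros z _. unfold Ccos. ring.
  - intros z _. unfold Csin. cbv beta.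
    replace (RtoC (- 1)) with (- (1))%C at 2 by (rewrite <- RtoC_opp; f_equal; ring). ring.
Qed.

Lemma holo_Csin a b : holo (band a b) Csin Ccos.
Proof.
  eapply holo_ext; [ | | apply (holo_scal _ (- Ci * RtoC (/ 2))%C _ _
    (holo_minus _ _ _ _ _ (holo_Cexpi_scal 1 a b) (holo_Cexpi_scal (-1) a b))) ].
  - intros z _. unfold Csin. ring.
  - intros z _. unfold Ccos. cbv beta.
    replace (RtoC (- 1)) with (- (1))%C at 2 by (rewrite <- RtoC_opp; f_equal; ring).
    match goal with |- (?l = (?u + ?v) * ?w)%C =>
      transitivity (- (Ci * Ci) * ((u + v) * w))%C; [ ring | rewrite Ci_sqr; ring ] end.
Qed.

Lemma Ccos_real (x : R) : Ccos (RtoC x) = RtoC (cos x).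
Proof.
  unfold Ccos, Cexpi. rewrite !im_scal_l, !re_scal_l. simpl.
  rewrite !Rmult_0_r, !Ropp_0, exp_0, !Rmult_1_l. replace (-1 * x) with (- x) by ring.
  rewrite cos_neg, sin_neg. apply injective_projections; simpl; field.
Qed.

Lemma Csin_real (x : R) : Csin (RtoC x) = RtoC (sin x).
Proof.
  unfold Csin, Cexpi. rewrite !im_scal_l, !re_scal_l. simpl.
  rewrite !Rmult_0_r, !Ropp_0, exp_0, !Rmult_1_l. replace (-1 * x) with (- x) by ring.
  rewrite cos_neg, sin_neg. apply injective_projections; simpl; field.
Qed.

Lemma Ccos_periodic z : Ccos (z + RtoC (2 * PI))%C = Ccos z.
Proof.
  unfold Ccos. assert (H1 := integer_freq_INR 1 z). assert (H2 := integer_freq_opp_INR 1 z).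
  change (INR 1) with 1 in H1, H2. change (Ropp 1) with (IZR (-1)) in H2. now rewrite H1, H2.
Qed.

Lemma Csin_periodic z : Csin (z + RtoC (2 * PI))%C = Csin z.
Proof.
  unfold Csin. assert (H1 := integer_freq_INR 1 z). assert (H2 := integer_freq_opp_INR 1 z).
  change (INR 1) with 1 in H1, H2. change (Ropp 1) with (IZR (-1)) in H2. now rewrite H1, H2.
Qed.

Lemma Ccos_Csin_bound z : band (-1) 1 z -> Cmod (Ccos z) <= 3 /\ Cmod (Csin z) <= 3.
Proof.
  intros [H1 H2].
  assert (E : forall s, Rabs s = 1 -> Cmod (Cexpi (RtoC s * z)) <= 3).
  { intros s Hs. rewrite Cmod_Cexpi, im_scal_l. eapply Rle_trans; [ | apply exp_le_3 ].
    assert (K : - (s * Im z) <= 1).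
    { eapply Rle_trans; [ apply Rle_abs | ]. rewrite Rabs_Ropp, Rabs_mult, Hs.
      rewrite Rmult_1_l. apply Rabs_le. lra. }
    destruct K as [K | ->]; [ left; now apply exp_increasing | lra ]. }
  assert (E1 := E 1 Rabs_R1). assert (E2 := E (-1) ltac:(rewrite Rabs_left; lra)).
  split; unfold Ccos, Csin.
  - eapply Rle_trans; [ apply Cmod_mult_le; [ apply Cmod_plus_le; [ exact E1 | exact E2 ] | apply Rle_refl ] | ].
    rewrite Cmod_R, Rabs_pos_eq; lra.
  - eapply Rle_trans; [ apply Cmod_mult_le; [ apply Cmod_minus_le; [ exact E1 | exact E2 ] | apply Rle_refl ] | ].
    rewrite Cmod_mult, Cmod_opp, Cmod_Ci, Cmod_R, Rabs_pos_eq; lra.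
Qed.

Lemma cavg_trig :
  cavg (fun t => RtoC (cos t * cos t)) = RtoC (/ 2) /\
  cavg (fun t => RtoC (sin t * sin t)) = RtoC (/ 2) /\
  cavg (fun t => RtoC (sin t * cos t)) = RtoC 0.
Proof.
  assert (E : forall t, ex 2 t = (RtoC (cos t * cos t - sin t * sin t) + Ci * RtoC (2 * (sin t * cos t)))%C).
  { intros t. rewrite ex_E. unfold Cexpi. rewrite im_scal_l, re_scal_l. simpl Im. simpl Re.
    rewrite Rmult_0_r, Ropp_0, exp_0. simpl INR. replace ((1 + 1) * t) with (2 * t) by ring.
    rewrite cos_2a, sin_2a. apply injective_projections; simpl; ring. }
  assert (E' : forall t, exm 2 t = (RtoC (cos t * cos t - sin t * sin t) - Ci * RtoC (2 * (sin t * cos t)))%C).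
  { intros t. rewrite exm_E. unfold Cexpi. rewrite im_scal_l, re_scal_l. simpl Im. simpl Re.
    rewrite Rmult_0_r, Ropp_0, exp_0. simpl INR. replace (- (1 + 1) * t) with (- (2 * t)) by ring.
    rewrite cos_neg, sin_neg, cos_2a, sin_2a. apply injective_projections; simpl; ring. }
  assert (X : cavg (fun t => ex 2 t + exm 2 t)%C = RtoC 0).
  { rewrite (cavg_plus (ex 2) (exm 2)), cavg_ex, cavg_exm by ccont. ring. }
  assert (Y : cavg (fun t => ex 2 t - exm 2 t)%C = RtoC 0).
  { rewrite (cavg_minus (ex 2) (exm 2)), cavg_ex, cavg_exm by ccont. ring. }
  assert (CP : Ccont (fun t => ex 2 t + exm 2 t)%C) by ccont.
  assert (CM : Ccont (fun t => ex 2 t - exm 2 t)%C) by ccont.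
  assert (U : forall t, cos t * cos t + sin t * sin t = 1).
  { intros t. generalize (sin2_cos2 t). unfold Rsqr. lra. }
  split; [ | split ].
  - rewrite (cavg_ext _ (fun t => RtoC (/ 2) + RtoC (/ 4) * (ex 2 t + exm 2 t))%C).
    + rewrite (cavg_plus (fun _ => RtoC (/ 2)) (fun t => RtoC (/ 4) * (ex 2 t + exm 2 t))%C);
        [ | apply Ccont_const | now apply Ccont_scal ].
      rewrite cavg_const, (cavg_scal (RtoC (/ 4)) (fun t => ex 2 t + exm 2 t)%C), X by exact CP. ring.
    + intros t. rewrite E, E'. specialize (U t). apply injective_projections; simpl; [ | ring ].
      replace (sin t * sin t) with (1 - cos t * cos t) by lra. field.
  - rewrite (cavg_ext _ (fun t => RtoC (/ 2) + RtoC (- / 4) * (ex 2 t + exm 2 t))%C).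
    + rewrite (cavg_plus (fun _ => RtoC (/ 2)) (fun t => RtoC (- / 4) * (ex 2 t + exm 2 t))%C);
        [ | apply Ccont_const | now apply Ccont_scal ].
      rewrite cavg_const, (cavg_scal (RtoC (- / 4)) (fun t => ex 2 t + exm 2 t)%C), X by exact CP. ring.
    + intros t. rewrite E, E'. specialize (U t). apply injective_projections; simpl; [ | ring ].
      replace (cos t * cos t) with (1 - sin t * sin t) by lra. field.
  - rewrite (cavg_ext _ (fun t => (- Ci * RtoC (/ 4)) * (ex 2 t - exm 2 t))%C).
    + rewrite (cavg_scal (- Ci * RtoC (/ 4))%C (fun t => ex 2 t - exm 2 t)%C), Y by exact CM. ring.
    + intros t. rewrite E, E'. apply injective_projections; simpl; field.
Qed.

(** [kap] is the degree in the angle: [1] for curves winding around the annulus,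
    [0] for contractible loops. *)
Lemma holo_comp2 (D D1 D2 : C -> Prop) (g p q : C -> C -> C) (L B : R) (kap : C) U U1 V V1 :
  (forall z z' w w', D1 z -> D1 z' -> D2 w -> D2 w' ->
    Cmod (g z' w' - g z w - (z' - z) * p z w - (w' - w) * q z w)%C
    <= L * (Cmod (z' - z)%C ^ 2 + Cmod (w' - w)%C ^ 2)) ->
  (forall z w, D1 z -> D2 w -> Cmod (g z w) <= B /\ Cmod (p z w) <= B /\ Cmod (q z w) <= B) ->
  holo D U U1 -> holo D V V1 ->
  (forall z, D z -> D1 (kap * z + U z)%C /\ D2 (V z)) ->
  holo D (fun z => g (kap * z + U z) (V z))%C
    (fun z => p (kap * z + U z) (V z) * (kap + U1 z) + q (kap * z + U z) (V z) * V1 z)%C.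
Proof.
  intros HQ HB HU HV HD.
  destruct (holo_bound2 _ _ _ _ _ HU HV) as [A [HA [BU BV]]].
  pose proof BU as [U0 [U1' U2]]. pose proof BV as [V0 [V1' V2]].
  set (k := Cmod kap). assert (Hk : 0 <= k) by apply Cmod_ge_0.
  set (B' := Rabs B). set (L' := Rabs L).
  assert (HB0 : 0 <= B') by apply Rabs_pos. assert (HL0 : 0 <= L') by apply Rabs_pos.
  assert (B1 := Rle_abs B). assert (L1 := Rle_abs L). fold B' in B1. fold L' in L1.
  assert (Lip : forall z w, D z -> D w -> Cmod ((kap * w + U w) - (kap * z + U z))%C <= (k + 2 * A) * Cmod (w - z)%C).
  { intros z w Hz Hw. replace ((kap * w + U w) - (kap * z + U z))%C with (kap * (w - z) + (U w - U z))%C by ring.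
    rewrite Rmult_plus_distr_r. apply Cmod_plus_le.
    - rewrite Cmod_mult. fold k. lra.
    - apply (holo_bound_lipschitz A D U U1); auto. }
  exists (B' + B' * (k + A) + B' * A + (L' * ((k + 2 * A) ^ 2 + (2 * A) ^ 2) + B' * A + B' * A)).
  assert (P1 : 0 <= B' * (k + A)) by (apply Rmult_le_pos; lra).
  assert (P2 : 0 <= B' * A) by (apply Rmult_le_pos; lra).
  assert (P3 : 0 <= L' * ((k + 2 * A) ^ 2 + (2 * A) ^ 2)).
  { apply Rmult_le_pos; auto. generalize (pow2_ge_0 (k + 2 * A)) (pow2_ge_0 (2 * A)). lra. }
  split; [ lra | split; [ | split ] ].
  - intros z Hz. destruct (HD z Hz) as [d1 d2]. destruct (HB _ _ d1 d2) as [b1 _]. lra.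
  - intros z Hz. destruct (HD z Hz) as [d1 d2]. destruct (HB _ _ d1 d2) as [_ [b2 b3]].
    eapply Rle_trans.
    { apply Cmod_plus_le; apply Cmod_mult_le.
      - eapply Rle_trans; [ exact b2 | exact B1 ].
      - apply Cmod_plus_le; [ apply Rle_refl | apply U1'; auto ].
      - eapply Rle_trans; [ exact b3 | exact B1 ].
      - apply V1'; auto. }
    fold k. lra.
  - intros z w Hz Hw. destruct (HD z Hz) as [d1 d2]. destruct (HD w Hw) as [e1 e2].
    destruct (HB _ _ d1 d2) as [_ [b2 b3]].
    specialize (HQ _ _ _ _ d1 e1 d2 e2).
    set (gz := g (kap * z + U z)%C (V z)) in *. set (gw := g (kap * w + U w)%C (V w)) in *.
    set (pz := p (kap * z + U z)%C (V z)) in *. set (qz := q (kap * z + U z)%C (V z)) in *.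
    replace (gw - gz - (w - z) * (pz * (kap + U1 z) + qz * V1 z))%C with
      ((gw - gz - (kap * w + U w - (kap * z + U z)) * pz - (V w - V z) * qz)
       + pz * (U w - U z - (w - z) * U1 z) + qz * (V w - V z - (w - z) * V1 z))%C by ring.
    assert (h0 : 0 <= Cmod (w - z)%C ^ 2) by apply pow2_ge_0.
    eapply Rle_trans.
    { apply Cmod_plus_le; [ apply Cmod_plus_le | ].
      - eapply Rle_trans; [ exact HQ | ].
        apply Rle_trans with (L' * ((k + 2 * A) ^ 2 + (2 * A) ^ 2) * Cmod (w - z)%C ^ 2); [ | apply Rle_refl ].
        rewrite Rmult_assoc.
        assert (S1 : Cmod ((kap * w + U w) - (kap * z + U z))%C ^ 2 <= (k + 2 * A) ^ 2 * Cmod (w - z)%C ^ 2).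
        { rewrite <- Rpow_mult_distr. apply pow_incr. split; [ apply Cmod_ge_0 | auto ]. }
        assert (S2 : Cmod (V w - V z)%C ^ 2 <= (2 * A) ^ 2 * Cmod (w - z)%C ^ 2).
        { rewrite <- Rpow_mult_distr. apply pow_incr. split; [ apply Cmod_ge_0 | ].
          apply (holo_bound_lipschitz A D V V1); auto. }
        match goal with |- L * ?X <= _ => assert (0 <= X) by
          (generalize (pow2_ge_0 (Cmod ((kap * w + U w) - (kap * z + U z))%C)) (pow2_ge_0 (Cmod (V w - V z)%C)); lra);
          apply Rle_trans with (L' * X); [ apply Rmult_le_compat_r; auto | ] end.
        apply Rmult_le_compat_l; auto. lra.
      - apply Cmod_mult_le; [ eapply Rle_trans; [ exact b2 | exact B1 ] | apply U2; auto ].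
      - apply Cmod_mult_le; [ eapply Rle_trans; [ exact b3 | exact B1 ] | apply V2; auto ]. }
    assert (0 <= B' * Cmod (w - z)%C ^ 2) by (apply Rmult_le_pos; auto).
    assert (0 <= B' * (k + A) * Cmod (w - z)%C ^ 2) by (apply Rmult_le_pos; auto).
    assert (0 <= B' * A * Cmod (w - z)%C ^ 2) by (apply Rmult_le_pos; auto). lra.
Qed.

Lemma RtoC_Re (z : C) : Im z = 0 -> z = RtoC (Re z).
Proof. destruct z as [x y]; simpl. now intros ->. Qed.

Lemma cdisc_real (I0 R0 y : R) : cdisc I0 R0 (RtoC y) -> Rabs (y - I0) < R0.
Proof. unfold cdisc. rewrite <- RtoC_minus, Cmod_R. auto. Qed.

(** For [kap = 1] the angle advances by a full period and the periodicity of [g] is used; for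
    [kap = 0] it returns to its value. *)
Lemma displacement_periodic (rho0 I0 R0 : R) (D : C -> Prop) (kap : R) (g : C -> C -> C) U V :
  (forall z w, strip rho0 z -> cdisc I0 R0 w -> g (z + RtoC (2 * PI))%C w = g z w) ->
  kap = 0 \/ kap = 1 -> periodic_on D U -> periodic_on D V ->
  (forall z, D z -> strip rho0 (RtoC kap * z + U z)%C /\ cdisc I0 R0 (V z)) ->
  periodic_on D (fun z => g (RtoC kap * z + U z) (V z))%C.
Proof.
  intros Hg Hk PU PV HD z Hz. rewrite PU, PV by exact Hz.
  destruct (HD z Hz). destruct Hk as [-> | ->].
  - f_equal. ring.
  - replace (RtoC 1 * (z + RtoC (2 * PI)) + U z)%C with (RtoC 1 * z + U z + RtoC (2 * PI))%C by ring.
    now apply Hg.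
Qed.

(** * Exact symplectic maps *)

(** [g1, g2] are the displacements of the two components of the complexified map,
    [pi, qi] their partial derivatives in angle and action. *)
Record exact_map (F : R * R -> R * R) (rho0 I0 R0 L B : R) (g1 g2 p1 q1 p2 q2 : C -> C -> C) : Prop := {
  em_taylor1 : forall z z' w w', strip rho0 z -> strip rho0 z' -> cdisc I0 R0 w -> cdisc I0 R0 w' ->
    Cmod (g1 z' w' - g1 z w - (z' - z) * p1 z w - (w' - w) * q1 z w)%C
      <= L * (Cmod (z' - z)%C ^ 2 + Cmod (w' - w)%C ^ 2);
  em_taylor2 : forall z z' w w', strip rho0 z -> strip rho0 z' -> cdisc I0 R0 w -> cdisc I0 R0 w' ->
    Cmod (g2 z' w' - g2 z w - (z' - z) * p2 z w - (w' - w) * q2 z w)%C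
      <= L * (Cmod (z' - z)%C ^ 2 + Cmod (w' - w)%C ^ 2);
  em_bound1 : forall z w, strip rho0 z -> cdisc I0 R0 w ->
    Cmod (g1 z w) <= B /\ Cmod (p1 z w) <= B /\ Cmod (q1 z w) <= B;
  em_bound2 : forall z w, strip rho0 z -> cdisc I0 R0 w ->
    Cmod (g2 z w) <= B /\ Cmod (p2 z w) <= B /\ Cmod (q2 z w) <= B;
  em_periodic1 : forall z w, strip rho0 z -> cdisc I0 R0 w -> g1 (z + RtoC (2 * PI))%C w = g1 z w;
  em_periodic2 : forall z w, strip rho0 z -> cdisc I0 R0 w -> g2 (z + RtoC (2 * PI))%C w = g2 z w;
  em_real1 : forall x y : R, Rabs (y - I0) < R0 -> g1 (RtoC x) (RtoC y) = RtoC (fst (F (x, y)) - x);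
  em_real2 : forall x y : R, Rabs (y - I0) < R0 -> g2 (RtoC x) (RtoC y) = RtoC (snd (F (x, y)) - y);
  em_exact : exact_symplectic F
}.
Arguments em_taylor1 {_ _ _ _ _ _ _ _ _ _ _ _} _.
Arguments em_taylor2 {_ _ _ _ _ _ _ _ _ _ _ _} _.
Arguments em_bound1 {_ _ _ _ _ _ _ _ _ _ _ _} _.
Arguments em_bound2 {_ _ _ _ _ _ _ _ _ _ _ _} _.
Arguments em_periodic1 {_ _ _ _ _ _ _ _ _ _ _ _} _.
Arguments em_periodic2 {_ _ _ _ _ _ _ _ _ _ _ _} _.
Arguments em_real1 {_ _ _ _ _ _ _ _ _ _ _ _} _.
Arguments em_real2 {_ _ _ _ _ _ _ _ _ _ _ _} _.
Arguments em_exact {_ _ _ _ _ _ _ _ _ _ _ _} _.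

Section ExactMap.

Variables (F : R * R -> R * R) (rho0 I0 R0 L B : R) (g1 g2 p1 q1 p2 q2 : C -> C -> C).
Hypothesis EM : exact_map F rho0 I0 R0 L B g1 g2 p1 q1 p2 q2.

Let taylor1 := em_taylor1 EM.
Let taylor2 := em_taylor2 EM.
Let bound1 := em_bound1 EM.
Let bound2 := em_bound2 EM.
Let periodic1 := em_periodic1 EM.
Let periodic2 := em_periodic2 EM.
Let real1 := em_real1 EM.
Let real2 := em_real2 EM.
Let exact := em_exact EM.

(** The identity [exactness_on_loop] rewritten with the complexified displacements, where averages
    can be integrated by parts. Along the real axis every function involved is real, so the average
    equals the real integral. *)
Lemma loop_average r kap U U1 V V1 :
  0 < r -> kap = 0 \/ kap = 1 ->
  holo (band (- r) r) U U1 -> holo (band (- r) r) V V1 ->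
  real_on_reals U -> real_on_reals V ->
  periodic_on (band (- r) r) U -> periodic_on (band (- r) r) V ->
  (forall z, band (- r) r z -> strip rho0 (RtoC kap * z + U z)%C /\ cdisc I0 R0 (V z)) ->
  cavg (line 0 (fun z => (V z + g2 (RtoC kap * z + U z) (V z)) *
     ((RtoC kap + U1 z) + (p1 (RtoC kap * z + U z) (V z) * (RtoC kap + U1 z) + q1 (RtoC kap * z + U z) (V z) * V1 z))
     - V z * (RtoC kap + U1 z))%C) = RtoC 0.
Proof.
  intros Hr Hk HU HV RU RV PU PV HD.
  set (D := band (- r) r) in *.
  assert (DR : forall x : R, D (RtoC x)) by (intros x; split; simpl; lra).
  assert (DL : forall x : R, D (x, 0)) by (intros x; split; simpl; lra).
  assert (H1 := holo_comp2 D (strip rho0) (cdisc I0 R0) g1 p1 q1 L B (RtoC kap) U U1 V V1 taylor1 bound1 HU HV HD).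
  assert (H2 := holo_comp2 D (strip rho0) (cdisc I0 R0) g2 p2 q2 L B (RtoC kap) U U1 V V1 taylor2 bound2 HU HV HD).
  set (G1 := fun z => g1 (RtoC kap * z + U z)%C (V z)) in *.
  set (G2 := fun z => g2 (RtoC kap * z + U z)%C (V z)) in *.
  set (G1' := fun z => (p1 (RtoC kap * z + U z)%C (V z) * (RtoC kap + U1 z) + q1 (RtoC kap * z + U z)%C (V z) * V1 z)%C) in *.
  set (G2' := fun z => (p2 (RtoC kap * z + U z)%C (V z) * (RtoC kap + U1 z) + q2 (RtoC kap * z + U z)%C (V z) * V1 z)%C) in *.
  change (cavg (line 0 (fun z => (V z + G2 z) * ((RtoC kap + U1 z) + G1' z) - V z * (RtoC kap + U1 z))%C) = RtoC 0).
  set (x := fun t : R => kap * t + Re (U (RtoC t))). set (y := fun t : R => Re (V (RtoC t))).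
  assert (EU : forall t : R, (RtoC kap * RtoC t + U (RtoC t))%C = RtoC (x t)).
  { intros t. unfold x. rewrite RtoC_plus, RtoC_mult, <- RtoC_Re; auto. }
  assert (EV : forall t : R, V (RtoC t) = RtoC (y t)) by (intros t; apply RtoC_Re, RV).
  assert (Hy : forall t, Rabs (y t - I0) < R0).
  { intros t. apply (cdisc_real I0 R0). rewrite <- EV. apply HD, DR. }
  assert (E1 : forall t : R, G1 (RtoC t) = RtoC (fst (F (x t, y t)) - x t)).
  { intros t. unfold G1. rewrite EU, EV. apply real1, Hy. }
  assert (E2 : forall t : R, G2 (RtoC t) = RtoC (snd (F (x t, y t)) - y t)).
  { intros t. unfold G2. rewrite EU, EV. apply real2, Hy. }
  assert (R1 : real_on_reals G1) by (intros t; now rewrite E1).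
  assert (R2 : real_on_reals G2) by (intros t; now rewrite E2).
  assert (R1' := holo_derive_real D G1 G1' H1 DR R1).
  assert (RU' := holo_derive_real D U U1 HU DR RU).
  assert (Cm : forall f : C -> C, Ccont (line 0 f) -> forall t, continuous (fun s : R => Re (f (RtoC s))) t).
  { intros f Hf t. apply Hf. }
  assert (CU1 := Cm U1 (holo_line_Ccont1 D U U1 0 HU DL)).
  assert (CV := Cm V (holo_line_Ccont D V V1 0 HV DL)).
  assert (CG2 := Cm G2 (holo_line_Ccont D G2 G2' 0 H2 DL)).
  assert (CG1' := Cm G1' (holo_line_Ccont1 D G1 G1' 0 H1 DL)).
  assert (Ex := exactness_on_loop F x y (fun t => kap + Re (U1 (RtoC t))) (fun t => Re (V1 (RtoC t)))
     (fun t => kap + Re (U1 (RtoC t)) + Re (G1' (RtoC t))) exact).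
  assert (Ex' : RInt (fun t => snd (F (x t, y t)) * (kap + Re (U1 (RtoC t)) + Re (G1' (RtoC t))) - y t * (kap + Re (U1 (RtoC t)))) 0 (2 * PI) = 0).
  { assert (Dx : forall t, is_derive x t (kap + Re (U1 (RtoC t)))).
    { intros t. unfold x. apply (is_derive_plus (fun t => kap * t) (fun t => Re (U (RtoC t)))).
      - auto_derive; [ auto | ring ].
      - apply (holo_is_derive D); auto. }
    apply Ex; clear Ex.
    - exact Dx.
    - intros t. apply (holo_is_derive D); auto.
    - intros t. apply (continuous_plus (fun _ => kap)); [ apply continuous_const | apply CU1 ].
    - intros t. apply (is_derive_ext (fun s => x s + Re (G1 (RtoC s)))).
      + intros s. rewrite E1. simpl. lra.
      + apply (is_derive_plus x (fun s => Re (G1 (RtoC s)))); [ apply Dx | apply (holo_is_derive D); auto ].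
    - intros t. apply (continuous_plus (fun t => kap + Re (U1 (RtoC t))) (fun t => Re (G1' (RtoC t)))); [ | apply CG1' ].
      apply (continuous_plus (fun _ => kap)); [ apply continuous_const | apply CU1 ].
    - intros t. apply (continuous_ext (fun s => y s + Re (G2 (RtoC s)))).
      + intros s. rewrite E2. simpl. lra.
      + apply (continuous_plus y (fun s => Re (G2 (RtoC s)))); [ apply CV | apply CG2 ].
    - assert (P0 := PU (RtoC 0) (DR 0)). rewrite <- RtoC_plus, Rplus_0_l in P0.
      unfold x. rewrite P0. destruct Hk as [-> | ->]; [ left | right ]; ring.
    - unfold y. assert (P0 := PV (RtoC 0) (DR 0)). rewrite <- RtoC_plus, Rplus_0_l in P0. now rewrite P0. }
  rewrite (cavg_ext _ (fun t => RtoC (snd (F (x t, y t)) * (kap + Re (U1 (RtoC t)) + Re (G1' (RtoC t))) - y t * (kap + Re (U1 (RtoC t)))))).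
  - apply injective_projections.
    + change (fst (cavg ?p)) with (Re (cavg p)). rewrite cavg_Re.
      replace (RInt _ 0 (2 * PI)) with 0 by (symmetry; exact Ex'). simpl. ring.
    + change (snd (cavg ?p)) with (Im (cavg p)). rewrite cavg_Im.
      replace (RInt _ 0 (2 * PI)) with (RInt (fun _ : R => 0) 0 (2 * PI)) by reflexivity.
      rewrite (RInt_const (V := R_CompleteNormedModule)). unfold scal; simpl; unfold mult; simpl. ring.
  - intros t. unfold line. change (t, 0) with (RtoC t).
    assert (Eu := RtoC_Re _ (RU' t)). assert (Eg := RtoC_Re _ (R1' t)).
    set (u := Re (U1 (RtoC t))) in *. set (g := Re (G1' (RtoC t))) in *.
    rewrite E2, EV, Eu, Eg.
    rewrite <- !RtoC_plus, <- !RtoC_mult, <- RtoC_minus. f_equal. ring.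
Qed.

(** [V] is only assumed differentiable, so the exactness relation cannot be differentiated once
    more; its integral over small circles replaces the exterior derivative. *)
Lemma determinant_one (phi y : R) :
  0 < rho0 -> Rabs (y - I0) < R0 ->
  ((1 + p1 (RtoC phi) (RtoC y)) * (1 + q2 (RtoC phi) (RtoC y)) - q1 (RtoC phi) (RtoC y) * p2 (RtoC phi) (RtoC y) = 1)%C.
Proof.
  intros Hrho Hy.
  (* On the band of half-width 1 the complex cosine and sine are at most 3 in modulus, so a quarter
     of the distances to the boundary keeps the complexified circle in the domain. *)
  set (s0 := Rmin (rho0 / 4) ((R0 - Rabs (y - I0)) / 4)).
  assert (Hs0 : 0 < s0 /\ s0 <= rho0 / 4 /\ s0 <= (R0 - Rabs (y - I0)) / 4).
  { unfold s0. split; [ apply Rmin_glb_lt; lra | split; [ apply Rmin_l | apply Rmin_r ] ]. }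
  set (D := band (-1) 1).
  assert (DL : forall x : R, D (x, 0)) by (intros x; split; simpl; lra).
  assert (Hc := holo_Ccos (-1) 1). assert (Hsn := holo_Csin (-1) 1). fold D in Hc, Hsn.
  assert (Pc : periodic_on D Ccos) by (intros z _; apply Ccos_periodic).
  assert (Ps : periodic_on D Csin) by (intros z _; apply Csin_periodic).
  set (A11 := (1 + p1 (RtoC phi) (RtoC y))%C). set (A12 := q1 (RtoC phi) (RtoC y)).
  set (A21 := p2 (RtoC phi) (RtoC y)). set (A22 := (1 + q2 (RtoC phi) (RtoC y))%C).
  (* [l1] and [l2] parametrize the image of the unit circle under the linearized map. *)
  set (l1 := fun z => (A11 * Ccos z + A12 * Csin z)%C). set (l2 := fun z => (A21 * Ccos z + A22 * Csin z)%C).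
  set (l1' := fun z => (A11 * - Csin z + A12 * Ccos z)%C). set (l2' := fun z => (A21 * - Csin z + A22 * Ccos z)%C).
  assert (Hl1 : holo D l1 l1') by (apply holo_plus; now apply holo_scal).
  assert (Hl2 : holo D l2 l2') by (apply holo_plus; now apply holo_scal).
  (* A circle of radius [s] and its image enclose the same area; divide by [s^2]. *)
  assert (Main : exists K, forall s, 0 < s <= s0 -> Cmod ((A11 * A22 - A12 * A21) - 1)%C <= 0 + K * s).
  { exists (4 * Rabs L * (Cmod A11 + Cmod A12 + 1 + 2 * Rabs B)).
    intros s Hs. rewrite Rplus_0_l.
    set (U := fun z => (RtoC s * Ccos z + RtoC phi)%C). set (V := fun z => (RtoC s * Csin z + RtoC y)%C).
    set (U1 := fun z => (RtoC s * - Csin z + 0)%C). set (V1 := fun z => (RtoC s * Ccos z + 0)%C).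
    assert (HU : holo D U U1) by (apply holo_plus; [ now apply holo_scal | apply holo_const ]).
    assert (HV : holo D V V1) by (apply holo_plus; [ now apply holo_scal | apply holo_const ]).
    assert (Dom : forall z, D z -> strip rho0 (RtoC 0 * z + U z)%C /\ cdisc I0 R0 (V z)).
    { intros z Hz. destruct (Ccos_Csin_bound z Hz) as [b1 b2]. split.
      - unfold strip, U. replace (RtoC 0 * z + (RtoC s * Ccos z + RtoC phi))%C with (RtoC s * Ccos z + RtoC phi)%C by ring.
        rewrite im_plus, im_scal_l. simpl Im at 2. rewrite Rplus_0_r, Rabs_mult, (Rabs_pos_eq s) by lra.
        generalize (Im_le_Cmod (Ccos z)) (Rabs_pos (Im (Ccos z))). nra.
      - unfold cdisc, V. replace (RtoC s * Csin z + RtoC y - RtoC I0)%C with (RtoC s * Csin z + RtoC (y - I0))%C by (rewrite RtoC_minus; ring).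
        eapply Rle_lt_trans; [ apply Cmod_triangle | ]. rewrite Cmod_mult, !Cmod_R, (Rabs_pos_eq s) by lra.
        generalize (Cmod_ge_0 (Csin z)). nra. }
    assert (PU : periodic_on D U) by (intros z _; unfold U; now rewrite Ccos_periodic).
    assert (PV : periodic_on D V) by (intros z _; unfold V; now rewrite Csin_periodic).
    assert (LA := loop_average 1 0 U U1 V V1 ltac:(lra) (or_introl eq_refl) HU HV).
    specialize (LA ltac:(intros x; unfold U; now rewrite Ccos_real, <- RtoC_mult, <- RtoC_plus)
                   ltac:(intros x; unfold V; now rewrite Csin_real, <- RtoC_mult, <- RtoC_plus) PU PV Dom).
    assert (H1 := holo_comp2 D (strip rho0) (cdisc I0 R0) g1 p1 q1 L B (RtoC 0) U U1 V V1 taylor1 bound1 HU HV Dom).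
    assert (H2 := holo_comp2 D (strip rho0) (cdisc I0 R0) g2 p2 q2 L B (RtoC 0) U U1 V V1 taylor2 bound2 HU HV Dom).
    assert (P1 := displacement_periodic rho0 I0 R0 D 0 g1 U V periodic1 (or_introl eq_refl) PU PV Dom).
    assert (P2 := displacement_periodic rho0 I0 R0 D 0 g2 U V periodic2 (or_introl eq_refl) PU PV Dom).
    set (G1 := fun z => g1 (RtoC 0 * z + U z)%C (V z)) in *.
    set (G2 := fun z => g2 (RtoC 0 * z + U z)%C (V z)) in *.
    set (G1' := fun z => (p1 (RtoC 0 * z + U z)%C (V z) * (RtoC 0 + U1 z) + q1 (RtoC 0 * z + U z)%C (V z) * V1 z)%C) in *.
    set (G2' := fun z => (p2 (RtoC 0 * z + U z)%C (V z) * (RtoC 0 + U1 z) + q2 (RtoC 0 * z + U z)%C (V z) * V1 z)%C) in *.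
    set (k1 := (g1 (RtoC phi) (RtoC y) + RtoC phi)%C). set (k2 := (g2 (RtoC phi) (RtoC y) + RtoC y)%C).
    (* Remainders of the image of the circle once its centre and its linear part are removed; on
       real arguments they are of order [s^2]. *)
    set (R1 := fun z => (U z + G1 z - RtoC s * l1 z - k1)%C). set (R1' := fun z => (U1 z + G1' z - RtoC s * l1' z - 0)%C).
    set (R2 := fun z => (V z + G2 z - RtoC s * l2 z - k2)%C). set (R2' := fun z => (V1 z + G2' z - RtoC s * l2' z - 0)%C).
    assert (HR1 : holo D R1 R1').
    { apply holo_minus; [ apply holo_minus; [ now apply holo_plus | now apply holo_scal ] | apply holo_const ]. }
    assert (HR2 : holo D R2 R2').
    { apply holo_minus; [ apply holo_minus; [ now apply holo_plus | now apply holo_scal ] | apply holo_const ]. }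
    assert (Dcenter : strip rho0 (RtoC phi) /\ cdisc I0 R0 (RtoC y)).
    { split; [ unfold strip; simpl; rewrite Rabs_R0; lra | unfold cdisc; now rewrite <- RtoC_minus, Cmod_R ]. }
    destruct Dcenter as [c1 c2].
    assert (Small : forall t : R, Cmod (R1 (RtoC t)) <= Rabs L * 2 * s ^ 2 /\ Cmod (R2 (RtoC t)) <= Rabs L * 2 * s ^ 2).
    { intros t. destruct (Dom (RtoC t) ltac:(split; simpl; lra)) as [d1 d2].
      assert (EU : (RtoC 0 * RtoC t + U (RtoC t) - RtoC phi)%C = (RtoC s * Ccos (RtoC t))%C) by (unfold U; ring).
      assert (EV : (V (RtoC t) - RtoC y)%C = (RtoC s * Csin (RtoC t))%C) by (unfold V; ring).
      assert (Q : Cmod (RtoC s * Ccos (RtoC t))%C ^ 2 + Cmod (RtoC s * Csin (RtoC t))%C ^ 2 <= 2 * s ^ 2).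
      { rewrite Ccos_real, Csin_real, <- !RtoC_mult, !Cmod_R, !RPow_abs, !Rabs_pos_eq by apply pow2_ge_0.
        generalize (sin2_cos2 t). unfold Rsqr. intros E. simpl.
        replace (s * cos t * (s * cos t * 1) + s * sin t * (s * sin t * 1)) with (s * s * (sin t * sin t + cos t * cos t)) by ring.
        rewrite E. nra. }
      assert (W : forall X, X <= L * (Cmod (RtoC s * Ccos (RtoC t))%C ^ 2 + Cmod (RtoC s * Csin (RtoC t))%C ^ 2) ->
         X <= Rabs L * 2 * s ^ 2).
      { intros X HX. set (q := Cmod (RtoC s * Ccos (RtoC t))%C ^ 2 + Cmod (RtoC s * Csin (RtoC t))%C ^ 2) in *.
        assert (0 <= q) by (unfold q; generalize (pow2_ge_0 (Cmod (RtoC s * Ccos (RtoC t))%C)) (pow2_ge_0 (Cmod (RtoC s * Csin (RtoC t))%C)); lra).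
        assert (L * q <= Rabs L * q) by (apply Rmult_le_compat_r; [ auto | apply Rle_abs ]).
        assert (Rabs L * q <= Rabs L * (2 * s ^ 2)) by (apply Rmult_le_compat_l; [ apply Rabs_pos | auto ]). lra. }
      split; apply W.
      - assert (T := taylor1 _ _ _ _ c1 d1 c2 d2). rewrite EU, EV in T.
        match type of T with Cmod ?a <= _ => replace (R1 (RtoC t)) with a; [ exact T | ] end.
        unfold R1, k1, l1, A11, A12, G1. unfold U at 2. ring.
      - assert (T := taylor2 _ _ _ _ c1 d1 c2 d2). rewrite EU, EV in T.
        match type of T with Cmod ?a <= _ => replace (R2 (RtoC t)) with a; [ exact T | ] end.
        unfold R2, k2, l2, A21, A22, G2. unfold V at 2. ring. }
    assert (PR1 : periodic_on D R1).
    { intros z Hz. unfold R1, l1. now rewrite PU, (P1 z Hz), Ccos_periodic, Csin_periodic. }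
    assert (PR2 : periodic_on D R2).
    { intros z Hz. unfold R2, l2. now rewrite PV, (P2 z Hz), Ccos_periodic, Csin_periodic. }
    assert (Pl1 : periodic_on D l1). { intros z Hz. unfold l1. now rewrite Ccos_periodic, Csin_periodic. }
    assert (Pl2 : periodic_on D l2). { intros z Hz. unfold l2. now rewrite Ccos_periodic, Csin_periodic. }
    assert (CR2 := holo_line_Ccont D R2 R2' 0 HR2 DL). assert (CR2' := holo_line_Ccont1 D R2 R2' 0 HR2 DL).
    assert (CR1 := holo_line_Ccont D R1 R1' 0 HR1 DL). assert (CR1' := holo_line_Ccont1 D R1 R1' 0 HR1 DL).
    assert (Cl2 := holo_line_Ccont D l2 l2' 0 Hl2 DL). assert (Cl2' := holo_line_Ccont1 D l2 l2' 0 Hl2 DL).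
    assert (Cl1' := holo_line_Ccont1 D l1 l1' 0 Hl1 DL).
    assert (Cs := holo_line_Ccont D Csin Ccos 0 Hsn DL).
    assert (Hg : holo D (fun z => RtoC s * l2 z + R2 z)%C (fun z => RtoC s * l2' z + R2' z)%C)
      by (apply holo_plus; [ now apply holo_scal | exact HR2 ]).
    set (g := fun z => (RtoC s * l2 z + R2 z)%C) in *. set (g' := fun z => (RtoC s * l2' z + R2' z)%C) in *.
    assert (Cg := holo_line_Ccont D g g' 0 Hg DL). assert (Cg' := holo_line_Ccont1 D g g' 0 Hg DL).
    assert (Pg : periodic_on D g) by (intros z Hz; unfold g; now rewrite Pl2, PR2).
    assert (Hf : holo D (fun z => RtoC s * l1 z + R1 z)%C (fun z => RtoC s * l1' z + R1' z)%C)
      by (apply holo_plus; [ now apply holo_scal | exact HR1 ]).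
    assert (Z1 : cavg (line 0 (fun z => RtoC s * l1' z + R1' z)%C) = RtoC 0).
    { apply (cavg_line_derive D _ _ 0 Hf); [ | exact DL ]. intros z Hz. now rewrite Pl1, PR1. }
    assert (Cf' := holo_line_Ccont1 D _ _ 0 Hf DL).
    (* Of [R1] only the values are known to be of order [s^2], not the derivative; integrating by
       parts moves the derivative to [g]. *)
    assert (Z4 := cavg_by_parts D R1 R1' g g' 0 HR1 Hg PR1 Pg DL).
    assert (Z6 : cavg (line 0 Csin) = RtoC 0).
    { replace (cavg (line 0 Csin)) with ((-(1)) * cavg (line 0 (fun z => - Csin z)%C))%C.
      - rewrite (cavg_line_derive D Ccos _ 0 Hc Pc DL). ring.
      - rewrite <- cavg_scal.
        + apply cavg_ext. intros t. unfold line. ring.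
        + apply (Ccont_ext (fun t => (-(1)) * line 0 Csin t)%C); [ intros t; unfold line; ring | now apply Ccont_scal ]. }
    destruct cavg_trig as [Tc [Ts Tm]].
    assert (Z5 : cavg (line 0 (fun z => Csin z * Csin z)%C) = RtoC (/ 2)).
    { rewrite <- Ts. apply cavg_ext. intros t. unfold line. change (t, 0) with (RtoC t). now rewrite Csin_real, RtoC_mult. }
    assert (Z2 : cavg (line 0 (fun z => l2 z * l1' z)%C) = ((A21 * A12 - A22 * A11) * RtoC (/ 2))%C).
    { rewrite (cavg_ext _ (fun t => (A21 * A12) * RtoC (cos t * cos t) + ((- (A22 * A11)) * RtoC (sin t * sin t)
          + (A22 * A12 - A21 * A11) * RtoC (sin t * cos t)))%C).
      - assert (C1 : Ccont (fun t => RtoC (cos t * cos t))).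
        { apply (Ccont_ext (fun t => line 0 Ccos t * line 0 Ccos t)%C).
          - intros t. unfold line. change (t, 0) with (RtoC t). now rewrite Ccos_real, RtoC_mult.
          - apply Ccont_mult; apply (holo_line_Ccont D Ccos _ 0 Hc DL). }
        assert (C2 : Ccont (fun t => RtoC (sin t * sin t))).
        { apply (Ccont_ext (fun t => line 0 Csin t * line 0 Csin t)%C).
          - intros t. unfold line. change (t, 0) with (RtoC t). now rewrite Csin_real, RtoC_mult.
          - apply Ccont_mult; exact Cs. }
        assert (C3 : Ccont (fun t => RtoC (sin t * cos t))).
        { apply (Ccont_ext (fun t => line 0 Csin t * line 0 Ccos t)%C).
          - intros t. unfold line. change (t, 0) with (RtoC t). now rewrite Ccos_real, Csin_real, RtoC_mult.
          - apply Ccont_mult; [ exact Cs | apply (holo_line_Ccont D Ccos _ 0 Hc DL) ]. }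
        rewrite (cavg_plus (fun t => A21 * A12 * RtoC (cos t * cos t))%C
           (fun t => - (A22 * A11) * RtoC (sin t * sin t) + (A22 * A12 - A21 * A11) * RtoC (sin t * cos t))%C),
          (cavg_plus (fun t => - (A22 * A11) * RtoC (sin t * sin t))%C (fun t => (A22 * A12 - A21 * A11) * RtoC (sin t * cos t))%C),
          !cavg_scal, Tc, Ts, Tm; auto using Ccont_scal, Ccont_plus. ring.
      - intros t. unfold line, l2, l1'. change (t, 0) with (RtoC t). rewrite Ccos_real, Csin_real, !RtoC_mult. ring. }
    change (cavg (line 0 (fun z => (V z + G2 z) * ((RtoC 0 + U1 z) + G1' z) - V z * (RtoC 0 + U1 z))%C) = RtoC 0) in LA.
    set (T2 := line 0 (fun z => l2 z * l1' z)%C) in *. set (T3 := line 0 (fun z => R2 z * l1' z)%C).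
    set (T4 := line 0 (fun z => R1' z * g z)%C) in *. set (T5 := line 0 (fun z => Csin z * Csin z)%C) in *.
    set (T6 := line 0 Csin) in *. set (T1 := line 0 (fun z => RtoC s * l1' z + R1' z)%C) in *.
    assert (C2 : Ccont T2) by exact (Ccont_mult _ _ Cl2 Cl1'). assert (C3 : Ccont T3) by exact (Ccont_mult _ _ CR2 Cl1').
    assert (C4 : Ccont T4) by exact (Ccont_mult _ _ CR1' Cg). assert (C5 : Ccont T5) by exact (Ccont_mult _ _ Cs Cs).
    (* Expansion of the exactness integral. Up to normalization, [T2] measures the area enclosed by
       the linearized image and [T5] that of the circle; the terms with [T3] and [T4] are of order
       [s^3], and [T1], [T6] have mean zero. *)
    assert (Split : RtoC 0 = (k2 * cavg T1 + (RtoC s * RtoC s * cavg T2 + (RtoC s * cavg T3 + (cavg T4 + (RtoC s * RtoC s * cavg T5 + RtoC y * RtoC s * cavg T6)))))%C).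
    { rewrite <- LA.
      rewrite (cavg_ext _ (fun t => k2 * T1 t + ((RtoC s * RtoC s) * T2 t + (RtoC s * T3 t + (T4 t + ((RtoC s * RtoC s) * T5 t + (RtoC y * RtoC s) * T6 t)))))%C).
      - assert (D6 : Ccont (fun t => (RtoC y * RtoC s) * T6 t)%C) by now apply Ccont_scal.
        assert (D5 : Ccont (fun t => (RtoC s * RtoC s) * T5 t)%C) by now apply Ccont_scal.
        assert (D3 : Ccont (fun t => RtoC s * T3 t)%C) by now apply Ccont_scal.
        assert (D2 : Ccont (fun t => (RtoC s * RtoC s) * T2 t)%C) by now apply Ccont_scal.
        assert (D1 : Ccont (fun t => k2 * T1 t)%C) by now apply Ccont_scal.
        assert (S5 := Ccont_plus _ _ D5 D6). assert (S4 := Ccont_plus _ _ C4 S5).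
        assert (S3 := Ccont_plus _ _ D3 S4). assert (S2 := Ccont_plus _ _ D2 S3).
        rewrite (cavg_plus _ _ D1 S2), (cavg_plus _ _ D2 S3), (cavg_plus _ _ D3 S4), (cavg_plus _ _ C4 S5), (cavg_plus _ _ D5 D6).
        now rewrite !cavg_scal by assumption.
      - intros t. unfold T1, T2, T3, T4, T5, T6, line. set (z := (t, 0) : C).
        replace (V z + G2 z)%C with (k2 + g z)%C by (unfold g, R2; ring).
        replace (RtoC 0 + U1 z + G1' z)%C with (RtoC s * l1' z + R1' z)%C by (unfold R1'; ring).
        replace (V z * (RtoC 0 + U1 z))%C with (- (RtoC s * RtoC s * (Csin z * Csin z) + RtoC y * RtoC s * Csin z))%C by (unfold V, U1; ring).
        unfold g. ring. }
    rewrite Z1, Z2, Z4, Z5, Z6 in Split.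
    set (W := cavg (line 0 (fun z => R1 z * g' z)%C)) in *.
    assert (Eq : (RtoC (s * s / 2) * ((A11 * A22 - A12 * A21) - 1) = RtoC s * cavg T3 - W)%C).
    { replace (RtoC (s * s / 2)) with (RtoC s * RtoC s * RtoC (/ 2))%C by (rewrite <- !RtoC_mult; f_equal; field).
      transitivity (RtoC s * RtoC s * RtoC (/ 2) * (A11 * A22 - A12 * A21 - 1) + 0)%C; [ ring | ].
      rewrite Split. ring. }
    assert (B3 : Cmod (cavg T3) <= Rabs L * 2 * s ^ 2 * (Cmod A11 + Cmod A12)).
    { apply cavg_bound; auto. intros t. unfold T3, line. change (t, 0) with (RtoC t).
      apply Cmod_mult_le; [ apply Small | ]. unfold l1'. rewrite Ccos_real, Csin_real.
      apply Cmod_plus_le; rewrite Cmod_mult; [ rewrite Cmod_opp | ]; rewrite Cmod_R;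
        rewrite <- Rmult_1_r; apply Rmult_le_compat_l; try apply Cmod_ge_0; apply Rabs_le;
        [ apply SIN_bound | apply COS_bound ]. }
    assert (BW : Cmod W <= Rabs L * 2 * s ^ 2 * (s + Rabs B * 2 * s)).
    { apply cavg_bound; [ exact (Ccont_mult _ _ CR1 Cg') | ]. intros t. unfold line. change (t, 0) with (RtoC t).
      apply Cmod_mult_le; [ apply Small | ].
      replace (g' (RtoC t)) with (V1 (RtoC t) + G2' (RtoC t))%C by (unfold g', R2'; ring).
      destruct (Dom (RtoC t) ltac:(split; simpl; lra)) as [d1 d2]. destruct (bound2 _ _ d1 d2) as [_ [b2 b3]].
      assert (Bb := Rle_abs B).
      assert (u1 : Cmod (RtoC 0 + U1 (RtoC t))%C <= s).
      { unfold U1. replace (RtoC 0 + (RtoC s * - Csin (RtoC t) + 0))%C with (- (RtoC s * Csin (RtoC t)))%C by ring.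
        rewrite Cmod_opp, Csin_real, <- RtoC_mult, Cmod_R, Rabs_mult, (Rabs_pos_eq s) by lra.
        assert (Rabs (sin t) <= 1) by (apply Rabs_le, SIN_bound). nra. }
      assert (v1 : Cmod (V1 (RtoC t)) <= s).
      { unfold V1. replace (RtoC s * Ccos (RtoC t) + 0)%C with (RtoC s * Ccos (RtoC t))%C by ring.
        rewrite Ccos_real, <- RtoC_mult, Cmod_R, Rabs_mult, (Rabs_pos_eq s) by lra.
        assert (Rabs (cos t) <= 1) by (apply Rabs_le, COS_bound). nra. }
      apply Cmod_plus_le; [ exact v1 | ]. unfold G2'.
      replace (Rabs B * 2 * s) with (Rabs B * s + Rabs B * s) by ring.
      apply Cmod_plus_le; apply Cmod_mult_le; try assumption.
      - eapply Rle_trans; [ exact b2 | exact Bb ].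
      - eapply Rle_trans; [ exact b3 | exact Bb ]. }
    apply Rmult_le_reg_l with (s * s / 2); [ nra | ].
    rewrite <- (Rabs_pos_eq (s * s / 2)) at 1 by nra. rewrite <- Cmod_R, <- Cmod_mult, Eq.
    eapply Rle_trans; [ apply Cmod_minus_le; [ apply Cmod_mult_le; [ apply Rle_refl | exact B3 ] | exact BW ] | ].
    rewrite Cmod_R, Rabs_pos_eq by lra. right. field. }
  destruct Main as [K HK].
  assert (Z : Cmod ((A11 * A22 - A12 * A21) - 1)%C <= 0) by (apply (Rle_of_le_plus_small _ _ K s0); [ lra | exact HK ]).
  apply Ceq_minus, Cmod_eq_0, Rle_antisym; [ exact Z | apply Cmod_ge_0 ].
Qed.

End ExactMap.

Lemma Ccv_rate (u : nat -> C) (l : C) (K : R) :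
  (forall n, Cmod (u n - l)%C <= K / INR (S n)) -> Ccv u l.
Proof.
  intros H eps He. destruct (INR_unbounded (Rabs K / eps)) as [N HN]. exists N. intros n Hn.
  eapply Rle_lt_trans; [ apply H | ].
  assert (P : 0 < INR (S n)) by (apply lt_0_INR; lia).
  assert (Q : INR N <= INR (S n)) by (apply le_INR; lia).
  apply Rmult_lt_reg_r with (INR (S n)); [ exact P | ].
  unfold Rdiv. rewrite Rmult_assoc, Rinv_l, Rmult_1_r by lra.
  apply Rle_lt_trans with (Rabs K); [ apply Rle_abs | ].
  apply (Rmult_lt_compat_l eps) in HN; [ | exact He ].
  replace (eps * (Rabs K / eps)) with (Rabs K) in HN by (field; lra).
  apply Rlt_le_trans with (1 := HN). apply Rmult_le_compat_l; lra.
Qed.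

(** The partial derivatives of [g] along a curve are limits of difference quotients
    of functions of the type [holo_comp2]; no third derivatives of [g] are needed. *)
Lemma holo_directional rho0 I0 R0 rho d a (g p q : C -> C -> C) (L B : R) (u u1 v v1 : C -> C) (al be : R) :
  0 < d < rho -> a < R0 -> Rabs al <= 1 -> Rabs be <= 1 ->
  (forall z z' w w', strip rho0 z -> strip rho0 z' -> cdisc I0 R0 w -> cdisc I0 R0 w' ->
    Cmod (g z' w' - g z w - (z' - z) * p z w - (w' - w) * q z w)%C
      <= L * (Cmod (z' - z)%C ^ 2 + Cmod (w' - w)%C ^ 2)) ->
  (forall z w, strip rho0 z -> cdisc I0 R0 w -> Cmod (g z w) <= B /\ Cmod (p z w) <= B /\ Cmod (q z w) <= B) ->
  (forall z w, strip rho0 z -> cdisc I0 R0 w -> g (z + RtoC (2 * PI))%C w = g z w) ->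
  (forall x y : R, Rabs (y - I0) < R0 -> Im (g (RtoC x) (RtoC y)) = 0) ->
  holo (band (- rho) rho) u u1 -> holo (band (- rho) rho) v v1 ->
  real_on_reals u -> real_on_reals v ->
  periodic_on (band (- rho) rho) u -> periodic_on (band (- rho) rho) v ->
  (forall z, band (- rho) rho z -> strip rho0 (RtoC 1 * z + u z)%C /\ Cmod (v z - RtoC I0)%C <= a) ->
  let w z := (RtoC al * p (RtoC 1 * z + u z) (v z) + RtoC be * q (RtoC 1 * z + u z) (v z))%C in
  (exists w1, holo (band (- (rho - d)) (rho - d)) w w1) /\ periodic_on (band (- rho) rho) w /\ real_on_reals w.
Proof.
  intros Hd Ha Hal Hbe HT HB HP HR Hu Hv Ru Rv Pu Pv HD w.
  (* Step sizes tending to [0] that keep the displaced curve in the disc of actions. *)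
  set (s := fun n => (R0 - a) / 2 / INR (S n)).
  assert (Ps : forall n, 0 < s n <= (R0 - a) / 2).
  { intros n. assert (P : 1 <= INR (S n)) by (rewrite S_INR; generalize (pos_INR n); lra).
    unfold s. split; [ apply Rdiv_lt_0_compat; lra | ].
    unfold Rdiv at 1. rewrite <- (Rmult_1_r ((R0 - a) / 2)) at 2. apply Rmult_le_compat_l; [ lra | ].
    rewrite <- Rinv_1. apply Rinv_le_contravar; lra. }
  set (U := fun n z => (u z + RtoC (al * s n))%C). set (V := fun n z => (v z + RtoC (be * s n))%C).
  assert (Dn : forall n z, band (- rho) rho z -> strip rho0 (RtoC 1 * z + U n z)%C /\ cdisc I0 R0 (V n z)).
  { intros n z Hz. destruct (HD z Hz) as [d1 d2]. split.
    - unfold strip in *. unfold U. replace (RtoC 1 * z + (u z + RtoC (al * s n)))%C with ((RtoC 1 * z + u z) + RtoC (al * s n))%C by ring.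
      rewrite im_plus. simpl Im at 2. rewrite Rplus_0_r. exact d1.
    - unfold cdisc, V. replace (v z + RtoC (be * s n) - RtoC I0)%C with ((v z - RtoC I0) + RtoC (be * s n))%C by ring.
      eapply Rle_lt_trans; [ apply Cmod_triangle | ]. rewrite Cmod_R, Rabs_mult, (Rabs_pos_eq (s n)) by (apply Rlt_le, Ps).
      generalize (Ps n) (Rabs_pos be). nra. }
  assert (D0 : forall z, band (- rho) rho z -> strip rho0 (RtoC 1 * z + u z)%C /\ cdisc I0 R0 (v z)).
  { intros z Hz. destruct (HD z Hz) as [d1 d2]. split; [ exact d1 | unfold cdisc; lra ]. }
  assert (HU : forall n, holo (band (- rho) rho) (U n) (fun z => u1 z + 0)%C) by (intros n; apply holo_plus; [ exact Hu | apply holo_const ]).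
  assert (HV : forall n, holo (band (- rho) rho) (V n) (fun z => v1 z + 0)%C) by (intros n; apply holo_plus; [ exact Hv | apply holo_const ]).
  assert (H0 := holo_comp2 _ _ _ g p q L B (RtoC 1) u u1 v v1 HT HB Hu Hv D0).
  assert (Hn := fun n => holo_comp2 _ _ _ g p q L B (RtoC 1) _ _ _ _ HT HB (HU n) (HV n) (Dn n)).
  set (f := fun n z => (RtoC (/ s n) * (g (RtoC 1 * z + U n z) (V n z) - g (RtoC 1 * z + u z) (v z)))%C).
  assert (Hf := fun n => holo_scal _ (RtoC (/ s n)) _ _ (holo_minus _ _ _ _ _ (Hn n) H0)).
  assert (P0 := displacement_periodic rho0 I0 R0 _ 1 g u v HP (or_intror eq_refl) Pu Pv D0).
  assert (Pn : forall n, periodic_on (band (- rho) rho) (fun z => g (RtoC 1 * z + U n z) (V n z))%C).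
  { intros n. apply (displacement_periodic rho0 I0 R0); auto; intros z Hz; [ unfold U; now rewrite Pu | unfold V; now rewrite Pv ]. }
  assert (Pf : forall n, periodic_on (band (- rho) rho) (f n)).
  { intros n z Hz. unfold f. now rewrite (Pn n z Hz), (P0 z Hz). }
  assert (Est : forall n z, band (- rho) rho z -> Cmod (f n z - w z)%C <= Rabs L * 2 * s n).
  { intros n z Hz. destruct (D0 z Hz) as [d1 d2]. destruct (Dn n z Hz) as [e1 e2].
    assert (T := HT _ _ _ _ d1 e1 d2 e2). specialize (Ps n).
    replace (RtoC 1 * z + U n z - (RtoC 1 * z + u z))%C with (RtoC (al * s n)) in T by (unfold U; ring).
    replace (V n z - v z)%C with (RtoC (be * s n)) in T by (unfold V; ring).
    rewrite !Cmod_R, !RPow_abs, !(Rabs_pos_eq (_ ^ 2)) in T by apply pow2_ge_0.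
    apply Rmult_le_reg_l with (s n); [ lra | ].
    rewrite <- (Rabs_pos_eq (s n)) at 1 by lra. rewrite <- Cmod_R, <- Cmod_mult.
    match type of T with Cmod ?X <= _ => replace (RtoC (s n) * (f n z - w z))%C with X end.
    - eapply Rle_trans; [ exact T | ].
      assert (Q : 0 <= (al * s n) ^ 2 + (be * s n) ^ 2 <= 2 * s n ^ 2).
      { rewrite !Rpow_mult_distr.
        assert (al ^ 2 <= 1). { rewrite <- (Rabs_pos_eq (al ^ 2)), <- RPow_abs by apply pow2_ge_0. generalize (Rabs_pos al). simpl. nra. }
        assert (be ^ 2 <= 1). { rewrite <- (Rabs_pos_eq (be ^ 2)), <- RPow_abs by apply pow2_ge_0. generalize (Rabs_pos be). simpl. nra. }
        generalize (pow2_ge_0 al) (pow2_ge_0 be) (pow2_ge_0 (s n)). nra. }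
      apply Rle_trans with (Rabs L * ((al * s n) ^ 2 + (be * s n) ^ 2)); [ apply Rmult_le_compat_r; [ apply Q | apply Rle_abs ] | ].
      replace (s n * (Rabs L * 2 * s n)) with (Rabs L * (2 * s n ^ 2)) by ring. apply Rmult_le_compat_l; [ apply Rabs_pos | apply Q ].
    - unfold f, w. rewrite !RtoC_mult, RtoC_inv by lra. field. intros E. apply RtoC_inj in E. lra. }
  assert (Cv : forall z, band (- rho) rho z -> Ccv (fun n => f n z) (w z)).
  { intros z Hz. apply (Ccv_rate _ _ (Rabs L * 2 * ((R0 - a) / 2))). intros n.
    eapply Rle_trans; [ now apply Est | ]. unfold s, Rdiv. right. ring. }
  split; [ | split ].
  - eexists. eapply (holo_limit (rho - d) rho (Rabs L * 2 * ((R0 - a) / 2) + 2 * Rabs B) f); [ lra | exact Hf | exact Pf | | exact Cv ].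
    intros n z Hz. replace (f n z) with ((f n z - w z) + w z)%C by ring.
    apply Cmod_plus_le.
    + eapply Rle_trans; [ now apply Est | ]. apply Rmult_le_compat_l; [ generalize (Rabs_pos L); lra | apply Ps ].
    + destruct (D0 z Hz) as [d1 d2]. destruct (HB _ _ d1 d2) as [_ [b2 b3]].
      assert (b4 := Rle_abs B). assert (b5 := Rabs_pos B). unfold w. replace (2 * Rabs B) with (1 * Rabs B + 1 * Rabs B) by ring.
      apply Cmod_plus_le; apply Cmod_mult_le; rewrite ?Cmod_R; lra.
  - intros z Hz.
    assert (Hz' : band (- rho) rho (z + RtoC (2 * PI))%C) by (destruct Hz; split; simpl; rewrite Rplus_0_r; auto).
    apply (Ccv_unique (fun n => f n (z + RtoC (2 * PI))%C)); [ now apply Cv | ].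
    apply (Ccv_ext (fun n => f n z)); [ intros n; now rewrite Pf | now apply Cv ].
  - intros x. assert (Hx : band (- rho) rho (RtoC x)) by (split; simpl; lra).
    apply Rabs_eq_0, Rle_antisym; [ | apply Rabs_pos ].
    apply le_epsilon. intros eps He. destruct (Cv _ Hx eps He) as [N HN]. specialize (HN N (le_n N)).
    rewrite Rplus_0_l. apply Rle_trans with (2 := Rlt_le _ _ HN).
    replace (Rabs (Im (w (RtoC x)))) with (Rabs (Im (f N (RtoC x) - w (RtoC x))%C)); [ apply Im_le_Cmod | ].
    unfold Cminus. rewrite im_plus, im_opp.
    replace (Im (f N (RtoC x))) with 0; [ rewrite Rplus_0_l; apply Rabs_Ropp | ].
    unfold f. rewrite im_scal_l. unfold Cminus. rewrite im_plus, im_opp.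
    destruct (D0 _ Hx) as [_ d2]. destruct (Dn N _ Hx) as [_ e2].
    rewrite (RtoC_Re (U N (RtoC x))), (RtoC_Re (V N (RtoC x))), (RtoC_Re (u (RtoC x)) (Ru x)), (RtoC_Re (v (RtoC x)) (Rv x)) in *
     by (unfold U, V; rewrite im_plus, ?Ru, ?Rv; simpl; ring).
    rewrite <- !RtoC_mult, <- !RtoC_plus, !HR; [ ring | | ].
    + now apply (cdisc_real I0 R0).
    + now apply (cdisc_real I0 R0).
Qed.

(** * Shifts, reality and periodicity on strips *)

Lemma band_shift a b z (s : R) : band a b z -> band a b (z + RtoC s)%C.
Proof. intros [H1 H2]. split; simpl; rewrite Rplus_0_r; auto. Qed.

Lemma real_on_reals_shift f (s : R) : real_on_reals f -> real_on_reals (fun z => f (z + RtoC s)%C).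
Proof. intros H x. rewrite <- RtoC_plus. apply H. Qed.

Lemma real_on_reals_plus f g : real_on_reals f -> real_on_reals g -> real_on_reals (fun z => f z + g z)%C.
Proof. intros H K x. rewrite im_plus, H, K. ring. Qed.

Lemma real_on_reals_mult f g : real_on_reals f -> real_on_reals g -> real_on_reals (fun z => f z * g z)%C.
Proof. intros H K x. rewrite im_mult, H, K. ring. Qed.

Lemma real_on_reals_minus f g : real_on_reals f -> real_on_reals g -> real_on_reals (fun z => f z - g z)%C.
Proof. intros H K x. unfold Cminus. rewrite im_plus, im_opp, H, K. ring. Qed.

Lemma real_on_reals_inv f : real_on_reals f -> real_on_reals (fun z => / f z)%C.
Proof.
  intros H x. specialize (H x). destruct (f (RtoC x)) as [p q]. simpl in *. subst q.
  unfold Rdiv. ring.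
Qed.

Lemma real_on_reals_const (x : R) : real_on_reals (fun _ => RtoC x).
Proof. intros y. reflexivity. Qed.

Lemma cavg_line_real f : real_on_reals f -> Im (cavg (line 0 f)) = 0.
Proof.
  intros H. rewrite cavg_Im. rewrite (RInt_ext _ (fun _ => 0)).
  - rewrite (RInt_const (V := R_CompleteNormedModule)). unfold scal; simpl; unfold mult; simpl. ring.
  - intros t _. apply H.
Qed.

Lemma periodic_on_sub (D D' : C -> Prop) f :
  (forall z, D' z -> D z) -> periodic_on D f -> periodic_on D' f.
Proof. intros H K z Hz. auto. Qed.

Lemma periodic_on_shift r f (s : R) :
  periodic_on (band (- r) r) f -> periodic_on (band (- r) r) (fun z => f (z + RtoC s)%C).
Proof.
  intros H z Hz. rewrite <- (H (z + RtoC s)%C (band_shift _ _ _ _ Hz)). f_equal. ring.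
Qed.

Lemma holo_band_shift r f f1 (s : R) :
  holo (band (- r) r) f f1 ->
  holo (band (- r) r) (fun z => f (z + RtoC s)%C) (fun z => f1 (z + RtoC s)%C).
Proof. intros H. apply (holo_shift _ f f1 (RtoC s) (band (- r) r)); auto. intros; now apply band_shift. Qed.

(** * The Newton step *)

Section Newton.

Variables (F : R * R -> R * R) (rho0 I0 R0 L B : R) (g1 g2 p1 q1 p2 q2 : C -> C -> C).
Hypothesis EM : exact_map F rho0 I0 R0 L B g1 g2 p1 q1 p2 q2.
Variables (gamma nu omega c1 c2 c3 c : R) (a0 : C).
Hypotheses (Hgamma : 0 < gamma <= 1) (Hnu : 2 <= nu) (HDio : diophantine gamma nu (omega / (2 * PI)))
  (Hc1 : 0 < c1) (Hc2 : 0 < c2) (Hc3 : 0 <= c3) (Hc : 0 < c) (HL : 0 <= L).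
Hypothesis twist : forall z w, strip rho0 z -> cdisc I0 R0 w ->
  Cmod (q1 z w - a0)%C <= c3 * Cmod (w - RtoC I0)%C + c /\ Cmod (q1 z w) <= 1 + c2 /\ Cmod (q2 z w) <= 1.
Hypothesis twist0 : c1 <= Cmod a0 <= c2.

(** [F o K - K(. + omega)] for [K z = (z + u z, v z)]; the factor [1] is the [kap]
    of [holo_comp2], and [- 0] gives both components the same shape. *)
Definition err1 (u v : C -> C) (z : C) : C :=
  (u z + g1 (RtoC 1 * z + u z) (v z) - RtoC omega - u (z + RtoC omega))%C.
Definition err2 (u v : C -> C) (z : C) : C :=
  (v z + g2 (RtoC 1 * z + u z) (v z) - 0 - v (z + RtoC omega))%C.

Record torus (rho a b eps : R) (u u1 v v1 : C -> C) : Prop := {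
  t_hu : holo (band (- rho) rho) u u1;
  t_hv : holo (band (- rho) rho) v v1;
  t_ru : real_on_reals u;
  t_rv : real_on_reals v;
  t_pu : periodic_on (band (- rho) rho) u;
  t_pv : periodic_on (band (- rho) rho) v;
  t_ua : forall z, band (- rho) rho z -> Cmod (u z) <= a /\ Cmod (v z - RtoC I0)%C <= a;
  t_ub : forall z, band (- rho) rho z -> Cmod (u1 z) <= b /\ Cmod (v1 z) <= b;
  t_e : forall z, band (- rho) rho z -> Cmod (err1 u v z) <= eps /\ Cmod (err2 u v z) <= eps
}.
Arguments t_hu {_ _ _ _ _ _ _ _} _.
Arguments t_hv {_ _ _ _ _ _ _ _} _.
Arguments t_ru {_ _ _ _ _ _ _ _} _.
Arguments t_rv {_ _ _ _ _ _ _ _} _.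
Arguments t_pu {_ _ _ _ _ _ _ _} _.
Arguments t_pv {_ _ _ _ _ _ _ _} _.
Arguments t_ua {_ _ _ _ _ _ _ _} _.
Arguments t_ub {_ _ _ _ _ _ _ _} _.
Arguments t_e {_ _ _ _ _ _ _ _} _.

Section Step.

Variables (rho a b eps d : R) (u u1 v v1 : C -> C).
Hypothesis T : torus rho a b eps u u1 v v1.
Hypotheses (Hd : 0 < d <= 1) (Hrho : 4 * d < rho) (Ha : a < R0) (Hb : 0 <= b <= 1 / 4) (Hdom : rho + a <= rho0).
(** Chosen so that the torsion [S] below stays within [c1 / 2] of [a0]: the factors are
    [2 >= 16 / 9] and [4 = (2 + 1 / 4) * 16 / 9], where [16 / 9] bounds the inverse of a product of
    two values of [phi]. *)
Hypothesis Htw : 2 * (c3 * a + c) + 4 * c2 * b <= c1 / 2.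

Let P (z : C) : C := (RtoC 1 * z + u z)%C.
Let dom (z : C) : band (- rho) rho z -> strip rho0 (P z) /\ cdisc I0 R0 (v z).
Proof.
  intros Hz. destruct (t_ua T z Hz) as [H1 H2]. split.
  - unfold strip, P. rewrite im_plus, im_scal_l, Rmult_1_l. eapply Rle_lt_trans; [ apply Rabs_triang | ].
    assert (Rabs (Im z) < rho) by (destruct Hz; apply Rabs_def1; lra).
    generalize (Im_le_Cmod (u z)). lra.
  - unfold cdisc. lra.
Qed.

Let dom' (z : C) : band (- rho) rho z -> strip rho0 (P z) /\ Cmod (v z - RtoC I0)%C <= a.
Proof. intros Hz. split; [ apply dom, Hz | apply (t_ua T z Hz) ]. Qed.

(** Each strip is narrower by [d]. [B1] carries the derivatives of the error and the entries of DF,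
    [B2] and [B3] the solutions of the two equations; a last strip [B4] serves the derivatives of
    the correction. *)
Let B0 := band (- rho) rho.
Let B1 := band (- (rho - d)) (rho - d).
Let B2 := band (- (rho - 2 * d)) (rho - 2 * d).
Let B3 := band (- (rho - 3 * d)) (rho - 3 * d).

Let inc10 z : B1 z -> B0 z. Proof. apply symmetric_band_mono; lra. Qed.
Let inc21 z : B2 z -> B1 z. Proof. apply symmetric_band_mono; lra. Qed.
Let inc32 z : B3 z -> B2 z. Proof. apply symmetric_band_mono; lra. Qed.

Let DL0 (t : R) : B0 (t, 0). Proof. split; simpl; lra. Qed.
Let DL1 (t : R) : B1 (t, 0). Proof. split; simpl; lra. Qed.
Let DL2 (t : R) : B2 (t, 0). Proof. split; simpl; lra. Qed.

Let e1 := err1 u v.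
Let e2 := err2 u v.
(** Together, [e1'] and [e2'] form the vector DF K' - K'(. + omega): the defect in the invariance of
    the tangent direction. *)
Let e1' (z : C) : C := (u1 z + (p1 (P z) (v z) * (RtoC 1 + u1 z) + q1 (P z) (v z) * v1 z) - 0 - u1 (z + RtoC omega))%C.
Let e2' (z : C) : C := (v1 z + (p2 (P z) (v z) * (RtoC 1 + u1 z) + q2 (P z) (v z) * v1 z) - 0 - v1 (z + RtoC omega))%C.

Let hu := t_hu T.
Let hv := t_hv T.
Let ru := t_ru T.
Let rv := t_rv T.
Let pu := t_pu T.
Let pv := t_pv T.

Let hg1 := holo_comp2 B0 (strip rho0) (cdisc I0 R0) g1 p1 q1 L B (RtoC 1) u u1 v v1
  (em_taylor1 EM) (em_bound1 EM) hu hv dom.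
Let hg2 := holo_comp2 B0 (strip rho0) (cdisc I0 R0) g2 p2 q2 L B (RtoC 1) u u1 v v1
  (em_taylor2 EM) (em_bound2 EM) hu hv dom.
Let pg1 := displacement_periodic rho0 I0 R0 B0 1 g1 u v (em_periodic1 EM) (or_intror eq_refl) pu pv dom.
Let pg2 := displacement_periodic rho0 I0 R0 B0 1 g2 u v (em_periodic2 EM) (or_intror eq_refl) pu pv dom.

Let he1 : holo B0 e1 e1'.
Proof.
  apply holo_minus; [ apply holo_minus; [ apply holo_plus; [ exact hu | exact hg1 ] | apply holo_const ] | now apply holo_band_shift ].
Qed.

Let he2 : holo B0 e2 e2'.
Proof.
  apply holo_minus; [ apply holo_minus; [ apply holo_plus; [ exact hv | exact hg2 ] | apply holo_const ] | now apply holo_band_shift ].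
Qed.

Let pe1 : periodic_on B0 e1.
Proof.
  intros z Hz. unfold e1, err1. assert (H1 := pg1 z Hz). assert (H2 := periodic_on_shift _ _ omega pu z Hz).
  cbv beta in H1, H2. now rewrite H1, H2, (pu z Hz).
Qed.

Let pe2 : periodic_on B0 e2.
Proof.
  intros z Hz. unfold e2, err2. assert (H1 := pg2 z Hz). assert (H2 := periodic_on_shift _ _ omega pv z Hz).
  cbv beta in H1, H2. now rewrite H1, H2, (pv z Hz).
Qed.

Let rg (g : C -> C -> C) : (forall x y : R, Rabs (y - I0) < R0 -> Im (g (RtoC x) (RtoC y)) = 0) ->
  real_on_reals (fun z => g (P z) (v z)).
Proof.
  intros H x. destruct (dom (RtoC x) (DL0 x)) as [_ H2].
  unfold P. rewrite (RtoC_Re (v (RtoC x)) (rv x)) in *. rewrite (RtoC_Re (u (RtoC x)) (ru x)), <- RtoC_mult, <- RtoC_plus.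
  apply H. now apply (cdisc_real I0 R0).
Qed.

Let im1 (x y : R) : Rabs (y - I0) < R0 -> Im (g1 (RtoC x) (RtoC y)) = 0.
Proof. intros H. now rewrite (em_real1 EM x y H). Qed.

Let im2 (x y : R) : Rabs (y - I0) < R0 -> Im (g2 (RtoC x) (RtoC y)) = 0.
Proof. intros H. now rewrite (em_real2 EM x y H). Qed.

Let re1 : real_on_reals e1.
Proof.
  apply (real_on_reals_minus (fun z => u z + g1 (P z) (v z) - RtoC omega)%C); [ | now apply real_on_reals_shift ].
  apply (real_on_reals_minus (fun z => u z + g1 (P z) (v z))%C); [ | apply real_on_reals_const ].
  apply (real_on_reals_plus u (fun z => g1 (P z) (v z))); auto.
Qed.

Let re2 : real_on_reals e2.
Proof.
  apply (real_on_reals_minus (fun z => v z + g2 (P z) (v z) - 0)%C); [ | now apply real_on_reals_shift ].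
  apply (real_on_reals_minus (fun z => v z + g2 (P z) (v z))%C); [ | apply (real_on_reals_const 0) ].
  apply (real_on_reals_plus v (fun z => g2 (P z) (v z))); auto.
Qed.

(** Entries of DF along the curve; [g1] and [g2] being displacements, the identity is added on the
    diagonal. *)
Let A11 (z : C) : C := (1 + p1 (P z) (v z))%C.
Let A12 (z : C) : C := q1 (P z) (v z).
Let A21 (z : C) : C := p2 (P z) (v z).
Let A22 (z : C) : C := (1 + q2 (P z) (v z))%C.

(** The choices [(1, 0)] and [(0, 1)] of [(al, be)] select the two partial derivatives. *)
Let entry (g p q : C -> C -> C) (al be : R) :
  Rabs al <= 1 -> Rabs be <= 1 ->
  (forall z z' w w', strip rho0 z -> strip rho0 z' -> cdisc I0 R0 w -> cdisc I0 R0 w' ->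
    Cmod (g z' w' - g z w - (z' - z) * p z w - (w' - w) * q z w)%C
      <= L * (Cmod (z' - z)%C ^ 2 + Cmod (w' - w)%C ^ 2)) ->
  (forall z w, strip rho0 z -> cdisc I0 R0 w -> Cmod (g z w) <= B /\ Cmod (p z w) <= B /\ Cmod (q z w) <= B) ->
  (forall z w, strip rho0 z -> cdisc I0 R0 w -> g (z + RtoC (2 * PI))%C w = g z w) ->
  (forall x y : R, Rabs (y - I0) < R0 -> Im (g (RtoC x) (RtoC y)) = 0) ->
  (exists w1, holo B1 (fun z => RtoC al * p (P z) (v z) + RtoC be * q (P z) (v z))%C w1) /\
  periodic_on B0 (fun z => RtoC al * p (P z) (v z) + RtoC be * q (P z) (v z))%C /\
  real_on_reals (fun z => RtoC al * p (P z) (v z) + RtoC be * q (P z) (v z))%C.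
Proof.
  intros Hal Hbe H1 H2 H3 H4.
  apply (holo_directional rho0 I0 R0 rho d a g p q L B u u1 v v1 al be); auto. lra.
Qed.

Let abs0 : Rabs 0 <= 1. Proof. rewrite Rabs_R0. lra. Qed.
Let abs1 : Rabs 1 <= 1. Proof. rewrite Rabs_R1. lra. Qed.

Let sel_q (p q : C -> C -> C) (z : C) : (RtoC 0 * p (P z) (v z) + RtoC 1 * q (P z) (v z))%C = q (P z) (v z).
Proof. ring. Qed.

Let hA12 : (exists w, holo B1 A12 w) /\ periodic_on B0 A12 /\ real_on_reals A12.
Proof.
  destruct (entry g1 p1 q1 0 1 abs0 abs1 (em_taylor1 EM) (em_bound1 EM)
    (em_periodic1 EM) im1) as [[w Hw] [Pw Rw]].
  split; [ exists w; eapply holo_ext; [ | | exact Hw ]; [ intros z _; apply sel_q | reflexivity ] | split ].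
  - intros z Hz. assert (K := Pw z Hz). cbv beta in K. rewrite !(sel_q p1 q1) in K. exact K.
  - intros x. assert (K := Rw x). cbv beta in K. rewrite (sel_q p1 q1) in K. exact K.
Qed.

(** [determinant_one] gives the identity at real points. The entries are analytic and periodic along
    the curve, so [zero_on_reals_zero] extends it to the strip. *)
Lemma det_along_torus z : B1 z -> (A11 z * A22 z - A12 z * A21 z = 1)%C.
Proof.
  destruct (entry g1 p1 q1 1 0 abs1 abs0 (em_taylor1 EM) (em_bound1 EM)
    (em_periodic1 EM) im1) as [[w11 H11] [P11 _]].
  destruct (entry g2 p2 q2 1 0 abs1 abs0 (em_taylor2 EM) (em_bound2 EM)
    (em_periodic2 EM) im2) as [[w21 H21] [P21 _]].
  destruct (entry g2 p2 q2 0 1 abs0 abs1 (em_taylor2 EM) (em_bound2 EM)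
    (em_periodic2 EM) im2) as [[w22 H22] [P22 _]].
  destruct hA12 as [[w12 H12] [P12 _]].
  set (a11 := fun z => (RtoC 1 * p1 (P z) (v z) + RtoC 0 * q1 (P z) (v z))%C) in *.
  set (a21 := fun z => (RtoC 1 * p2 (P z) (v z) + RtoC 0 * q2 (P z) (v z))%C) in *.
  set (a22 := fun z => (RtoC 0 * p2 (P z) (v z) + RtoC 1 * q2 (P z) (v z))%C) in *.
  assert (E : forall z, ((1 + a11 z) * (1 + a22 z) - A12 z * a21 z - 1 = A11 z * A22 z - A12 z * A21 z - 1)%C).
  { intros w. unfold a11, a21, a22, A11, A21, A22. ring. }
  intros Hz. apply Ceq_minus. rewrite <- E.
  eapply (zero_on_reals_zero (rho - d) (fun z => (1 + a11 z) * (1 + a22 z) - A12 z * a21 z - 1)%C); [ | | | exact Hz ].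
  - apply holo_minus; [ apply holo_minus | apply holo_const ].
    + apply holo_mult; apply holo_plus; try apply holo_const; eassumption.
    + apply holo_mult; eassumption.
  - intros w Hw. specialize (P11 w (inc10 w Hw)). specialize (P21 w (inc10 w Hw)). specialize (P22 w (inc10 w Hw)).
    specialize (P12 w (inc10 w Hw)). cbv beta in *. now rewrite P11, P21, P22, P12.
  - intros x. cbv beta. rewrite E. apply (proj1 (Ceq_minus _ _)).
    assert (G0 : 0 < rho0).
    { assert (Z : B0 (RtoC x)) by apply DL0. destruct (dom _ Z) as [s1 _]. unfold strip in s1. generalize (Rabs_pos (Im (P (RtoC x)))). lra. }
    destruct (dom (RtoC x) (DL0 x)) as [_ D2].
    unfold A11, A12, A21, A22, P.
    rewrite (RtoC_Re (v (RtoC x)) (rv x)) in *. rewrite (RtoC_Re (u (RtoC x)) (ru x)), <- RtoC_mult, <- RtoC_plus.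
    apply (determinant_one F rho0 I0 R0 L B g1 g2 p1 q1 p2 q2 EM); auto.
    now apply (cdisc_real I0 R0).
Qed.

Lemma err_derivative_bound z : B1 z -> Cmod (e1' z) <= 2 * eps / d /\ Cmod (e2' z) <= 2 * eps / d.
Proof.
  intros Hz. replace d with (rho - (rho - d)) at 1 2 by ring. split.
  - apply (cauchy_estimate (rho - d) rho e1 e1' eps z); auto; [ lra | ].
    intros w Hw. apply (t_e T w Hw).
  - apply (cauchy_estimate (rho - d) rho e2 e2' eps z); auto; [ lra | ].
    intros w Hw. apply (t_e T w Hw).
Qed.

(** The component K_phi' of the tangent vector. *)
Let phi (z : C) : C := (RtoC 1 + u1 z)%C.

Let phi_bound z : B0 z -> 3 / 4 <= Cmod (phi z) <= 5 / 4 /\ phi z <> RtoC 0 /\ Cmod (/ phi z)%C <= 4 / 3.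
Proof.
  intros Hz. destruct (t_ub T z Hz) as [H1 _].
  assert (L1 : 3 / 4 <= Cmod (phi z)).
  { assert (K := Cmod_minus_le (phi z) (u1 z) (Cmod (phi z)) b (Rle_refl _) H1).
    replace (phi z - u1 z)%C with (RtoC 1) in K by (unfold phi; ring). rewrite Cmod_1 in K. lra. }
  assert (U1 : Cmod (phi z) <= 5 / 4).
  { unfold phi. eapply Rle_trans; [ apply Cmod_triangle | ]. rewrite Cmod_1. lra. }
  assert (N : phi z <> RtoC 0). { intros E. rewrite E, Cmod_0 in L1. lra. }
  split; [ lra | split; [ exact N | ] ].
  rewrite Cmod_inv by exact N. replace (4 / 3) with (/ (3 / 4)) by field. apply Rinv_le_contravar; lra.
Qed.

Let regular1 : exists u2, holo B1 u1 u2.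
Proof.
  destruct (holo_bound_interior (rho - d) rho) as [K [_ HK]]; [ lra | ].
  destruct (HK u u1 a hu pu) as [_ [_ H]]; auto. intros z Hz. apply (t_ua T z Hz).
Qed.

Let pu1 : periodic_on B1 u1.
Proof.
  destruct (holo_bound_interior (rho - d) rho) as [K [_ HK]]; [ lra | ].
  destruct (HK u u1 a hu pu) as [_ [H _]]; auto. intros z Hz. apply (t_ua T z Hz).
Qed.

Let vbound : exists M, forall z, B0 z -> Cmod (v z) <= M.
Proof. assert (H := hv). destruct H as [M [_ [H _]]]. exists M. exact H. Qed.

Let regular2 : exists v2, holo B1 v1 v2.
Proof.
  destruct vbound as [M HM].
  destruct (holo_bound_interior (rho - d) rho) as [K [_ HK]]; [ lra | ].
  destruct (HK v v1 M hv pv HM) as [_ [_ H]]; auto.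
Qed.

Let pv1 : periodic_on B1 v1.
Proof.
  destruct vbound as [M HM].
  destruct (holo_bound_interior (rho - d) rho) as [K [_ HK]]; [ lra | ].
  destruct (HK v v1 M hv pv HM) as [_ [H _]]; auto.
Qed.

Let ru1 : real_on_reals u1. Proof. apply (holo_derive_real B0 u); auto.  Qed.
Let rv1 : real_on_reals v1. Proof. apply (holo_derive_real B0 v); auto.  Qed.

(** Normal component of the error in the frame [(K', (0, 1 / phi))]. *)
Let n2 (z : C) : C := (phi (z + RtoC omega) * e2 z - v1 (z + RtoC omega) * e1 z)%C.
Let mean := cavg (line 0 n2).

(** By exactness [I dphi] has the same integral over the curve and over its image,
    which cancels the part of the mean that is linear in the error. *)
Let mean_bound : Cmod mean <= 2 * eps ^ 2 / d.
Proof.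
  assert (LA := loop_average F rho0 I0 R0 L B g1 g2 p1 q1 p2 q2 EM rho 1 u u1 v v1 ltac:(lra) (or_intror eq_refl) hu hv ru rv pu pv dom).
  assert (Cv := holo_line_Ccont B0 v v1 0 hv DL0). assert (Cu1 := holo_line_Ccont1 B0 u u1 0 hu DL0).
  assert (Ce1 := holo_line_Ccont B0 e1 e1' 0 he1 DL0). assert (Ce2 := holo_line_Ccont B0 e2 e2' 0 he2 DL0).
  assert (Ce1' := holo_line_Ccont1 B0 e1 e1' 0 he1 DL0).
  assert (hvs := holo_band_shift rho v v1 omega hv). fold B0 in hvs.
  assert (hus := holo_band_shift rho u u1 omega hu). fold B0 in hus.
  assert (Cvs := holo_line_Ccont B0 _ _ 0 hvs DL0). assert (Cvs1 := holo_line_Ccont1 B0 _ _ 0 hvs DL0).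
  assert (Cus1 := holo_line_Ccont1 B0 _ _ 0 hus DL0).
  set (vs := fun z => v (z + RtoC omega)%C) in *. set (vs1 := fun z => v1 (z + RtoC omega)%C) in *.
  set (us1 := fun z => u1 (z + RtoC omega)%C) in *. cbv beta in *.
  assert (BP := cavg_by_parts B0 e1 e1' vs vs1 0 he1 hvs pe1 (periodic_on_shift _ _ omega pv) DL0).
  (* Translation by [omega] does not change the action integral of the curve, which therefore
     cancels against the last term of [LA]. *)
  assert (Sh : cavg (line 0 (fun z => vs z * (RtoC 1 + us1 z))%C) = cavg (line 0 (fun z => v z * (RtoC 1 + u1 z))%C)).
  { assert (Cw : Ccont (line 0 (fun z => v z * (RtoC 1 + u1 z))%C)).
    { apply (Ccont_mult (line 0 v) (fun t => RtoC 1 + line 0 u1 t)%C); [ exact Cv | ].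
      apply Ccont_plus; [ apply Ccont_const | exact Cu1 ]. }
    rewrite <- (cavg_shift _ omega Cw).
    - apply cavg_ext. intros t. unfold line, vs, us1.
      replace ((t, 0) + RtoC omega)%C with ((t + omega)%R, 0) by (apply injective_projections; simpl; ring). reflexivity.
    - apply (line_periodic B1); [ | exact DL1 ]. intros z Hz. rewrite (pv z (inc10 z Hz)), (pu1 z Hz). reflexivity. }
  set (T1 := line 0 (fun z => vs z * (RtoC 1 + us1 z))%C) in *. set (T2 := line 0 (fun z => e1' z * vs z)%C) in *.
  set (T3 := line 0 (fun z => e2 z * (RtoC 1 + us1 z))%C). set (T4 := line 0 (fun z => e2 z * e1' z)%C).
  set (T5 := line 0 (fun z => v z * (RtoC 1 + u1 z))%C) in *. set (T6 := line 0 (fun z => e1 z * vs1 z)%C) in *.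
  assert (K1 : Ccont (fun t => RtoC 1 + line 0 us1 t)%C) by (apply Ccont_plus; [ apply Ccont_const | exact Cus1 ]).
  assert (C1 : Ccont T1) by exact (Ccont_mult _ _ Cvs K1). assert (C2 : Ccont T2) by exact (Ccont_mult _ _ Ce1' Cvs).
  assert (C3 : Ccont T3) by exact (Ccont_mult _ _ Ce2 K1). assert (C4 : Ccont T4) by exact (Ccont_mult _ _ Ce2 Ce1').
  assert (C5 : Ccont T5).
  { apply (Ccont_mult (line 0 v) (fun t => RtoC 1 + line 0 u1 t)%C); [ exact Cv | ].
    apply Ccont_plus; [ apply Ccont_const | exact Cu1 ]. }
  assert (C6 : Ccont T6) by exact (Ccont_mult _ _ Ce1 Cvs1).
  assert (E : (cavg T1 + (cavg T2 + (cavg T3 + cavg T4)) - cavg T5 = 0)%C).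
  { rewrite <- LA. rewrite <- (cavg_plus _ _ C3 C4), <- (cavg_plus _ _ C2 (Ccont_plus _ _ C3 C4)),
      <- (cavg_plus _ _ C1 (Ccont_plus _ _ C2 (Ccont_plus _ _ C3 C4))),
      <- (cavg_minus _ _ (Ccont_plus _ _ C1 (Ccont_plus _ _ C2 (Ccont_plus _ _ C3 C4))) C5).
    apply cavg_ext. intros t. unfold T1, T2, T3, T4, T5, line. set (z := (t, 0) : C).
    unfold e1', e2, err2, vs, us1, P. ring. }
  assert (EM' : mean = (- cavg T4)%C).
  { transitivity (cavg T3 - cavg T6)%C.
    - unfold mean. rewrite <- (cavg_minus _ _ C3 C6). apply cavg_ext. intros t.
      unfold T3, T6, line, n2, phi, us1, vs1. ring.
    - rewrite BP, Sh in E. transitivity ((cavg T5 + (- cavg T6 + (cavg T3 + cavg T4)) - cavg T5) - cavg T4)%C; [ ring | ].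
      rewrite E. ring. }
  rewrite EM', Cmod_opp. apply cavg_bound; [ exact C4 | ]. intros t. unfold T4, line.
  replace (2 * eps ^ 2 / d) with (eps * (2 * eps / d)) by (field; lra).
  apply Cmod_mult_le; [ apply (t_e T), DL0 | apply err_derivative_bound, DL1 ].
Qed.

(** Price of solving one cohomological equation at the loss [d]. By [HX] it dominates [1] and the
    factor [1 / d] of the Cauchy estimates, so all losses are measured in powers of [X]. *)
Let X := sol_const nu / (gamma * Rpower d nu).
Hypothesis HX : 1 <= X /\ / d <= X.
(** One constant in place of [1], [1 + c2] and [(1 + c2) / c1]. *)
Let A := (1 + / c1) * (1 + c2).

Let eps_nonneg : 0 <= eps.
Proof. destruct (t_e T _ (DL0 0)) as [H _]. generalize (Cmod_ge_0 (err1 u v (0, 0))). lra. Qed.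

Let A_bounds : 1 + c2 <= A /\ 1 <= A /\ / c1 * (1 + c2) <= A.
Proof. assert (K : 0 < / c1) by now apply Rinv_0_lt_compat. unfold A. repeat split; nra. Qed.

(** Torsion: the off-diagonal entry of DF in the frame [(K', (0, 1 / phi))]. *)
Let S (z : C) : C := (A12 z * / (phi z * phi (z + RtoC omega)))%C.

Let phis z : B1 z -> B0 (z + RtoC omega)%C.
Proof. intros Hz. apply band_shift, inc10, Hz. Qed.

Let hphi : exists w, holo B1 phi w.
Proof. destruct regular1 as [w Hw]. eexists. apply holo_plus; [ apply holo_const | exact Hw ]. Qed.

Let hphis : exists w, holo B1 (fun z => phi (z + RtoC omega)%C) w.
Proof. destruct hphi as [w Hw]. eexists. apply holo_band_shift. exact Hw. Qed.

Let pphi : periodic_on B1 phi.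
Proof. intros z Hz. unfold phi. now rewrite pu1. Qed.

Let rphi : real_on_reals phi.
Proof. apply (real_on_reals_plus (fun _ => RtoC 1) u1); [ apply real_on_reals_const | exact ru1 ]. Qed.

Let hS : exists w, holo B1 S w.
Proof.
  destruct hA12 as [[wa Ha12] _]. destruct hphi as [wb Hb1]. destruct hphis as [wc Hc1'].
  eexists. apply holo_mult; [ exact Ha12 | ].
  eapply (holo_inv B1 (fun z => phi z * phi (z + RtoC omega))%C _ (9 / 16)); [ lra | | ].
  - intros z Hz. rewrite Cmod_mult. destruct (phi_bound z (inc10 z Hz)) as [k1 _].
    destruct (phi_bound _ (phis z Hz)) as [k2 _]. nra.
  - apply holo_mult; [ exact Hb1 | exact Hc1' ].
Qed.

Let pS : periodic_on B1 S.
Proof.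
  intros z Hz. destruct hA12 as [_ [H _]]. unfold S.
  assert (K := periodic_on_shift _ _ omega pphi z Hz). cbv beta in K.
  now rewrite (H z (inc10 z Hz)), (pphi z Hz), K.
Qed.

Let rS : real_on_reals S.
Proof.
  destruct hA12 as [_ [_ H]]. apply (real_on_reals_mult A12); [ exact H | ].
  apply (real_on_reals_inv (fun z => phi z * phi (z + RtoC omega))%C).
  apply real_on_reals_mult; [ exact rphi | now apply real_on_reals_shift ].
Qed.

Let S_bound z : B1 z -> Cmod (S z) <= 2 * (1 + c2) /\ Cmod (S z - a0)%C <= c1 / 2.
Proof.
  intros Hz. destruct (phi_bound z (inc10 z Hz)) as [k1 [k2 k3]].
  destruct (phi_bound _ (phis z Hz)) as [l1 [l2 l3]].
  destruct (dom z (inc10 z Hz)) as [d1 d2]. destruct (twist _ _ d1 d2) as [t1 [t2 _]].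
  destruct (dom' z (inc10 z Hz)) as [_ d3].
  assert (J : Cmod (/ (phi z * phi (z + RtoC omega)))%C <= 16 / 9).
  { replace (/ (phi z * phi (z + RtoC omega)))%C with (/ phi z * / phi (z + RtoC omega))%C by (field; auto).
    replace (16 / 9) with (4 / 3 * (4 / 3)) by field. now apply Cmod_mult_le. }
  split.
  - eapply Rle_trans; [ apply Cmod_mult_le; [ exact t2 | exact J ] | ]. lra.
  - replace (S z - a0)%C with ((A12 z - a0) * / (phi z * phi (z + RtoC omega)) +
      a0 * ((1 - phi z * phi (z + RtoC omega)) * / (phi z * phi (z + RtoC omega))))%C
      by (unfold S; field; auto).
    destruct (t_ub T z (inc10 z Hz)) as [b1 _].
    destruct (t_ub T _ (phis z Hz)) as [b2 _].
    assert (J2 : Cmod (1 - phi z * phi (z + RtoC omega))%C <= b + b + b * (1 / 4)).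
    { replace (1 - phi z * phi (z + RtoC omega))%C with (- (u1 z + u1 (z + RtoC omega) + u1 z * u1 (z + RtoC omega)))%C
        by (unfold phi; ring).
      rewrite Cmod_opp. apply Cmod_plus_le; [ now apply Cmod_plus_le | ]. apply Cmod_mult_le; lra. }
    eapply Rle_trans.
    { apply Cmod_plus_le; apply Cmod_mult_le; [ exact t1 | exact J | apply twist0 | apply Cmod_mult_le; [ exact J2 | exact J ] ]. }
    assert (W : c3 * Cmod (v z - RtoC I0)%C <= c3 * a) by (apply Rmult_le_compat_l; auto).
    assert (0 <= c3 * a) by (apply Rmult_le_pos; [ auto | generalize (Cmod_ge_0 (v z - RtoC I0)%C); lra ]). lra.
Qed.

(** Tangential component of the error in the same frame, the companion of [n2]. *)
Let n1 (z : C) : C := (e1 z * / phi (z + RtoC omega))%C.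

Let hn1 : exists w, holo B1 n1 w.
Proof.
  destruct hphis as [w Hw]. eexists. apply holo_mult; [ eapply holo_sub; [ exact inc10 | exact he1 ] | ].
  apply (holo_inv B1 (fun z => phi (z + RtoC omega)%C) w (3 / 4)); [ lra | | exact Hw ].
  intros z Hz. apply (phi_bound _ (phis z Hz)).
Qed.

Let pn1 : periodic_on B1 n1.
Proof.
  intros z Hz. unfold n1. assert (K := periodic_on_shift _ _ omega pphi z Hz). cbv beta in K.
  now rewrite (pe1 z (inc10 z Hz)), K.
Qed.

Let rn1 : real_on_reals n1.
Proof.
  apply (real_on_reals_mult e1); [ exact re1 | ]. apply (real_on_reals_inv (fun z => phi (z + RtoC omega)%C)). now apply real_on_reals_shift.
Qed.

Let hn2 : exists w, holo B1 n2 w.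
Proof.
  destruct hphis as [w Hw]. destruct regular2 as [w2 Hw2].
  eexists. apply holo_minus; apply holo_mult.
  - exact Hw.
  - eapply holo_sub; [ exact inc10 | exact he2 ].
  - apply holo_band_shift. exact Hw2.
  - eapply holo_sub; [ exact inc10 | exact he1 ].
Qed.

Let pn2 : periodic_on B1 n2.
Proof.
  intros z Hz. unfold n2. assert (K := periodic_on_shift _ _ omega pphi z Hz).
  assert (K2 := periodic_on_shift _ _ omega pv1 z Hz). cbv beta in K, K2.
  now rewrite (pe1 z (inc10 z Hz)), (pe2 z (inc10 z Hz)), K, K2.
Qed.

Let rn2 : real_on_reals n2.
Proof.
  apply real_on_reals_minus; apply real_on_reals_mult; auto.
  - now apply (real_on_reals_shift phi).
  - now apply (real_on_reals_shift v1).
Qed.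

Let n_bound z : B1 z -> Cmod (n1 z) <= 2 * eps /\ Cmod (n2 z) <= 2 * eps.
Proof.
  intros Hz. destruct (t_e T z (inc10 z Hz)) as [E1 E2]. fold e1 in E1. fold e2 in E2.
  destruct (phi_bound _ (phis z Hz)) as [k1 [k2 k3]].
  destruct (t_ub T _ (phis z Hz)) as [_ b2]. split.
  - eapply Rle_trans; [ apply Cmod_mult_le; [ exact E1 | exact k3 ] | ]. lra.
  - eapply Rle_trans.
    { apply Cmod_minus_le; apply Cmod_mult_le; [ apply k1 | exact E2 | exact b2 | exact E1 ]. } nra.
Qed.

Let solve (r : R) (f f1 : C -> C) (M : R) : d < r ->
  holo (band (- r) r) f f1 -> periodic_on (band (- r) r) f -> real_on_reals f ->
  (forall z, band (- r) r z -> Cmod (f z) <= M) -> cavg (line 0 f) = RtoC 0 ->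
  exists e w, holo (band (- (r - d)) (r - d)) e w /\
    periodic_on (band (- (r - d)) (r - d)) e /\ real_on_reals e /\
    (forall z, band (- (r - d)) (r - d) z -> (e (z + RtoC omega) - e z = f z)%C) /\
    (forall z, band (- (r - d)) (r - d) z -> Cmod (e z) <= X * M).
Proof.
  intros Hr Hf Pf Rf HM Hz.
  destruct (cohomological_equation gamma nu omega ltac:(lra) Hnu HDio r d f f1 M ltac:(lra) ltac:(lra) Hf Pf Rf HM Hz)
    as [e [w [Q1 [Q2 [Q3 [Q4 Q5]]]]]].
  exists e, w. repeat split; auto.
  intros z Hz'. eapply Rle_trans; [ now apply Q5 | ]. unfold X. right. field.
  split; [ apply Rgt_not_eq, Rpower_pos | lra ].
Qed.

(** Coordinates of the correction in the frame: [xi] along [K'] and [et] along [(0, 1 / phi)]. The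
    mean [m] of [n2] obstructs the first equation; it is left in place because it is quadratic in
    the error. *)
Lemma newton_solve :
  exists et et' xi xi' m, holo B3 et et' /\ holo B3 xi xi' /\ real_on_reals et /\ real_on_reals xi /\
    periodic_on B3 et /\ periodic_on B3 xi /\
    (forall z, B3 z -> et (z + RtoC omega)%C = (et z + n2 z - m)%C) /\
    (forall z, B3 z -> xi (z + RtoC omega)%C = (xi z + (n1 z + S z * et z))%C) /\
    (forall z, B3 z -> Cmod (et z) <= 24 * A * X * eps) /\
    (forall z, B3 z -> Cmod (xi z) <= 50 * A ^ 2 * X ^ 2 * eps) /\
    Cmod m <= 2 * eps ^ 2 / d.
Proof.
  destruct HX as [HX1 HX2]. destruct A_bounds as [HA1 [HA2 HA3]].
  destruct hn1 as [w1 Hn1]. destruct hn2 as [w2 Hn2]. destruct hS as [w3 HS].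
  assert (Cn2 := holo_line_Ccont B1 _ _ 0 Hn2 DL1). assert (Cn1 := holo_line_Ccont B1 _ _ 0 Hn1 DL1).
  assert (CS := holo_line_Ccont B1 _ _ 0 HS DL1).
  assert (Em : mean = RtoC (Re mean)) by apply RtoC_Re, cavg_line_real, rn2.
  assert (Mb : Cmod mean <= 2 * eps).
  { apply cavg_bound; [ exact Cn2 | ]. intros t. apply n_bound, DL1. }
  (* Here the mean is estimated crudely by [2 * eps], hence [4 * eps] in all; its quadratic bound
     matters in the new error. *)
  destruct (solve (rho - d) (fun z => n2 z - mean)%C (fun z => w2 z - 0)%C (4 * eps)) as [et0 [et0' [Q1 [Q2 [Q3 [Q4 Q5]]]]]].
  - lra.
  - apply holo_minus; [ exact Hn2 | apply holo_const ].
  - intros z Hz. cbv beta. now rewrite (pn2 z Hz).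
  - rewrite Em. apply real_on_reals_minus; [ exact rn2 | apply real_on_reals_const ].
  - intros z Hz. replace (4 * eps) with (2 * eps + 2 * eps) by ring.
    apply Cmod_minus_le; [ now apply n_bound | exact Mb ].
  - transitivity (cavg (line 0 n2) - cavg (fun _ => mean))%C.
    + apply (cavg_minus (line 0 n2) (fun _ => mean)); [ exact Cn2 | apply Ccont_const ].
    + rewrite cavg_const. unfold mean. ring.
  - replace (rho - d - d) with (rho - 2 * d) in * by ring. fold B2 in Q1, Q2, Q4, Q5.
    assert (Ce := holo_line_Ccont B2 _ _ 0 Q1 DL2).
    set (kS := cavg (line 0 S)). set (ks1 := cavg (line 0 n1)).
    set (ks2 := cavg (line 0 (fun z => S z * et0 z)%C)).
    (* The twist enters here: the mean of the torsion stays at distance [c1 / 2] from [0]. *)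
    assert (KS : c1 / 2 <= Cmod kS).
    { assert (K : Cmod (kS - a0)%C <= c1 / 2).
      { rewrite <- (cavg_const a0). unfold kS. rewrite <- (cavg_minus (line 0 S) (fun _ => a0)) by (try exact CS; apply Ccont_const).
        apply cavg_bound; [ apply Ccont_minus; [ exact CS | apply Ccont_const ] | ]. intros t. apply S_bound, DL1. }
      assert (K2 := Cmod_minus_le kS (kS - a0)%C (Cmod kS) (c1 / 2) (Rle_refl _) K).
      replace (kS - (kS - a0))%C with a0 in K2 by ring. lra. }
    assert (NS : kS <> RtoC 0). { intros E. rewrite E, Cmod_0 in KS. lra. }
    set (bar := (- (ks1 + ks2) * / kS)%C).
    assert (Rbar' : Im bar = 0).
    { assert (I1 : Im kS = 0) by apply cavg_line_real, rS. assert (I2 : Im ks1 = 0) by apply cavg_line_real, rn1.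
      assert (I3 : Im ks2 = 0) by (apply cavg_line_real, real_on_reals_mult; [ exact rS | exact Q3 ]).
      unfold bar. rewrite (RtoC_Re kS I1), (RtoC_Re ks1 I2), (RtoC_Re ks2 I3), <- RtoC_plus, <- RtoC_opp.
      rewrite <- RtoC_inv, <- RtoC_mult; [ reflexivity | ].
      intros E. apply NS. now rewrite (RtoC_Re kS I1), E. }
    (* 20 = 4 + 16: the factors 2 and 8 in the bounds of [ks1] and [ks2], doubled by
       [/ (c1 / 2)]. *)
    assert (Bbar : Cmod bar <= 20 * (/ c1 * (1 + c2)) * X * eps).
    { assert (J1 : Cmod ks1 <= 2 * eps).
      { apply cavg_bound; [ exact Cn1 | ]. intros t. apply n_bound, DL1. }
      assert (J2 : Cmod ks2 <= 2 * (1 + c2) * (X * (4 * eps))).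
      { apply cavg_bound; [ apply (Ccont_mult (line 0 S) (line 0 et0)); [ exact CS | exact Ce ] | ].
        intros t. apply Cmod_mult_le; [ apply S_bound, DL1 | apply Q5, DL2 ]. }
      assert (J3 : Cmod (/ kS)%C <= / (c1 / 2)).
      { rewrite Cmod_inv by exact NS. apply Rinv_le_contravar; lra. }
      unfold bar. eapply Rle_trans.
      { apply Cmod_mult_le; [ rewrite Cmod_opp; apply Cmod_plus_le; [ exact J1 | exact J2 ] | exact J3 ]. }
      replace (/ (c1 / 2)) with (2 * / c1) by (field; lra).
      assert (P1 : 0 < / c1) by now apply Rinv_0_lt_compat.
      assert (P2 : eps <= (1 + c2) * X * eps). { assert (1 <= (1 + c2) * X) by nra. nra. }
      replace ((2 * eps + 2 * (1 + c2) * (X * (4 * eps))) * (2 * / c1)) with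
        (/ c1 * (4 * eps + 16 * ((1 + c2) * X * eps))) by ring.
      replace (20 * (/ c1 * (1 + c2)) * X * eps) with (/ c1 * (20 * ((1 + c2) * X * eps))) by ring.
      apply Rmult_le_compat_l; lra. }
    set (et := fun z => (et0 z + bar)%C).
    assert (Het : holo B2 et (fun z => et0' z + 0)%C) by (apply holo_plus; [ exact Q1 | apply holo_const ]).
    assert (Pet : periodic_on B2 et) by (intros z Hz; unfold et; now rewrite Q2).
    assert (Ret : real_on_reals et).
    { unfold et. rewrite (RtoC_Re bar Rbar'). apply real_on_reals_plus; [ exact Q3 | apply real_on_reals_const ]. }
    assert (AX : 0 <= X * eps) by (apply Rmult_le_pos; lra).
    assert (Bet : forall z, B2 z -> Cmod (et z) <= 24 * A * X * eps).
    { intros z Hz. eapply Rle_trans; [ apply Cmod_plus_le; [ now apply Q5 | exact Bbar ] | ].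
      replace (X * (4 * eps) + 20 * (/ c1 * (1 + c2)) * X * eps) with ((4 + 20 * (/ c1 * (1 + c2))) * (X * eps)) by ring.
      replace (24 * A * X * eps) with (24 * A * (X * eps)) by ring. apply Rmult_le_compat_r; [ exact AX | lra ]. }
    (* 50 = 2 + 48: [2 * eps] for [n1], and [2 * (1 + c2)] times [24 * A * X * eps] for the torsion
       term. *)
    destruct (solve (rho - 2 * d) (fun z => n1 z + S z * et z)%C
       (fun z => w1 z + (w3 z * et z + S z * (et0' z + 0)))%C (50 * A ^ 2 * X * eps)) as [xi [xi' [V1 [V2 [V3 [V4 V5]]]]]].
    + lra.
    + apply holo_plus; [ eapply holo_sub; [ exact inc21 | exact Hn1 ] | ].
      apply holo_mult; [ eapply holo_sub; [ exact inc21 | exact HS ] | exact Het ].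
    + intros z Hz. cbv beta. rewrite (pn1 z (inc21 z Hz)), (pS z (inc21 z Hz)), (Pet z Hz). reflexivity.
    + apply real_on_reals_plus; [ exact rn1 | apply real_on_reals_mult; [ exact rS | exact Ret ] ].
    + intros z Hz. eapply Rle_trans.
      { apply Cmod_plus_le; [ apply n_bound, inc21, Hz | apply Cmod_mult_le; [ apply S_bound, inc21, Hz | now apply Bet ] ]. }
      assert (R1 : eps <= A ^ 2 * X * eps). { assert (1 <= A ^ 2 * X). { assert (1 <= A ^ 2) by (simpl; nra). nra. } nra. }
      assert (R2 : (1 + c2) * (A * X * eps) <= A ^ 2 * X * eps).
      { replace (A ^ 2 * X * eps) with (A * (A * X * eps)) by ring. apply Rmult_le_compat_r; [ | exact HA1 ].
        replace (A * X * eps) with (A * (X * eps)) by ring. apply Rmult_le_pos; lra. }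
      lra.
    + transitivity (ks1 + (ks2 + kS * bar))%C.
      * transitivity (cavg (fun t => line 0 n1 t + (line 0 S t * line 0 et0 t + bar * line 0 S t))%C).
        { apply cavg_ext. intros t. unfold line, et. ring. }
        assert (C1 : Ccont (fun t => line 0 S t * line 0 et0 t)%C) by exact (Ccont_mult _ _ CS Ce).
        assert (C2 : Ccont (fun t => bar * line 0 S t)%C) by now apply Ccont_scal.
        rewrite (cavg_plus _ _ Cn1 (Ccont_plus _ _ C1 C2)), (cavg_plus _ _ C1 C2), (cavg_scal bar (line 0 S) CS).
        unfold ks1, ks2, kS, line. ring.
      * unfold bar. field. exact NS.
    + replace (rho - 2 * d - d) with (rho - 3 * d) in * by ring. fold B3 in V1, V2, V4, V5.
      exists et, (fun z => et0' z + 0)%C, xi, xi', mean.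
      split; [ eapply holo_sub; [ exact inc32 | exact Het ] | split; [ exact V1 | split; [ exact Ret | split; [ exact V3 | ] ] ] ].
      split; [ eapply periodic_on_sub; [ exact inc32 | exact Pet ] | split; [ exact V2 | ] ].
      split; [ | split; [ | split; [ | split ] ] ].
      * intros z Hz. unfold et. assert (K := Q4 z (inc32 z Hz)).
        replace (et0 (z + RtoC omega)%C) with ((et0 (z + RtoC omega) - et0 z) + et0 z)%C by ring. rewrite K. ring.
      * intros z Hz. assert (K := V4 z Hz).
        replace (xi (z + RtoC omega)%C) with ((xi (z + RtoC omega) - xi z) + xi z)%C by ring. rewrite K. ring.
      * intros z Hz. apply Bet, inc32, Hz.
      * intros z Hz. eapply Rle_trans; [ now apply V5 | ]. right. ring.
      * exact mean_bound.
Qed.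

(** Bound for both components of the correction; 100 leaves room over the 50 of [xi] and the 24 of
    [et] for the factors [5 / 4] and [4 / 3] of the frame. *)
Let D := 100 * A ^ 2 * X ^ 2 * eps.
Hypotheses (HD1 : D <= d) (HD2 : a + D < R0).

Let B4 := band (- (rho - 4 * d)) (rho - 4 * d).

(** The linear part of the error is cancelled by the choice of [xi] and [et]. There remain products
    of the correction with derivatives of the error, the mean [m], and the Taylor remainder; the
    last one sets the power [X^4], as [D] is of order [X^2 * eps]. *)
Lemma newton_step :
  exists x x1 y y1,
    torus (rho - 4 * d) (a + D) (b + 2 * D / d) (20400 * (1 + L) * A ^ 4 * X ^ 4 * eps ^ 2)
      (fun z => u z + x z)%C (fun z => u1 z + x1 z)%C (fun z => v z + y z)%C (fun z => v1 z + y1 z)%C /\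
    (forall z, B4 z -> Cmod (x z) <= D /\ Cmod (y z) <= D) /\
    (forall z, B4 z -> Cmod (x1 z) <= 2 * D / d /\ Cmod (y1 z) <= 2 * D / d).
Proof.
  destruct newton_solve as [et [et' [xi [xi' [m [E1 [E2 [E3 [E4 [E5 [E6 [E7 [E8 [E9 [E10 E11]]]]]]]]]]]]]]].
  destruct HX as [HX1 HX2]. destruct A_bounds as [HA1 [HA2 HA3]].
  assert (inc31 : forall z, B3 z -> B1 z) by auto. assert (inc30 : forall z, B3 z -> B0 z) by auto.
  assert (inc43 : forall z, B4 z -> B3 z) by (intros z; apply symmetric_band_mono; lra).
  destruct hphi as [wp Hwp]. destruct regular2 as [wv Hwv].
  assert (Hip := holo_inv B1 phi wp (3 / 4) ltac:(lra) (fun z Hz => proj1 (proj1 (phi_bound z (inc10 z Hz)))) Hwp).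
  (* The correction is [xi K' + et (0, 1 / phi)]: in this frame [DF] is unipotent up to derivatives of the error. *)
  set (x := fun z => (xi z * phi z)%C). set (y := fun z => (xi z * v1 z + et z * / phi z)%C).
  assert (Hx := holo_mult B3 xi xi' phi wp E2 (holo_sub _ _ _ _ inc31 Hwp)).
  assert (Hy := holo_plus _ _ _ _ _ (holo_mult B3 xi xi' v1 wv E2 (holo_sub _ _ _ _ inc31 Hwv))
     (holo_mult B3 et et' _ _ E1 (holo_sub _ _ _ _ inc31 Hip))).
  set (x1 := fun z => (xi' z * phi z + xi z * wp z)%C) in *.
  cbv beta in Hy. match type of Hy with holo _ _ ?f => set (y1 := f) in * end.
  fold x in Hx. fold y in Hy.
  assert (EX : 0 <= X * eps) by (apply Rmult_le_pos; lra).
  assert (EX2 : 0 <= A * X ^ 2 * eps).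
  { apply Rmult_le_pos; [ | exact eps_nonneg ]. apply Rmult_le_pos; [ lra | apply pow2_ge_0 ]. }
  assert (Ord1 : A * X * eps <= A ^ 2 * X ^ 2 * eps).
  { replace (A ^ 2 * X ^ 2 * eps) with (A * X * (A * X * eps)) by ring.
    replace (A * X * eps) with (1 * (A * X * eps)) at 1 by ring. apply Rmult_le_compat_r; [ | nra ].
    replace (A * X * eps) with (A * (X * eps)) by ring. apply Rmult_le_pos; lra. }
  assert (PD : 0 <= A ^ 2 * X ^ 2 * eps).
  { apply Rmult_le_pos; [ apply Rmult_le_pos; apply pow2_ge_0 | exact eps_nonneg ]. }
  assert (Bxy : forall z, B3 z -> Cmod (x z) <= D /\ Cmod (y z) <= D).
  { intros z Hz. destruct (phi_bound z (inc30 z Hz)) as [k1 [k2 k3]].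
    destruct (t_ub T z (inc30 z Hz)) as [_ b2]. unfold D. split.
    - eapply Rle_trans; [ apply Cmod_mult_le; [ now apply E10 | apply k1 ] | ]. lra.
    - eapply Rle_trans; [ apply Cmod_plus_le; apply Cmod_mult_le; [ now apply E10 | exact b2 | now apply E9 | exact k3 ] | ].
      assert (50 * A ^ 2 * X ^ 2 * eps * b <= 50 * A ^ 2 * X ^ 2 * eps * (1 / 4)) by (apply Rmult_le_compat_l; lra). lra. }
  assert (D0 : 0 <= D) by (unfold D; lra).
  assert (Bd : forall z, B4 z -> Cmod (x1 z) <= 2 * D / d /\ Cmod (y1 z) <= 2 * D / d).
  { intros z Hz. replace d with ((rho - 3 * d) - (rho - 4 * d)) at 1 2 by ring. split.
    - apply (cauchy_estimate (rho - 4 * d) (rho - 3 * d) x x1 D z); auto; [ lra | ]. intros w Hw. now apply Bxy.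
    - apply (cauchy_estimate (rho - 4 * d) (rho - 3 * d) y y1 D z); auto; [ lra | ]. intros w Hw. now apply Bxy. }
  exists x, x1, y, y1. split; [ | split; [ intros z Hz; apply Bxy; auto | exact Bd ] ].
  assert (Dn : forall z, B4 z -> strip rho0 (RtoC 1 * z + (u z + x z))%C /\ cdisc I0 R0 (v z + y z)%C).
  { intros z Hz. assert (Hz0 := inc30 z (inc43 z Hz)). destruct (Bxy z (inc43 z Hz)) as [b1 b2].
    destruct (t_ua T z Hz0) as [a1 a2]. split.
    - unfold strip. rewrite im_plus, im_scal_l, Rmult_1_l. eapply Rle_lt_trans; [ apply Rabs_triang | ].
      assert (Rabs (Im z) < rho - 4 * d) by (destruct Hz; apply Rabs_def1; lra).
      assert (K := Im_le_Cmod (u z + x z)%C). assert (K2 := Cmod_triangle (u z) (x z)). lra.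
    - unfold cdisc. replace (v z + y z - RtoC I0)%C with ((v z - RtoC I0) + y z)%C by ring.
      eapply Rle_lt_trans; [ apply Cmod_triangle | ]. lra. }
  (* 20000 is twice the square of the 100 in [D]. *)
  assert (Quad : forall z, B4 z -> L * (Cmod (x z) ^ 2 + Cmod (y z) ^ 2) <= 20000 * L * (A ^ 4 * X ^ 4 * eps ^ 2)).
  { intros z Hz. destruct (Bxy z (inc43 z Hz)) as [b1 b2].
    assert (Q1 : Cmod (x z) ^ 2 <= D ^ 2) by (apply pow_incr; split; [ apply Cmod_ge_0 | exact b1 ]).
    assert (Q2 : Cmod (y z) ^ 2 <= D ^ 2) by (apply pow_incr; split; [ apply Cmod_ge_0 | exact b2 ]).
    apply Rle_trans with (L * (2 * D ^ 2)); [ apply Rmult_le_compat_l; lra | ]. right. unfold D. ring. }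
  set (W := A ^ 4 * X ^ 4 * eps ^ 2) in *.
  assert (HW : forall k : R, 0 <= k -> k <= A ^ 4 * X ^ 4 -> k * eps ^ 2 <= W).
  { intros k Hk1 Hk2. unfold W. apply Rmult_le_compat_r; [ apply pow2_ge_0 | exact Hk2 ]. }
  assert (A1 : 1 <= A ^ 2) by (simpl; nra). assert (X1 : 1 <= X ^ 2) by (simpl; nra).
  assert (A4 : A ^ 2 <= A ^ 4). { replace (A ^ 4) with (A ^ 2 * A ^ 2) by ring. nra. }
  assert (X34 : X ^ 3 <= X ^ 4). { replace (X ^ 4) with (X ^ 3 * X) by ring. assert (0 <= X ^ 3) by (apply pow_le; lra). nra. }
  assert (X24 : X ^ 2 <= X ^ 4). { replace (X ^ 4) with (X ^ 2 * X ^ 2) by ring. nra. }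
  assert (P4 : 1 <= A ^ 4) by lra. assert (PX4 : 1 <= X ^ 4) by lra.
  assert (W1 : X * eps ^ 2 <= W).
  { apply HW; [ lra | ]. assert (X <= X ^ 2) by (simpl; nra). nra. }
  assert (W2 : A ^ 2 * X ^ 3 * eps ^ 2 <= W).
  { apply HW; [ apply Rmult_le_pos; [ lra | apply pow_le; lra ] | ].
    apply Rmult_le_compat; try lra. apply pow_le; lra. }
  assert (W3 : A ^ 2 * X ^ 2 * eps ^ 2 <= W).
  { apply HW; [ apply Rmult_le_pos; lra | ]. apply Rmult_le_compat; lra. }
  assert (ed : 2 * eps / d <= 2 * (X * eps)).
  { unfold Rdiv. rewrite Rmult_assoc, (Rmult_comm eps). apply Rmult_le_compat_l; [ lra | ].
    apply Rmult_le_compat_r; auto. }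
  assert (Be' : forall z, B4 z -> Cmod (e1' z) <= 2 * (X * eps) /\ Cmod (e2' z) <= 2 * (X * eps)).
  { intros z Hz. destruct (err_derivative_bound z (inc31 z (inc43 z Hz))). lra. }
  assert (Bxie : forall z e, B4 z -> Cmod e <= 2 * (X * eps) -> Cmod (xi z * e)%C <= 100 * W).
  { intros z e Hz He. eapply Rle_trans; [ apply Cmod_mult_le; [ apply E10, inc43, Hz | exact He ] | ].
    replace (50 * A ^ 2 * X ^ 2 * eps * (2 * (X * eps))) with (100 * (A ^ 2 * X ^ 3 * eps ^ 2)) by ring. lra. }
  (* DF maps [xi K'] to [xi] times the sum of [K'(. + omega)] and the defect, so in the first
     component only [xi * e1'] and the Taylor remainder survive. *)
  assert (Split1 : forall z, B4 z -> err1 (fun z => u z + x z)%C (fun z => v z + y z)%C z =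
     (xi z * e1' z + (g1 (RtoC 1 * z + (u z + x z)) (v z + y z) - g1 (P z) (v z)
        - (RtoC 1 * z + (u z + x z) - P z) * p1 (P z) (v z) - (v z + y z - v z) * q1 (P z) (v z)))%C).
  { intros z Hz. assert (Hz3 := inc43 z Hz). assert (Hz1 := inc31 z Hz3).
    destruct (phi_bound z (inc10 z Hz1)) as [_ [N1 _]]. destruct (phi_bound _ (phis z Hz1)) as [_ [N2 _]].
    assert (Ex : x (z + RtoC omega)%C = (xi z * phi (z + RtoC omega) + e1 z + A12 z * et z * / phi z)%C).
    { unfold x. rewrite (E8 z Hz3). unfold n1, S. field. auto. }
    unfold err1. rewrite Ex. unfold e1, err1, e1', y, x, A12. fold (P z). unfold phi.
    replace (RtoC 1 * z + (u z + xi z * (RtoC 1 + u1 z)))%C with (P z + xi z * (RtoC 1 + u1 z))%C by (unfold P; ring).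
    ring. }
  assert (Split2 : forall z, B4 z -> err2 (fun z => u z + x z)%C (fun z => v z + y z)%C z =
     (xi z * e2' z + m * / phi (z + RtoC omega) + et z * (A12 z * e2' z - A22 z * e1' z) * (/ phi z * / phi (z + RtoC omega)) +
        (g2 (RtoC 1 * z + (u z + x z)) (v z + y z) - g2 (P z) (v z)
        - (RtoC 1 * z + (u z + x z) - P z) * p2 (P z) (v z) - (v z + y z - v z) * q2 (P z) (v z)))%C).
  { intros z Hz. assert (Hz3 := inc43 z Hz). assert (Hz1 := inc31 z Hz3).
    destruct (phi_bound z (inc10 z Hz1)) as [_ [N1 _]]. destruct (phi_bound _ (phis z Hz1)) as [_ [N2 _]].
    assert (Det := det_along_torus z Hz1).
    assert (F1 : phi (z + RtoC omega)%C = (A11 z * phi z + A12 z * v1 z - e1' z)%C).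
    { unfold A11, A12, e1', phi. ring. }
    assert (F2 : v1 (z + RtoC omega)%C = (A21 z * phi z + A22 z * v1 z - e2' z)%C).
    { unfold A21, A22, e2', phi. ring. }
    assert (Ey : y (z + RtoC omega)%C = (xi z * v1 (z + RtoC omega) + e2 z - m * / phi (z + RtoC omega) + et z * / phi (z + RtoC omega)
       + A12 z * et z * (/ phi z * / phi (z + RtoC omega)) * v1 (z + RtoC omega))%C).
    { unfold y. rewrite (E7 z Hz3), (E8 z Hz3). unfold n1, n2, S. field. auto. }
    (* the coefficient of [et] vanishes up to derivatives of the error since the determinant is one *)
    assert (Key : (A22 z * / phi z - / phi (z + RtoC omega) - A12 z * (/ phi z * / phi (z + RtoC omega)) * v1 (z + RtoC omega) =
       (A12 z * e2' z - A22 z * e1' z) * (/ phi z * / phi (z + RtoC omega)))%C).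
    { transitivity ((A22 z * phi (z + RtoC omega) - phi z - A12 z * v1 (z + RtoC omega)) * (/ phi z * / phi (z + RtoC omega)))%C.
      - field. auto.
      - f_equal. rewrite F1, F2.
        transitivity ((A11 z * A22 z - A12 z * A21 z) * phi z - phi z + (A12 z * e2' z - A22 z * e1' z))%C; [ ring | ].
        rewrite Det. ring. }
    unfold err2. rewrite Ey.
    transitivity (xi z * e2' z + m * / phi (z + RtoC omega) + et z * (A22 z * / phi z - / phi (z + RtoC omega) - A12 z * (/ phi z * / phi (z + RtoC omega)) * v1 (z + RtoC omega))
      + (g2 (RtoC 1 * z + (u z + x z)) (v z + y z) - g2 (P z) (v z)
        - (RtoC 1 * z + (u z + x z) - P z) * p2 (P z) (v z) - (v z + y z - v z) * q2 (P z) (v z)))%C.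
    - generalize (/ phi (z + RtoC omega))%C (g2 (RtoC 1 * z + (u z + x z)) (v z + y z)). intros ip G.
      unfold e2, err2, e2'. fold (P z). unfold y, x, A22.
      replace (RtoC 1 * z + (u z + xi z * phi z) - P z)%C with (xi z * phi z)%C by (unfold P; ring).
      generalize (/ phi z)%C. intros jp. unfold phi. ring.
    - rewrite Key. ring. }
  (* 400 covers 100 for the [xi] term, 3 for the mean and 260 for the [et] term. *)
  assert (Fin : forall k : R, 0 <= k <= 20000 * L * W + 400 * W -> k <= 20400 * (1 + L) * A ^ 4 * X ^ 4 * eps ^ 2).
  { intros k Hk. replace (20400 * (1 + L) * A ^ 4 * X ^ 4 * eps ^ 2) with (20400 * (1 + L) * W) by (unfold W; ring).
    assert (0 <= W) by (unfold W; apply Rmult_le_pos; [ apply Rmult_le_pos; lra | apply pow2_ge_0 ]).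
    assert (0 <= L * W) by (apply Rmult_le_pos; auto). lra. }
  constructor.
  - apply holo_plus; [ exact (holo_sub B0 B4 _ _ (fun z Hz => inc30 z (inc43 z Hz)) hu) | exact (holo_sub B3 B4 _ _ inc43 Hx) ].
  - apply holo_plus; [ exact (holo_sub B0 B4 _ _ (fun z Hz => inc30 z (inc43 z Hz)) hv) | exact (holo_sub B3 B4 _ _ inc43 Hy) ].
  - apply real_on_reals_plus; [ exact ru | apply real_on_reals_mult; [ exact E4 | exact rphi ] ].
  - apply real_on_reals_plus; [ exact rv | ]. apply (real_on_reals_plus (fun z => xi z * v1 z)%C (fun z => et z * / phi z)%C).
    + apply real_on_reals_mult; [ exact E4 | exact rv1 ].
    + apply real_on_reals_mult; [ exact E3 | now apply real_on_reals_inv ].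
  - intros z Hz. assert (Hz3 := inc43 z Hz). unfold x.
    now rewrite (pu z (inc30 z Hz3)), (E6 z Hz3), (pphi z (inc31 z Hz3)).
  - intros z Hz. assert (Hz3 := inc43 z Hz). unfold y.
    now rewrite (pv z (inc30 z Hz3)), (E6 z Hz3), (E5 z Hz3), (pphi z (inc31 z Hz3)), (pv1 z (inc31 z Hz3)).
  - intros z Hz. destruct (Bxy z (inc43 z Hz)) as [b1 b2].
    destruct (t_ua T z (inc30 z (inc43 z Hz))) as [a1 a2]. split.
    + now apply Cmod_plus_le.
    + replace (v z + y z - RtoC I0)%C with ((v z - RtoC I0) + y z)%C by ring. now apply Cmod_plus_le.
  - intros z Hz. destruct (Bd z Hz) as [b1 b2].
    destruct (t_ub T z (inc30 z (inc43 z Hz))) as [a1 a2]. split; now apply Cmod_plus_le.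
  - intros z Hz. assert (Hz3 := inc43 z Hz). assert (Hz1 := inc31 z Hz3).
    destruct (dom z (inc10 z Hz1)) as [d1 d2]. destruct (Dn z Hz) as [n3 n4]. destruct (Be' z Hz) as [be1 be2].
    assert (DX : (RtoC 1 * z + (u z + x z) - P z)%C = x z) by (unfold P; ring).
    assert (DY : (v z + y z - v z)%C = y z) by ring.
    assert (T1 := em_taylor1 EM _ _ _ _ d1 n3 d2 n4).
    assert (T2 := em_taylor2 EM _ _ _ _ d1 n3 d2 n4).
    assert (QQ := Quad z Hz).
    rewrite (Split1 z Hz), (Split2 z Hz). split; apply Fin; (split; [ apply Cmod_ge_0 | ]).
    + eapply Rle_trans; [ apply Cmod_plus_le; [ apply Bxie; auto | exact T1 ] | ]. rewrite DX, DY.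
      assert (0 <= W) by (unfold W; apply Rmult_le_pos; [ apply Rmult_le_pos; lra | apply pow2_ge_0 ]). lra.
    + destruct (phi_bound z (inc10 z Hz1)) as [_ [_ k3]]. destruct (phi_bound _ (phis z Hz1)) as [_ [_ l3]].
      destruct (twist _ _ d1 d2) as [_ [t2 t3]].
      assert (A22b : Cmod (A22 z) <= 2).
      { unfold A22. eapply Rle_trans; [ apply Cmod_triangle | ]. rewrite Cmod_1. lra. }
      eapply Rle_trans.
      { apply Cmod_plus_le; [ apply Cmod_plus_le; [ apply Cmod_plus_le | ] | exact T2 ].
        - apply Bxie; auto.
        - apply Cmod_mult_le; [ exact E11 | exact l3 ].
        - apply Cmod_mult_le; [ apply Cmod_mult_le; [ now apply E9 | apply Cmod_minus_le; apply Cmod_mult_le; [ exact t2 | exact be2 | exact A22b | exact be1 ] ]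
          | apply Cmod_mult_le; [ exact k3 | exact l3 ] ]. }
      rewrite DX, DY.
      assert (M1 : 2 * eps ^ 2 / d * (4 / 3) <= 3 * W).
      { apply Rle_trans with (2 * (X * eps ^ 2) * (4 / 3)).
        - apply Rmult_le_compat_r; [ lra | ]. unfold Rdiv. rewrite Rmult_assoc, (Rmult_comm (eps ^ 2)).
          apply Rmult_le_compat_l; [ lra | ]. apply Rmult_le_compat_r; [ apply pow2_ge_0 | auto ].
        - assert (0 <= W) by (unfold W; apply Rmult_le_pos; [ apply Rmult_le_pos; lra | apply pow2_ge_0 ]). lra. }
      assert (M2 : 24 * A * X * eps * ((1 + c2) * (2 * (X * eps)) + 2 * (2 * (X * eps))) * (4 / 3 * (4 / 3)) <= 260 * W).
      { apply Rle_trans with (24 * A * X * eps * (3 * A * (2 * (X * eps))) * (4 / 3 * (4 / 3))).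
        - apply Rmult_le_compat_r; [ lra | ]. apply Rmult_le_compat_l.
          + replace (24 * A * X * eps) with (24 * A * (X * eps)) by ring. apply Rmult_le_pos; lra.
          + replace ((1 + c2) * (2 * (X * eps)) + 2 * (2 * (X * eps))) with ((1 + c2 + 2) * (2 * (X * eps))) by ring.
            apply Rmult_le_compat_r; lra.
        - replace (24 * A * X * eps * (3 * A * (2 * (X * eps))) * (4 / 3 * (4 / 3))) with (256 * (A ^ 2 * X ^ 2 * eps ^ 2)) by field.
          assert (0 <= W) by (unfold W; apply Rmult_le_pos; [ apply Rmult_le_pos; lra | apply pow2_ge_0 ]). lra. }
      assert (0 <= W) by (unfold W; apply Rmult_le_pos; [ apply Rmult_le_pos; lra | apply pow2_ge_0 ]). lra.
Qed.

End Step.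
End Newton.

Arguments t_hu {_ _ _ _ _ _ _ _ _ _ _ _} _.
Arguments t_hv {_ _ _ _ _ _ _ _ _ _ _ _} _.
Arguments t_ru {_ _ _ _ _ _ _ _ _ _ _ _} _.
Arguments t_rv {_ _ _ _ _ _ _ _ _ _ _ _} _.
Arguments t_pu {_ _ _ _ _ _ _ _ _ _ _ _} _.
Arguments t_pv {_ _ _ _ _ _ _ _ _ _ _ _} _.
Arguments t_ua {_ _ _ _ _ _ _ _ _ _ _ _} _.
Arguments t_ub {_ _ _ _ _ _ _ _ _ _ _ _} _.
Arguments t_e {_ _ _ _ _ _ _ _ _ _ _ _} _.

(** * Convergence of the iteration *)

Lemma dependent_choice (T : Type) (P : nat -> T -> Prop) (Q : nat -> T -> T -> Prop) (x0 : T) :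
  P 0%nat x0 -> (forall n x, P n x -> exists y, P (S n) y /\ Q n x y) ->
  exists f : nat -> T, f 0%nat = x0 /\ forall n, P n (f n) /\ Q n (f n) (f (S n)).
Proof.
  intros H0 Hs.
  set (next := fun n (s : {x | P n x}) => constructive_indefinite_description _ (Hs n (proj1_sig s) (proj2_sig s))).
  set (F := fix F n : {x | P n x} := match n with
     0%nat => exist _ x0 H0 | S m => exist _ (proj1_sig (next m (F m))) (proj1 (proj2_sig (next m (F m)))) end).
  exists (fun n => proj1_sig (F n)). split; [ reflexivity | ].
  intros n. split; [ apply (proj2_sig (F n)) | ]. apply (proj2 (proj2_sig (next n (F n)))).
Qed.

Lemma torus_weaken omega I0 g1 g2 rho a b e a' b' e' u u1 v v1 :
  a <= a' -> b <= b' -> e <= e' ->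
  torus I0 g1 g2 omega rho a b e u u1 v v1 -> torus I0 g1 g2 omega rho a' b' e' u u1 v v1.
Proof.
  intros Ha Hb He [T1 T2 T3 T4 T5 T6 T7 T8 T9]. constructor; auto.
  - intros z Hz. destruct (T7 z Hz). lra.
  - intros z Hz. destruct (T8 z Hz). lra.
  - intros z Hz. destruct (T9 z Hz). lra.
Qed.

Lemma Rpower_div_pow2 (x nu : R) (n : nat) :
  0 < x -> Rpower (x / 2 ^ n) nu = Rpower x nu / Rpower 2 nu ^ n.
Proof.
  intros Hx. induction n.
  - simpl. unfold Rdiv. now rewrite Rinv_1, !Rmult_1_r.
  - assert (P2 : 0 < 2 ^ n) by (apply pow_lt; lra). assert (Pw := Rpower_pos 2 nu).
    assert (Pn : 0 < Rpower 2 nu ^ n) by (apply pow_lt; lra).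
    assert (E : x / 2 ^ n = x / 2 ^ S n * 2) by (simpl; field; lra).
    rewrite E, <- Rpower_mult_distr in IHn; [ | apply Rdiv_lt_0_compat; [ lra | apply pow_lt; lra ] | lra ].
    apply Rmult_eq_reg_r with (Rpower 2 nu); [ | lra ]. rewrite IHn. simpl. field. lra.
Qed.

Lemma sol_const_ge_1 nu : 2 <= nu -> 1 <= sol_const nu.
Proof.
  intros H. unfold sol_const, div_const.
  assert (E := exp_ineq1_le (nu * nu)). assert (P : 1 <= Rpower 2 nu).
  { rewrite <- (Rpower_O 2) by lra. apply Rle_Rpower; lra. }
  assert (1 <= exp (nu * nu)) by nra. nra.
Qed.

(** For [d <= 1] the power [d^nu] is at most [d]; with [gamma <= 1] this provides the hypothesis
    [HX] of the Newton step. *)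
Lemma divisor_scale (nu gamma d : R) :
  2 <= nu -> 0 < gamma <= 1 -> 0 < d <= 1 ->
  1 <= sol_const nu / (gamma * Rpower d nu) /\ / d <= sol_const nu / (gamma * Rpower d nu).
Proof.
  intros Hnu Hg Hd. assert (K := sol_const_ge_1 nu Hnu). assert (P := Rpower_pos d nu).
  assert (L : Rpower d nu <= d).
  { rewrite <- (Rpower_1 d) at 2 by lra. unfold Rpower.
    assert (ln d <= 0) by (rewrite <- ln_1; apply ln_le; lra).
    assert (nu * ln d <= 1 * ln d) by nra.
    destruct H0 as [H0 | ->]; [ left; now apply exp_increasing | lra ]. }
  assert (Q : gamma * Rpower d nu <= d) by nra.
  assert (P2 : 0 < gamma * Rpower d nu) by nra.
  assert (I : / d <= / (gamma * Rpower d nu)) by (apply Rinv_le_contravar; auto).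
  assert (I1 : 1 <= / d) by (rewrite <- Rinv_1; apply Rinv_le_contravar; lra).
  unfold Rdiv. split; nra.
Qed.

Section Iteration.

Variables (F : R * R -> R * R) (rho0 I0 R0 L B : R) (g1 g2 p1 q1 p2 q2 : C -> C -> C).
Hypothesis EM : exact_map F rho0 I0 R0 L B g1 g2 p1 q1 p2 q2.
Variables (gamma nu omega c1 c2 c3 c : R) (a0 : C).
Hypotheses (Hgamma : 0 < gamma <= 1) (Hnu : 2 <= nu) (HDio : diophantine gamma nu (omega / (2 * PI)))
  (Hc1 : 0 < c1) (Hc2 : 0 < c2) (Hc3 : 0 <= c3) (Hc : 0 < c) (HL : 0 <= L).
Hypothesis twist : forall z w, strip rho0 z -> cdisc I0 R0 w ->
  Cmod (q1 z w - a0)%C <= c3 * Cmod (w - RtoC I0)%C + c /\ Cmod (q1 z w) <= 1 + c2 /\ Cmod (q2 z w) <= 1.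
Hypothesis twist0 : c1 <= Cmod a0 <= c2.
Hypothesis Hrho0 : 0 < rho0 < 1.
Hypothesis initial : forall z, strip rho0 z ->
  Cmod (g1 z (RtoC I0) - RtoC omega)%C <= c /\ Cmod (g2 z (RtoC I0)) <= c.

(** The steps use up [4 * d0 * (1 + 1 / 2 + ...) = 8 * d0], a third of [rho0 = 24 * d0]. The strip
    [16 * d0] common to all iterates exceeds [rho0 / 2 = 12 * d0], and [14 * d0] in between leaves
    room for the derivatives of the limit. *)
Let d0 := rho0 / 24.
Let A := (1 + / c1) * (1 + c2).
Let X0 := sol_const nu / (gamma * Rpower d0 nu).
Let w := Rpower 2 nu.
(** Halving the strip multiplies [X0 ^ 4] by [w ^ 4], so the quadratic estimate
    still contracts the error at the rate [q]. *)
Let q := / (2 * w ^ 4).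
(** Twice the correction bound [D] of the first step; the later ones are dominated by a geometric
    series of ratio [1 / 2]. *)
Let Bc := 200 * A ^ 2 * X0 ^ 2 * c.

Hypothesis S1 : 20400 * (1 + L) * A ^ 4 * X0 ^ 4 * c <= q.
Hypothesis S2 : 8 * Bc <= d0.
Hypothesis S3 : Bc <= R0 / 2.
Hypothesis S4 : 2 * (c3 * Bc + c) + 4 * c2 * (2 * Bc / d0) <= c1 / 2.
Hypothesis HR0 : 0 < R0.

(** Share of the budget still unspent after [n] steps: strip width, distance and slope are all used
    up in proportion to [1 - h n]. *)
Let h (n : nat) : R := (1 / 2) ^ n.
Let rh (n : nat) : R := rho0 - 8 * d0 * (1 - h n).
Let St (n : nat) (s : (C -> C) * (C -> C) * (C -> C) * (C -> C)) : Prop :=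
  let '(u, u1, v, v1) := s in
  torus I0 g1 g2 omega (rh n) (Bc * (1 - h n)) (2 * Bc / d0 * (1 - h n)) (c * q ^ n) u u1 v v1.
(** The strip of half-width [16 * d0] lies in all the strips [rh n], so limits can be taken
    there. *)
Let Near (n : nat) (s t : (C -> C) * (C -> C) * (C -> C) * (C -> C)) : Prop :=
  let '(u, u1, v, v1) := s in let '(x, x1, y, y1) := t in
  forall z, band (- (16 * d0)) (16 * d0) z -> Cmod (x z - u z)%C <= Bc * h n /\ Cmod (y z - v z)%C <= Bc * h n.

Let h_S n : h (S n) = h n / 2. Proof. unfold h. simpl. field. Qed.
Let h_b n : 0 < h n <= 1.
Proof.
  unfold h. split; [ apply pow_lt; lra | ]. generalize (pow_incr (1 / 2) 1 n ltac:(lra)). now rewrite pow1.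
Qed.
Let d0_pos : 0 < d0 <= 1. Proof. unfold d0. lra. Qed.
Let w_ge : 4 <= w.
Proof.
  unfold w. replace 4 with (Rpower 2 2); [ apply Rle_Rpower; lra | ].
  replace 2 with (INR 2) at 2 by (simpl; ring). rewrite Rpower_pow by lra. simpl. ring.
Qed.
Let X0_ge : 1 <= X0. Proof. apply divisor_scale; auto. Qed.
Let A_ge : 1 <= A. Proof. assert (0 < / c1) by now apply Rinv_0_lt_compat. unfold A. nra. Qed.
Let q_b : 0 < q /\ q * w ^ 4 = 1 / 2 /\ q * w ^ 2 <= 1 / 4.
Proof.
  assert (P : 0 < w ^ 4) by (apply pow_lt; lra). assert (P2 : 16 <= w ^ 2) by (simpl; nra).
  unfold q. split; [ apply Rinv_0_lt_compat; lra | split; [ field; lra | ] ].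
  replace (/ (2 * w ^ 4) * w ^ 2) with (/ (2 * w ^ 2)) by (field; lra).
  replace (1 / 4) with (/ 4) by field. apply Rinv_le_contravar; lra.
Qed.
Let Bc_pos : 0 < Bc.
Proof.
  unfold Bc. apply Rmult_lt_0_compat; [ | exact Hc ].
  apply Rmult_lt_0_compat; [ | apply pow_lt; lra ]. apply Rmult_lt_0_compat; [ lra | apply pow_lt; lra ].
Qed.

(** Each halving of [d] multiplies the price [X] by [2^nu]. *)
Let X_n n : sol_const nu / (gamma * Rpower (d0 * h n) nu) = X0 * w ^ n.
Proof.
  assert (E : d0 * h n = d0 / 2 ^ n).
  { unfold h, Rdiv. rewrite Rmult_1_l, pow_inv. reflexivity. }
  rewrite E, Rpower_div_pow2 by lra. unfold X0, w.
  assert (P1 := Rpower_pos d0 nu). assert (P2 : 0 < Rpower 2 nu ^ n) by (apply pow_lt, Rpower_pos).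
  field. repeat split; lra.
Qed.

Let step n s : St n s -> exists t, St (S n) t /\ Near n s t.
Proof.
  destruct s as [[[u u1] v] v1]. intros HT. simpl in HT.
  destruct (h_b n) as [h1 h2]. destruct d0_pos as [D1 D2]. destruct q_b as [Q1 [Q2 Q3]].
  set (d := d0 * h n).
  assert (Hd : 0 < d <= 1) by (unfold d; nra).
  assert (HX := divisor_scale nu gamma d Hnu Hgamma Hd). unfold d in HX. rewrite (X_n n) in HX.
  assert (Pq : 0 < q ^ n) by now apply pow_lt.
  assert (Pw : 0 < w ^ n) by (apply pow_lt; lra).
  set (D := 100 * A ^ 2 * (X0 * w ^ n) ^ 2 * (c * q ^ n)).
  assert (ED : D = Bc / 2 * (q * w ^ 2) ^ n).
  { unfold D, Bc. rewrite (Rpow_mult_distr q), <- pow_mult, (Nat.mul_comm 2 n), pow_mult. field. }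
  (* [X] grows like [w^n] and the error falls like [q^n], so [D] falls like [(q * w^2)^n], at least
     as fast as [(1 / 4)^n]. The second factor [h n] is spent on the division by [d]. *)
  assert (HD : D <= Bc / 2 * (h n * h n)).
  { rewrite ED. apply Rmult_le_compat_l; [ lra | ].
    replace (h n * h n) with ((1 / 4) ^ n) by (unfold h; rewrite <- Rpow_mult_distr; f_equal; field).
    apply pow_incr. split; [ | exact Q3 ]. apply Rmult_le_pos; [ lra | apply pow2_ge_0 ]. }
  assert (HD' : D <= Bc / 2 * h n) by (assert (h n * h n <= h n) by nra; nra).
  assert (HB8 : 2 * Bc / d0 <= 1 / 4).
  { apply Rmult_le_reg_r with d0; [ lra | ]. unfold Rdiv. rewrite Rmult_assoc, Rinv_l by lra. lra. }
  assert (HB0 : 0 <= 2 * Bc / d0) by (apply Rdiv_le_0_compat; lra).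
  assert (C1 : 4 * d < rh n) by (unfold d, rh, d0 in *; nra).
  assert (C2 : Bc * (1 - h n) < R0) by nra.
  assert (C3 : 0 <= 2 * Bc / d0 * (1 - h n) <= 1 / 4) by nra.
  assert (C4 : rh n + Bc * (1 - h n) <= rho0) by (unfold rh; nra).
  assert (C5 : 2 * (c3 * (Bc * (1 - h n)) + c) + 4 * c2 * (2 * Bc / d0 * (1 - h n)) <= c1 / 2).
  { assert (0 <= c3 * Bc) by (apply Rmult_le_pos; lra). assert (0 <= c2 * (2 * Bc / d0)) by (apply Rmult_le_pos; lra). nra. }
  assert (C6 : D <= d) by (unfold d; nra).
  assert (C7 : Bc * (1 - h n) + D < R0) by nra.
  destruct (newton_step F rho0 I0 R0 L B g1 g2 p1 q1 p2 q2 EM gamma nu omega c1 c2 c3 c a0) with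
    (rho := rh n) (a := Bc * (1 - h n)) (b := 2 * Bc / d0 * (1 - h n)) (eps := c * q ^ n) (d := d)
    (u := u) (u1 := u1) (v := v) (v1 := v1) as [x [x1 [y [y1 [NT [N1 N2]]]]]];
    try assumption; try (unfold d; rewrite (X_n n); assumption).
  unfold d in NT, N1, N2. rewrite (X_n n) in NT, N1, N2. fold d in NT, N1, N2. fold A in NT, N1, N2. fold D in NT, N1, N2.
  exists (fun z => u z + x z, fun z => u1 z + x1 z, fun z => v z + y z, fun z => v1 z + y1 z)%C.
  split.
  - simpl. replace (rh (S n)) with (rh n - 4 * d) by (unfold rh, d; rewrite h_S; field).
    eapply torus_weaken; [ | | | exact NT ].
    + rewrite h_S. lra.
    + rewrite h_S. assert (E : 2 * D / d <= Bc / d0 * h n).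
      { apply Rmult_le_reg_r with d; [ lra | ]. unfold Rdiv at 1. rewrite Rmult_assoc, Rinv_l, Rmult_1_r by lra.
        unfold d. replace (Bc / d0 * h n * (d0 * h n)) with (Bc * (h n * h n)) by (field; lra). lra. }
      replace (2 * Bc / d0 * (1 - h n / 2)) with (2 * Bc / d0 * (1 - h n) + Bc / d0 * h n) by (field; lra). lra.
    (* The factor [(q * w ^ 4) ^ n] is [h n], at most [1]; [S1] then supplies the factor [q] by
       which the error must decrease. *)
    + replace (20400 * (1 + L) * A ^ 4 * (X0 * w ^ n) ^ 4 * (c * q ^ n) ^ 2) with
        (20400 * (1 + L) * A ^ 4 * X0 ^ 4 * c * (c * q ^ n) * (q * w ^ 4) ^ n).
      * rewrite Q2. fold (h n). simpl (q ^ S n).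
        apply Rle_trans with (q * (c * q ^ n) * h n).
        -- apply Rmult_le_compat_r; [ lra | ]. apply Rmult_le_compat_r; [ nra | exact S1 ].
        -- assert (0 < q * (c * q ^ n)) by (apply Rmult_lt_0_compat; nra). nra.
      * assert (E : (q * w ^ 4) ^ n = q ^ n * (w ^ n) ^ 4).
        { rewrite Rpow_mult_distr, <- !pow_mult. do 2 f_equal. lia. }
        rewrite E. generalize (q ^ n), (w ^ n). intros. ring.
  - intros z Hz. assert (Hz' : band (- (rh n - 4 * d)) (rh n - 4 * d) z).
    { revert Hz. apply symmetric_band_mono. unfold rh, d, d0. nra. }
    destruct (N1 z Hz') as [b1 b2].
    replace (u z + x z - u z)%C with (x z) by ring. replace (v z + y z - v z)%C with (y z) by ring. split; nra.
Qed.

(** The circle [I = I0], whose invariance error is bounded by [initial]. *)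
Let start : St 0 ((fun _ => RtoC 0), (fun _ => RtoC 0), (fun _ => RtoC I0), (fun _ => RtoC 0)).
Proof.
  simpl. assert (E0 : h 0 = 1) by reflexivity. assert (Er : rh 0 = rho0) by (unfold rh; rewrite E0; ring).
  rewrite E0, Er. constructor; try apply holo_const; try apply real_on_reals_const; try (intros z Hz; reflexivity).
  - intros z _. replace (RtoC I0 - RtoC I0)%C with (RtoC 0) by ring. rewrite Cmod_0. lra.
  - intros z _. rewrite Cmod_0. lra.
  - intros z Hz. assert (Hs : strip rho0 z) by (destruct Hz; apply Rabs_def1; lra).
    destruct (initial z Hs) as [i1 i2]. unfold err1, err2.
    replace (RtoC 1 * z + 0)%C with z by ring.
    replace (0 + g1 z (RtoC I0) - RtoC omega - 0)%C with (g1 z (RtoC I0) - RtoC omega)%C by ring.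
    replace (RtoC I0 + g2 z (RtoC I0) - 0 - RtoC I0)%C with (g2 z (RtoC I0)) by ring. simpl. lra.
Qed.

Let geometric_Ccv (u : nat -> C) : (forall n, Cmod (u (S n) - u n)%C <= Bc * h n) -> Ccv u (Clim u).
Proof.
  intros H. apply Ccv_cauchy. intros eps He.
  assert (T : forall n m, Cmod (u (n + m)%nat - u n)%C <= 2 * Bc * (h n - h (n + m)%nat)).
  { intros n m. induction m.
    - rewrite Nat.add_0_r. replace (u n - u n)%C with (RtoC 0) by ring. rewrite Cmod_0. lra.
    - rewrite Nat.add_succ_r, h_S.
      replace (u (S (n + m)) - u n)%C with ((u (S (n + m)) - u (n + m)%nat) + (u (n + m)%nat - u n))%C by ring.
      eapply Rle_trans; [ apply Cmod_plus_le; [ apply H | exact IHm ] | ]. lra. }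
  assert (Lm : is_lim_seq h 0) by (apply is_lim_seq_geom; rewrite Rabs_pos_eq; lra).
  apply is_lim_seq_spec in Lm.
  assert (Pe : 0 < eps / (5 * Bc)) by (apply Rdiv_lt_0_compat; lra).
  destruct (Lm (mkposreal _ Pe)) as [N HN]. simpl in HN. specialize (HN N (le_n N)).
  rewrite Rminus_0_r, Rabs_pos_eq in HN by (apply Rlt_le, h_b).
  exists N. intros n m Hn Hm.
  assert (T1 := T N (n - N)%nat). assert (T2 := T N (m - N)%nat).
  replace (N + (n - N))%nat with n in T1 by lia. replace (N + (m - N))%nat with m in T2 by lia.
  replace (u n - u m)%C with ((u n - u N) - (u m - u N))%C by ring.
  eapply Rle_lt_trans; [ apply Cmod_minus_le; [ exact T1 | exact T2 ] | ].
  apply (Rmult_lt_compat_l (5 * Bc)) in HN; [ | lra ].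
  replace (5 * Bc * (eps / (5 * Bc))) with eps in HN by (field; lra).
  generalize (h_b n) (h_b m) (h_b N). nra.
Qed.

(** The invariance equation is asserted at real points: there the angle of the curve has an
    imaginary part of at most [Bc], so it stays in the domain of the displacements, and the errors
    of the iterates pass to the limit. *)
Lemma invariant_torus_exists :
  exists u u1 v v1, holo (band (- (14 * d0)) (14 * d0)) u u1 /\ holo (band (- (14 * d0)) (14 * d0)) v v1 /\
    real_on_reals u /\ real_on_reals v /\
    periodic_on (band (- (14 * d0)) (14 * d0)) u /\ periodic_on (band (- (14 * d0)) (14 * d0)) v /\
    (forall z, band (- (14 * d0)) (14 * d0) z ->
      Cmod (u z) <= Bc /\ Cmod (v z - RtoC I0)%C <= Bc /\ Cmod (u1 z) <= 2 * Bc / d0 /\ Cmod (v1 z) <= 2 * Bc / d0) /\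
    forall x : R, err1 g1 omega u v (RtoC x) = RtoC 0 /\ err2 g2 omega u v (RtoC x) = RtoC 0.
Proof.
  destruct (dependent_choice _ St Near _ start step) as [f [_ Hf]].
  set (un := fun n => fst (fst (fst (f n)))). set (un1 := fun n => snd (fst (fst (f n)))).
  set (vn := fun n => snd (fst (f n))). set (vn1 := fun n => snd (f n)).
  destruct d0_pos as [D1 D2].
  assert (HT : forall n, torus I0 g1 g2 omega (rh n) (Bc * (1 - h n)) (2 * Bc / d0 * (1 - h n)) (c * q ^ n) (un n) (un1 n) (vn n) (vn1 n)).
  { intros n. destruct (Hf n) as [H _]. unfold un, un1, vn, vn1. destruct (f n) as [[[a b] a'] b']. exact H. }
  set (D := band (- (16 * d0)) (16 * d0)).
  assert (HN : forall n z, D z -> Cmod (un (S n) z - un n z)%C <= Bc * h n /\ Cmod (vn (S n) z - vn n z)%C <= Bc * h n).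
  { intros n. destruct (Hf n) as [_ H]. unfold un, vn. destruct (f n) as [[[a b] a'] b'], (f (S n)) as [[[e k] e'] k']. exact H. }
  assert (inc : forall n z, D z -> band (- rh n) (rh n) z).
  { intros n z. apply symmetric_band_mono. generalize (h_b n). unfold rh, d0. nra. }
  assert (Cu : forall z, D z -> Ccv (fun n => un n z) (Clim (fun n => un n z))).
  { intros z Hz. apply geometric_Ccv. intros n. now apply HN. }
  assert (Cv : forall z, D z -> Ccv (fun n => vn n z) (Clim (fun n => vn n z))).
  { intros z Hz. apply geometric_Ccv. intros n. now apply HN. }
  set (u := fun z => Clim (fun n => un n z)) in *. set (v := fun z => Clim (fun n => vn n z)) in *.
  assert (Bu : forall n z, D z -> Cmod (un n z) <= Bc /\ Cmod (vn n z - RtoC I0)%C <= Bc).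
  { intros n z Hz. destruct (t_ua (HT n) z (inc n z Hz)). generalize (h_b n). nra. }
  assert (P8 : 0 <= 2 * Bc / d0) by (apply Rdiv_le_0_compat; lra).
  assert (Bu1 : forall n z, D z -> Cmod (un1 n z) <= 2 * Bc / d0 /\ Cmod (vn1 n z) <= 2 * Bc / d0).
  { intros n z Hz. destruct (t_ub (HT n) z (inc n z Hz)). generalize (h_b n). nra. }
  destruct (holo_limit (14 * d0) (16 * d0) Bc un un1 u) as [Lu Lu1]; [ lra | | | | | ].
  { intros n. eapply holo_sub; [ apply (inc n) | apply (t_hu (HT n)) ]. }
  { intros n. eapply periodic_on_sub; [ apply (inc n) | apply (t_pu (HT n)) ]. }
  { intros n z Hz. now apply Bu. }
  { exact Cu. }
  destruct (holo_limit (14 * d0) (16 * d0) (Bc + Rabs I0) vn vn1 v) as [Lv Lv1]; [ lra | | | | | ].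
  { intros n. eapply holo_sub; [ apply (inc n) | apply (t_hv (HT n)) ]. }
  { intros n. eapply periodic_on_sub; [ apply (inc n) | apply (t_pv (HT n)) ]. }
  { intros n z Hz. replace (vn n z) with ((vn n z - RtoC I0) + RtoC I0)%C by ring.
    apply Cmod_plus_le; [ now apply Bu | rewrite Cmod_R; lra ]. }
  { exact Cv. }
  assert (inc14 : forall z, band (- (14 * d0)) (14 * d0) z -> D z) by (intros z; apply symmetric_band_mono; lra).
  assert (DR : forall x : R, D (RtoC x)) by (intros x; split; simpl; lra).
  assert (RL : forall (s : nat -> C) l, Ccv s l -> (forall n, Im (s n) = 0) -> Im l = 0).
  { intros s l Hs Hi. apply Rabs_eq_0, Rle_antisym; [ | apply Rabs_pos ].
    apply le_epsilon. intros eps He. destruct (Hs eps He) as [N H]. specialize (H N (le_n N)).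
    rewrite Rplus_0_l. apply Rle_trans with (2 := Rlt_le _ _ H).
    replace (Rabs (Im l)) with (Rabs (Im (s N - l)%C)); [ apply Im_le_Cmod | ].
    unfold Cminus. rewrite im_plus, im_opp, Hi, Rplus_0_l. apply Rabs_Ropp. }
  assert (Per : forall (s : nat -> C -> C) z, (forall n, s n (z + RtoC (2 * PI))%C = s n z) ->
     Clim (fun n => s n (z + RtoC (2 * PI))%C) = Clim (fun n => s n z)).
  { intros s z H. unfold Clim. f_equal; f_equal; apply Lim_seq_ext; intros n; now rewrite H. }
  exists u, (fun z => Clim (fun n => un1 n z)), v, (fun z => Clim (fun n => vn1 n z)).
  split; [ exact Lu | split; [ exact Lv | split; [ | split; [ | split; [ | split; [ | split ] ] ] ] ] ].
  - intros x. apply (RL _ _ (Cu _ (DR x))). intros n. apply (t_ru (HT n)).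
  - intros x. apply (RL _ _ (Cv _ (DR x))). intros n. apply (t_rv (HT n)).
  - intros z Hz. apply Per. intros n. apply (t_pu (HT n)). auto.
  - intros z Hz. apply Per. intros n. apply (t_pv (HT n)). auto.
  - intros z Hz. assert (Hz' := inc14 z Hz). split; [ | split; [ | split ] ].
    + apply (Ccv_bound _ _ _ (Cu z Hz')). intros n. now apply Bu.
    + apply (Ccv_bound (fun n => vn n z - RtoC I0)%C).
      * apply (Ccv_minus _ _ _ _ (Cv z Hz') (Ccv_const (RtoC I0))).
      * intros n. now apply Bu.
    + apply (Ccv_bound _ _ _ (Lu1 z Hz)). intros n. now apply Bu1.
    + apply (Ccv_bound _ _ _ (Lv1 z Hz)). intros n. now apply Bu1.
  - intros x. set (z := RtoC x). assert (Hz := DR x). fold z in Hz.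
    assert (Hzw : D (z + RtoC omega)%C) by now apply band_shift.
    assert (Dom : forall s t, Cmod s <= Bc -> Cmod (t - RtoC I0)%C <= Bc -> strip rho0 (RtoC 1 * z + s)%C /\ cdisc I0 R0 t).
    { intros s t Hs Ht. split.
      - unfold strip, z. rewrite im_plus, im_scal_l. simpl Im at 1. rewrite Rmult_0_r, Rplus_0_l.
        eapply Rle_lt_trans; [ apply Im_le_Cmod | ]. unfold d0 in *. lra.
      - unfold cdisc. lra. }
    assert (Bu' : Cmod (u z) <= Bc) by (apply (Ccv_bound _ _ _ (Cu z Hz)); intros n; now apply Bu).
    assert (Bv' : Cmod (v z - RtoC I0)%C <= Bc).
    { apply (Ccv_bound (fun n => vn n z - RtoC I0)%C); [ apply (Ccv_minus _ _ _ _ (Cv z Hz) (Ccv_const (RtoC I0))) | intros n; now apply Bu ]. }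
    destruct (Dom _ _ Bu' Bv') as [K1 K2].
    (* Continuity of the displacements at the limit point, read off from the Taylor bound. *)
    assert (Cg : forall g p r : C -> C -> C,
       (forall z z' w w', strip rho0 z -> strip rho0 z' -> cdisc I0 R0 w -> cdisc I0 R0 w' ->
          Cmod (g z' w' - g z w - (z' - z) * p z w - (w' - w) * r z w)%C <= L * (Cmod (z' - z)%C ^ 2 + Cmod (w' - w)%C ^ 2)) ->
       Ccv (fun n => g (RtoC 1 * z + un n z)%C (vn n z)) (g (RtoC 1 * z + u z)%C (v z))).
    { intros g p r Hg eps He.
      set (P := p (RtoC 1 * z + u z)%C (v z)). set (Rr := r (RtoC 1 * z + u z)%C (v z)).
      set (M := Cmod P + Cmod Rr + 2 * L + 1). assert (PM : 0 < M) by (unfold M; generalize (Cmod_ge_0 P) (Cmod_ge_0 Rr); lra).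
      assert (Pe : 0 < Rmin 1 (eps / M)) by (apply Rmin_glb_lt; [ lra | now apply Rdiv_lt_0_compat ]).
      destruct (Cu z Hz _ Pe) as [N1 H1]. destruct (Cv z Hz _ Pe) as [N2 H2].
      exists (N1 + N2)%nat. intros n Hn. specialize (H1 n ltac:(lia)). specialize (H2 n ltac:(lia)).
      destruct (Bu n z Hz) as [b1 b2]. destruct (Dom _ _ b1 b2) as [J1 J2].
      assert (T := Hg _ _ _ _ K1 J1 K2 J2). fold P in T. fold Rr in T.
      replace (RtoC 1 * z + un n z - (RtoC 1 * z + u z))%C with (un n z - u z)%C in T by ring.
      set (x1 := (un n z - u z)%C) in *. set (x2 := (vn n z - v z)%C) in *.
      set (dm := Rmin 1 (eps / M)) in *. assert (L1 := Rmin_l 1 (eps / M)). assert (L2 := Rmin_r 1 (eps / M)). fold dm in L1, L2.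
      match goal with |- Cmod ?G < _ => replace G with ((G - x1 * P - x2 * Rr) + (x1 * P + x2 * Rr))%C by ring end.
      assert (sq : forall t, 0 <= t < dm -> t ^ 2 <= dm) by (intros t Ht; simpl; nra).
      assert (Sx1 := sq _ (conj (Cmod_ge_0 x1) H1)). assert (Sx2 := sq _ (conj (Cmod_ge_0 x2) H2)).
      apply Rle_lt_trans with (L * (dm + dm) + (dm * Cmod P + dm * Cmod Rr)).
      - apply Cmod_plus_le; [ eapply Rle_trans; [ exact T | apply Rmult_le_compat_l; lra ] | ].
        apply Cmod_plus_le; rewrite Cmod_mult; apply Rmult_le_compat_r; try apply Cmod_ge_0; apply Rlt_le; assumption.
      - apply Rlt_le_trans with (dm * M); [ unfold M; nra | ].
        apply Rle_trans with (eps / M * M); [ apply Rmult_le_compat_r; lra | right; field; lra ]. }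
    assert (Small : forall (s : nat -> C) l, Ccv s l -> (forall n, Cmod (s n) <= c * q ^ n) -> l = RtoC 0).
    { intros s l Hs Hb. apply (Ccv_unique s); [ exact Hs | ]. intros eps He.
      assert (Lm : is_lim_seq (fun n => c * q ^ n) 0).
      { replace (Finite 0) with (Rbar_mult c 0) by (simpl; f_equal; ring). apply is_lim_seq_scal_l.
        apply is_lim_seq_geom. destruct q_b as [Q1 [Q2 Q3]]. rewrite Rabs_pos_eq by lra.
        assert (1 <= w ^ 2) by (simpl; nra). nra. }
      apply is_lim_seq_spec in Lm. destruct (Lm (mkposreal eps He)) as [N HN']. exists N. intros n Hn.
      specialize (HN' n Hn). simpl in HN'. rewrite Rminus_0_r in HN'.
      replace (s n - 0)%C with (s n) by ring. eapply Rle_lt_trans; [ apply Hb | ].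
      generalize (Rle_abs (c * q ^ n)). lra. }
    split.
    + apply (Small (fun n => err1 g1 omega (un n) (vn n) z)).
      * unfold err1. apply Ccv_minus; [ apply Ccv_minus; [ apply Ccv_plus | apply Ccv_const ] | ].
        -- exact (Cu z Hz).
        -- apply (Cg g1 p1 q1). apply (em_taylor1 EM).
        -- exact (Cu _ Hzw).
      * intros n. apply (t_e (HT n)). auto.
    + apply (Small (fun n => err2 g2 omega (un n) (vn n) z)).
      * unfold err2. apply Ccv_minus; [ apply Ccv_minus; [ apply Ccv_plus | apply Ccv_const ] | ].
        -- exact (Cv z Hz).
        -- apply (Cg g2 p2 q2). apply (em_taylor2 EM).
        -- exact (Cv _ Hzw).
      * intros n. apply (t_e (HT n)). auto.
Qed.

End Iteration.

(** * The constant *)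

(** [c3 + 3] is [1 + L] for the Taylor constant [L = c3 + 2], and [(1 + x) * (1 + c2)] is the [A] of
    the Newton step. Of [Rpower 2 nu ^ 8], four powers come from [d0 = delta0 / 2] in [X0 ^ 4] and
    four from the contraction rate [q]. *)
Definition kam_const (x c2 c3 nu : R) : R :=
  1000000 * (c3 + 3) * ((1 + x) * (1 + c2)) ^ 4 * sol_const nu ^ 4 * Rpower 2 nu ^ 8.

Lemma pow_lt_mono (a b : R) (n : nat) : 0 < a < b -> a ^ S n < b ^ S n.
Proof.
  intros H. induction n; [ simpl; lra | ].
  change (a * a ^ S n < b * b ^ S n). assert (0 < a ^ S n) by (apply pow_lt; lra). nra.
Qed.

Lemma Rpower_2_ge_1 nu : 2 <= nu -> 1 <= Rpower 2 nu.
Proof. intros H. rewrite <- (Rpower_O 2) by lra. apply Rle_Rpower; lra. Qed.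

Lemma sol_const_mono nu nu' : 2 <= nu -> nu < nu' -> sol_const nu < sol_const nu'.
Proof.
  intros H H'. unfold sol_const, div_const. apply Rmult_lt_compat_l; [ lra | ].
  assert (exp (nu * nu) < exp (nu' * nu')) by (apply exp_increasing; nra).
  assert (Rpower 2 nu < Rpower 2 nu') by (apply Rpower_lt; lra).
  assert (P := exp_pos (nu * nu)). assert (P' := Rpower_pos 2 nu). nra.
Qed.

Lemma pow_ge_1 (a : R) (n : nat) : 1 <= a -> 1 <= a ^ n.
Proof. intros H. rewrite <- (pow1 n). apply pow_incr. lra. Qed.

Lemma kam_const_ge_1 x c2 c3 nu : 0 < x -> 0 < c2 -> 0 < c3 -> 2 <= nu -> 1 <= kam_const x c2 c3 nu.
Proof.
  intros Hx H2 H3 Hn. unfold kam_const.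
  assert (E1 := pow_ge_1 ((1 + x) * (1 + c2)) 4 ltac:(nra)).
  assert (E2 := pow_ge_1 (sol_const nu) 4 (sol_const_ge_1 nu Hn)).
  assert (E3 := pow_ge_1 (Rpower 2 nu) 8 (Rpower_2_ge_1 nu Hn)).
  set (p := ((1 + x) * (1 + c2)) ^ 4) in *. set (s := sol_const nu ^ 4) in *. set (t := Rpower 2 nu ^ 8) in *.
  assert (F1 : 1 <= 1000000 * (c3 + 3) * p) by nra. assert (F2 : 1 <= 1000000 * (c3 + 3) * p * s) by nra. nra.
Qed.

Lemma kam_const_increasing : increasing_in_each kam_const.
Proof.
  intros x c2 c3 nu Hx H2 H3 Hn. unfold kam_const.
  assert (E1 : 0 < ((1 + x) * (1 + c2)) ^ 4) by (apply pow_lt; nra).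
  assert (E2 : 0 < sol_const nu ^ 4) by (apply pow_lt; generalize (sol_const_ge_1 nu Hn); lra).
  assert (E3 : 0 < Rpower 2 nu ^ 8) by (apply pow_lt, Rpower_pos).
  split; [ | split; [ | split ] ]; intros y Hy.
  - do 2 (apply Rmult_lt_compat_r; [ assumption | ]). apply Rmult_lt_compat_l; [ lra | ].
    apply pow_lt_mono. nra.
  - do 2 (apply Rmult_lt_compat_r; [ assumption | ]). apply Rmult_lt_compat_l; [ lra | ].
    apply pow_lt_mono. nra.
  - do 3 (apply Rmult_lt_compat_r; [ assumption | ]). lra.
  - assert (F2 : sol_const nu ^ 4 < sol_const y ^ 4).
    { apply pow_lt_mono. split; [ generalize (sol_const_ge_1 nu Hn); lra | now apply sol_const_mono ]. }
    assert (F3 : Rpower 2 nu ^ 8 < Rpower 2 y ^ 8).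
    { apply pow_lt_mono. split; [ apply Rpower_pos | apply Rpower_lt; lra ]. }
    rewrite !(Rmult_assoc (1000000 * (c3 + 3) * _)).
    apply Rmult_lt_compat_l; [ apply Rmult_lt_0_compat; lra | ].
    apply Rmult_gt_0_lt_compat; lra.
Qed.

(** The first smallness condition yields, through bounds on [Bc] in terms of [Q], the conditions on
    the domain and on the twist; the second one yields the contraction of the error. *)
Lemma kam_const_smallness (rho0 R0 gamma nu c1 c2 c3 c : R) :
  let delta0 := rho0 / 12 in
  let Q := kam_const (1 / c1) c2 c3 nu * c / (gamma ^ 2 * Rpower delta0 (2 * nu)) in
  let d0 := rho0 / 24 in
  let A := (1 + / c1) * (1 + c2) in
  let X0 := sol_const nu / (gamma * Rpower d0 nu) in
  let w := Rpower 2 nu in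
  let Bc := 200 * A ^ 2 * X0 ^ 2 * c in
  0 < rho0 < 1 -> 0 < R0 < 1 -> 0 < gamma <= 1 -> 2 <= nu -> 0 < c1 -> 0 < c2 -> 0 < c3 -> 0 < c <= 1 ->
  kam_const (1 / c1) c2 c3 nu * c <= gamma ^ 2 * Rpower delta0 (2 * nu) *
     Rmin (Rmin (c1 * delta0 / 8) (delta0 / 12)) (R0 / 3) ->
  kam_const (1 / c1) c2 c3 nu * c <= Rpower 2 (- 4 * nu - 2) * gamma ^ 4 * Rpower delta0 (4 * nu + 1) ->
  20400 * (1 + (c3 + 2)) * A ^ 4 * X0 ^ 4 * c <= / (2 * w ^ 4) /\
  8 * Bc <= d0 /\ Bc <= R0 / 2 /\
  2 * (c3 * Bc + c) + 4 * c2 * (2 * Bc / d0) <= c1 / 2 /\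
  0 < Bc /\ Bc <= 2 * Q /\
  2 * Bc / d0 <= 2 * kam_const (1 / c1) c2 c3 nu * c / (gamma ^ 2 * Rpower delta0 (2 * nu + 1)).
Proof.
  intros delta0 Q d0 A X0 w Bc Hrho HR Hg Hnu H1 H2 H3 Hc HA HB.
  assert (Hd : 0 < delta0 < 1) by (unfold delta0; lra).
  set (K := sol_const nu) in *. assert (K1 : 1 <= K) by now apply sol_const_ge_1.
  assert (w1 : 1 <= w) by now apply Rpower_2_ge_1.
  set (Y := Rpower delta0 nu). assert (PY : 0 < Y) by apply Rpower_pos.
  assert (Y1 : Y <= 1).
  { unfold Y. rewrite <- (Rpower_O delta0) by lra. unfold Rpower.
    assert (L : ln delta0 <= 0) by (rewrite <- ln_1; apply ln_le; lra).
    destruct (Rle_lt_or_eq_dec (nu * ln delta0) (0 * ln delta0)) as [T | T]; [ nra | | ].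
    - left. now apply exp_increasing.
    - rewrite T. lra. }
  assert (EY : Rpower delta0 (2 * nu) = Y ^ 2).
  { unfold Y. rewrite <- Rpower_pow by apply Rpower_pos. rewrite Rpower_mult. f_equal. simpl. ring. }
  (* Passing from [delta0] to [d0 = delta0 / 2] costs the factor [w]. *)
  assert (EX : X0 = K * w / (gamma * Y)).
  { unfold X0. replace d0 with (delta0 / 2 ^ 1) by (unfold d0, delta0; field).
    rewrite Rpower_div_pow2 by lra. fold Y w. field. lra. }
  assert (A1 : 1 <= A /\ 1 + c2 <= A).
  { assert (0 < / c1) by now apply Rinv_0_lt_compat. unfold A. nra. }
  assert (EK : kam_const (1 / c1) c2 c3 nu = 1000000 * (c3 + 3) * A ^ 4 * K ^ 4 * w ^ 8).
  { unfold kam_const, A, Rdiv. now rewrite Rmult_1_l. }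
  unfold Q. rewrite EY in HA |- *. rewrite EK in HA, HB |- *. clear Q.
  set (G := gamma ^ 2 * Y ^ 2) in *.
  assert (PG : 0 < G <= 1).
  { unfold G. split; [ apply Rmult_lt_0_compat; apply pow_lt; lra | ]. simpl. rewrite !Rmult_1_r.
    assert (0 < gamma * gamma <= 1) by nra. assert (0 < Y * Y <= 1) by nra. nra. }
  set (cs := 1000000 * (c3 + 3) * A ^ 4 * K ^ 4 * w ^ 8) in *.
  set (Q := cs * c / G).
  assert (EQ : cs * c = G * Q) by (unfold Q; field; lra).
  assert (HQ : Q <= Rmin (Rmin (c1 * delta0 / 8) (delta0 / 12)) (R0 / 3)).
  { rewrite EQ in HA. apply Rmult_le_reg_l with G; lra. }
  set (Mn := Rmin (Rmin (c1 * delta0 / 8) (delta0 / 12)) (R0 / 3)) in *.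
  assert (M1 : Mn <= c1 * delta0 / 8).
  { unfold Mn. eapply Rle_trans; [ apply Rmin_l | apply Rmin_l ]. }
  assert (M2 : Mn <= delta0 / 12).
  { unfold Mn. eapply Rle_trans; [ apply Rmin_l | apply Rmin_r ]. }
  assert (M3 : Mn <= R0 / 3) by apply Rmin_r.
  assert (PA2 := pow_ge_1 A 2 (proj1 A1)). assert (PK2 := pow_ge_1 K 2 K1). assert (Pw2 := pow_ge_1 w 2 w1).
  assert (EB : Bc = 200 * A ^ 2 * K ^ 2 * w ^ 2 * c / G).
  { unfold Bc, G. rewrite EX. field. lra. }
  assert (PB : 200 * c <= Bc).
  { rewrite EB. apply Rmult_le_reg_r with G; [ lra | ]. unfold Rdiv. rewrite !Rmult_assoc, Rinv_l, Rmult_1_r by lra.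
    assert (1 <= K ^ 2 * w ^ 2) by nra. assert (T : 1 <= A ^ 2 * (K ^ 2 * w ^ 2)) by nra.
    assert (c <= A ^ 2 * (K ^ 2 * w ^ 2) * c) by nra. nra. }
  (* 1000000 = 5000 * 200, the 200 coming from [Bc]; the spare powers of [K] and [w] are at least
     [1]. *)
  assert (PBQ : 5000 * (c3 + 3) * A ^ 2 * Bc <= Q).
  { unfold Q, cs. rewrite EB. unfold Rdiv. apply Rle_trans with (1000000 * (c3 + 3) * A ^ 4 * (K ^ 2 * w ^ 2) * c * / G); [ right; ring | ].
    apply Rmult_le_compat_r; [ left; apply Rinv_0_lt_compat; lra | ]. apply Rmult_le_compat_r; [ lra | ].
    rewrite (Rmult_assoc (1000000 * (c3 + 3) * A ^ 4)). apply Rmult_le_compat_l.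
    - apply Rmult_le_pos; [ lra | apply pow_le; lra ].
    - replace (K ^ 4) with (K ^ 2 * K ^ 2) by ring. replace (w ^ 8) with (w ^ 2 * w ^ 6) by ring.
      assert (P6 := pow_ge_1 w 6 w1).
      apply Rmult_le_compat; try (apply pow_le; lra).
      + rewrite <- (Rmult_1_r (K ^ 2)) at 1. apply Rmult_le_compat_l; lra.
      + rewrite <- (Rmult_1_r (w ^ 2)) at 1. apply Rmult_le_compat_l; lra. }
  assert (PB0 : 0 < Bc) by lra.
  assert (B1 : 15000 * Bc <= Q).
  { assert (Bc <= A ^ 2 * Bc) by nra. assert (0 <= c3 * (A ^ 2 * Bc)) by (apply Rmult_le_pos; nra). nra. }
  assert (B2 : 5000 * (c3 * Bc) <= Q).
  { assert (Bc <= A ^ 2 * Bc) by nra. assert (c3 * Bc <= c3 * (A ^ 2 * Bc)) by (apply Rmult_le_compat_l; lra). nra. }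
  assert (B3 : 15000 * (c2 * Bc) <= Q).
  { assert (c2 <= A ^ 2) by (simpl; nra). assert (c2 * Bc <= A ^ 2 * Bc) by (apply Rmult_le_compat_r; lra).
    assert (0 <= c3 * (A ^ 2 * Bc)) by (apply Rmult_le_pos; nra). nra. }
  assert (Ed : d0 = delta0 / 2) by (unfold d0, delta0; field).
  split; [ | split; [ | split; [ | split; [ | split; [ | split ] ] ] ] ].
  - assert (Pw4 : 0 < w ^ 4) by (apply pow_lt; lra).
    assert (PG4 : 0 < gamma ^ 4 * Y ^ 4) by (apply Rmult_lt_0_compat; apply pow_lt; lra).
    assert (HB' : cs * c <= gamma ^ 4 * Y ^ 4).
    { eapply Rle_trans; [ exact HB | ].
      assert (E4 : Rpower delta0 (4 * nu + 1) = Y ^ 4 * delta0).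
      { rewrite Rpower_plus, Rpower_1 by lra. f_equal. unfold Y. rewrite <- Rpower_pow by apply Rpower_pos.
        rewrite Rpower_mult. f_equal. simpl. ring. }
      rewrite E4. assert (E2 : 0 < Rpower 2 (- 4 * nu - 2) <= 1).
      { split; [ apply Rpower_pos | ]. rewrite <- (Rpower_O 2) by lra. apply Rle_Rpower; lra. }
      apply Rle_trans with (1 * (gamma ^ 4 * Y ^ 4) * 1); [ | lra ].
      replace (Rpower 2 (- 4 * nu - 2) * gamma ^ 4 * (Y ^ 4 * delta0)) with
        (Rpower 2 (- 4 * nu - 2) * (gamma ^ 4 * Y ^ 4) * delta0) by ring.
      apply Rmult_le_compat; try lra; [ apply Rmult_le_pos; lra | apply Rmult_le_compat_r; lra ]. }
    (* 204 / 10000 is 20400 / 1000000, well below the [1 / 2] required by the rate. *)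
    rewrite EX. replace (20400 * (1 + (c3 + 2)) * A ^ 4 * (K * w / (gamma * Y)) ^ 4 * c) with
      (cs * c / (gamma ^ 4 * Y ^ 4) * (204 / 10000) * / w ^ 4) by (unfold cs; field; lra).
    replace (/ (2 * w ^ 4)) with (1 / 2 * / w ^ 4) by (field; lra).
    apply Rmult_le_compat_r; [ left; now apply Rinv_0_lt_compat | ].
    assert (cs * c / (gamma ^ 4 * Y ^ 4) <= 1).
    { apply Rmult_le_reg_r with (gamma ^ 4 * Y ^ 4); [ lra | ]. unfold Rdiv. rewrite Rmult_assoc, Rinv_l; lra. }
    lra.
  - lra.
  - lra.
  - assert (2 * Bc / d0 = 4 * Bc / delta0) as -> by (rewrite Ed; field; lra).
    assert (T : c2 * Bc / delta0 <= c1 / 120000).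
    { apply Rmult_le_reg_r with delta0; [ lra | ]. unfold Rdiv at 1. rewrite Rmult_assoc, Rinv_l by lra. lra. }
    replace (4 * c2 * (4 * Bc / delta0)) with (16 * (c2 * Bc / delta0)) by (field; lra).
    assert (c1 * delta0 <= c1) by nra. lra.
  - lra.
  - lra.
  - rewrite Rpower_plus, Rpower_1, EY by lra.
    replace (2 * cs * c / (gamma ^ 2 * (Y ^ 2 * delta0))) with (2 * Q / delta0) by (unfold Q, G; field; lra).
    replace (2 * Bc / d0) with (4 * Bc / delta0) by (rewrite Ed; field; lra).
    apply Rmult_le_compat_r; [ left; apply Rinv_0_lt_compat; lra | lra ].
Qed.

(** * From the hypotheses on the map to an exact map with twist *)

(** The mixed derivative is taken in the order of [partials], first in the action and then in the
    angle, which is the third slice of [analytic2_at_slices]. *)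
Lemma partials_taylor (D1 D2 : C -> Prop) (f : C -> C -> C) (c : R) :
  convexC D1 -> convexC D2 -> complex_analytic2_on D1 D2 f ->
  (forall z w i j, D1 z -> D2 w -> (i + j <= 2)%nat -> Cmod (partials i j f z w) <= c) ->
  forall z z' w w', D1 z -> D1 z' -> D2 w -> D2 w' ->
    Cmod (f z' w' - f z w - (z' - z) * partials 1 0 f z w - (w' - w) * partials 0 1 f z w)%C
    <= 2 * c * (Cmod (z' - z)%C ^ 2 + Cmod (w' - w)%C ^ 2).
Proof.
  intros C1 C2 Hf HB.
  apply (two_variable_taylor D1 D2 f (partials 1 0 f) (partials 0 1 f) (partials 2 0 f) (partials 0 2 f) (partials 1 1 f));
    try assumption; intros z w Hz Hw; destruct (analytic2_at_slices f z w (Hf z w Hz Hw)) as [Az [Aw Ai]].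
  - apply (analytic_at_cderiv _ _ Az).
  - apply (analytic_at_cderiv _ _ Az).
  - apply (analytic_at_cderiv _ _ Aw).
  - apply (analytic_at_cderiv _ _ Aw).
  - apply (analytic_at_cderiv _ _ Ai).
  - repeat split; apply HB; auto with arith.
Qed.

Section Extension.

Variables (alpha : R -> R) (fphi fI : R -> R -> R) (I0 rho0 R0 c1 c2 c3 c : R).
Variables (alphaC : C -> C) (fphiC fIC : C -> C -> C).
Let F := annulus_map alpha fphi fI.
Hypotheses (HF : exact_symplectic F) (Hrho0 : 0 < rho0 < 1) (HR0 : 0 < R0 < 1).
Hypotheses (Halpha : analytic_extension_disc I0 R0 alpha alphaC)
  (Hfphi : analytic_extension_strip_disc rho0 I0 R0 fphi fphiC)
  (HfI : analytic_extension_strip_disc rho0 I0 R0 fI fIC).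
Hypotheses (Hc2 : 0 < c2) (Hc3 : 0 < c3) (Hc : 0 < c <= 1).
Hypothesis H3alpha : forall I : C, cdisc I0 R0 I ->
  c1 <= Cmod (C_derive alphaC I) <= c2 /\ Cmod (C_derive (C_derive alphaC) I) <= c3.
Hypothesis H3f : forall (phi I : C) (i j : nat), strip rho0 phi -> cdisc I0 R0 I -> (i + j <= 2)%nat ->
  Cmod (partials i j fphiC phi I) <= c /\ Cmod (partials i j fIC phi I) <= c.

(** [alpha] is part of the angular displacement, so the twist sits in its action derivative [q1]. *)
Let g1 (z w : C) : C := (alphaC w + fphiC z w)%C.
Let q1 (z w : C) : C := (C_derive alphaC w + partials 0 1 fphiC z w)%C.

Let centre : cdisc I0 R0 (RtoC I0).
Proof. unfold cdisc. replace (RtoC I0 - RtoC I0)%C with (RtoC 0) by ring. rewrite Cmod_0. lra. Qed.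

(** In the Taylor constant, [c3] bounds the second derivative of [alpha] and [2 * c <= 2] comes from
    the perturbation. In the sup bound, [alphaC] differs from its value at the centre by at most
    [c2 * R0 <= c2]. *)
Lemma exact_map_of_extension :
  exact_map F rho0 I0 R0 (c3 + 2) (Cmod (alphaC (RtoC I0)) + c2 + 1)
    g1 fIC (partials 1 0 fphiC) q1 (partials 1 0 fIC) (partials 0 1 fIC).
Proof.
  destruct Halpha as [Aan Are]. destruct Hfphi as [Pan [Pper Pre]]. destruct HfI as [Ian [Iper Ire]].
  assert (CS := convex_strip rho0). assert (CD := convex_cdisc I0 R0).
  assert (P0 := Cmod_ge_0 (alphaC (RtoC I0))).
  assert (Dal : forall w, cdisc I0 R0 w -> cderiv alphaC w (C_derive alphaC w) /\
    cderiv (C_derive alphaC) w (C_derive (C_derive alphaC) w)).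
  { intros w Hw. apply analytic_at_cderiv. now apply Aan. }
  constructor.
  - intros z z' w w' Hz Hz' Hw Hw'.
    assert (T1 := segment_taylor (cdisc I0 R0) alphaC (C_derive alphaC) (C_derive (C_derive alphaC)) w w' c3 CD
      (fun x Hx => proj1 (Dal x Hx)) (fun x Hx => proj2 (Dal x Hx)) (fun x Hx => proj2 (H3alpha x Hx)) Hw Hw').
    assert (T2 := partials_taylor _ _ fphiC c CS CD Pan (fun x y i j Hx Hy Hij => proj1 (H3f x y i j Hx Hy Hij))
      z z' w w' Hz Hz' Hw Hw').
    unfold g1, q1.
    replace (alphaC w' + fphiC z' w' - (alphaC w + fphiC z w) - (z' - z) * partials 1 0 fphiC z w -
      (w' - w) * (C_derive alphaC w + partials 0 1 fphiC z w))%C with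
      ((alphaC w' - alphaC w - (w' - w) * C_derive alphaC w) +
       (fphiC z' w' - fphiC z w - (z' - z) * partials 1 0 fphiC z w - (w' - w) * partials 0 1 fphiC z w))%C by ring.
    eapply Rle_trans; [ apply Cmod_plus_le; [ exact T1 | exact T2 ] | ].
    assert (Q1 := pow2_ge_0 (Cmod (z' - z))). assert (Q2 := pow2_ge_0 (Cmod (w' - w))). nra.
  - intros z z' w w' Hz Hz' Hw Hw'.
    assert (T2 := partials_taylor _ _ fIC c CS CD Ian (fun x y i j Hx Hy Hij => proj2 (H3f x y i j Hx Hy Hij))
      z z' w w' Hz Hz' Hw Hw').
    eapply Rle_trans; [ exact T2 | ].
    assert (Q1 := pow2_ge_0 (Cmod (z' - z))). assert (Q2 := pow2_ge_0 (Cmod (w' - w))). nra.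
  - intros z w Hz Hw.
    assert (b0 := proj1 (H3f z w 0 0 Hz Hw ltac:(lia))). simpl in b0.
    assert (b1 := proj1 (H3f z w 1 0 Hz Hw ltac:(lia))). assert (b2 := proj1 (H3f z w 0 1 Hz Hw ltac:(lia))).
    destruct (H3alpha w Hw) as [[_ a1] _].
    assert (M : Cmod (alphaC w - alphaC (RtoC I0))%C <= c2 * Cmod (w - RtoC I0)%C).
    { apply segment_mvt with (C_derive alphaC); intros t Ht.
      - apply Dal. now apply CD.
      - apply H3alpha. now apply CD. }
    split; [ | split ].
    + unfold g1. replace (alphaC w + fphiC z w)%C with
        (alphaC (RtoC I0) + (alphaC w - alphaC (RtoC I0)) + fphiC z w)%C by ring.
      apply Cmod_plus_le; [ | lra ]. apply Cmod_plus_le; [ lra | ].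
      unfold cdisc in Hw. assert (P := Cmod_ge_0 (w - RtoC I0)%C). nra.
    + lra.
    + unfold q1. apply Rle_trans with (c2 + c); [ now apply Cmod_plus_le | lra ].
  - intros z w Hz Hw.
    assert (b0 := proj2 (H3f z w 0 0 Hz Hw ltac:(lia))). simpl in b0.
    assert (b1 := proj2 (H3f z w 1 0 Hz Hw ltac:(lia))). assert (b2 := proj2 (H3f z w 0 1 Hz Hw ltac:(lia))).
    repeat split; lra.
  - intros z w Hz Hw. unfold g1. now rewrite Pper.
  - intros z w Hz Hw. now apply Iper.
  - intros x y Hy. unfold g1. rewrite Are, Pre by assumption. unfold F, annulus_map. simpl fst. simpl snd.
    rewrite <- RtoC_plus. f_equal. ring.
  - intros x y Hy. rewrite Ire by assumption. unfold F, annulus_map. simpl fst. simpl snd. f_equal. ring.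
  - exact HF.
Qed.

Lemma twist_of_extension z w : strip rho0 z -> cdisc I0 R0 w ->
  Cmod (q1 z w - C_derive alphaC (RtoC I0))%C <= c3 * Cmod (w - RtoC I0)%C + c /\
  Cmod (q1 z w) <= 1 + c2 /\ Cmod (partials 0 1 fIC z w) <= 1.
Proof.
  intros Hz Hw. destruct Halpha as [Aan _]. assert (CD := convex_cdisc I0 R0).
  destruct (H3f z w 0 1 Hz Hw ltac:(lia)) as [b1 b2]. destruct (H3alpha w Hw) as [[_ a1] _].
  split; [ | split ].
  - unfold q1. replace (C_derive alphaC w + partials 0 1 fphiC z w - C_derive alphaC (RtoC I0))%C with
      ((C_derive alphaC w - C_derive alphaC (RtoC I0)) + partials 0 1 fphiC z w)%C by ring.
    apply Cmod_plus_le; [ | exact b1 ].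
    apply segment_mvt with (C_derive (C_derive alphaC)); intros t Ht.
    + apply analytic_at_cderiv. apply Aan. now apply CD.
    + apply H3alpha. now apply CD.
  - unfold q1. apply Rle_trans with (c2 + c); [ now apply Cmod_plus_le | lra ].
  - lra.
Qed.

Lemma initial_of_extension z : strip rho0 z ->
  Cmod (g1 z (RtoC I0) - RtoC (alpha I0))%C <= c /\ Cmod (fIC z (RtoC I0)) <= c.
Proof.
  intros Hz. destruct (H3f z (RtoC I0) 0 0 Hz centre ltac:(lia)) as [b1 b2]. simpl in b1, b2.
  split; [ | exact b2 ]. destruct Halpha as [_ Are]. unfold g1.
  rewrite Are by (rewrite Rminus_diag, Rabs_R0; lra).
  now replace (RtoC (alpha I0) + fphiC z (RtoC I0) - RtoC (alpha I0))%C with (fphiC z (RtoC I0)) by ring.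
Qed.

End Extension.

(** * Curves on the annulus and the final assembly *)

Lemma annulus_eq_refl p : annulus_eq p p.
Proof. split; [ exists 0%Z; simpl; ring | reflexivity ]. Qed.

Lemma annulus_eq_trans p q r : annulus_eq p q -> annulus_eq q r -> annulus_eq p r.
Proof.
  intros [[k Hk] E] [[l Hl] E']. split; [ | congruence ].
  exists (k + l)%Z. rewrite plus_IZR. lra.
Qed.

Lemma periodic_IZR f (k : Z) x : periodic f -> f (x + 2 * PI * IZR k) = f x.
Proof.
  intros Hf. assert (N : forall (n : nat) y, f (y + 2 * PI * INR n) = f y).
  { induction n; intros y; [ f_equal; simpl; ring | ].
    rewrite S_INR. replace (y + 2 * PI * (INR n + 1)) with (y + 2 * PI * INR n + 2 * PI) by ring.
    now rewrite Hf. }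
  destruct (Z_le_gt_dec 0 k) as [H | H].
  - rewrite <- (Z2Nat.id k) by lia. rewrite <- INR_IZR_INZ. apply N.
  - rewrite <- (N (Z.to_nat (- k)) (x + 2 * PI * IZR k)). f_equal.
    rewrite INR_IZR_INZ, Z2Nat.id, opp_IZR by lia. ring.
Qed.

Lemma annulus_map_eq alpha fphi fI p q :
  (forall I, periodic (fun phi => fphi phi I)) -> (forall I, periodic (fun phi => fI phi I)) ->
  annulus_eq p q -> annulus_eq (annulus_map alpha fphi fI p) (annulus_map alpha fphi fI q).
Proof.
  intros H1 H2 [[k Hk] E]. destruct p as [x y], q as [x' y']. simpl in Hk, E. subst x y'.
  unfold annulus_map. simpl fst. simpl snd.
  rewrite (periodic_IZR (fun phi => fphi phi y) k x' (H1 y)), (periodic_IZR (fun phi => fI phi y) k x' (H2 y)).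
  split; [ | reflexivity ]. exists k. simpl. ring.
Qed.

(** The equation is assumed in the plane, before reduction modulo [2 * PI]. That the image covers
    the curve is seen at the parameter [t - omega]. *)
Lemma invariant_curve_of_equation F (P : R -> R * R) omega :
  (forall p q, annulus_eq p q -> annulus_eq (F p) (F q)) ->
  (forall t, F (P t) = P (t + omega)) -> parametrizes_invariant_curve F P omega.
Proof.
  intros HF HP. split.
  - intros t. rewrite HP. apply annulus_eq_refl.
  - intros p. split.
    + intros [t Ht]. exists (P (t - omega)). split.
      * exists (t - omega). apply annulus_eq_refl.
      * rewrite HP. now replace (t - omega + omega) with t by ring.
    + intros [q [[t Ht] Hq]]. exists (t + omega). rewrite <- HP.
      eapply annulus_eq_trans; [ exact Hq | now apply HF ].
Qed.

Lemma strip_norm_le rho f M : (forall z, strip rho z -> Cmod (f z) <= M) -> Rbar_le (strip_norm rho f) M.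
Proof.
  intros H. unfold strip_norm. apply (proj2 (Lub_Rbar_correct _)). intros x [z [Hz ->]]. now apply H.
Qed.

Lemma holo_strip_derive r f f1 z : holo (band (- r) r) f f1 -> band (- r) r z -> C_derive f z = f1 z.
Proof.
  intros [B [HB [_ [_ Q]]]] Hz. apply cderiv_C_derive.
  destruct Hz as [h1 h2].
  apply cderiv_of_quadratic with (Rmin (r - Im z) (r + Im z)) B.
  - apply Rmin_glb_lt; lra.
  - intros h Hh. assert (L1 := Rmin_l (r - Im z) (r + Im z)). assert (L2 := Rmin_r (r - Im z) (r + Im z)).
    assert (Hi := Im_le_Cmod h).
    assert (Hz' : band (- r) r (z + h)%C).
    { split; rewrite im_plus; generalize (Rle_abs (Im h)) (Rle_abs (- Im h)); rewrite Rabs_Ropp;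
      generalize (Im_le_Cmod h); lra. }
    generalize (Q z (z + h)%C (conj h1 h2) Hz').
    now replace (z + h - z)%C with h by ring.
Qed.

Theorem theoremB :
  exists cst : R -> R -> R -> R -> R,
    (forall x c2 c3 nu : R, 0 < x -> 0 < c2 -> 0 < c3 -> 2 <= nu ->
       1 <= cst x c2 c3 nu) /\
    increasing_in_each cst /\
    forall (alpha : R -> R) (fphi fI : R -> R -> R)
           (I0 rho0 R0 gamma nu c1 c2 c3 c : R)
           (alphaC : C -> C) (fphiC fIC : C -> C -> C),
      let F := annulus_map alpha fphi fI in
      let omega := alpha I0 in
      let delta0 := rho0 / 12 in
      let cstar := cst (1 / c1) c2 c3 nu in
      (* F is a real analytic, exact symplectic map of the annulus *)
      (forall I : R, periodic (fun phi => fphi phi I)) ->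
      (forall I : R, periodic (fun phi => fI phi I)) ->
      real_analytic2 (fun phi I => fst (F (phi, I))) ->
      real_analytic2 (fun phi I => snd (F (phi, I))) ->
      exact_symplectic F ->
      (* H1 *)
      0 < rho0 < 1 -> 0 < R0 < 1 ->
      analytic_extension_disc I0 R0 alpha alphaC ->
      analytic_extension_strip_disc rho0 I0 R0 fphi fphiC ->
      analytic_extension_strip_disc rho0 I0 R0 fI fIC ->
      (* H2 *)
      0 < gamma <= 1 -> 2 <= nu ->
      diophantine gamma nu (omega / (2 * PI)) ->
      (* H3 *)
      0 < c1 -> 0 < c2 -> 0 < c3 -> 0 < c <= 1 ->
      (forall I : C, cdisc I0 R0 I ->
         c1 <= Cmod (C_derive alphaC I) <= c2 /\
         Cmod (C_derive (C_derive alphaC) I) <= c3) ->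
      (forall (phi I : C) (i j : nat),
         strip rho0 phi -> cdisc I0 R0 I -> (i + j <= 2)%nat ->
         Cmod (partials i j fphiC phi I) <= c /\
         Cmod (partials i j fIC phi I) <= c) ->
      (* smallness of c *)
      cstar * c <= gamma ^ 2 * Rpower delta0 (2 * nu) *
                   Rmin (Rmin (c1 * delta0 / 8) (delta0 / 12)) (R0 / 3) ->
      cstar * c <= Rpower 2 (- 4 * nu - 2) * gamma ^ 4 *
                   Rpower delta0 (4 * nu + 1) ->
      exists (gphi gI : R -> R) (gphiC gIC : C -> C),
        real_analytic gphi /\ real_analytic gI /\
        periodic gphi /\ periodic gI /\
        (forall theta : R,
           (Derive (fun t => fst (param gphi gI t)) theta,
            Derive (fun t => snd (param gphi gI t)) theta) <> (0, 0)) /\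
        parametrizes_invariant_curve F (param gphi gI) omega /\
        analytic_extension_strip (rho0 / 2) gphi gphiC /\
        analytic_extension_strip (rho0 / 2) gI gIC /\
        Rbar_le (strip_norm (rho0 / 2) gphiC)
                (2 * cstar * c / (gamma ^ 2 * Rpower delta0 (2 * nu))) /\
        Rbar_le (strip_norm (rho0 / 2) (fun theta => gIC theta - RtoC I0)%C)
                (2 * cstar * c / (gamma ^ 2 * Rpower delta0 (2 * nu))) /\
        Rbar_le (strip_norm (rho0 / 2) (C_derive gphiC))
                (2 * cstar * c / (gamma ^ 2 * Rpower delta0 (2 * nu + 1))) /\
        Rbar_le (strip_norm (rho0 / 2) (C_derive gIC))
                (2 * cstar * c / (gamma ^ 2 * Rpower delta0 (2 * nu + 1))).
Proof.
  exists kam_const. split; [ exact kam_const_ge_1 | split; [ exact kam_const_increasing | ] ].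
  intros alpha fphi fI I0 rho0 R0 gamma nu c1 c2 c3 c alphaC fphiC fIC F omega delta0 cstar
    Pphi PfI _ _ HF Hrho0 HR0 Halpha Hfphi HfI Hgamma Hnu HDio Hc1 Hc2 Hc3 Hc H3a H3f Sm1 Sm2.
  destruct (kam_const_smallness rho0 R0 gamma nu c1 c2 c3 c Hrho0 HR0 Hgamma Hnu Hc1 Hc2 Hc3 Hc Sm1 Sm2)
    as [S1 [S2 [S3 [S4 [S5 [S6 S7]]]]]].
  assert (EM := exact_map_of_extension alpha fphi fI I0 rho0 R0 c1 c2 c3 c alphaC fphiC fIC
    HF HR0 Halpha Hfphi HfI Hc2 Hc3 Hc H3a H3f).
  assert (I0in : cdisc I0 R0 (RtoC I0)).
  { unfold cdisc. replace (RtoC I0 - RtoC I0)%C with (RtoC 0) by ring. rewrite Cmod_0. lra. }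
  destruct (invariant_torus_exists _ _ _ _ _ _ _ _ _ _ _ _ EM gamma nu omega c1 c2 c3 c (C_derive alphaC (RtoC I0)))
    as [u [u1 [v [v1 [Hu [Hv [Ru [Rv [Pu [Pv [Bd Inv]]]]]]]]]]]; try assumption; try lra.
  { intros z w Hz Hw. eapply twist_of_extension; eassumption. }
  { now apply H3a. }
  { intros z Hz. eapply initial_of_extension; eassumption. }
  (* [r] is [7 / 12] of [rho0], hence larger than [rho0 / 2]; derivatives and power series are thus
     available on the whole strip of the conclusion. *)
  set (r := 14 * (rho0 / 24)) in *.
  set (Bc := 200 * ((1 + / c1) * (1 + c2)) ^ 2 * (sol_const nu / (gamma * Rpower (rho0 / 24) nu)) ^ 2 * c) in *.
  assert (inc : forall z, strip (rho0 / 2) z -> band (- r) r z).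
  { intros z Hz. unfold strip in Hz. apply Rabs_def2 in Hz. unfold r. split; lra. }
  assert (onR : forall x : R, band (- r) r (RtoC x)) by (intros x; unfold r; split; simpl; lra).
  assert (U : forall x : R, u (RtoC x) = RtoC (Re (u (RtoC x)))) by (intros x; apply RtoC_Re, Ru).
  assert (V : forall x : R, v (RtoC x) = RtoC (Re (v (RtoC x)))) by (intros x; apply RtoC_Re, Rv).
  assert (Pr : 0 < r) by (unfold r; lra).
  assert (Ext : forall f f1 : C -> C, holo (band (- r) r) f f1 -> periodic_on (band (- r) r) f ->
    (forall x : R, f (RtoC x) = RtoC (Re (f (RtoC x)))) ->
    real_analytic (fun x => Re (f (RtoC x))) /\ periodic (fun x => Re (f (RtoC x))) /\
    analytic_extension_strip (rho0 / 2) (fun x => Re (f (RtoC x))) f).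
  { intros f f1 Hf Pf Rf. split; [ | split; [ | split; [ | split ] ] ].
    - now apply (real_analytic_of_holo r f f1).
    - intros x. rewrite RtoC_plus. now rewrite Pf.
    - intros z Hz. apply (analytic_of_holo r f f1 z Hf). auto.
    - intros z Hz. apply Pf. auto.
    - exact Rf. }
  destruct (Ext u u1 Hu Pu U) as [u_an [u_per u_ext]]. destruct (Ext v v1 Hv Pv V) as [v_an [v_per v_ext]].
  exists (fun x => Re (u (RtoC x))), (fun x => Re (v (RtoC x))), u, v.
  split; [ exact u_an | split; [ exact v_an | split; [ exact u_per | split; [ exact v_per | ] ] ] ].
  (* The slope of the angular part is at most [1 / 4], so the angular component of the tangent
     vector is at least [3 / 4]. *)
  assert (Small : 2 * Bc / (rho0 / 24) <= 1 / 4).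
  { apply Rmult_le_reg_r with (rho0 / 24); [ lra | ]. unfold Rdiv at 1. rewrite Rmult_assoc, Rinv_l; lra. }
  split; [ | split; [ | split; [ exact u_ext | split; [ exact v_ext | split; [ | split; [ | split ] ] ] ] ] ].
  - intros t E. apply (f_equal fst) in E. simpl in E.
    assert (D : is_derive (fun s => s + Re (u (RtoC s))) t (1 + Re (u1 (RtoC t)))).
    { apply (is_derive_plus (K := R_AbsRing) (V := R_NormedModule)); [ exact (is_derive_id (K := R_AbsRing) t) | ].
      now apply (holo_is_derive (band (- r) r)). }
    assert (E' := eq_trans (eq_sym (is_derive_unique _ _ _ D)) E).
    destruct (Bd (RtoC t) (onR t)) as [_ [_ [b _]]].
    assert (K := re_le_Cmod (u1 (RtoC t))). generalize (Rle_abs (- Re (u1 (RtoC t)))). rewrite Rabs_Ropp. simpl in E'. lra.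
  - apply invariant_curve_of_equation.
    + intros p q Hpq. now apply annulus_map_eq.
    (* At real points [err1 = 0] and [err2 = 0] become equations between real numbers, the two
       components of the invariance equation. *)
    + intros t. destruct (Inv t) as [e1 e2]. destruct (Bd (RtoC t) (onR t)) as [_ [bv _]].
      unfold err1, err2 in e1, e2. rewrite Cmult_1_l in e1, e2.
      rewrite (U t), (V t), <- !RtoC_plus, (U (t + omega)%R) in e1. rewrite (U t), (V t), <- !RtoC_plus, (V (t + omega)%R) in e2.
      assert (Hy : Rabs (Re (v (RtoC t)) - I0) < R0).
      { rewrite V, <- RtoC_minus, Cmod_R in bv. unfold r in *. lra. }
      rewrite (em_real1 EM _ _ Hy) in e1.
      rewrite (em_real2 EM _ _ Hy) in e2.
      rewrite <- !RtoC_plus, <- !RtoC_minus in e1, e2. apply RtoC_inj in e1. apply RtoC_inj in e2.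
      fold F in e1, e2. unfold param. rewrite (surjective_pairing (F _)). f_equal; lra.
  - apply strip_norm_le. intros z Hz. destruct (Bd z (inc z Hz)) as [b _].
    eapply Rle_trans; [ exact b | ]. eapply Rle_trans; [ exact S6 | ]. right. fold delta0 cstar. unfold Rdiv. ring.
  - apply strip_norm_le. intros z Hz. destruct (Bd z (inc z Hz)) as [_ [b _]].
    eapply Rle_trans; [ exact b | ]. eapply Rle_trans; [ exact S6 | ]. right. fold delta0 cstar. unfold Rdiv. ring.
  - apply strip_norm_le. intros z Hz. destruct (Bd z (inc z Hz)) as [_ [_ [b _]]].
    rewrite (holo_strip_derive r u u1 z Hu (inc z Hz)). eapply Rle_trans; [ exact b | exact S7 ].
  - apply strip_norm_le. intros z Hz. destruct (Bd z (inc z Hz)) as [_ [_ [_ b]]].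
    rewrite (holo_strip_derive r v v1 z Hv (inc z Hz)). eapply Rle_trans; [ exact b | exact S7 ].
Qed.
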